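(* Let $\ell$ be a prime number and let $F$ be a global function field of characteristic $\ell$ with field of constants $\kappa$. Assume that $F$ has a prime $P_\infty$ of degree $1$, and fix it. Let $p$ and $q$ be prime numbers that are not necessarily distinct, and assume that $q\neq \ell$. Let $f(X)$ be a polynomial with coefficients in $\kappa$ satisfying the following conditions. (i) $f(X)$ factorizes into $f(X)=a_0(X-a_1)^{n_1}\cdots (X-a_t)^{n_t}$, where $a_0\in \kappa$, $a_1,\dots,a_t$ are distinct elements of $\kappa$, $n_1,\dots,n_t$ are positive integers and $t\geq 2$. (ii) At least two of the exponents $n_i$ are not divisible by $q$. Then the following assertions hold. (1) Suppose that $p$ and $q$ are distinct. Then, for all sufficiently large numbers $k>0$, the only solutions $(X,Y)$ to $Y^{q^k}=f(X)$ with $X,Y\in\mathcal{O}_\infty^{(p)}$ are constant. (2) Suppose that $p\nmid h_F$. Then the only solutions $(X,Y)$ to $Y^p=f(X)$ with $X,Y\in\mathcal{O}_\infty^{(p)}$ are constant.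
   Context: The field of constants $\kappa$ of $F$ is the algebraic closure of $\mathbb{F}_\ell$ in $F$; it is a finite field. A prime of $F$ is the maximal ideal of a discrete valuation ring in $F$ with fraction field $F$. The class group of $F$ is the (finite) group of degree $0$ divisors of $F$ modulo principal divisors, and $h_F$ is its order. For a prime $p$ and $n\geq 0$, let $\kappa_n^{(p)}$ be the unique extension of $\kappa$ of degree $p^n$ (inside a fixed algebraic closure of $F$), and let $F_n^{(p)}=F\cdot\kappa_n^{(p)}$. The constant $\mathbb{Z}_p$-extension of $F$ is $F_\infty^{(p)}=\bigcup_{n\ge 0} F_n^{(p)}$. Since $P_\infty$ has degree $1$, there is exactly one prime of $F_n^{(p)}$ (and of $F_\infty^{(p)}$) above $P_\infty$; it is again denoted $P_\infty$. The ring $\mathcal{O}_\infty^{(p)}$ consists of all functions in $F_\infty^{(p)}$ having no poles away from $P_\infty$. A solution $(X,Y)$ is constant if $X$ and $Y$ both lie in the field of constants $\bigcup_{n\ge 0}\kappa_n^{(p)}$ of $F_\infty^{(p)}$.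
   Formalization: Assertion (2) is stated for p = q, since for p ≠ q it fails (F = F_ℓ(T), f = X^p(X−1)^p, X = T, Y = T(T−1)); and a_0 ≠ 0 is assumed, since for a_0 = 0 every (X,0) is a solution. *)

(* Defs.v *)
From HB Require Import structures.
From mathcomp Require Import all_boot all_order all_algebra all_field.
From mathcomp Require Import boolp classical_sets functions cardinality.
From mathcomp Require Import finmap freeg.

Set Implicit Arguments.
Unset Strict Implicit.
Unset Printing Implicit Defensive.

Import GRing.Theory.
Local Open Scope classical_set_scope.
Local Open Scope ring_scope.

(* Rings and fields are subsets of an ambient field L, because infinite
   extensions such as the constant Z_p-extension are not fieldExtTypes. *)
Section Subrings.
Context {L : fieldType}.
Implicit Types K k O P I J V W : set L.

Definition is_subring O := subring_closed [in O].
Definition is_subfield K := divring_closed [in K].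

Definition compositum K k : set L := smallest is_subfield (K `|` k).

(* V / W is a k-vector space of dimension d; W may be a subspace of V given
   as any subset of L, e.g. [set 0]. *)
Definition has_dim k V W (d : nat) :=
  exists b : 'rV[L]_d,
    (forall i, V (b 0 i)) /\
    (forall x, V x -> exists! c : 'rV[L]_d,
       (forall i, k (c 0 i)) /\ W (x - \sum_i c 0 i * b 0 i)).

Definition is_extension_of_degree k K (d : nat) :=
  [/\ is_subfield K, k `<=` K & has_dim k K [set 0] d].

Definition is_ideal O I :=
  [/\ I `<=` O, I 0, (forall x y, I x -> I y -> I (x + y))
    & (forall a x, O a -> I x -> I (a * x))].

Definition principal_ideal O (a : L) : set L := [set a * x | x in O].

Definition is_maximal_ideal O P :=
  [/\ is_ideal O P, P != O
    & (forall J, is_ideal O J -> P `<=` J -> J = P \/ J = O)].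

Definition is_fraction_field O K :=
  K = [set z | exists x y, [/\ O x, O y, y != 0 & z = x / y]].

(* A discrete valuation ring: a local principal ideal domain that is not a
   field (its maximal ideal is not zero). *)
Definition is_dvr O :=
  [/\ is_subring O,
      (forall I, is_ideal O I -> exists2 a, O a & I = principal_ideal O a)
    & exists P, [/\ is_maximal_ideal O P, P != [set 0]
                  & (forall P', is_maximal_ideal O P' -> P' = P)]].

Definition is_dvr_of_prime K O P :=
  [/\ is_dvr O, is_fraction_field O K & is_maximal_ideal O P].

Definition primes K : set (set L) :=
  [set P | exists O, is_dvr_of_prime K O P].

(* x is nonzero and ord_P x = n. *)
Definition has_order K P (x : L) (n : int) :=
  exists O, is_dvr_of_prime K O P /\
  exists pi u, [/\ P = principal_ideal O pi, u != 0, O u, O u^-1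
                 & x = u * pi ^ n].

Definition has_pole K P (x : L) := exists2 n : int, n < 0 & has_order K P x n.

(* The degree of the residue field O / P over k (0 if it is not finite). *)
Definition prime_degree k K P : nat :=
  xget 0%N [set d | exists2 O, is_dvr_of_prime K O P & has_dim k O P d].

End Subrings.

Section FunctionField.
Context {ell : nat} (F : fieldExtType {fraction {poly 'F_ell}}).

Definition prime_field_embedding (c : 'F_ell) : F :=
  (FracField.tofrac (c%:P : {poly 'F_ell}))%:A.

Definition constants : set F :=
  [set x | algebraicOver prime_field_embedding x].

Definition place : choiceType := set_type (primes [set: F]).

Definition place_ideal (P : place) : set F := set_val P.

Definition place_degree (P : place) : nat :=
  prime_degree constants [set: F] (place_ideal P).

Definition divisor : zmodType := {freeg place / int}.

Definition divisor_degree (D : divisor) : int :=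
  fglift (fun P => (place_degree P)%:Z : int^o) D.

Definition is_principal_divisor (D : divisor) :=
  exists2 x : F, x != 0 &
    forall P : place, has_order [set: F] (place_ideal P) x (coeff P D).

Definition divisor_class (D : divisor) : set divisor :=
  [set E | divisor_degree E = 0 /\ is_principal_divisor (E - D)].

Definition class_group : set (set divisor) :=
  [set divisor_class D | D in [set D | divisor_degree D = 0]].

Definition class_number : nat := #|` fset_set class_group|.

(* The constant Z_p-extension, inside an algebraic closure Omega of F. *)
Section ConstantExtension.
Context {Omega : closedFieldType} (iota : {rmorphism F -> Omega}) (p : nat).

(* Omega has exactly one subfield of degree p ^ n over the finite field of
   constants; the union below is that subfield. *)
Definition const_layer (n : nat) : set Omega :=
  \bigcup_(K in [set K | is_extension_of_degree (iota @` constants) K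
                           (p ^ n)%N]) K.

Definition layer (n : nat) : set Omega :=
  compositum (range iota) (const_layer n).

Definition const_tower : set Omega := \bigcup_n const_layer n.

Definition tower : set Omega := \bigcup_n layer n.

Definition lies_above (Q : set Omega) (P : place) :=
  iota @^-1` Q = place_ideal P.

Definition ring_at_infinity (Pinf : place) : set Omega :=
  [set x | tower x /\
     forall Q, primes tower Q -> ~ lies_above Q Pinf -> ~ has_pole tower Q x].

End ConstantExtension.
End FunctionField.

Arguments constants {ell} F _.
Arguments class_number {ell} F.

(* Main.v *)
(* If Y^N = f(X) with N a power of q and X is not constant, then N divides
   ord_Q(X - a) for every prime Q not above P_infinity and every root a of f
   whose multiplicity is prime to q, because two distinct roots differ by a
   constant unit.

   Suppose that p = q does not divide h_F.  Then such an X - a is a p-th power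
   in the tower: modulo p-th powers phi - 1 acts nilpotently on a layer, where
   phi is the Frobenius automorphism of the tower over F, and Hilbert's
   Theorem 90, for the layer and for its field of constants, reduces the claim
   to elements of F, where it holds since a divisor class killed by p is
   trivial.  Two roots thus yield u and v with u^p - v^p a nonzero constant;
   u - v is then a unit, hence a constant, and comparing poles shows that v is
   constant.

   Suppose that p <> q.  A Mason-Stothers argument in characteristic ell bounds
   N.  Fix t in F, regular outside P_infinity and with a pole there of order
   prime to ell.  A regular function x has a unique expansion
   x = sum_(b < ell) B_b^ell t^b; the B_b have a common denominator r depending
   only on F, and r B_b vanishes at Q to order about ord_Q(x) / ell.  For
   x = X - a1 and y = X - a2, which share the coordinates with b > 0, this
   makes (r B_b)^(ell N) / (x y)^(N - ell + 1) regular.  Comparing the poles at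
   infinity bounds N in terms of r and ell alone, since the order of the pole of
   X is divisible by N: the norm to F multiplies this order by a power of p, and
   the degree of a principal divisor of F is 0.  If only B_0 is nonzero, x is an
   ell-th power and is replaced by its root. *)

Require Import Defs.
From HB Require Import structures.
From mathcomp Require Import all_boot all_order all_algebra all_field.
From mathcomp Require Import boolp classical_sets functions cardinality.
From mathcomp Require Import finmap freeg.
From mathcomp Require Import cyclic zify ring.

Set Implicit Arguments.
Unset Strict Implicit.
Unset Printing Implicit Defensive.

Import Order.TTheory GRing.Theory Num.Theory.
Local Open Scope classical_set_scope.
Local Open Scope ring_scope.

(** No finite theory describes the primes of the infinite tower: its valuation rings come from
    Zorn's lemma, and they are discrete only because a uniformizer of F stays one in a constant
    extension. Riemann-Roch is replaced by one count: for a nonconstant y regular outside P_infinity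
    and a nonzero ideal J of the ring of such functions, J / y J has dimension equal to the pole
    order of y. It is read off from pole numbers modulo that of y, leading terms being cancelled by
    constants at a place of degree 1; it yields local rings as rings of fractions and the product
    formula. Degree 1 also forces a single prime above P_infinity, which is what makes comparing
    poles meaningful. The nilpotence of phi - 1 modulo p-th powers is the congruence of (X -
    1)^(p^n) with X^(p^n) - 1 modulo p. The bound on N has to hold in all layers at once; it does
    because the regular functions of the tower are the combinations of those of F with constant
    coefficients, so that one denominator r serves everywhere. Coordinates over ell-th powers stand
    in for derivatives. *)

Lemma Zorn_above (T : Type) (P : set (set T)) (C : set T) : P C ->
  (forall G : set (set T), G !=set0 -> G `<=` P -> total_on G subset ->
     P (\bigcup_(X in G) X)) ->
  exists A, [/\ P A, C `<=` A & forall B, A `<=` B -> P B -> B = A].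
Proof.
(* [Zorn_bigcup] covers the empty chain as well, whose union need not satisfy [P]; adjoining [C] to
   every set turns that union into [C]. *)
move=> PC Pch; pose P' := [set X | P (X `|` C)].
have [|A [PA Amax]] := @Zorn_bigcup T P'.
  move=> G GP' Gtot; rewrite /P' /=.
  have [[X0 GX0]|G0] := pselect (G !=set0); last first.
    suff -> : \bigcup_(X in G) X = set0 by rewrite set0U.
    by rewrite -subset0 => x [X GX _]; apply: G0; exists X.
  suff -> : \bigcup_(X in G) X `|` C = \bigcup_(Y in [set X `|` C | X in G]) Y.
    apply: Pch; first by exists (X0 `|` C); exists X0.
      by move=> _ [X GX <-]; exact: GP'.
    move=> _ _ [X GX <-] [Y GY <-].
    by have [XY|YX] := Gtot X Y GX GY; [left|right]; exact: setSU.
  apply/seteqP; split=> x.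
    move=> [[X GX Xx]|Cx]; first by exists (X `|` C); [exists X|left].
    by exists (X0 `|` C); [exists X0|right].
  by move=> [_ [X GX <-] [Xx|Cx]]; [left; exists X|right].
exists (A `|` C); split => // B AB PB.
have BE : B `|` C = B by apply: setUidl => x Cx; apply: AB; right.
have PB' : P' B by rewrite /P' /= BE.
have AB' : A `<=` B by move=> x Ax; apply: AB; left.
have [BA|nBA] := pselect (B `<=` A); last by case: (Amax B).
by apply/seteqP; split=> // x Bx; left; exact: BA.
Qed.

(** * Valuation rings and divisibility in them *)

Section Subrings.
Context {L : fieldType}.
Implicit Types K k O P I J : set L.

Lemma is_subringP O : is_subring O <->
  [/\ O 1, (forall x y, O x -> O y -> O (x - y))
    & (forall x y, O x -> O y -> O (x * y))].
Proof.
split=> [[O1 OB OM]|[O1 OB OM]].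
  split; first exact: set_mem O1.
    by move=> x y /mem_set Ox /mem_set Oy; apply: set_mem; exact: OB.
  by move=> x y /mem_set Ox /mem_set Oy; apply: set_mem; exact: OM.
split; first exact: (@mem_set _ O).
  by move=> x y /(@set_mem _ O) Ox /(@set_mem _ O) Oy; apply: (@mem_set _ O); exact: OB.
by move=> x y /(@set_mem _ O) Ox /(@set_mem _ O) Oy; apply: (@mem_set _ O); exact: OM.
Qed.

Lemma is_subfieldP K : is_subfield K <->
  [/\ K 1, (forall x y, K x -> K y -> K (x - y))
    & (forall x y, K x -> K y -> K (x / y))].
Proof.
split=> [[O1 OB OM]|[O1 OB OM]].
  split; first exact: set_mem O1.
    by move=> x y /mem_set Ox /mem_set Oy; apply: set_mem; exact: OB.
  by move=> x y /mem_set Ox /mem_set Oy; apply: set_mem; exact: OM.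
split; first exact: (@mem_set _ K).
  by move=> x y /(@set_mem _ K) Ox /(@set_mem _ K) Oy; apply: (@mem_set _ K); exact: OB.
by move=> x y /(@set_mem _ K) Ox /(@set_mem _ K) Oy; apply: (@mem_set _ K); exact: OM.
Qed.

Lemma subfield_subring K : is_subfield K -> is_subring K.
Proof.
move=> /is_subfieldP [K1 KB KM]; apply/is_subringP; split=> // x y Kx Ky.
by rewrite -[y]invrK -[y^-1]mul1r; apply: (KM) => //; exact: (KM).
Qed.

Lemma is_subfieldT : is_subfield [set: L].
Proof. by apply/is_subfieldP. Qed.

Section SubringTheory.
Context (O : set L) (OR : is_subring O).

Lemma sr1 : O 1. Proof. by have /is_subringP [] := OR. Qed.
Lemma srB x y : O x -> O y -> O (x - y).
Proof. by have /is_subringP [_ + _] := OR; apply. Qed.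
Lemma srM x y : O x -> O y -> O (x * y).
Proof. by have /is_subringP [_ _] := OR; apply. Qed.
Lemma sr0 : O 0. Proof. by rewrite -(subrr 1); apply: srB; exact: sr1. Qed.
Lemma srN x : O x -> O (- x).
Proof. by move=> Ox; rewrite -sub0r; apply: srB => //; exact: sr0. Qed.
Lemma srD x y : O x -> O y -> O (x + y).
Proof. by move=> Ox Oy; rewrite -[y]opprK; apply: srB => //; exact: srN. Qed.
Lemma srX x n : O x -> O (x ^+ n).
Proof.
by move=> Ox; elim: n => [|n IH]; [exact: sr1|rewrite exprS; exact: srM].
Qed.
Lemma srMn x n : O x -> O (x *+ n).
Proof.
by move=> Ox; elim: n => [|n IH]; [exact: sr0|rewrite mulrS; exact: srD].
Qed.
Lemma sr_nat n : O n%:R. Proof. by apply: srMn; exact: sr1. Qed.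
Lemma sr_sum (T : Type) (s : seq T) (Q : pred T) (f : T -> L) :
  (forall i, Q i -> O (f i)) -> O (\sum_(i <- s | Q i) f i).
Proof. by move=> Of; apply: big_ind => //; [exact: sr0|exact: srD]. Qed.
Lemma sr_prod (T : Type) (s : seq T) (Q : pred T) (f : T -> L) :
  (forall i, Q i -> O (f i)) -> O (\prod_(i <- s | Q i) f i).
Proof. by move=> Of; apply: big_ind => //; [exact: sr1|exact: srM]. Qed.
Lemma sr_horner (h : {poly L}) x : (forall i, O h`_i) -> O x -> O h.[x].
Proof.
by move=> Oh Ox; rewrite horner_coef; apply: sr_sum => i _; apply: srM (Oh i) _;
  exact: srX.
Qed.
End SubringTheory.

Lemma sfV K x : is_subfield K -> K x -> K x^-1.
Proof.
move=> /is_subfieldP[K1 _ KM] Kx.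
by rewrite -[x^-1]mul1r; exact: KM.
Qed.

Lemma sf_div K x y : is_subfield K -> K x -> K y -> K (x / y).
Proof. by move=> /is_subfieldP[_ _]; apply. Qed.

Lemma sfXz K x (n : int) : is_subfield K -> K x -> K (x ^ n).
Proof.
move=> KF Kx; case: n => n.
  by rewrite -exprnP; apply: srX Kx; exact: subfield_subring.
rewrite NegzE -exprnN; apply: sfV => //.
by apply: srX Kx; exact: subfield_subring.
Qed.

Definition is_valring K O :=
  [/\ is_subring O, O `<=` K, (forall z, K z -> O z \/ O z^-1)
    & exists2 z, K z & ~ O z].

(** Zero is listed apart because 0^-1 = 0 lies in [O]. For a valuation ring this is the maximal
    ideal. *)
Definition nonunits O : set L := [set x | O x /\ (x = 0 \/ ~ O x^-1)].

(** For nonzero arguments: equal valuations, expressed before any value group is available. As x / 0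
    = 0, the relation is trivial when an argument is 0, hence the many side conditions. *)
Definition associated O x y := O (x / y) /\ O (y / x).

Lemma unitP O x : is_subring O -> O x -> ~ nonunits O x -> x != 0 /\ O x^-1.
Proof.
move=> OR Ox nPx; split.
  by apply/eqP => x0; apply: nPx; rewrite x0; split; [exact: sr0|left].
by apply: contrapT => nOx; apply: nPx; split=> //; right.
Qed.

Section ValringTheory.
Context (K O : set L) (KF : is_subfield K) (OV : is_valring K O).

Let OR : is_subring O. Proof. by case: OV. Qed.
Let KR : is_subring K. Proof. exact: subfield_subring. Qed.

Lemma valring_sub x : O x -> K x. Proof. by case: OV => _ OK _ _ /OK. Qed.

Lemma valring_total z : K z -> O z \/ O z^-1.
Proof. by case: OV => _ _ + _ => /[apply]. Qed.

Lemma nonunits1 : ~ nonunits O 1.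
Proof.
move=> [_ [/eqP|]]; first by rewrite oner_eq0.
by rewrite invr1; apply; exact: sr1.
Qed.

Lemma nonunitsN1 x : x != 0 -> nonunits O x -> ~ O x^-1.
Proof. by move=> /eqP x0 [_ [//|]]. Qed.

Lemma nonunitsM x y : O x -> nonunits O y -> nonunits O (x * y).
Proof.
move=> Ox [Oy y0]; split; first exact: srM.
have [->|x0] := eqVneq x 0; first by left; rewrite mul0r.
case: y0 => [->|nOy]; first by left; rewrite mulr0.
right; rewrite invfM => H; apply: nOy.
by rewrite -[y^-1](mulVKf x0); exact: srM.
Qed.

Lemma nonunitsD x y : nonunits O x -> nonunits O y -> nonunits O (x + y).
Proof.
move=> Px Py; have [Ox x0] := Px; have [Oy y0] := Py.
have [->|xn0] := eqVneq x 0; first by rewrite add0r.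
have [->|yn0] := eqVneq y 0; first by rewrite addr0.
have Kxy : K (x / y) by apply: sf_div => //; exact: valring_sub.
have [H|] := valring_total Kxy.
  have -> : x + y = (x / y + 1) * y by rewrite mulrDl mul1r divfK.
  by apply: nonunitsM => //; apply: srD => //; exact: sr1.
rewrite invf_div => H.
have -> : x + y = (y / x + 1) * x by rewrite mulrDl mul1r divfK // addrC.
by apply: nonunitsM => //; apply: srD => //; exact: sr1.
Qed.

Lemma nonunitsN x : nonunits O x -> nonunits O (- x).
Proof. by move=> ?; rewrite -mulN1r; apply: nonunitsM => //; apply: srN => //; exact: sr1. Qed.

Lemma nonunits0 : nonunits O 0.
Proof. by split; [exact: sr0|left]. Qed.

Lemma nonunits_sum (T : Type) (s : seq T) (Q : pred T) (f : T -> L) :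
  (forall i, Q i -> nonunits O (f i)) -> nonunits O (\sum_(i <- s | Q i) f i).
Proof. by move=> Of; apply: big_ind => //; [exact: nonunits0|exact: nonunitsD]. Qed.

Lemma nonunits_prime x y : O x -> O y -> nonunits O (x * y) ->
  nonunits O x \/ nonunits O y.
Proof.
move=> Ox Oy Pxy; have [Px|/(unitP OR Ox) [x0 Oxi]] := pselect (nonunits O x).
  by left.
by right; rewrite -[y](mulKf x0); exact: nonunitsM.
Qed.

Lemma nonunits_exp x n : O x -> nonunits O (x ^+ n) -> nonunits O x.
Proof.
move=> Ox; elim: n => [|n IH]; first by rewrite expr0 => /nonunits1.
by rewrite exprS => /(nonunits_prime Ox) -/(_ (srX OR n Ox)) [].
Qed.

Lemma nonunitsV x : K x -> ~ O x -> nonunits O x^-1.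
Proof.
move=> Kx nOx; have [//|Oxi] := valring_total Kx; split=> //; right.
by rewrite invrK.
Qed.

(** Valuation rings are integrally closed: if z lies outside [O], dividing the equation by the
    leading power of z writes 1 as a sum of nonunits. *)
Lemma valring_integral (h : {poly L}) z : K z -> h \is monic ->
  (forall i, O h`_i) -> root h z -> O z.
Proof.
move=> Kz hm Oh /rootP hz; apply: contrapT => nOz.
have z0 : z != 0 by apply/eqP => z0; apply: nOz; rewrite z0; exact: sr0.
have Pz := nonunitsV Kz nOz.
have hn : (0 < size h)%N by rewrite size_poly_gt0 monic_neq0.
apply: nonunits1; move: hz.
rewrite horner_coef -(prednK hn) big_ord_recr /= -lead_coefE (monicP hm) mul1r.
move=> /eqP; rewrite addrC addr_eq0 => /eqP hz.
have zn0 : z ^+ (size h).-1 != 0 by rewrite expf_neq0.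
rewrite -(divff zn0) {1}hz mulNr mulr_suml; apply: nonunitsN.
apply: nonunits_sum => i _; rewrite -mulrA; apply: nonunitsM.
  exact: Oh.
have /= il := ltn_ord i; set m := (size h).-1 in il *.
have -> : z ^+ i / z ^+ m = z^-1 ^+ (m - i).
  by rewrite -[in LHS](subnK (ltnW il)) exprD invfM mulrCA mulfV
    ?expf_neq0 // mulr1 exprVn.
rewrite -(subnSK il) exprS mulrC; apply: nonunitsM => //.
by apply: srX => //; case: Pz.
Qed.

(* A vanishing sum has two associated terms, since otherwise its term of
   least valuation would dominate it. *)
Lemma valring_two_terms n (u : 'I_n -> L) : (forall i, K (u i)) ->
  \sum_i u i = 0 -> (exists i, u i != 0) ->
  exists i j, [/\ i != j, u i != 0, u j != 0 & associated O (u i) (u j)].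
Proof.
move=> Ku su [i0 ui0].
have [i [uin0 imin]] : exists i, u i != 0 /\ forall j, O (u j / u i).
  have Kdiv j i : K (u j / u i) by exact: sf_div.
  suff [i [uin0 imin]] : exists i, u i != 0 /\
      forall j, j \in enum 'I_n -> O (u j / u i).
    by exists i; split=> // j; apply: imin; rewrite mem_enum.
  elim: (enum 'I_n) => [|k s [i [uin0 imin]]]; first by exists i0.
  have [uk0|ukn0] := eqVneq (u k) 0.
    exists i; split=> // j; rewrite inE => /orP[/eqP->|/imin //].
    by rewrite uk0 mul0r; exact: sr0.
  have [H|H] := valring_total (Kdiv k i).
    by exists i; split=> // j; rewrite inE => /orP[/eqP->|/imin //].
  exists k; split=> // j; rewrite inE => /orP[/eqP->|/imin Oj].
    by rewrite divff //; exact: sr1.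
  have -> : u j / u k = (u j / u i) * (u k / u i)^-1.
    by rewrite invf_div mulrA divfK.
  exact: srM.
apply: contrapT => nex; apply: nonunits1.
have : \sum_j u j / u i = 0 by rewrite -mulr_suml su mul0r.
rewrite (bigD1 i) //= divff // => /eqP; rewrite addr_eq0 => /eqP ->.
apply: nonunitsN; apply: nonunits_sum => j ji; split=> //.
have [->|ujn0] := eqVneq (u j) 0; first by left; rewrite mul0r.
right; rewrite invf_div => H; apply: nex; exists i, j; split=> //.
by rewrite eq_sym.
Qed.

End ValringTheory.

Section AssociatedTheory.
Context (O : set L) (OR : is_subring O).

Lemma associated_sym x y : associated O x y -> associated O y x.
Proof. by case. Qed.

Lemma associated_refl x : x != 0 -> associated O x x.
Proof. by move=> x0; rewrite /associated divff //; split; exact: sr1. Qed.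

Lemma associated_trans y x z : y != 0 ->
  associated O x y -> associated O y z -> associated O x z.
Proof.
move=> y0 [xy yx] [yz zy]; split.
  by rewrite -[x](divfK y0) -mulrA; exact: srM.
by rewrite -[z](divfK y0) -mulrA; exact: srM.
Qed.

Lemma associatedM x y x' y' :
  associated O x y -> associated O x' y' -> associated O (x * x') (y * y').
Proof. by move=> [? ?] [? ?]; rewrite /associated -!mulf_div; split; exact: srM. Qed.

Lemma associatedV x y : associated O x y -> associated O x^-1 y^-1.
Proof. by move=> [a b]; rewrite /associated !invrK ![_^-1 * _]mulrC. Qed.

Lemma associatedX x y n : associated O x y -> associated O (x ^+ n) (y ^+ n).
Proof. by move=> [a b]; rewrite /associated -!expr_div_n; split; exact: srX. Qed.

Lemma associatedXz x y (n : int) : associated O x y -> associated O (x ^ n) (y ^ n).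
Proof.
move=> a; case: n => n; first by rewrite -!exprnP; exact: associatedX.
by rewrite NegzE -!exprnN; apply: associatedV; exact: associatedX.
Qed.

Lemma associated1 x : x != 0 -> O x -> ~ nonunits O x -> associated O x 1.
Proof.
move=> x0 Ox /(unitP OR Ox) [_ Oxi]; rewrite /associated divr1.
by split=> //; rewrite mul1r.
Qed.

End AssociatedTheory.
End Subrings.

(** * Primes and discrete valuations *)

Section DiscreteValuations.
Context {L : fieldType}.
Implicit Types K k O P I J : set L.

Definition is_uniformizer K O (pi : L) :=
  [/\ nonunits O pi, pi != 0
    & forall z, K z -> z != 0 -> exists n : int, associated O z (pi ^ n)].

Lemma ideal_eq O J : is_subring O -> is_ideal O J -> J 1 -> J = O.
Proof.
move=> OR [JO _ _ JM] J1; apply/seteqP; split=> // x Ox.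
by rewrite -[x]mulr1; exact: JM.
Qed.

Lemma principal_idealP O (a : L) : is_subring O -> O a ->
  is_ideal O (principal_ideal O a).
Proof.
move=> OR Oa; split.
- by move=> _ [x Ox <-]; exact: srM.
- by exists 0; [exact: sr0|rewrite mulr0].
- by move=> _ _ [x Ox <-] [y Oy <-]; exists (x + y); [exact: srD|rewrite mulrDr].
- by move=> b _ Ob [y Oy <-]; exists (b * y); [exact: srM|rewrite mulrCA].
Qed.

Lemma krull O (x : L) : is_subring O -> O x -> nonunits O x ->
  exists J, is_maximal_ideal O J /\ J x.
Proof.
move=> OR Ox [_ xN].
pose Q J := [/\ is_ideal O J, J x & ~ J 1].
have Q0 : Q (principal_ideal O x).
  split; first exact: principal_idealP.
    by exists 1; [exact: sr1|rewrite mulr1].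
  move=> [y Oy xy1]; case: xN => [x0|]; last apply.
    by move: xy1 => /esym/eqP; rewrite x0 mul0r oner_eq0.
  have x0 : x != 0 by apply: contra_eq_neq xy1 => ->; rewrite mul0r eq_sym oner_eq0.
  by rewrite -[x^-1]mulr1 -xy1 mulKf.
have [G [J0 GJ0] GQ Gtot|A [[AI Ax A1] _ Amax]] := Zorn_above Q0.
  split; last 2 first.
  - by exists J0 => //; have [] := GQ _ GJ0.
  - by move=> [J GJ J1]; have [] := GQ _ GJ.
  split.
  - by move=> y [J GJ Jy]; have [[+ _ _ _] _ _] := GQ _ GJ; apply.
  - by exists J0 => //; have [[]] := GQ _ GJ0.
  - move=> y z [J GJ Jy] [J' GJ' J'z].
    have [JJ|JJ] := Gtot _ _ GJ GJ'.
      by exists J' => //; have [[_ _ + _] _ _] := GQ _ GJ'; apply=> //; exact: JJ.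
    by exists J => //; have [[_ _ + _] _ _] := GQ _ GJ; apply=> //; exact: JJ.
  - move=> a y Oa [J GJ Jy]; exists J => //.
    by have [[_ _ _ +] _ _] := GQ _ GJ; apply.
exists A; split=> //; split=> //.
  by apply/eqP => AO; apply: A1; rewrite AO; exact: sr1.
move=> J JI AJ; have [J1|J1] := pselect (J 1); first by right; exact: ideal_eq.
by left; apply: Amax => //; split=> //; exact: AJ.
Qed.

(** A generator pi of the maximal ideal divides a nonzero x of [O] only finitely often, so that x is
    a unit times a power of pi. *)
Lemma dvr_spec K O P : is_subfield K -> is_dvr_of_prime K O P ->
  [/\ is_valring K O, P = nonunits O & exists pi, is_uniformizer K O pi].
Proof.
move=> KF [[OR PID [P0 [P0max P0n0 P0u]]] OK Pmax].
have {P0u} PE J : is_maximal_ideal O J -> J = P.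
  by move=> Jm; rewrite (P0u _ Jm) (P0u _ Pmax).
have {P0max P0n0} Pn0 : P != [set 0] by rewrite -(PE _ P0max).
have [[PO P00 PD PM] PnO _] := Pmax.
have P1 : ~ P 1.
  by move=> P1; move/eqP: PnO; apply; apply: ideal_eq P1 => //; case: Pmax.
have PN : P = nonunits O.
  apply/seteqP; split=> x.
    move=> Px; split; first exact: PO.
    have [->|x0] := eqVneq x 0; [by left|right=> Oxi].
    by apply: P1; rewrite -(mulVf x0); exact: PM.
  move=> Nx; have [Ox _] := Nx.
  by have [J [Jm Jx]] := krull OR Ox Nx; rewrite -(PE _ Jm).
have [pi Opi Ppi] := PID P (let: And3 H _ _ := Pmax in H).
have Ppi' : P pi by rewrite Ppi; exists 1; [exact: sr1|rewrite mulr1].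
have pi0 : pi != 0.
  apply: contraNneq Pn0 => pi0; apply/eqP/seteqP; split=> x.
    by rewrite Ppi => -[y _ <-]; rewrite pi0 /= mul0r.
  by move=> /= ->.
have piN : ~ O pi^-1.
  by move: Ppi'; rewrite PN => -[_ [/eqP|//]]; rewrite (negPf pi0).
have decO x : O x -> x != 0 -> exists n : nat, associated O x (pi ^+ n).
  move=> Ox x0.
  have [n nO] : exists n, ~ O (x / pi ^+ n).
    apply: contrapT => allO.
    have {}allO n : O (x / pi ^+ n) by apply: contrapT => H; apply: allO; exists n.
    (* The elements divisible by every power of pi form a principal ideal a O; as a / pi lies in it
       too, pi would be invertible. *)
    pose J := [set z | O z /\ forall n, O (z / pi ^+ n)].
    have JI : is_ideal O J.
      split; first by move=> z [].
      - by split=> [|n]; rewrite ?mul0r; exact: sr0.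
      - move=> y z [Oy yn] [Oz zn]; split=> [|n]; first exact: srD.
        by rewrite mulrDl; exact: srD.
      - move=> a z Oa [Oz zn]; split=> [|n]; first exact: srM.
        by rewrite -mulrA; exact: srM.
    have [a Oa JE] := PID J JI.
    have Ja : J a by rewrite JE; exists 1; [exact: sr1|rewrite mulr1].
    have a0 : a != 0.
      apply: contraNneq x0 => a0; have : J x by split.
      by rewrite JE => -[y _ <-]; rewrite a0 mul0r.
    have : J (a / pi).
      split; first by have := Ja.2 1; rewrite expr1.
      by move=> n; rewrite -mulrA -invfM -exprS; exact: Ja.2.
    by rewrite JE => -[r Or] /(mulfI a0) rE; apply: piN; rewrite -rE.
  have exn : exists n, `[< ~ O (x / pi ^+ n) >] by exists n; apply/asboolP.
  case: (ex_minnP exn) => -[/asboolP|m /asboolP nOm mmin].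
    by rewrite expr0 divr1.
  have Om : O (x / pi ^+ m).
    by apply: contrapT => /asboolP /mmin; rewrite ltnn.
  have um : ~ nonunits O (x / pi ^+ m).
    rewrite -PN Ppi => -[r Or rE]; apply: nOm.
    by rewrite exprSr invfM mulrA -rE [_ * r]mulrC mulfK.
  exists m; split=> //; have [_] := unitP OR Om um.
  by rewrite invf_div.
have OKsub : O `<=` K.
  by move=> x Ox; rewrite OK; exists x, 1; split=> //; [exact: sr1|exact: oner_neq0|rewrite divr1].
have unif : is_uniformizer K O pi.
  split; [by rewrite -PN|by []|move=> z + z0].
  rewrite {1}OK => -[x [y [Ox Oy y0 zE]]].
  have x0 : x != 0 by apply: contra_neq z0; rewrite zE => ->; rewrite mul0r.
  have [n xn] := decO x Ox x0; have [m ym] := decO y Oy y0.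
  exists (n%:Z - m%:Z); rewrite zE expfzDr // -exprnP -exprnN.
  by apply: associatedM => //; exact: associatedV.
split=> //; last by exists pi.
split=> //; last by exists pi^-1 => //; apply: sfV => //; exact: OKsub.
move=> z Kz; have [->|z0] := eqVneq z 0; first by left; exact: sr0.
have [_ _ /(_ z Kz z0) [[n|n] [a b]]] := unif.
  by left; rewrite -[z](divfK (expfz_neq0 n%:Z pi0)); apply: srM => //; exact: srX.
right; rewrite -[z^-1](divfK (expfz_neq0 n.+1%:Z pi0)); apply: srM => //; last exact: srX.
by move: b; rewrite NegzE -exprnN -exprnP mulrC.
Qed.

(** Converse of [dvr_spec]: this is how valuation rings found by Zorn's lemma become primes in the
    sense of the statement. *)
Lemma valring_prime K O pi : is_subfield K -> is_valring K O ->
  is_uniformizer K O pi -> is_dvr_of_prime K O (nonunits O).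
Proof.
move=> KF OV [piN pi0 pidec]; have [OR OK Otot _] := OV.
have Opi : O pi by case: piN.
have NI : is_ideal O (nonunits O).
  split; first by move=> x [].
  - by split; [exact: sr0|left].
  - by move=> x y; exact: (nonunitsD KF OV).
  - by move=> a x; exact: (nonunitsM OV).
have NnO : nonunits O <> O by move=> NE; apply: (nonunits1 OV); rewrite NE; exact: sr1.
have subN J : is_ideal O J -> J <> O -> J `<=` nonunits O.
  move=> JI JnO x Jx; apply: contrapT => /(unitP OR) - [|x0 Oxi].
    by case: JI => + _ _ _; apply.
  apply: JnO; apply: ideal_eq => //; rewrite -(mulVf x0).
  by case: JI => _ _ _; apply.
have Nmax : is_maximal_ideal O (nonunits O).
  split=> //; first exact/eqP.
  move=> J JI NJ; have [|JnO] := pselect (J = O); first by right.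
  by left; apply/seteqP; split=> //; exact: subN.
split=> //.
  split=> //.
    move=> I II; have [IO I0 ID IM] := II.
    have [|nI] := pselect (I = [set 0]).
      move=> ->; exists 0; first exact: sr0.
      apply/seteqP; split=> x /=; first by move=> ->; exists 0; [exact: sr0|rewrite mul0r].
      by move=> [y _ <-]; rewrite mul0r.
    have inN i : I i -> i != 0 -> exists2 n : nat, associated O i (pi ^+ n) & I (pi ^+ n).
      move=> Ii i0; have [[n|n] [a b]] := pidec i (OK _ (IO _ Ii)) i0.
        by exists n => //; rewrite -[_ ^+ _](divfK i0); exact: IM.
      exfalso; move: b; rewrite NegzE -exprnN => H.
      have Oi := IO _ Ii; case: piN => _ [/eqP|]; first by rewrite (negPf pi0).
      apply; have -> : pi^-1 = pi ^- n.+1 / i * (pi ^+ n * i).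
        have pin := expf_neq0 n pi0; rewrite exprS; field.
        by rewrite pi0 i0 pin.
      by apply: srM => //; apply: srM => //; exact: srX.
    have [i [Ii i0]] : exists i, I i /\ i != 0.
      apply: contrapT => H; apply: nI; apply/seteqP; split=> x /=; last by move=> ->.
      by move=> Ix; apply: contrapT => /eqP x0; apply: H; exists x.
    have [n0 _ In0] := inN i Ii i0.
    have exn : exists n, `[< I (pi ^+ n) >] by exists n0; apply/asboolP.
    case: (ex_minnP exn) => n /asboolP In nmin; exists (pi ^+ n); first exact: srX.
    apply/seteqP; split=> x.
      move=> Ix; have [->|x0] := eqVneq x 0.
        by exists 0; [exact: sr0|rewrite mulr0].
      have [m [a b] /asboolP /nmin nm] := inN x Ix x0.
      exists (x / pi ^+ n); last by rewrite mulrC divfK // expf_neq0.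
      have E : pi ^+ m = pi ^+ (m - n) * pi ^+ n by rewrite -exprD subnK.
      have -> : x / pi ^+ n = x / pi ^+ m * pi ^+ (m - n).
        by rewrite E; field; rewrite !expf_neq0.
      by apply: srM => //; exact: srX.
    by move=> [y Oy <-]; rewrite mulrC; exact: IM.
  exists (nonunits O); split=> //.
    apply/eqP => NE; have : [set 0] pi by rewrite -NE.
    by move=> /= /eqP; rewrite (negPf pi0).
  move=> P' P'max; have [P'I P'O P'm] := P'max.
  have sub : P' `<=` nonunits O by apply: subN => //; exact/eqP.
  by case: (P'm _ NI sub) => [->//|/NnO].
rewrite /is_fraction_field; apply/seteqP; split=> z.
  move=> Kz; have [Oz|Oz] := Otot z Kz.
    by exists z, 1; split=> //; [exact: sr1|exact: oner_neq0|rewrite divr1].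
  have [->|z0] := eqVneq z 0.
    by exists 0, 1; split; [exact: sr0|exact: sr1|exact: oner_neq0|rewrite mul0r].
  by exists 1, z^-1; split=> //; [exact: sr1|rewrite invr_eq0|rewrite invrK mul1r].
by move=> [x [y [Ox Oy _ ->]]]; apply: sf_div => //; exact: OK.
Qed.

(** The default 0 is taken in particular at x = 0, so that orders are used under x != 0 or through
    [oge]. *)
Definition ord K P (x : L) : int := xget 0 [set n | has_order K P x n].

Lemma associated_pow_inj K O pi (n m : int) : is_valring K O ->
  nonunits O pi -> pi != 0 -> associated O (pi ^ n) (pi ^ m) -> n = m.
Proof.
move=> OV piN pi0 [a b]; have [OR _ _ _] := OV; have Opi : O pi by case: piN.
wlog lt_nm : n m a b / n < m => [wl|].
  by have [nm|mn|//] := ltgtP n m; [exact: wl|apply/esym; exact: wl].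
exfalso; case: piN => _ [/eqP|]; first by rewrite (negPf pi0).
apply; have -> : pi^-1 = pi ^ n / pi ^ m * pi ^+ absz (m - n - 1)%R.
  rewrite exprnP gez0_abs; last by lia.
  rewrite invr_expz -!expfzDr //.
  by rewrite (_ : n - m + (m - n - 1) = -1) //; lia.
by apply: srM => //; exact: srX.
Qed.

Section OrdTheory.
Context (K P : set L) (KF : is_subfield K) (HP : Defs.primes K P).

(** The prime determines its ring, since a nonzero z of [K] lies outside the ring exactly when z^-1
    is in [P]. Hence the rings hidden in different instances of [has_order] agree. *)
Lemma valring_of_primeE O z : is_dvr_of_prime K O P ->
  O z <-> K z /\ (z = 0 \/ ~ P z^-1).
Proof.
move=> /(dvr_spec KF) [OV -> _]; have [OR OK Ot _] := OV; split.
  move=> Oz; split; first exact: OK.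
  have [->|z0] := eqVneq z 0; [by left|right=> -[_ []]].
    by move=> /eqP; rewrite invr_eq0 (negPf z0).
  by rewrite invrK.
move=> [Kz [->|nP]]; first exact: sr0.
have [//|Ozi] := Ot z Kz; apply: contrapT => nOz; apply: nP; split=> //.
by right; rewrite invrK.
Qed.

Lemma ord_spec : exists O pi, [/\ is_valring K O, P = nonunits O,
  is_uniformizer K O pi,
  (forall x n, has_order K P x n <-> [/\ K x, x != 0 & n = ord K P x])
  & (forall x, K x -> x != 0 -> associated O x (pi ^ (ord K P x)))].
Proof.
have [O OP] := HP; have [OV PE [pi unif]] := dvr_spec KF OP.
have [piN pi0 pidec] := unif.
have OR : is_subring O by case: OV.
have Opi : O pi by case: piN.
have ho x n : has_order K P x n <-> [/\ K x, x != 0 & associated O x (pi ^ n)].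
  split.
    move=> [O' [O'P [pi' [u [PE' u0 Ou Oui ->]]]]].
    have O'E : O' = O.
      by apply/seteqP; split=> z; rewrite !(valring_of_primeE _ O'P) (valring_of_primeE _ OP).
    rewrite {O'P}O'E in PE' Ou Oui.
    have pi'P : P pi' by rewrite PE'; exists 1; [exact: sr1|rewrite mulr1].
    have pi'0 : pi' != 0.
      apply: contraNneq pi0 => p0.
      have : P pi by rewrite PE.
      by rewrite PE' => -[r _ <-]; rewrite p0 mul0r.
    have Kpi' : K pi' by case: OV => _ + _ _; apply; move: pi'P; rewrite PE => -[].
    split; first by apply: (srM (subfield_subring KF)); [case: OV => _ + _ _; apply|exact: sfXz].
      by rewrite mulf_neq0 // expfz_neq0.
    have pia : associated O pi' pi.
      have : P pi by rewrite PE.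
      rewrite PE' => -[r Or rE].
      split; last by rewrite -rE mulrAC divff ?mul1r.
      have [m [a b]] := pidec pi' Kpi' pi'0.
      case: m a b => [[|m]|m] a b.
      - exfalso; move: pi'P; rewrite PE => -[_ [/eqP|]]; first by rewrite (negPf pi'0).
        by apply; move: b; rewrite expr0z mul1r.
      - move: a; rewrite -exprnP exprS invfM mulrA => a.
        rewrite -[X in O X](divfK (expf_neq0 m pi0)).
        by apply: srM => //; exact: srX.
      - exfalso; move: pi'P; rewrite PE => -[_ [/eqP|]]; first by rewrite (negPf pi'0).
        apply; move: b; rewrite NegzE -exprnN => b.
        have -> : pi'^-1 = pi ^- m.+1 / pi' * pi ^+ m.+1 by rewrite mulrAC mulVf ?mul1r ?expf_neq0.
        by apply: srM => //; exact: srX.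
    have H : associated O u 1 by rewrite /associated divr1 mul1r.
    by rewrite -[pi ^ n]mul1r; apply: associatedM H _ => //; exact: associatedXz.
  move=> [Kx x0 [a b]]; exists O; split=> //; exists pi, (x / pi ^ n).
  have pin0 := expfz_neq0 n pi0; split=> //.
  - rewrite PE; apply/seteqP; split=> z; last first.
      by move=> [r Or <-]; rewrite mulrC; exact: (nonunitsM OV).
    move=> [Oz zN]; have [->|z0] := eqVneq z 0.
      by exists 0; [exact: sr0|rewrite mulr0].
    have Kz : K z by case: OV => _ + _ _; apply.
    have [[[|m]|m] [c d]] := pidec z Kz z0.
    + case: zN => [/eqP|]; first by rewrite (negPf z0).
      by case; move: d; rewrite expr0z mul1r.
    + move: c; rewrite -exprnP exprS invfM mulrA => c.
      exists (z / pi); last by rewrite mulrC divfK.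
      rewrite -[X in O X](divfK (expf_neq0 m pi0)).
      by apply: srM => //; exact: srX.
    + case: zN => [/eqP|]; first by rewrite (negPf z0).
      case; move: d; rewrite NegzE -exprnN => d.
      have -> : z^-1 = pi ^- m.+1 / z * pi ^+ m.+1 by rewrite mulrAC mulVf ?mul1r ?expf_neq0.
      by apply: srM => //; exact: srX.
  - by rewrite mulf_neq0 // invr_eq0.
  - by rewrite invf_div.
  - by rewrite divfK.
exists O, pi; split=> //.
  move=> x n; rewrite ho; split.
    move=> [Kx x0 a]; split=> //; apply/esym/xget_unique => /=.
      by rewrite ho.
    move=> m; rewrite ho => -[_ _ b].
    apply: (associated_pow_inj OV piN pi0).
    apply: associated_trans a => //; exact: associated_sym.
  move=> [Kx x0 ->]; split=> //.
  have [m am] := pidec x Kx x0.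
  have : has_order K P x (ord K P x).
    by apply: (@xgetPex _ 0 [set n | has_order K P x n]); exists m; rewrite /= ho.
  by rewrite ho => -[].
move=> x Kx x0; have [m am] := pidec x Kx x0.
have : has_order K P x (ord K P x).
  by apply: (@xgetPex _ 0 [set n | has_order K P x n]); exists m; rewrite /= ho.
by rewrite ho => -[].
Qed.

Lemma has_orderP x n : has_order K P x n <-> [/\ K x, x != 0 & n = ord K P x].
Proof. by have [O [pi [_ _ _ H _]]] := ord_spec; exact: H. Qed.

Lemma ordM x y : K x -> K y -> x != 0 -> y != 0 ->
  ord K P (x * y) = ord K P x + ord K P y.
Proof.
have [O [pi [OV _ [piN pi0 _] _ A]]] := ord_spec; have [OR _ _ _] := OV.
have KR := subfield_subring KF.
move=> Kx Ky x0 y0; apply: (associated_pow_inj OV piN pi0).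
rewrite expfzDr //; apply: associated_trans (associatedM OR (A x Kx x0) (A y Ky y0)) => //.
  exact: mulf_neq0.
by apply: associated_sym; apply: A; [exact: srM|exact: mulf_neq0].
Qed.

Lemma ord_one : ord K P 1 = 0.
Proof.
have K1 := sr1 (subfield_subring KF).
have := ordM K1 K1 (oner_neq0 _) (oner_neq0 _); rewrite mulr1; lia.
Qed.

Lemma ordV x : K x -> x != 0 -> ord K P x^-1 = - ord K P x.
Proof.
move=> Kx x0; have Kxi := sfV KF Kx.
have := ordM Kx Kxi x0; rewrite invr_eq0 => /(_ x0); rewrite divff // ord_one; lia.
Qed.

Lemma ordX x n : K x -> x != 0 -> ord K P (x ^+ n) = n%:Z * ord K P x.
Proof.
move=> Kx x0; elim: n => [|n IH]; first by rewrite expr0 ord_one mul0r.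
rewrite exprS ordM ?IH ?expf_neq0 //; last by apply: srX => //; exact: subfield_subring.
by rewrite intS mulrDl mul1r.
Qed.

Lemma ord_div x y : K x -> K y -> x != 0 -> y != 0 ->
  ord K P (x / y) = ord K P x - ord K P y.
Proof. by move=> Kx Ky x0 y0; rewrite ordM ?ordV ?invr_eq0 //; exact: sfV. Qed.

Lemma ord_prod (T : Type) (s : seq T) (f : T -> L) :
  (forall i, K (f i)) -> (forall i, f i != 0) ->
  ord K P (\prod_(i <- s) f i) = \sum_(i <- s) ord K P (f i).
Proof.
move=> Kf f0; have KR := subfield_subring KF.
elim: s => [|i s IH]; first by rewrite !big_nil ord_one.
rewrite !big_cons ordM ?IH //; first by apply: sr_prod.
by apply: (big_ind (fun z => z != 0)) => [|u v|i0 _]; [exact: oner_neq0|exact: mulf_neq0|exact: f0].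
Qed.

(* [oge n x]: x lies in the fractional ideal of order n. *)
Definition oge (n : int) x := K x /\ (x = 0 \/ n <= ord K P x).

Lemma oge0 n : oge n 0.
Proof. by split; [exact: sr0 (subfield_subring KF)|left]. Qed.

Lemma ogeE n x : K x -> x != 0 -> oge n x <-> n <= ord K P x.
Proof. by move=> Kx /eqP x0; split=> [[_ [/x0|]]//|]; split=> //; right. Qed.

Lemma oge_le n m x : m <= n -> oge n x -> oge m x.
Proof. by move=> mn [Kx [->|nx]]; [exact: oge0|split=> //; right; exact: le_trans nx]. Qed.

Lemma ogeM n m x y : oge n x -> oge m y -> oge (n + m) (x * y).
Proof.
move=> [Kx nx] [Ky my]; have [->|x0] := eqVneq x 0; first by rewrite mul0r; exact: oge0.
have [->|y0] := eqVneq y 0; first by rewrite mulr0; exact: oge0.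
split; first by apply: srM => //; exact: subfield_subring.
right; rewrite ordM //; apply: lerD.
  by case: nx => // /eqP; rewrite (negPf x0).
by case: my => // /eqP; rewrite (negPf y0).
Qed.

Lemma oge_ring : exists O, [/\ is_dvr_of_prime K O P, is_valring K O, P = nonunits O,
   (forall x, O x <-> oge 0 x) & (forall x, P x <-> oge 1 x)].
Proof.
have [O [pi [OV PE unif ho A]]] := ord_spec; have [piN pi0 _] := unif.
have [OR OK _ _] := OV; have Opi : O pi by case: piN.
have OE x : O x <-> oge 0 x.
  split=> [Ox|[Kx [->|]]]; last 2 first.
  - exact: sr0.
  - move=> o0; have [->|x0] := eqVneq x 0; first exact: sr0.
    have [a b] := A x Kx x0; rewrite -[x](divfK (expfz_neq0 (ord K P x) pi0)).
    by apply: srM => //; case: (ord K P x) o0 => // n _; exact: srX.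
  split; first exact: OK.
  have [->|x0] := eqVneq x 0; [by left|right].
  rewrite leNgt; apply/negP => neg; have [a b] := A x (OK _ Ox) x0.
  case: piN => _ [/eqP|]; first by rewrite (negPf pi0).
  apply; have -> : pi^-1 = (pi ^ (ord K P x) / x) * x * pi ^+ absz (- ord K P x - 1)%R.
    rewrite divfK // exprnP gez0_abs; last by lia.
    rewrite -expfzDr //.
    by rewrite (_ : ord K P x + (- ord K P x - 1) = -1) //; lia.
  by apply: srM => //; [exact: srM|exact: srX].
exists O; split=> //; first by rewrite PE; exact: valring_prime unif.
move=> x; rewrite PE; split.
  move=> [Ox xN]; split; first exact: OK.
  have [->|x0] := eqVneq x 0; [by left|right].
  have : oge 0 x by apply/OE.
  rewrite ogeE //; last exact: OK.
  move=> o0; suff : ord K P x != 0 by lia.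
  apply/eqP => oe; case: xN => [/eqP|]; first by rewrite (negPf x0).
  apply; apply/OE; split; first by apply: sfV => //; exact: OK.
  by right; rewrite ordV ?oe //; exact: OK.
move=> ox; have ox0 : oge 0 x by apply: oge_le ox.
have Ox : O x by apply/OE.
split=> //; have [->|x0] := eqVneq x 0; [by left|right].
move=> /OE; rewrite ogeE ?invr_eq0 //; last by apply: sfV => //; exact: OK.
move: ox; rewrite ogeE //; last exact: OK.
by rewrite ordV //; [lia|exact: OK].
Qed.

Lemma ogeD n x y : oge n x -> oge n y -> oge n (x + y).
Proof.
move=> nx ny; have [->|x0] := eqVneq x 0; first by rewrite add0r.
have [->|y0] := eqVneq y 0; first by rewrite addr0.
have [Kx _] := nx; have [Ky _] := ny.
have [O [_ OV _ OE _]] := oge_ring; have [OR _ _ _] := OV.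
have [xy|yx] := valring_total OV (sf_div KF Kx Ky).
  have -> : x + y = (x / y + 1) * y by rewrite mulrDl mul1r divfK.
  rewrite -[n]add0r; apply: ogeM => //; apply/OE.
  by apply: srD => //; exact: sr1.
have -> : x + y = (1 + y / x) * x by rewrite mulrDl mul1r divfK.
rewrite -[n]add0r; apply: ogeM => //; apply/OE.
by rewrite -invf_div; apply: srD => //; exact: sr1.
Qed.

Lemma ogeN n x : oge n x -> oge n (- x).
Proof.
move=> nx; rewrite -mulN1r -[n]add0r; apply: ogeM => //.
by have [O [_ [OR _ _ _] _ OE _]] := oge_ring; apply/OE; apply: srN => //; exact: sr1.
Qed.

Lemma ogeB n x y : oge n x -> oge n y -> oge n (x - y).
Proof. by move=> nx ny; apply: ogeD => //; exact: ogeN. Qed.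

Lemma oge_sum n (T : Type) (s : seq T) (Q : pred T) (f : T -> L) :
  (forall i, Q i -> oge n (f i)) -> oge n (\sum_(i <- s | Q i) f i).
Proof. by move=> Of; apply: big_ind => //; [exact: oge0|exact: ogeD]. Qed.

Lemma oge1 : oge 0 1.
Proof. by split; [exact: sr1 (subfield_subring KF)|right; rewrite ord_one]. Qed.

Lemma ogeX n x i : oge n x -> oge (i%:Z * n) (x ^+ i).
Proof.
move=> nx; elim: i => [|i IH]; first by rewrite mul0r; exact: oge1.
by rewrite exprS intS mulrDl mul1r; exact: ogeM.
Qed.

Lemma oge_ord x : K x -> oge (ord K P x) x.
Proof. by move=> Kx; split=> //; right. Qed.

Lemma ord_lt_add x y n : K x -> x != 0 -> oge n y -> ord K P x < n ->
  x + y != 0 /\ ord K P (x + y) = ord K P x.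
Proof.
move=> Kx x0 ny xn; have Ky : K y by case: ny.
have Kxy := srD (subfield_subring KF) Kx Ky.
have ny' : oge (ord K P x + 1) y by apply: oge_le ny; lia.
have xyN : x + y != 0.
  apply/eqP => xy; have : oge (ord K P x + 1) x.
    by rewrite -[X in oge _ X](addrK y) xy sub0r; exact: ogeN.
  by move=> /(ogeE _ Kx x0); lia.
split=> //; apply/eqP; rewrite eq_le; apply/andP; split.
  rewrite leNgt; apply/negP => lt.
  have : oge (ord K P x + 1) x.
    rewrite -[X in oge _ X](addrK y); apply: ogeB => //.
    by apply: oge_le (oge_ord Kxy); lia.
  by move=> /(ogeE _ Kx x0); lia.
rewrite -ogeE //; apply: ogeD; first exact: oge_ord.
by apply: oge_le ny; lia.
Qed.

Lemma prime_oge x : P x <-> oge 1 x.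
Proof. by have [O [_ _ _ _ H]] := oge_ring; exact: H. Qed.

Lemma ord_uniformizer : exists pi, [/\ K pi, pi != 0 & ord K P pi = 1].
Proof.
have [O [pi [OV PE [piN pi0 _] ho A]]] := ord_spec.
have Kpi : K pi by case: OV => _ + _ _; apply; case: piN.
exists pi; split=> //; apply: (associated_pow_inj OV piN pi0).
by rewrite expr1z; apply: associated_sym; exact: A.
Qed.
End OrdTheory.

(** Units at P are units at P', so the order at P' is e times the order at P, where e is the order
    at P' of a uniformizer of P; e is positive because some element has order 1 at P'. *)
Lemma prime_eq K P P' : is_subfield K -> Defs.primes K P -> Defs.primes K P' ->
  (forall x, oge K P 0 x -> oge K P' 0 x) -> P = P'.
Proof.
move=> KF HP HP' sub.
have u x : K x -> x != 0 -> ord K P x = 0 -> ord K P' x = 0.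
  move=> Kx x0 ox; have := sub x; rewrite !ogeE // ox => /(_ isT).
  have := sub x^-1; rewrite !ogeE ?invr_eq0 //; try exact: sfV.
  rewrite !ordV // ox oppr0 => /(_ isT); lia.
have [pi [Kpi pi0 opi]] := ord_uniformizer KF HP.
have E x : K x -> x != 0 -> ord K P' x = ord K P x * ord K P' pi.
  move=> Kx x0; pose n := ord K P x.
  have Kpin : K (pi ^ n) by exact: sfXz.
  have pin0 : pi ^ n != 0 by rewrite expfz_neq0.
  have oz Q : Defs.primes K Q -> ord K Q (pi ^ n) = n * ord K Q pi.
    move=> HQ; case: (n) => m; first by rewrite -exprnP (ordX KF HQ).
    by rewrite NegzE -exprnN (ordV KF HQ) ?expf_neq0 // ?(ordX KF HQ) ?mulNr //;
       apply: srX => //; exact: subfield_subring.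
  have : ord K P' (x / pi ^ n) = 0.
    apply: u; first exact: sf_div.
      by rewrite mulf_neq0 // invr_eq0.
    by rewrite ord_div // oz // opi mulr1 subrr.
  rewrite ord_div // oz // => /eqP; rewrite subr_eq0 => /eqP ->.
  by [].
have pos : 0 < ord K P' pi.
  have : 0 <= ord K P' pi by apply/(ogeE _ _ Kpi pi0); apply: sub; apply/ogeE; rewrite ?opi.
  have [pi' [Kpi' pi'0 opi']] := ord_uniformizer KF HP'.
  have := E pi' Kpi' pi'0; rewrite opi' => e1.
  by rewrite le_eqVlt => /orP[/eqP b0|//]; move: e1; rewrite -b0 mulr0.
apply/seteqP; split=> x.
  move=> /(prime_oge KF HP) ox; apply/(prime_oge KF HP').
  have [->|x0] := eqVneq x 0; first exact: oge0.
  have Kx : K x by case: ox.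
  by move: ox; rewrite !ogeE // E //; nia.
move=> /(prime_oge KF HP') ox; apply/(prime_oge KF HP).
have [->|x0] := eqVneq x 0; first exact: oge0.
have Kx : K x by case: ox.
by move: ox; rewrite !ogeE // E //; nia.
Qed.

End DiscreteValuations.

Lemma ord_of_uniformizer (L : fieldType) (K O : set L) pi : is_subfield K ->
  is_valring K O -> is_uniformizer K O pi ->
  Defs.primes K (nonunits O) /\
  (forall x (n : int), K x -> x != 0 -> associated O x (pi ^ n) ->
     ord K (nonunits O) x = n).
Proof.
move=> KF OV unif; have dvr := valring_prime KF OV unif.
have HP : Defs.primes K (nonunits O) by exists O.
split=> // x n Kx x0 xn; have OR : is_subring O by case: OV.
have [piN pi0 pidec] := unif; have Kpi : K pi.
  by case: OV => _ + _ _; apply; case: piN.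
have [O' [pi' [OV' PE [piN' pi0' pidec'] _ A]]] := ord_spec KF HP.
have dvr' : is_dvr_of_prime K O' (nonunits O) by rewrite PE; apply: (@valring_prime _ K O' pi').
have OE : O' = O.
  by apply/seteqP; split=> z; rewrite (valring_of_primeE KF z dvr') (valring_of_primeE KF z dvr).
rewrite {O' OV' PE dvr' pidec'}OE in A piN'.
have Kpi' : K pi' by case: OV => _ + _ _; apply; case: piN'.
have [m am] := pidec pi' Kpi' pi0'.
set o := ord K (nonunits O) in A *.
have E : 1 = o pi * m :> int.
  apply: (associated_pow_inj OV piN' pi0'); rewrite expr1z.
  apply: (associated_trans OR _ am); first by rewrite expfz_neq0.
  rewrite -exprz_exp; apply: (associatedXz OR); exact: A.
have opi : o pi = 1.
  have pos : 0 < o pi.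
    have /(prime_oge KF HP) : nonunits O pi by [].
    by rewrite ogeE.
  have m0 : 0 < m by rewrite -(pmulr_rgt0 _ pos) -E.
  have : o pi <= o pi * m by rewrite ler_peMr; lia.
  by rewrite -E; lia.
apply: (associated_pow_inj OV piN' pi0').
apply: (associated_trans OR x0 (associated_sym (A x Kx x0))).
apply: (associated_trans OR _ xn); first by rewrite expfz_neq0.
by have := associatedXz OR n (A pi Kpi pi0); rewrite opi expr1z.
Qed.

Lemma oge_ord0 (L : fieldType) (K P : set L) x : is_subfield K -> Defs.primes K P ->
  K x -> x != 0 -> oge K P 0 x -> oge K P 0 x^-1 -> ord K P x = 0.
Proof.
move=> KF HP Kx x0; rewrite !ogeE ?invr_eq0 //; last exact: sfV.
by rewrite ordV //; lia.
Qed.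

(** * Existence of valuation rings *)

Section CoefsIn.
Context {L : fieldType} (O : set L) (OR : is_subring O).

Definition coefs_in (h : {poly L}) := forall i, O h`_i.

Lemma coefs_inC c : O c -> coefs_in c%:P.
Proof. by move=> Oc i; rewrite coefC; case: eqP => // _; exact: sr0. Qed.
Lemma coefs_inXn n : coefs_in 'X^n.
Proof. by move=> i; rewrite coefXn; exact: sr_nat. Qed.
Lemma coefs_inX : coefs_in 'X.
Proof. by rewrite -['X]expr1; exact: coefs_inXn. Qed.
Lemma coefs_inD h g : coefs_in h -> coefs_in g -> coefs_in (h + g).
Proof. by move=> ? ? i; rewrite coefD; exact: srD. Qed.
Lemma coefs_inB h g : coefs_in h -> coefs_in g -> coefs_in (h - g).
Proof. by move=> ? ? i; rewrite coefB; exact: srB. Qed.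
Lemma coefs_inM h g : coefs_in h -> coefs_in g -> coefs_in (h * g).
Proof. by move=> ? ? i; rewrite coefM; apply: sr_sum => // j _; exact: srM. Qed.
Lemma coefs_inZ c h : O c -> coefs_in h -> coefs_in (c *: h).
Proof. by move=> ? ? i; rewrite coefZ; exact: srM. Qed.
Lemma coefs_in_sum (T : Type) (s : seq T) (Q : pred T) (f : T -> {poly L}) :
  (forall i, Q i -> coefs_in (f i)) -> coefs_in (\sum_(i <- s | Q i) f i).
Proof.
move=> Of; apply: big_ind => //; last exact: coefs_inD.
by rewrite -polyC0; apply: coefs_inC; exact: sr0.
Qed.
Definition adjoin (z : L) : set L := [set h.[z] | h in coefs_in].

Lemma adjoin_subring z : is_subring (adjoin z).
Proof.
apply/is_subringP; split.
- by exists 1%:P; [apply: coefs_inC; exact: sr1|rewrite hornerC].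
- by move=> _ _ [h hO <-] [g gO <-]; exists (h - g); [exact: coefs_inB|rewrite hornerD hornerN].
- by move=> _ _ [h hO <-] [g gO <-]; exists (h * g); [exact: coefs_inM|rewrite hornerM].
Qed.

Lemma adjoin_base z : O `<=` adjoin z.
Proof. by move=> c Oc; exists c%:P; [exact: coefs_inC|rewrite hornerC]. Qed.

Lemma adjoin_gen z : adjoin z z.
Proof. by exists 'X; [exact: coefs_inX|rewrite hornerX]. Qed.

End CoefsIn.

(* A relation expressing s^-1 in O[z] can be shortened by one expressing it
   in O[z^-1] and conversely. *)
Lemma adjoin_inverse_descent (L : fieldType) (O : set L) (s z : L) (h g : {poly L}) :
  is_subring O -> O s -> s != 0 -> z != 0 -> coefs_in O h -> coefs_in O g ->
  h.[z] = s^-1 -> g.[z^-1] = s^-1 -> O s^-1.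
Proof.
move=> OR Os s0; move: {-1}(_ + _)%N (leqnn (size h + size g)) => N.
elim: N z h g => [|N IH] z h g szN z0 hO gO hz gz.
  have : size h = 0%N by lia.
  by move=> /eqP; rewrite size_poly_eq0 => /eqP h0; rewrite -hz h0 horner0; exact: sr0.
wlog le_gh : z h g szN z0 hO gO hz gz / (size g <= size h)%N => [wl|].
  have [|/ltnW] := leqP (size g) (size h); first exact: (wl z h g).
  by apply: (wl z^-1 g h); rewrite ?invr_eq0 ?invrK // addnC.
have [sg1|sg1] := leqP (size g) 1.
  by rewrite -gz [g]size1_polyC // hornerC; exact: gO.
set n := (size h).-1; set m := (size g).-1.
have hn : size h = n.+1 by rewrite /n prednK //; lia.
have gm : size g = m.+1 by rewrite /m prednK //; lia.
have mn : (m <= n)%N by lia.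
pose b0 := g`_0; pose c := 1 - s * b0.
have Oc : O c by apply: srB => //; [exact: sr1|apply: srM => //; exact: gO].
(* As c = s (s^-1 - b0), the relation for z^-1 multiplied by s z^n rewrites c z^n in powers of z
   below n. So [h1] is b0 + c h with its top term rewritten, and its value is b0 + c s^-1 = s^-1. *)
pose h1 := b0%:P + c *: (\sum_(i < n) h`_i *: 'X^i)
   + (h`_n * s) *: \sum_(i < m) g`_i.+1 *: 'X^(n.-1 - i).
have h1O : coefs_in O h1.
  apply: coefs_inD => //; first apply: coefs_inD => //.
  - by apply: coefs_inC => //; exact: gO.
  - apply: coefs_inZ => //; apply: coefs_in_sum => // i _.
    by apply: coefs_inZ => //; exact: coefs_inXn.
  - apply: coefs_inZ => //; first by apply: srM => //; exact: hO.
    apply: coefs_in_sum => // i _.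
    by apply: coefs_inZ => //; exact: coefs_inXn.
have h1s : (size h1 <= n)%N.
  have n0 : (0 < n)%N by lia.
  apply: leq_trans (size_polyD _ _) _; rewrite geq_max; apply/andP; split.
    apply: leq_trans (size_polyD _ _) _; rewrite geq_max; apply/andP; split.
      by apply: leq_trans n0; exact: size_polyC_leq1.
    apply: leq_trans (size_scale_leq _ _) _.
    by apply: (leq_trans (size_sum _ _ _)); apply/bigmax_leqP => i _;
      apply: leq_trans (size_scale_leq _ _) _; rewrite size_polyXn.
  apply: leq_trans (size_scale_leq _ _) _.
  apply: (leq_trans (size_sum _ _ _)); apply/bigmax_leqP => i _.
  apply: leq_trans (size_scale_leq _ _) _; rewrite size_polyXn.
  by lia.
apply: (IH z h1 g) => //; first by lia.
have hzE : s^-1 = \sum_(i < n) h`_i * z ^+ i + h`_n * z ^+ n.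
  by rewrite -hz horner_coef hn big_ord_recr.
have gzE : s^-1 = b0 + \sum_(i < m) g`_i.+1 * z^-1 ^+ i.+1.
  by rewrite -gz horner_coef gm big_ord_recl expr0 mulr1.
have S : \sum_(i < m) g`_i.+1 * z ^+ (n.-1 - i) = z ^+ n * (s^-1 - b0).
  rewrite gzE addrAC subrr add0r mulr_sumr; apply: eq_bigr => i _.
  rewrite mulrCA; congr (_ * _); have il := ltn_ord i.
  have -> : n = ((n.-1 - i) + i.+1)%N by lia.
  by rewrite exprD exprVn mulfK ?expf_neq0 //; congr (_ ^+ _); lia.
rewrite !hornerD !hornerZ hornerC !horner_sum.
under eq_bigr do rewrite hornerZ hornerXn.
under [X in _ + _ * X]eq_bigr do rewrite hornerZ hornerXn.
rewrite S.
have -> : \sum_(i < n) h`_i * z ^+ i = s^-1 - h`_n * z ^+ n by rewrite hzE addrK.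
by rewrite /c; field.
Qed.

(** Chevalley's extension theorem: a subring O maximal among those without s^-1 is a valuation ring,
    for if z and z^-1 were both outside, s^-1 would lie in O[z] and in O[z^-1]. *)
Lemma valring_exists (L : fieldType) (K C : set L) (s : L) :
  is_subfield K -> is_subring C -> C `<=` K -> C s -> s != 0 -> ~ C s^-1 ->
  exists O, [/\ is_valring K O, C `<=` O & ~ O s^-1].
Proof.
move=> KF CR CK Cs s0 nC.
pose Q X := [/\ is_subring X, X `<=` K & ~ X s^-1].
have QC : Q C by [].
have [G [J0 GJ0] GQ Gtot|O [[OR OK nO] CO Omax]] := Zorn_above QC.
  have both x y J J' : G J -> G J' -> J x -> J' y -> exists X, [/\ G X, X x & X y].
    move=> GJ GJ' Jx J'y; have [JJ|JJ] := Gtot _ _ GJ GJ'.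
      by exists J'; split=> //; exact: JJ.
    by exists J; split=> //; exact: JJ.
  split.
  - apply/is_subringP; split.
    + by exists J0 => //; have [OR _ _] := GQ _ GJ0; exact: sr1.
    + move=> x y [J GJ Jx] [J' GJ' J'y]; have [X [GX Xx Xy]] := both _ _ _ _ GJ GJ' Jx J'y.
      by exists X => //; have [OR _ _] := GQ _ GX; exact: srB.
    + move=> x y [J GJ Jx] [J' GJ' J'y]; have [X [GX Xx Xy]] := both _ _ _ _ GJ GJ' Jx J'y.
      by exists X => //; have [OR _ _] := GQ _ GX; exact: srM.
  - by move=> x [J GJ Jx]; have [_ + _] := GQ _ GJ; apply.
  - by move=> [J GJ Jx]; have [_ _] := GQ _ GJ.
have KR := subfield_subring KF.
exists O; split=> //; split=> //; last by exists s^-1 => //; apply: sfV => //; exact: CK.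
have Os : O s by exact: CO.
have adj z : K z -> ~ O z -> exists2 h, coefs_in O h & h.[z] = s^-1.
  move=> Kz nOz; apply: contrapT => H.
  have : adjoin O z = O.
    apply: Omax; first exact: adjoin_base.
    split; first exact: adjoin_subring.
      by move=> _ [h hO <-]; apply: sr_horner => // i; apply: OK; exact: hO.
    by move=> [h hO hz]; apply: H; exists h.
  by move=> E; apply: nOz; rewrite -E; exact: adjoin_gen.
move=> z Kz; apply: contrapT => /not_orP [nOz nOzi].
have z0 : z != 0 by apply/eqP => z0; apply: nOz; rewrite z0; exact: sr0.
have [h hO hz] := adj z Kz nOz; have [g gO gz] := adj z^-1 (sfV KF Kz) nOzi.
by apply: nO; apply: (@adjoin_inverse_descent _ O s z h g).
Qed.

(** * Dimensions of quotients *)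

Section Dimension.
Context {L : fieldType}.
Implicit Types k V W U : set L.

Definition is_subspace k W :=
  [/\ W 0, (forall x y, W x -> W y -> W (x + y)) & (forall a x, k a -> W x -> W (a * x))].

Definition lincomb (d : nat) (c b : 'rV[L]_d) : L := \sum_i c 0 i * b 0 i.

Lemma lincombD d (c c' b : 'rV[L]_d) : lincomb (c + c') b = lincomb c b + lincomb c' b.
Proof. by rewrite -big_split; apply: eq_bigr => i _; rewrite mxE mulrDl. Qed.

Lemma lincombN d (c b : 'rV[L]_d) : lincomb (- c) b = - lincomb c b.
Proof. by rewrite -sumrN; apply: eq_bigr => i _; rewrite mxE mulNr. Qed.

Lemma lincombB d (c c' b : 'rV[L]_d) : lincomb (c - c') b = lincomb c b - lincomb c' b.
Proof. by rewrite lincombD lincombN. Qed.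

Lemma subspaceN k W x : is_subfield k -> is_subspace k W -> W x -> W (- x).
Proof.
move=> kF [_ _ WM] Wx; rewrite -mulN1r; apply: WM => //.
have kR := subfield_subring kF.
by apply: srN => //; exact: sr1.
Qed.

Lemma subspaceB k W x y : is_subfield k -> is_subspace k W ->
  W x -> W y -> W (x - y).
Proof.
move=> kF WS Wx Wy; have [_ WD _] := WS.
by apply: WD => //; exact: (subspaceN kF WS).
Qed.

Lemma subspace_sum k W (T : Type) (s : seq T) (Q : pred T) (f : T -> L) :
  is_subspace k W ->
  (forall i, Q i -> W (f i)) -> W (\sum_(i <- s | Q i) f i).
Proof. by move=> [W0 WD _] Wf; apply: big_ind. Qed.

Lemma subspace_subring k W : is_subring W -> k `<=` W -> is_subspace k W.
Proof.
move=> WR kW; split; first exact: sr0.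
  by move=> x y; exact: srD.
by move=> a x ka; apply: srM => //; exact: kW.
Qed.

Lemma has_dim_indep k V W d (b : 'rV[L]_d) (c : 'rV[L]_d) :
  is_subfield k -> is_subspace k V -> W 0 ->
  (forall i, V (b 0 i)) ->
  (forall x, V x -> exists! c : 'rV[L]_d, (forall i, k (c 0 i)) /\ W (x - lincomb c b)) ->
  (forall i, k (c 0 i)) -> W (lincomb c b) -> c = 0.
Proof.
move=> kF VS W0 Vb bP kc Wc.
have kR := subfield_subring kF.
have Vx : V (lincomb c b).
  by rewrite /lincomb; apply: (subspace_sum _ VS) => i _; have [_ _] := VS; apply.
have [c0 [_ u]] := bP _ Vx.
have e1 : c0 = c by apply: u; split=> //; rewrite subrr.
have e2 : c0 = 0.
  apply: u; split=> [i|]; first by rewrite mxE; exact: sr0.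
  by rewrite [X in _ - X](_ : _ = 0) ?subr0 // /lincomb big1 // => i _; rewrite mxE mul0r.
by rewrite -e1 e2.
Qed.

Lemma has_dim_intro k V W d (b : 'rV[L]_d) : is_subfield k -> is_subspace k W ->
  (forall i, V (b 0 i)) ->
  (forall x, V x -> exists c : 'rV[L]_d, (forall i, k (c 0 i)) /\ W (x - lincomb c b)) ->
  (forall c : 'rV[L]_d, (forall i, k (c 0 i)) -> W (lincomb c b) -> c = 0) ->
  has_dim k V W d.
Proof.
move=> kF WS Vb bs bi; have kR := subfield_subring kF.
exists b; split=> // x Vx; have [c [kc Wc]] := bs x Vx; exists c; split=> //.
move=> c' [kc' Wc']; apply/eqP; rewrite -subr_eq0; apply/eqP; apply: bi => [i|].
  by rewrite !mxE; exact: srB.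
rewrite lincombB (_ : _ - _ = (x - lincomb c' b) - (x - lincomb c b)); last by ring.
exact: (subspaceB kF WS).
Qed.

Lemma has_dim_span k V W d (b : 'rV[L]_d) : is_subfield k ->
  is_subspace k V -> is_subspace k W ->
  (forall i, V (b 0 i)) ->
  (forall x, V x -> exists c : 'rV[L]_d, (forall i, k (c 0 i)) /\ W (x - lincomb c b)) ->
  exists d', (d' <= d)%N /\ has_dim k V W d'.
Proof.
move=> kF VS WS; elim: d b => [|d IH] b Vb bs.
  exists 0%N; split=> //; apply: (has_dim_intro (b := b)) => // c _ _.
  by apply/rowP => -[].
have [bi|] := pselect (forall c : 'rV[L]_d.+1, (forall i, k (c 0 i)) -> W (lincomb c b) -> c = 0).
  by exists d.+1; split=> //; apply: (has_dim_intro (b := b)).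
move=> /existsNP [c /not_implyP [kc /not_implyP [Wc /eqP c0]]].
have [j cj] : exists j, c 0 j != 0.
  by apply/existsP; rewrite -negb_forall; apply: contra c0 => /forallP H; apply/eqP/rowP => i; rewrite mxE; exact/eqP.
suff [d' [le Hd']] : exists d', (d' <= d)%N /\ has_dim k V W d'.
  by exists d'; split=> //; exact: leqW.
apply: (IH (\row_(i < d) b 0 (fintype.lift j i))) => [i|x Vx]; first by rewrite mxE.
have [e [ke We]] := bs x Vx.
have kR := subfield_subring kF.
pose e' := e - (e 0 j / c 0 j) *: c.
have ke' i : k (e' 0 i).
  by rewrite !mxE; apply: srB => //; apply: srM => //; exact: sf_div.
exists (\row_(i < d) e' 0 (fintype.lift j i)); split=> [i|]; first by rewrite mxE.
have -> : lincomb (\row_(i < d) e' 0 (fintype.lift j i)) (\row_(i < d) b 0 (fintype.lift j i)) = lincomb e' b.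
  rewrite /lincomb [RHS](bigD1_ord j) //= {1}/e' !mxE divfK // subrr mul0r add0r.
  by apply: eq_bigr => i _; rewrite !mxE.
rewrite lincombB (_ : lincomb (_ *: c) b = e 0 j / c 0 j * lincomb c b); last first.
  by rewrite /lincomb mulr_sumr; apply: eq_bigr => i _; rewrite mxE mulrA.
rewrite opprB addrCA addrC; have [_ WD WM] := WS.
by apply: WD => //; apply: WM => //; exact: sf_div.
Qed.

(** Each basis is expressed in the other modulo W; by independence the two coefficient matrices have
    product 1, which compares their sizes. *)
Lemma has_dim_le k V W d d' : is_subfield k -> is_subspace k V -> is_subspace k W ->
  has_dim k V W d -> has_dim k V W d' -> (d <= d')%N.
Proof.
move=> kF VS WS [b [Vb bP]] [b' [Vb' bP']]; have kR := subfield_subring kF.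
have [W0 WD WM] := WS.
have choose m (e : 'rV[L]_m) : (forall x, V x ->
    exists! c : 'rV[L]_m, (forall i, k (c 0 i)) /\ W (x - lincomb c e)) ->
  forall n (a : 'rV[L]_n), (forall i, V (a 0 i)) ->
  exists C : 'M[L]_(n, m), (forall i j, k (C i j)) /\ forall i, W (a 0 i - lincomb (row i C) e).
  move=> eP n a Va.
  have H i : {c : 'rV[L]_m | (forall j, k (c 0 j)) /\ W (a 0 i - lincomb c e)}.
    by apply: cid; have [c [cP _]] := eP _ (Va i); exists c.
  exists (\matrix_(i, j) (sval (H i)) 0 j); split=> [i j|i].
    by rewrite mxE; have [] := svalP (H i).
  rewrite (_ : row i _ = sval (H i)); last by apply/rowP => j; rewrite !mxE.
  by have [] := svalP (H i).
have [C [kC CP]] := choose _ b' bP' _ b Vb.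
have [D [kD DP]] := choose _ b bP _ b' Vb'.
suff : C *m D = 1%:M by move/mulmx1_min.
apply/row_matrixP => i; apply/eqP; rewrite -subr_eq0; apply/eqP.
have kCD j : k ((row i (C *m D)) 0 j).
  by rewrite !mxE; apply: sr_sum => // l _; exact: srM.
have k1 j : k ((row i (1%:M : 'M[L]_d)) 0 j).
  by rewrite !mxE; exact: sr_nat.
apply: (has_dim_indep kF VS W0 Vb bP) => [j|].
  by rewrite !mxE; apply: srB => //; [move: (kCD j); rewrite !mxE|exact: sr_nat].
rewrite lincombB.
have -> : lincomb (row i 1%:M) b = b 0 i.
  rewrite /lincomb (bigD1 i) //= !mxE eqxx mul1r big1 ?addr0 // => j ji.
  by rewrite !mxE eq_sym (negPf ji) mul0r.
have -> : lincomb (row i (C *m D)) b = \sum_l C i l * lincomb (row l D) b.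
  rewrite /lincomb; under [RHS]eq_bigr do rewrite mulr_sumr.
  rewrite exchange_big; apply: eq_bigr => j _; rewrite !mxE mulr_suml.
  by apply: eq_bigr => l _; rewrite !mxE mulrA.
have -> : (\sum_l C i l * lincomb (row l D) b) - b 0 i
   = - (\sum_l C i l * (b' 0 l - lincomb (row l D) b) + (b 0 i - lincomb (row i C) b')).
  rewrite (_ : lincomb (row i C) b' = \sum_l C i l * b' 0 l); last first.
    by apply: eq_bigr => l _; rewrite mxE.
  under [X in _ = - (X + _)]eq_bigr do rewrite mulrBr.
  by rewrite sumrB; ring.
apply: (subspaceN kF WS); apply: WD => //.
by apply: (subspace_sum _ WS) => l _; exact: WM.
Qed.

Lemma has_dim_uniq k V W d d' : is_subfield k -> is_subspace k V -> is_subspace k W ->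
  has_dim k V W d -> has_dim k V W d' -> d = d'.
Proof.
move=> kF VS WS H H'; apply/eqP; rewrite eqn_leq.
by rewrite (has_dim_le kF VS WS H H') (has_dim_le kF VS WS H' H).
Qed.

Lemma has_dim_quotient k V W W' d : is_subfield k -> is_subspace k V ->
  is_subspace k W' -> W `<=` W' -> has_dim k V W d ->
  exists d', (d' <= d)%N /\ has_dim k V W' d'.
Proof.
move=> kF VS WS' WW' [b [Vb bP]]; apply: (has_dim_span kF VS WS' Vb) => x /bP.
by move=> [c [[kc /WW' Wc] _]]; exists c.
Qed.

Lemma has_dim_add k V W U d d' : is_subfield k -> is_subspace k V ->
  is_subspace k W -> is_subspace k U -> W `<=` V -> U `<=` W ->
  has_dim k V W d -> has_dim k W U d' -> has_dim k V U (d + d').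
Proof.
move=> kF VS WS US WV UW [b [Vb bP]] [b' [Wb' bP']].
have [W0 WD WM] := WS; have [U0 UD UM] := US; have kR := subfield_subring kF.
pose B := row_mx b b'.
have lcB (c : 'rV[L]_(d + d')) : lincomb c B = lincomb (lsubmx c) b + lincomb (rsubmx c) b'.
  rewrite /lincomb big_split_ord; congr (_ + _); apply: eq_bigr => i _.
    by rewrite row_mxEl !mxE.
  by rewrite row_mxEr !mxE.
apply: (has_dim_intro (b := B)) => //.
- by move=> i; rewrite /B mxE; case: splitP => j _ //; exact: WV.
- move=> x Vx; have [c [[kc Wc] _]] := bP x Vx.
  have [c' [[kc' Uc'] _]] := bP' _ Wc.
  exists (row_mx c c'); split; first by move=> i; rewrite mxE; case: splitP.
  by rewrite lcB row_mxKl row_mxKr opprD addrA.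
- move=> c kc; rewrite lcB => Uc.
  have W' : W (lincomb (rsubmx c) b').
    by rewrite /lincomb; apply: (subspace_sum _ WS) => i _; apply: WM => //; rewrite mxE.
  have c1 : lsubmx c = 0.
    apply: (has_dim_indep kF VS W0 Vb bP); first by move=> i; rewrite mxE.
    by rewrite -[lincomb _ _](addrK (lincomb (rsubmx c) b')); apply: (subspaceB kF WS) => //; exact: UW.
  have c2 : rsubmx c = 0.
    apply: (has_dim_indep kF WS U0 Wb' bP'); first by move=> i; rewrite mxE.
    by move: Uc; rewrite c1 /lincomb [X in X + _]big1 ?add0r // => i _; rewrite mxE mul0r.
  by rewrite -[c]hsubmxK c1 c2 row_mx0.
Qed.

Definition enumerates V (s : seq L) := uniq s /\ forall x, V x <-> x \in s.

Lemma enumerates_size V s s' : enumerates V s -> enumerates V s' -> size s = size s'.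
Proof.
move=> [us Vs] [us' Vs']; apply/perm_size; apply: uniq_perm => // x.
by apply/idP/idP => [/Vs/Vs'|/Vs'/Vs].
Qed.

Lemma finite_set_enumerates V : finite_set V -> exists s, enumerates V s.
Proof.
by move=> /finite_fsetP [X VX]; exists X; split; [exact: fset_uniq|move=> x; rewrite VX].
Qed.

Lemma has_dim_card k V d s : is_subfield k -> is_subspace k V ->
  enumerates k s -> has_dim k V [set 0] d -> exists2 s', enumerates V s' & size s' = (size s ^ d)%N.
Proof.
move=> kF VS [us ks] [b [Vb bP]]; have kR := subfield_subring kF.
pose g (c : {ffun 'I_d -> seq_sub s}) := \sum_i val (c i) * b 0 i.
have gE c : g c = lincomb (\row_i val (c i)) b.
  by apply: eq_bigr => i _; rewrite mxE.
exists [seq g c | c <- enum {ffun 'I_d -> seq_sub s}]; last first.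
  by rewrite size_map -cardE card_ffun card_ord card_seq_sub.
split.
  rewrite map_inj_uniq ?enum_uniq // => c c'; rewrite !gE => gcc.
  have E : (\row_i val (c i)) - (\row_i val (c' i)) = 0 :> 'rV[L]_d.
    apply: (has_dim_indep kF VS (erefl : [set 0] 0) Vb bP) => [i|].
      by rewrite !mxE; apply: srB => //; apply/ks; exact: valP.
    by rewrite lincombB gcc subrr.
  apply/ffunP => i; apply/val_inj; move/eqP: E; rewrite subr_eq0 => /eqP/rowP/(_ i).
  by rewrite !mxE.
move=> x; split.
  move=> Vx; have [c [[kc /= /eqP]]] := bP x Vx; rewrite subr_eq0 => /eqP xE _.
  have cs i : c 0 i \in s by apply/ks.
  apply/mapP; exists [ffun i => SeqSub (cs i)]; first by rewrite mem_enum.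
  by rewrite xE; apply: eq_bigr => i _; rewrite ffunE.
move=> /mapP [c _ ->]; apply: (subspace_sum _ VS) => i _.
by have [_ _] := VS; apply=> //; apply/ks; exact: valP.
Qed.

Lemma enumerates_has_dim k V W s : is_subfield k -> is_subspace k V -> is_subspace k W ->
  enumerates V s -> exists d, has_dim k V W d.
Proof.
move=> kF VS WS [us Vs]; have kR := subfield_subring kF.
suff [d [_ Hd]] : exists d, (d <= size s)%N /\ has_dim k V W d by exists d.
apply: (@has_dim_span k V W (size s) (\row_i s`_i)) => // [i|x Vx].
  by rewrite mxE; apply/Vs; exact: mem_nth.
have xs : (index x s < size s)%N by rewrite index_mem; exact/Vs.
exists (\row_i (i == Ordinal xs)%:R); split=> [i|]; first by rewrite mxE; exact: sr_nat.
rewrite /lincomb (bigD1 (Ordinal xs)) //= !mxE eqxx mul1r nth_index; last exact/Vs.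
rewrite big1 ?addr0 ?subrr; last by move=> i ix; rewrite !mxE (negPf ix) mul0r.
by case: WS.
Qed.

End Dimension.

(** * The field of constants *)

Lemma nat_pigeonhole (T : finType) (f : nat -> T) : exists i j, (i < j)%N /\ f i = f j.
Proof.
apply: contrapT => H; suff : (#|'I_#|T|.+1| <= #|T|)%N by rewrite card_ord ltnn.
apply: (@leq_card _ _ (fun i : 'I_#|T|.+1 => f i)) => i j fij.
apply/val_inj; apply: contrapT => /eqP; rewrite neq_ltn => /orP[ij|ji]; apply: H.
  by exists i, j.
by exists j, i.
Qed.

Section Frobenius.
Context (ell : nat) (hell : prime ell) (L : fieldType) (chL : ell \in [pchar L]).

Lemma pnat_frob r : [pchar L].-nat (ell ^ r)%N.
Proof.
by rewrite (eq_pnat _ (pcharf_eq chL)) pnatX pnat_id.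
Qed.

Lemma frobD r (x y : L) : (x + y) ^+ (ell ^ r) = x ^+ (ell ^ r) + y ^+ (ell ^ r).
Proof. by apply: exprDn_pchar; exact: pnat_frob. Qed.

Lemma frob0 r : (0 : L) ^+ (ell ^ r) = 0.
Proof. by rewrite expr0n expn_eq0 (gtn_eqF (prime_gt0 hell)). Qed.

Lemma frobN r (x : L) : (- x) ^+ (ell ^ r) = - x ^+ (ell ^ r).
Proof. by apply/eqP; rewrite -subr_eq0 opprK -frobD addNr frob0. Qed.

Lemma frobB r (x y : L) : (x - y) ^+ (ell ^ r) = x ^+ (ell ^ r) - y ^+ (ell ^ r).
Proof. by rewrite frobD frobN. Qed.

Lemma frob_inj r : injective (fun x : L => x ^+ (ell ^ r)).
Proof.
move=> x y /= /eqP; rewrite -subr_eq0 -frobB expf_eq0 subr_eq0.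
by case/andP=> _ /eqP.
Qed.

Lemma frob_sum r (T : Type) (s : seq T) (Q : pred T) (f : T -> L) :
  (\sum_(i <- s | Q i) f i) ^+ (ell ^ r) = \sum_(i <- s | Q i) f i ^+ (ell ^ r).
Proof.
by apply: (big_morph (fun x : L => x ^+ (ell ^ r)) (frobD r) (frob0 r)).
Qed.

(** Algebraicity over the prime field, by [algebraic_frob_fixed], as an equation that passes easily
    between F and [Omega]. *)
Definition is_frob_fixed (z : L) := exists r, (0 < r)%N /\ z ^+ (ell ^ r) = z.

Lemma frob_fixed_mul r m (z : L) : z ^+ (ell ^ r) = z -> z ^+ (ell ^ (r * m)) = z.
Proof.
move=> zr; elim: m => [|m IH]; first by rewrite muln0 expn0 expr1.
by rewrite mulnS expnD exprM zr.
Qed.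

Lemma frob_fixed_subfield r : is_subfield [set z : L | z ^+ (ell ^ r) = z].
Proof.
apply/is_subfieldP; split=> /=; first by rewrite expr1n.
  by move=> x y xr yr; rewrite frobB xr yr.
by move=> x y xr yr; rewrite expr_div_n xr yr.
Qed.

Context (e : {rmorphism 'F_ell -> L}).

(** The residues of X^(ell^i) modulo a polynomial annihilating z are finite in number, so two of
    them agree; since Frobenius is injective, the smaller exponent can be cancelled. *)
Lemma algebraic_frob_fixed (z : L) : algebraicOver e z <-> is_frob_fixed z.
Proof.
split; last first.
  move=> [r [r0 zr]]; exists ('X^(ell ^ r) - 'X).
    rewrite -size_poly_gt0 size_polyDl ?size_polyXn // size_polyN size_polyX ltnS.
    by apply: leq_trans (prime_gt1 hell) _; rewrite -{1}[ell]expn1 leq_exp2l // prime_gt1.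
  by rewrite rmorphB /= map_polyXn map_polyX rootE !hornerE zr subrr.
move=> /integral_algebraic [h hm hz].
have [i [j [ij fij]]] :=
  nat_pigeonhole (fun i : nat => poly_rV ('X^(ell ^ i) %% h) : 'rV['F_ell]_(size h)).
have {}fij : ('X^(ell ^ i) %% h) = ('X^(ell ^ j) %% h).
  have sz n : (size ('X^n %% h)%R <= size h)%N.
    by rewrite ltnW // ltn_modp monic_neq0.
  by rewrite -(poly_rV_K (sz _)) fij poly_rV_K.
have zE n : z ^+ n = (map_poly e ('X^n %% h)).[z].
  have := congr1 (fun p => (map_poly e p).[z]) (divp_eq ('X^n) h).
  rewrite /= rmorphD rmorphM /= map_polyXn hornerD hornerM (rootP hz) mulr0 add0r.
  by rewrite hornerXn.
exists (j - i)%N; split; first by rewrite subn_gt0.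
apply: (@frob_inj i) => /=; rewrite -exprM -expnD subnK; last exact: ltnW.
by rewrite !zE fij.
Qed.

End Frobenius.

Section FractionEvaluation.
Context (R : idomainType).
Local Notation "x %:F" := (@FracField.tofrac R x).
Local Open Scope quotient_scope.

Lemma frac_repr (x : {fraction R}) : exists a b, b != 0 /\ x = a%:F / b%:F.
Proof.
elim/quotW: x => -[[a b] /= b0]; exists a, b; split=> //.
have bF : b%:F != 0 by rewrite tofrac_eq0.
apply: (mulIf bF); rewrite divfK //.
unlock FracField.tofrac; rewrite -[LHS]FracField.pi_mul; apply/eqmodP.
by rewrite /= /equivf /FracField.mulf /= !numden_Ratio ?mulf_neq0 ?oner_neq0 // !mulr1 mulrC.
Qed.

Lemma frac_lift (L : fieldType) (g : {rmorphism R -> L}) : injective g ->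
  exists fm : {rmorphism {fraction R} -> L}, forall a, fm a%:F = g a.
Proof.
move=> ginj.
have g0 a : (g a == 0) = (a == 0) by rewrite -(rmorph0 g) (inj_eq ginj).
have H x : {ab : R * R | ab.2 != 0 /\ x = ab.1%:F / ab.2%:F}.
  by apply: cid; have [a [b ?]] := frac_repr x; exists (a, b).
pose f x := g (sval (H x)).1 / g (sval (H x)).2.
have fE a b : b != 0 -> f (a%:F / b%:F) = g a / g b.
  move=> b0; rewrite /f; case: (H _) => -[c d] /= [d0].
  move=> /eqP; rewrite eqr_div ?tofrac_eq0 // -!rmorphM tofrac_eq => /eqP E.
  by apply/eqP; rewrite eqr_div ?g0 // -!rmorphM E.
have fB : zmod_morphism f.
  move=> x y; have [a [b [b0 ->]]] := frac_repr x; have [c [d [d0 ->]]] := frac_repr y.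
  have F0 z : z != 0 -> z%:F != 0 :> {fraction R} by rewrite tofrac_eq0.
  rewrite -mulNr addf_div ?F0 // -!rmorphN -!rmorphM -rmorphD !fE ?mulf_neq0 //.
  by rewrite !rmorphD !rmorphM rmorphN /= -mulNr addf_div ?g0.
have fM : monoid_morphism f.
  split; first by rewrite -[1]divr1 -{1 2}tofrac1 fE ?oner_neq0 // rmorph1 divr1.
  move=> x y; have [a [b [b0 ->]]] := frac_repr x; have [c [d [d0 ->]]] := frac_repr y.
  by rewrite mulf_div -!rmorphM !fE ?mulf_neq0 // !rmorphM mulf_div.
pose fm : {rmorphism {fraction R} -> L} :=
  HB.pack f (GRing.isZmodMorphism.Build _ _ f fB) (GRing.isMonoidMorphism.Build _ _ f fM).
by exists fm => a; rewrite /= -[a%:F]divr1 -tofrac1 fE ?oner_neq0 // rmorph1 divr1.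
Qed.

Lemma frac_poly_clear (h : {poly {fraction R}}) : h != 0 ->
  exists (P : {poly R}) (c : {fraction R}),
    [/\ P != 0, c != 0 & map_poly (@FracField.tofrac R) P = c *: h].
Proof.
move=> h0.
have [D D0 DP] : exists2 D : R, D != 0 & forall i, exists a, D%:F * h`_i = a%:F.
  suff [D D0 DP] : exists2 D : R, D != 0 &
      forall i, (i < size h)%N -> exists a, D%:F * h`_i = a%:F.
    exists D => // i; have [/DP //|hi] := ltnP i (size h).
    by exists 0; rewrite nth_default // mulr0 rmorph0.
  elim: (size h) => [|n [D D0 DP]]; first by exists 1 => //; exact: oner_neq0.
  have [a [b [b0 hE]]] := frac_repr h`_n; exists (D * b); first exact: mulf_neq0.
  have bF : b%:F != 0 by rewrite tofrac_eq0.
  move=> i; rewrite ltnS leq_eqVlt => /orP[/eqP ->|/DP [c cE]].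
    by exists (D * a); rewrite hE !rmorphM /=; field.
  by exists (b * c); rewrite !rmorphM /= -cE; ring.
have DF : D%:F != 0 by rewrite tofrac_eq0.
have {}DP i : {a | D%:F * h`_i = a%:F} by exact: cid.
have PE : map_poly (@FracField.tofrac R) (\poly_(i < size h) sval (DP i)) = D%:F *: h.
  apply/polyP => i; rewrite coef_map coef_poly coefZ; case: ltnP => [_|hi].
    exact/esym/(svalP (DP i)).
  by rewrite [in RHS]nth_default // mulr0; exact: tofrac0.
exists (\poly_(i < size h) sval (DP i)), D%:F; split=> //.
apply: contra_neq h0 => P0; move: PE; rewrite P0 rmorph0 => /esym/eqP.
by rewrite scaler_eq0 (negPf DF) => /eqP.
Qed.

Lemma size_map_tofrac (P : {poly R}) : size (map_poly (@FracField.tofrac R) P) = size P.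
Proof.
apply: size_map_inj_poly; last exact: tofrac0.
by move=> a b /eqP; rewrite tofrac_eq => /eqP.
Qed.

Lemma map_tofrac_neq0 (P : {poly R}) : P != 0 -> map_poly (@FracField.tofrac R) P != 0.
Proof. by rewrite -!size_poly_gt0 size_map_tofrac. Qed.

End FractionEvaluation.

Lemma horner2_map (R : comNzRingType) (u : {poly {poly R}}) (x y : R) :
  u.[x, y] = (map_poly (horner_eval y) u).[x].
Proof. by rewrite -{2}[x](hornerC x y) -[RHS]/(_.[horner_eval y x%:P]) horner_map. Qed.

Section FieldOfConstants.
Context (ell : nat) (hell : prime ell) (F : fieldExtType {fraction {poly 'F_ell}}).

Local Notation F0 := {fraction {poly 'F_ell}}.
Local Notation pfe := (@prime_field_embedding ell F).
Local Notation "x %:F" := (@FracField.tofrac {poly 'F_ell} x).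
Local Notation kap := (constants F).

Lemma pfe_zmod : zmod_morphism pfe.
Proof. by move=> a b; rewrite /prime_field_embedding polyCB tofracB scalerBl. Qed.

Lemma pfe_monoid : monoid_morphism pfe.
Proof.
split; first by rewrite /prime_field_embedding polyC1 tofrac1 scale1r.
by move=> a b; rewrite /prime_field_embedding polyCM tofracM -scalerAl mul1r scalerA.
Qed.

HB.instance Definition _ := GRing.isZmodMorphism.Build _ _ pfe pfe_zmod.
HB.instance Definition _ := GRing.isMonoidMorphism.Build _ _ pfe pfe_monoid.

Lemma pcharF : ell \in [pchar F].
Proof. exact: (rmorph_pchar pfe (pchar_Fp hell)). Qed.

Definition gen_x : F := ('X%:F)%:A.

Lemma poly_in_F (p : {poly 'F_ell}) : (p%:F)%:A = (map_poly pfe p).[gen_x].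
Proof.
elim/poly_ind: p => [|p c IH]; first by rewrite tofrac0 scale0r rmorph0 horner0.
rewrite tofracD tofracM scalerDl rmorphD rmorphM /= map_polyX map_polyC /=.
rewrite !hornerE -IH /gen_x; congr (_ + _).
by rewrite -scalerAl mul1r scalerA.
Qed.

Lemma constantsP z : kap z <-> is_frob_fixed ell z.
Proof. exact: (algebraic_frob_fixed hell pcharF). Qed.

Lemma constants_subfield : is_subfield kap.
Proof.
apply/is_subfieldP; split.
- exact: algebraic1.
- by move=> x y; exact: algebraic_sub.
- by move=> x y; exact: algebraic_div.
Qed.

Lemma constants_root (h : {poly F}) z :
  h != 0 -> coefs_in kap h -> root h z -> kap z.
Proof.
move=> h0 hk hz; apply/integral_algebraic; apply: integral_root h0 hz _.
move=> c /(nthP 0) [i _ <-]; apply/integral_algebraic; exact: hk.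
Qed.

Lemma gen_x_transcendental : ~ kap gen_x.
Proof.
move=> [h h0 /rootP]; rewrite -poly_in_F => /eqP.
by rewrite scaler_eq0 tofrac_eq0 (negPf h0) oner_eq0.
Qed.

Lemma minPoly_base z : exists h : {poly F0},
  [/\ h \is monic, root (map_poly (in_alg F) h) z & (size h <= (\dim {:F}).+1)%N].
Proof.
have /polyOver1P [h hE] := minPolyOver 1 z; exists h.
have hm := monic_minPoly 1 z; have hz := root_minPoly 1 z.
rewrite -hE; split=> //; first by move: hm; rewrite hE map_monic.
rewrite -(size_map_poly (in_alg F)) -hE size_minPoly ltnS adjoin_degreeE dimv1 divn1.
exact: dimvS (subvf _).
Qed.

(** Exchange: a relation for y over F_ell(x), cleared of denominators, is a polynomial in two
    variables. Read in the other variable it makes x algebraic over F_ell(y), and F is algebraic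
    over F_ell(x). *)
Lemma transcendental_extension y : ~ kap y ->
  exists fm : {rmorphism F0 -> F},
    (forall p : {poly 'F_ell}, fm (p%:F) = (map_poly pfe p).[y]) /\
    (forall z, algebraicOver fm z).
Proof.
move=> yk; pose g : {rmorphism {poly 'F_ell} -> F} := horner_eval y \o map_poly pfe.
have gE p : g p = (map_poly pfe p).[y] by [].
have ginj : injective g.
  move=> p q /eqP; rewrite -subr_eq0 -rmorphB /= => /eqP pq.
  apply/eqP; rewrite -subr_eq0; apply: contrapT => pq0.
  by apply: yk; exists (p - q); [apply/negP|apply/rootP].
have [fm fmE] := frac_lift ginj.
exists fm; split; first by move=> p; rewrite fmE.
have algx : algebraicOver fm gen_x.
  have [h [hm hz _]] := minPoly_base y.
  have [P [c [P0 c0 PE]]] := frac_poly_clear (monic_neq0 hm).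
  pose U := map_poly (map_poly pfe) P.
  have Uyx : U.[y, gen_x] = 0.
    rewrite horner2_map /U -map_poly_comp.
    rewrite (_ : map_poly _ P = map_poly (in_alg F) (c *: h)).
      by rewrite map_polyZ hornerZ (rootP hz) mulr0.
    by rewrite -PE -map_poly_comp; apply: eq_map_poly => p; exact/esym/poly_in_F.
  exists (map_poly (@FracField.tofrac _) (swapXY P)).
    by apply: map_tofrac_neq0; rewrite swapXY_eq0.
  apply/rootP; rewrite -map_poly_comp.
  move: Uyx; rewrite -horner2_swapXY /U swapXY_map.
  rewrite horner2_map -map_poly_comp => E; rewrite -[RHS]E.
  by congr horner; apply: eq_map_poly => p; rewrite /= fmE.
have algF0 (c : F0) : algebraicOver fm c%:A.
  have [a [b [_ ->]]] := frac_repr c.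
  have alg_poly (p : {poly 'F_ell}) : algebraicOver fm (p%:F)%:A.
    rewrite poly_in_F horner_coef size_map_poly.
    apply: (big_ind (algebraicOver fm)) => [||i _]; first exact: algebraic0.
      exact: algebraic_add.
    apply: algebraic_mul.
      rewrite coef_map /=; have -> : pfe p`_i = fm ((p`_i)%:P)%:F.
        by rewrite fmE gE map_polyC hornerC.
      exact: algebraic_id.
    elim: (nat_of_ord i) => [|n IH]; first by rewrite expr0; exact: algebraic1.
    by rewrite exprS; exact: algebraic_mul.
  have -> : (a%:F / b%:F)%:A = (a%:F)%:A / (b%:F)%:A :> F.
    by rewrite -[LHS]/(in_alg F _) fmorph_div.
  exact: algebraic_div.
move=> z; have [h [hm hz _]] := minPoly_base z.
apply/integral_algebraic; apply: (integral_root _ hz).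
  by rewrite map_poly_eq0 monic_neq0.
move=> c /(nthP 0) [i _ <-]; rewrite coef_map; apply/integral_algebraic; exact: algF0.
Qed.

(** The powers of z below its degree over F_ell stay independent over F_ell(x), because x is
    transcendental over the constants. The degree is therefore at most that of F over F_ell(x). *)
Lemma constants_degree z : kap z -> exists h : {poly 'F_ell},
  [/\ h != 0, root (map_poly pfe h) z & (size h <= (\dim {:F}).+1)%N].
Proof.
move=> [h0 h0n h0z].
have ex : exists n, `[< exists h : {poly 'F_ell}, [/\ h != 0, root (map_poly pfe h) z & size h = n.+1] >].
  exists (size h0).-1; apply/asboolP; exists h0; split=> //.
  by rewrite prednK // size_poly_gt0.
case: (ex_minnP ex) => d /asboolP [h [hn hz hs]] dmin; exists h; split=> //.
rewrite hs ltnS.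
have indep (a : 'I_d -> 'F_ell) : \sum_i pfe (a i) * z ^+ i = 0 -> forall i, a i = 0.
  move=> sa; apply: contrapT => /existsNP [i0 /eqP ai0].
  pose g := \poly_(i < d) (if insub i is Some j then a j else 0 : 'F_ell).
  have gE i : g`_(nat_of_ord (i : 'I_d)) = a i.
    by rewrite coef_poly ltn_ord valK.
  have gn : g != 0 by apply: contraNneq ai0 => g0; rewrite -gE g0 coef0.
  have : (d <= (size g).-1)%N.
    apply: dmin; apply/asboolP; exists g; split=> //; last by rewrite prednK // size_poly_gt0.
    apply/rootP; rewrite (@horner_coef_wide _ d); last by rewrite size_map_poly size_poly.
    by rewrite -[RHS]sa; apply: eq_bigr => i _; rewrite coef_map gE.
  have := size_poly d (fun i => if insub i is Some j then a j else 0 : 'F_ell).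
  by rewrite -/g; move: gn; rewrite -size_poly_gt0; lia.
pose X : d.-tuple F := [tuple z ^+ i | i < d].
have XE (i : 'I_d) : X`_i = z ^+ i by rewrite -tnth_nth tnth_mktuple.
suff fX : free X by have := dimvS (subvf <<X>>); rewrite (eqP fX) size_tuple.
apply/freeP => c sc.
pose hc := \poly_(i < d) (if insub i is Some j then c j else 0).
have hcE (i : 'I_d) : hc`_i = c i by rewrite coef_poly ltn_ord valK.
have [hc0 i|hc0] := eqVneq hc 0; first by rewrite -hcE hc0 coef0.
exfalso; have [P [C [P0 C0 PE]]] := frac_poly_clear hc0.
have szP : (size P <= d)%N.
  have := size_poly d (fun i => if insub i is Some j then c j else 0).
  rewrite -/hc; apply: leq_trans.
  by rewrite -(size_map_tofrac P) PE; exact: size_scale_leq.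
pose U := map_poly (map_poly pfe) P.
(* The dependence over F_ell(x), cleared of denominators, is read as a polynomial in x whose
   coefficients are polynomials in z, hence constants; it must vanish identically. *)
have Uzx : (swapXY U).[gen_x, z] = 0.
  rewrite horner2_swapXY horner2_map /U -map_poly_comp.
  rewrite (_ : map_poly _ P = map_poly (in_alg F) (C *: hc)).
    rewrite map_polyZ hornerZ (@horner_coef_wide _ d); last by rewrite size_map_poly size_poly.
    rewrite [X in _ * X](_ : _ = 0) ?mulr0 // -[RHS]sc; apply: eq_bigr => i _.
    by rewrite coef_map hcE XE /= mulr_algl.
  by rewrite -PE -map_poly_comp; apply: eq_map_poly => p; exact/esym/poly_in_F.
move: Uzx; rewrite horner2_map /U swapXY_map -map_poly_comp; set G := map_poly _ _ => Gx.
have Gk : coefs_in kap G.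
  move=> i; rewrite coef_map /= /horner_eval.
  apply: (sr_horner (subfield_subring constants_subfield)) => [j|].
    by rewrite coef_map; exact: algebraic_id.
  by exists h0.
have [G0|Gn0] := eqVneq G 0; last by apply: gen_x_transcendental; apply: constants_root Gn0 Gk _; apply/rootP.
move/eqP: P0; apply; apply/polyP => i; rewrite coef0; apply/polyP => j; rewrite coef0.
have [di|di] := leqP d i; first by rewrite [P`_i]nth_default ?coef0 // (leq_trans szP).
pose i' := Ordinal di; rewrite -[i]/(nat_of_ord i').
apply: (indep (fun i : 'I_d => P`_i`_j)).
have := congr1 (fun p : {poly F} => p`_j) G0; rewrite coef0 coef_map /= /horner_eval.
rewrite (@horner_coef_wide _ d); last first.
  apply: leq_trans (size_poly _ _) _; apply/leq_sizeP => m dm.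
  by rewrite coef_swapXY [P`_m]nth_default ?coef0 // (leq_trans szP).
by move=> E0; rewrite -[RHS]E0; apply: eq_bigr => m _; rewrite coef_map /= coef_swapXY.
Qed.

Lemma constants_finite : exists s, enumerates kap s.
Proof.
(* The periods found by the pigeonhole are at most the number of residues, which is uniform since
   the degrees are bounded; so they all divide N, and every constant is a root of X^(ell^N) - X. *)
pose N := ((#|{:'rV['F_ell]_(\dim {:F}).+1}|)`!)%N.
have fixN z : kap z -> z ^+ (ell ^ N) = z.
  move=> /constants_degree [h [h0 hz hs]].
  have [i [j [ij fij jN]]] : exists i j, [/\ (i < j)%N,
      ('X^(ell ^ i) %% h) = ('X^(ell ^ j) %% h) & (j <= #|{:'rV['F_ell]_(\dim {:F}).+1}|)%N].
    pose T : finType := {:'rV['F_ell]_(\dim {:F}).+1}; rewrite -/T.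
    pose f (i : 'I_#|T|.+1) : T := poly_rV ('X^(ell ^ i) %% h).
    have /injectivePn [i [j ij fij]] : ~~ injectiveb f.
      apply: contraTN isT => /injectiveP /leq_card; by rewrite card_ord ltnn.
    have {}fij : ('X^(ell ^ i) %% h) = ('X^(ell ^ j) %% h).
      have sz n : (size ('X^n %% h)%R <= (\dim {:F}).+1)%N.
        by apply: leq_trans hs; rewrite ltnW // ltn_modp.
      by rewrite -(poly_rV_K (sz _)) -/(f i) fij poly_rV_K.
    move: ij; rewrite -val_eqE neq_ltn => /orP[ij|ji].
      by exists i, j; split=> //; rewrite -ltnS; exact: ltn_ord.
    by exists j, i; split=> //; rewrite -ltnS; exact: ltn_ord.
  have zE n : z ^+ n = (map_poly pfe ('X^n %% h)).[z].
    have := congr1 (fun p => (map_poly pfe p).[z]) (divp_eq ('X^n) h).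
    rewrite /= rmorphD rmorphM /= map_polyXn hornerD hornerM (rootP hz) mulr0 add0r.
    by rewrite hornerXn.
  have zij : z ^+ (ell ^ (j - i)) = z.
    apply: (@frob_inj _ hell _ pcharF i) => /=; rewrite -exprM -expnD subnK; last exact: ltnW.
    by rewrite !zE fij.
  have /dvdnP [m ->] : (j - i %| N)%N by apply: dvdn_fact; lia.
  by rewrite mulnC; exact: frob_fixed_mul.
have N0 : (0 < N)%N by exact: fact_gt0.
apply: finite_set_enumerates; apply: contrapT => inf.
have [B BA Bn] := infinite_set_fset (ell ^ N).+1 inf.
pose h := 'X^(ell ^ N) - 'X : {poly F}.
have szh : size h = (ell ^ N).+1.
  rewrite size_polyDl ?size_polyXn // size_polyN size_polyX ltnS.
  by apply: leq_trans (prime_gt1 hell) _; rewrite -{1}[ell]expn1 leq_exp2l // prime_gt1.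
have h0 : h != 0 by rewrite -size_poly_gt0 szh.
have : (#|` B| < size h)%N.
  apply: (max_poly_roots h0); last exact: fset_uniq.
  by apply/allP => x /BA /fixN xN; rewrite rootE !hornerE xN subrr.
by rewrite szh ltnS => /(leq_trans Bn); rewrite ltnn.
Qed.

End FieldOfConstants.

(** * The constant extension and its Frobenius automorphism *)

Lemma enumerates_map (L L' : fieldType) (g : {rmorphism L -> L'}) (V : set L) s :
  enumerates V s -> enumerates (g @` V) (map g s).
Proof.
move=> [us Vs]; split; first by rewrite map_inj_uniq //; exact: fmorph_inj.
move=> x; split; first by move=> [y /Vs ys <-]; exact: map_f.
by move=> /mapP [y /Vs Vy ->]; exists y.
Qed.

Lemma image_subfield (L L' : fieldType) (g : {rmorphism L -> L'}) (V : set L) :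
  is_subfield V -> is_subfield (g @` V).
Proof.
move=> /is_subfieldP [V1 VB VD]; apply/is_subfieldP; split.
- by exists 1; rewrite ?rmorph1.
- by move=> _ _ [x Vx <-] [y Vy <-]; exists (x - y); [exact: VB|rewrite rmorphB].
- by move=> _ _ [x Vx <-] [y Vy <-]; exists (x / y); [exact: VD|rewrite fmorph_div].
Qed.

Lemma zero_subspace (L : fieldType) (k : set L) : is_subspace k [set 0].
Proof.
split=> //=; first by move=> x y -> ->; rewrite addr0.
by move=> a x _ ->; rewrite mulr0.
Qed.

Lemma finite_subfield_card (L : fieldType) (ell : nat) (e : {rmorphism 'F_ell -> L})
  (V : set L) s : prime ell -> is_subfield V -> enumerates V s ->
  exists r, (0 < r)%N /\ size s = (ell ^ r)%N.
Proof.
move=> hell VF VE; have VR := subfield_subring VF; have [us Vs] := VE.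
have setTF : is_subfield [set: 'F_ell] by exact: is_subfieldT.
have ET : enumerates [set: 'F_ell] (enum 'F_ell).
  by split; [exact: enum_uniq|move=> x; rewrite mem_enum].
have kE := enumerates_map e ET; have kF := image_subfield e setTF.
have kV : e @` [set: 'F_ell] `<=` V.
  move=> _ [a _ <-]; rewrite -[a]natr_Zp rmorph_nat; exact: sr_nat.
have VS := subspace_subring VR kV.
have [d Vd] := enumerates_has_dim kF VS (zero_subspace _) VE.
have [s' VE' sz] := has_dim_card kF VS kE Vd; exists d.
rewrite (enumerates_size VE VE') sz size_map -cardE card_Fp //; split=> //.
rewrite lt0n; apply/eqP => d0; move: (enumerates_size VE VE'); rewrite sz d0 expn0 => s1.
have : (size [:: 0%R; 1%R : L] <= size s)%N.
  apply: uniq_leq_size; first by rewrite /= inE eq_sym oner_neq0.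
  move=> x; rewrite !inE => /orP[] /eqP ->; apply/Vs; [exact: sr0|exact: sr1].
by rewrite s1.
Qed.

(** Multiplication by a nonzero z permutes the nonzero elements and hence preserves their
    product. *)
Lemma finite_subfield_fixed (L : fieldType) (V : set L) s z : is_subfield V ->
  enumerates V s -> V z -> z ^+ size s = z.
Proof.
move=> VF [us Vs] Vz; have VR := subfield_subring VF.
have s0 : 0 \in s by apply/Vs; exact: sr0.
have [->|z0] := eqVneq z 0.
  by rewrite expr0n; case: s s0 {us Vs}.
pose s' := rem 0 s.
have s'E x : (x \in s') = (x != 0) && (x \in s) by rewrite mem_rem_uniq // inE.
have us' : uniq s' by rewrite rem_uniq.
have sz : size s = (size s').+1 by rewrite size_rem // prednK //; case: s s0 {us Vs s' s'E us'}.
have pr : \prod_(c <- s') c != 0.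
  by rewrite prodf_seq_neq0; apply/allP => x; rewrite s'E => /andP[].
have pm : perm_eq [seq z * c | c <- s'] s'.
  apply: uniq_perm => //; first by rewrite map_inj_uniq //; exact: mulfI.
  move=> x; apply/mapP/idP.
    move=> [c]; rewrite s'E => /andP[c0 /Vs Vc] ->; rewrite s'E mulf_neq0 //=.
    by apply/Vs; exact: srM.
  rewrite s'E => /andP[x0 /Vs Vx]; exists (x / z); last by rewrite mulrC divfK.
  by rewrite s'E mulf_neq0 ?invr_eq0 //=; apply/Vs; exact: sf_div.
have E : \prod_(c <- [seq z * c | c <- s']) c = \prod_(c <- s') c by exact: perm_big.
rewrite big_map big_split /= in E.
have : z ^+ size s' = 1.
  apply: (mulIf pr); rewrite mul1r -[RHS]E; congr (_ * _).
  by rewrite big_const_seq count_predT -Monoid.iteropE.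
by move=> zs; rewrite sz exprS zs mulr1.
Qed.

Section Tower.
Context (ell : nat) (hell : prime ell) (F : fieldExtType {fraction {poly 'F_ell}}).
Context (Omega : closedFieldType) (iota : {rmorphism F -> Omega}).
Context (p : nat) (hp : prime p).

Local Notation pfe := (@prime_field_embedding ell F).
Local Notation kap := (constants F).
Local Notation "h ^i" := (map_poly iota h) (at level 2, format "h ^i").

Lemma pcharO : ell \in [pchar Omega].
Proof. exact: (rmorph_pchar iota (pcharF hell F)). Qed.

Definition q0 : nat := size (sval (cid (constants_finite hell F))).

Lemma q0P : exists s, enumerates kap s /\ size s = q0.
Proof. by exists (sval (cid (constants_finite hell F))); split=> //; exact: svalP. Qed.

Lemma q0_ell : exists r, (0 < r)%N /\ q0 = (ell ^ r)%N.
Proof.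
have [s [sE <-]] := q0P.
exact: (finite_subfield_card pfe hell (constants_subfield F) sE).
Qed.

Lemma q0_gt1 : (1 < q0)%N.
Proof.
have [r [r0 ->]] := q0_ell; apply: leq_trans (prime_gt1 hell) _.
by rewrite -{1}[ell]expn1 leq_exp2l // prime_gt1.
Qed.

Lemma constants_q0 z : kap z -> z ^+ q0 = z.
Proof.
move=> kz; have [s [sE <-]] := q0P.
exact: finite_subfield_fixed (constants_subfield F) sE kz.
Qed.

(** The subfield of [Omega] with q0^(p^n) elements, given by its equation; [const_layerE] identifies
    it with the layer of constants of the statement. *)
Definition Fr n : set Omega := [set z | z ^+ (q0 ^ (p ^ n)) = z].

Lemma Fr_subfield n : is_subfield (Fr n).
Proof.
have [r [_ qE]] := q0_ell; rewrite /Fr qE -expnM.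
exact: frob_fixed_subfield pcharO _.
Qed.

Lemma Fr_expn n i z : Fr n z -> z ^+ (q0 ^ (p ^ n * i)) = z.
Proof.
move=> zn; elim: i => [|i IH]; first by rewrite muln0 expn0 expr1.
by rewrite mulnS expnD exprM zn.
Qed.

Lemma Fr_mono n m : (n <= m)%N -> Fr n `<=` Fr m.
Proof. by move=> nm z zn; rewrite /Fr /= -(subnKC nm) expnD; exact: Fr_expn. Qed.

Lemma Fr_constants n c : kap c -> Fr n (iota c).
Proof.
move=> kc; apply: (Fr_mono (leq0n n)).
by rewrite /Fr /= expn0 expn1 -rmorphXn constants_q0.
Qed.

Lemma Fr_constantsE n c : Fr n (iota c) -> kap c.
Proof.
move=> /= cn; apply/(constantsP hell); have [r [r0 qE]] := q0_ell.
exists (r * p ^ n)%N; split; first by rewrite muln_gt0 r0 expn_gt0 prime_gt0.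
by apply: (fmorph_inj iota); rewrite rmorphXn expnM -qE.
Qed.

Lemma Fr_frob n z : Fr n z -> Fr n (z ^+ q0).
Proof. by move=> /= zn; rewrite /Fr /= -exprM mulnC exprM zn. Qed.

Lemma Fr0_constants z : Fr 0 z -> exists2 c, kap c & z = iota c.
Proof.
rewrite /Fr /= expn0 expn1 => zq; have [s [[us ks] sz]] := q0P.
apply: contrapT => nz; pose h := 'X^q0 - 'X : {poly Omega}.
have szh : size h = q0.+1.
  by rewrite size_polyDl ?size_polyXn // size_polyN size_polyX ltnS q0_gt1.
have h0 : h != 0 by rewrite -size_poly_gt0 szh.
have : (size (z :: map iota s) < size h)%N.
  apply: (max_poly_roots h0).
    rewrite /= rootE !hornerE zq subrr eqxx /=; apply/allP => _ /mapP [c /ks kc ->].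
    by rewrite rootE !hornerE -rmorphXn constants_q0 // subrr.
  rewrite /= map_inj_uniq ?us ?andbT; last exact: fmorph_inj.
  by apply/mapP => -[c /ks kc zc]; apply: nz; exists c.
by rewrite szh /= size_map sz ltnn.
Qed.

Local Notation ord_n n := (q0 ^ (p ^ n)).-1.

Lemma card_gt1 n : (1 < q0 ^ (p ^ n))%N.
Proof. by rewrite -{1}(expn0 q0) ltn_exp2l ?q0_gt1 // expn_gt0 prime_gt0. Qed.

Lemma prim_exists n : exists z : Omega, (ord_n n).-primitive_root z.
Proof.
have A1 := card_gt1 n; set m := ord_n n.
have m0 : (0 < m)%N by rewrite /m; lia.
(* In characteristic ell, m is -1; so X^m - 1 is separable and has m distinct roots. *)
have mn0 : m%:R != 0 :> Omega.
  have [r [r0 qE]] := q0_ell; rewrite /m -subn1 natrB; last lia.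
  rewrite qE -expnM natrX (pcharf0 pcharO) expr0n.
  by rewrite muln_eq0 expn_eq0 (gtn_eqF r0) (gtn_eqF (prime_gt0 hp)) sub0r oppr_eq0 oner_neq0.
have [s sE] := closed_field_poly_normal ('X^m - 1 : {poly Omega}).
have hm : ('X^m - 1 : {poly Omega}) \is monic by exact: monicXnsubC.
rewrite (monicP hm) scale1r in sE.
have us : uniq s by rewrite -separable_prod_XsubC -sE separable_Xn_sub_1.
have : has m.-primitive_root s.
  apply: has_prim_root => //.
    by apply/allP => z zs; rewrite unity_rootE -subr_eq0; move: (root_prod_XsubC s z);
      rewrite zs -sE rootE !hornerE.
  have := congr1 (fun p : {poly Omega} => size p) sE.
  by rewrite size_prod_XsubC size_polyDl ?size_polyXn ?size_polyN ?size_poly1 // => -[->].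
by move=> /hasP [z _ zp]; exists z.
Qed.

(** A generator of the nonzero elements of [Fr n]. Every element of the layer is then a polynomial
    in it over F, and automorphisms can be given by substitution. *)
Definition theta n : Omega := sval (cid (prim_exists n)).

Lemma thetaP n : (ord_n n).-primitive_root (theta n).
Proof. exact: svalP (cid (prim_exists n)). Qed.

Lemma theta_Fr n : Fr n (theta n).
Proof.
rewrite /Fr /= -[(q0 ^ _)%N]prednK ?(ltnW (card_gt1 n)) // exprS.
by rewrite (prim_expr_order (thetaP n)) mulr1.
Qed.

Lemma Fr_theta n z : Fr n z -> z = 0 \/ exists i, z = theta n ^+ i.
Proof.
move=> /= zn; have [->|z0] := eqVneq z 0; [by left|right].
have zm : z ^+ ord_n n = 1.
  apply: (mulfI z0); rewrite -exprS prednK ?(ltnW (card_gt1 n)) //.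
  by rewrite zn mulr1.
by have [i ->] := prim_rootP (thetaP n) zm; exists i.
Qed.

Lemma Fr_enum n : exists s, enumerates (Fr n) s /\ size s = (q0 ^ (p ^ n))%N.
Proof.
have A1 := card_gt1 n; have m0 : (0 < ord_n n)%N by lia.
exists (0 :: [seq theta n ^+ i | i <- seq.iota 0 (ord_n n)]); split; last first.
  by rewrite /= size_map size_iota prednK //; lia.
have th0 : theta n != 0 by rewrite (prim_root_eq0 (thetaP n)); lia.
split.
  rewrite /= map_inj_in_uniq ?iota_uniq ?andbT.
    by apply/mapP => -[i _ /esym/eqP]; rewrite expf_eq0 (negPf th0) andbF.
  move=> i j; rewrite !mem_iota /= !add0n => im jm /eqP.
  by rewrite (eq_prim_root_expr (thetaP n)) !modn_small // => /eqP.
move=> x; rewrite inE; split.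
  move=> /= xn; have [->|x0] := eqVneq x 0; [by []|rewrite /=].
  have xm : x ^+ ord_n n = 1.
    apply: (mulfI x0); rewrite -exprS prednK ?(ltnW (card_gt1 n)) //.
    by rewrite xn mulr1.
  have [i ->] := prim_rootP (thetaP n) xm; apply: map_f.
  by rewrite mem_iota /= add0n.
have FrR := subfield_subring (Fr_subfield n).
move=> /orP[/eqP ->|/mapP [i _ ->]]; first exact: sr0.
by apply: srX => //; exact: theta_Fr.
Qed.

(** A field of degree p^n over q0 elements has q0^(p^n) elements, each fixed by that power;
    conversely the dimension of [Fr n] is read off from its cardinality. *)
Lemma const_layerE n : const_layer iota p n = Fr n.
Proof.
have kF := image_subfield iota (constants_subfield F).
have [s [sE sz]] := q0P; have isE := enumerates_map iota sE.
have [t [tE tz]] := Fr_enum n.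
apply/seteqP; split=> z.
  move=> [K [KF kK Kd] Kz].
  have KS := subspace_subring (subfield_subring KF) kK.
  have [s' KE sz'] := has_dim_card kF KS isE Kd.
  by rewrite /Fr /= -sz -(size_map iota) -sz'; exact: finite_subfield_fixed KE Kz.
move=> zn; exists (Fr n) => //.
have kFr : iota @` kap `<=` Fr n by move=> _ [c kc <-]; exact: Fr_constants.
split=> //; first exact: Fr_subfield.
have VS := subspace_subring (subfield_subring (Fr_subfield n)) kFr.
have [d Vd] := enumerates_has_dim kF VS (zero_subspace _) tE.
have [s' VE' sz'] := has_dim_card kF VS isE Vd.
suff <- : d = (p ^ n)%N by [].
apply/eqP; rewrite -(eqn_exp2l _ _ q0_gt1) -tz (enumerates_size tE VE') sz'.
by rewrite size_map sz.
Qed.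

Lemma const_towerP z : const_tower iota p z <-> exists n, Fr n z.
Proof.
split; first by move=> [n _]; rewrite const_layerE => zn; exists n.
by move=> [n zn]; exists n => //; rewrite const_layerE.
Qed.

Lemma const_tower_subfield : is_subfield (const_tower iota p).
Proof.
apply/is_subfieldP; split.
- apply/const_towerP; exists 0%N; exact: sr1 (subfield_subring (Fr_subfield _)).
- move=> x y /const_towerP [n xn] /const_towerP [m ym]; apply/const_towerP; exists (maxn n m).
  apply: (srB (subfield_subring (Fr_subfield _))); [apply: Fr_mono xn|apply: Fr_mono ym];
  by rewrite ?leq_maxl ?leq_maxr.
- move=> x y /const_towerP [n xn] /const_towerP [m ym]; apply/const_towerP; exists (maxn n m).
  apply: (sf_div (Fr_subfield _)); [apply: Fr_mono xn|apply: Fr_mono ym];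
  by rewrite ?leq_maxl ?leq_maxr.
Qed.

Lemma algebraic_inverse_poly z : algebraicOver iota z -> z != 0 ->
  exists h, z^-1 = h^i.[z].
Proof.
move=> [g g0 gz] z0.
have ex : exists n, `[< exists g, [/\ g != 0, root g^i z & size g = n] >].
  by exists (size g); apply/asboolP; exists g.
case: (ex_minnP ex) => d /asboolP [h [h0 hz hs]] dmin.
have [g' [c hE]] : exists g' c, h = g' * 'X + c%:P.
  elim/poly_ind: h {h0 hz hs dmin} => [|g' c _]; last by exists g', c.
  by exists 0, 0; rewrite mul0r add0r.
have c0 : c != 0.
  apply: contraTneq isT => c0; have g'0 : g' != 0.
    by apply: contra_neq h0 => g'0; rewrite hE g'0 c0 mul0r add0r.
  have : (d <= size g')%N.
    apply: dmin; apply/asboolP; exists g'; split=> //.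
    move: hz; rewrite hE c0 addr0 rmorphM /= map_polyX rootM rootX (negPf z0) orbF //.
  by rewrite -hs hE c0 addr0 size_mulX // ltnn.
exists ((- c^-1) *: g'); apply: (mulIf z0); rewrite mulVf //.
have := rootP hz; rewrite hE rmorphD rmorphM /= map_polyX map_polyC /= hornerD hornerMX hornerC.
move=> /eqP; rewrite addr_eq0 => /eqP E.
have ic : iota c != 0 by rewrite fmorph_eq0.
by rewrite map_polyZ hornerZ -mulrA E rmorphN fmorphV mulrNN mulVf.
Qed.

Lemma theta_algebraic n : algebraicOver iota (theta n).
Proof.
have := theta_Fr n; rewrite /Fr /= => tn.
exists ('X^(q0 ^ (p ^ n)) - 'X).
  rewrite -size_poly_gt0 size_polyDl ?size_polyXn // size_polyN size_polyX ltnS.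
  exact: card_gt1.
by rewrite rmorphB /= map_polyXn map_polyX rootE !hornerE tn subrr.
Qed.

Lemma layerP n z : layer iota p n z <-> exists h, z = h^i.[theta n].
Proof.
pose K : set Omega := [set z | exists h, z = h^i.[theta n]].
suff -> : layer iota p n = K by [].
have KR : is_subring K.
  apply/is_subringP; split.
  - by exists 1; rewrite rmorph1 hornerC.
  - by move=> _ _ [h ->] [g ->]; exists (h - g); rewrite rmorphB hornerD hornerN.
  - by move=> _ _ [h ->] [g ->]; exists (h * g); rewrite rmorphM hornerM.
have Kalg x : K x -> algebraicOver iota x.
  move=> [h ->]; rewrite horner_coef.
  apply: (big_ind (algebraicOver iota)) => [||i _]; [exact: algebraic0|exact: algebraic_add|].
  apply: algebraic_mul; first by rewrite coef_map; exact: algebraic_id.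
  elim: (nat_of_ord i) => [|m IH]; first by rewrite expr0; exact: algebraic1.
  by rewrite exprS; apply: algebraic_mul => //; exact: theta_algebraic.
have KV x : K x -> K x^-1.
  move=> Kx; have [->|x0] := eqVneq x 0; first by rewrite invr0; exact: sr0.
  have [h ->] := algebraic_inverse_poly (Kalg x Kx) x0.
  apply: sr_horner => // i; rewrite coef_map; exists (h`_i)%:P.
  by rewrite map_polyC hornerC.
have KF : is_subfield K.
  apply/is_subfieldP; split; first exact: sr1.
    by move=> x y; exact: srB.
  by move=> x y Kx Ky; apply: srM => //; exact: KV.
apply/seteqP; split.
  apply: smallest_sub => // x [[y _ <-]|].
    by exists y%:P; rewrite map_polyC hornerC.
  rewrite const_layerE => /Fr_theta [->|[i ->]]; first exact: sr0.
  by exists 'X^i; rewrite map_polyXn hornerXn.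
move=> _ [h ->] M [MF MK]; have MR := subfield_subring MF.
apply: sr_horner => // [i|]; first by rewrite coef_map; apply: MK; left; exists h`_i.
by apply: MK; right; rewrite const_layerE; exact: theta_Fr.
Qed.

Lemma layer_subfield n : is_subfield (layer iota p n).
Proof.
apply/is_subfieldP; split.
- by move=> M [MF _]; exact: sr1 (subfield_subring MF).
- move=> x y Lx Ly M MM; have [MF _] := MM.
  by apply: (srB (subfield_subring MF)); [exact: Lx|exact: Ly].
- by move=> x y Lx Ly M MM; have [MF _] := MM; apply: sf_div => //; [exact: Lx|exact: Ly].
Qed.

Lemma layer_iota n y : layer iota p n (iota y).
Proof. by move=> M [_ MK]; apply: MK; left; exists y. Qed.

Lemma layer_Fr n z : Fr n z -> layer iota p n z.
Proof. by move=> zn M [_ MK]; apply: MK; right; rewrite const_layerE. Qed.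

Lemma layer_mono n m : (n <= m)%N -> layer iota p n `<=` layer iota p m.
Proof.
move=> nm; apply: smallest_sub; first exact: layer_subfield.
move=> x [[y _ <-]|]; first exact: layer_iota.
by rewrite const_layerE => /(Fr_mono nm); exact: layer_Fr.
Qed.

Lemma tower_subfield : is_subfield (tower iota p).
Proof.
apply/is_subfieldP; split.
- by exists 0%N => //; exact: sr1 (subfield_subring (layer_subfield _)).
- move=> x y [n _ xn] [m _ ym]; exists (maxn n m) => //.
  apply: (srB (subfield_subring (layer_subfield _))); [apply: layer_mono xn|apply: layer_mono ym];
  by rewrite ?leq_maxl ?leq_maxr.
- move=> x y [n _ xn] [m _ ym]; exists (maxn n m) => //.
  apply: (sf_div (layer_subfield _)); [apply: layer_mono xn|apply: layer_mono ym];
  by rewrite ?leq_maxl ?leq_maxr.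
Qed.

Lemma tower_iota y : tower iota p (iota y).
Proof. by exists 0%N => //; exact: layer_iota. Qed.

Lemma tower_Fr n z : Fr n z -> tower iota p z.
Proof. by move=> zn; exists n => //; exact: layer_Fr. Qed.

(* The minimal polynomial of a root of unity over F has constant
   coefficients, so that it also annihilates the q0-th power of that root. *)
Lemma horner_frob n x (h : {poly F}) : Fr n x -> h^i.[x] = 0 -> h^i.[x ^+ q0] = 0.
Proof.
move=> xn hx; have A1 := card_gt1 n.
pose T := 'X^(q0 ^ (p ^ n)) - 'X : {poly F}.
have T0 : T != 0.
  rewrite -size_poly_gt0 size_polyDl ?size_polyXn // size_polyN size_polyX ltnS.
  exact: card_gt1.
have Tr y : root T^i y <-> Fr n y.
  rewrite /T rmorphB /= map_polyXn map_polyX rootE !hornerE subr_eq0.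
  by split=> /eqP.
have ex : exists d, `[< exists g, [/\ g != 0, root g^i x & size g = d] >].
  by exists (size T); apply/asboolP; exists T; split=> //; exact/Tr.
case: (ex_minnP ex) => d /asboolP [g [g0 gx gs]] dmin.
wlog gm : g g0 gx gs / g \is monic => [wl|].
  have lg : (lead_coef g)^-1 != 0 by rewrite invr_eq0 lead_coef_eq0.
  apply: (wl ((lead_coef g)^-1 *: g)); rewrite ?scaler_eq0 ?negb_or ?lg //.
  - by rewrite map_polyZ rootE hornerZ (rootP gx) mulr0.
  - by rewrite size_scale.
  - by rewrite monicE lead_coefZ mulVf ?lead_coef_eq0.
have gdvd (k : {poly F}) : root k^i x -> g %| k.
  move=> kx; apply: contrapT => ngk.
  have r0 : k %% g != 0 by apply/negP.
  have : (d <= size (k %% g)%R)%N.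
    apply: dmin; apply/asboolP; exists (k %% g); split=> //.
    have := divp_eq k g => /(congr1 (map_poly iota)); rewrite rmorphD rmorphM /= => /(congr1 (fun u : {poly Omega} => u.[x])).
    by rewrite hornerD hornerM (rootP gx) mulr0 add0r (rootP kx) => /esym/eqP.
  by rewrite -gs leqNgt ltn_modp g0.
have [s sE] := closed_field_poly_normal g^i.
have gim : g^i \is monic by rewrite map_monic.
rewrite (monicP gim) scale1r in sE.
have FrR := subfield_subring (Fr_subfield n).
have gFr : coefs_in (Fr n) g^i.
  have sFr y : y \in s -> Fr n y.
    move=> ys; apply/Tr; have /dvdpP [k ->] := gdvd T (introT idP ((Tr x).2 xn)).
    by rewrite rmorphM /= rootM sE root_prod_XsubC ys orbT.
  rewrite sE; elim: s sFr {sE} => [|y s IH] sFr; first by rewrite big_nil -polyC1; apply: coefs_inC => //; exact: sr1.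
  rewrite big_cons; apply: coefs_inM => //; last by apply: IH => z zs; apply: sFr; rewrite inE zs orbT.
  by apply: coefs_inB => //; [exact: coefs_inX|apply: coefs_inC => //; apply: sFr; rewrite mem_head].
have gk : coefs_in kap g.
  by move=> i; apply: (@Fr_constantsE n); move: (gFr i); rewrite coef_map.
have gxq : g^i.[x ^+ q0] = 0.
  have [r [r0 qE]] := q0_ell.
  have : g^i.[x] ^+ q0 = 0 by rewrite (rootP gx) expr0n (gtn_eqF (ltnW q0_gt1)).
  move=> <-; rewrite !horner_coef qE frob_sum ?pcharO // -qE.
  apply: eq_bigr => i _; rewrite exprMn coef_map -rmorphXn /= constants_q0 //.
    by rewrite -!exprM mulnC.
  exact: gk.
have /dvdpP [k ->] : g %| h by apply: gdvd; apply/rootP.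
by rewrite rmorphM hornerM gxq mulr0.
Qed.

(* The Frobenius automorphism of the tower over F. *)
Definition phi (z : Omega) : Omega := xget 0 [set w | exists n x h,
  [/\ Fr n x, z = h^i.[x] & w = h^i.[x ^+ q0]]].

(** Well-definedness: two representations of the same element are rewritten in a common [theta N],
    and [horner_frob] is applied to their difference. *)
Lemma phiE n x h : Fr n x -> phi h^i.[x] = h^i.[x ^+ q0].
Proof.
move=> xn; apply: xget_unique => /=; first by exists n, x, h.
move=> w [m [y [g [ym E ->]]]].
pose N := maxn n m.
have rep z : Fr N z -> exists u : {poly F}, z = u^i.[theta N] /\ z ^+ q0 = u^i.[theta N ^+ q0].
  move=> /Fr_theta [->|[i ->]].
    by exists 0; rewrite rmorph0 !horner0 expr0n (gtn_eqF (ltnW q0_gt1)).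
  by exists 'X^i; rewrite map_polyXn !hornerXn -!exprM mulnC.
have [u [xE xqE]] := rep x (Fr_mono (leq_maxl n m) xn).
have [v [yE yqE]] := rep y (Fr_mono (leq_maxr n m) ym).
have := @horner_frob N (theta N) ((h \Po u) - (g \Po v)) (theta_Fr N).
rewrite rmorphB /= !map_comp_poly !hornerD !hornerN !horner_comp -xE -yE -xqE -yqE.
by rewrite E subrr => /(_ erefl) /eqP; rewrite subr_eq0 => /eqP.
Qed.

Lemma phi_layer n h : phi h^i.[theta n] = h^i.[theta n ^+ q0].
Proof. exact: phiE (theta_Fr n). Qed.

Lemma phi_iota y : phi (iota y) = iota y.
Proof. by have := phi_layer 0 y%:P; rewrite map_polyC !hornerC. Qed.

Lemma phi_Fr n b : Fr n b -> phi b = b ^+ q0.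
Proof. by move=> bn; have := phiE 'X bn; rewrite map_polyX !hornerX. Qed.

Lemma tower_rep2 x y : tower iota p x -> tower iota p y ->
  exists n h g, x = h^i.[theta n] /\ y = g^i.[theta n].
Proof.
move=> [n _ xn] [m _ ym]; exists (maxn n m).
have /layerP [h ->] := layer_mono (leq_maxl n m) xn.
have /layerP [g ->] := layer_mono (leq_maxr n m) ym.
by exists h, g.
Qed.

Lemma phiB x y : tower iota p x -> tower iota p y -> phi (x - y) = phi x - phi y.
Proof.
move=> Kx Ky; have [n [h [g [-> ->]]]] := tower_rep2 Kx Ky.
have := phi_layer n (h - g); rewrite rmorphB !hornerD !hornerN => ->.
by rewrite !phi_layer.
Qed.

Lemma phiM x y : tower iota p x -> tower iota p y -> phi (x * y) = phi x * phi y.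
Proof.
move=> Kx Ky; have [n [h [g [-> ->]]]] := tower_rep2 Kx Ky.
have := phi_layer n (h * g); rewrite rmorphM !hornerM => ->.
by rewrite !phi_layer.
Qed.

Lemma phi0 : phi 0 = 0. Proof. by rewrite -(rmorph0 iota) phi_iota. Qed.
Lemma phi1 : phi 1 = 1. Proof. by rewrite -(rmorph1 iota) phi_iota. Qed.

Lemma phiD x y : tower iota p x -> tower iota p y -> phi (x + y) = phi x + phi y.
Proof.
move=> Kx Ky; have [n [h [g [-> ->]]]] := tower_rep2 Kx Ky.
have := phi_layer n (h + g); rewrite rmorphD !hornerD => ->.
by rewrite !phi_layer.
Qed.

Lemma layer_phi n z : layer iota p n z -> layer iota p n (phi z).
Proof.
move=> /layerP [h ->]; rewrite phi_layer; apply/layerP; exists (h \Po 'X^q0).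
by rewrite map_comp_poly horner_comp map_polyXn hornerXn.
Qed.

Lemma tower_phi z : tower iota p z -> tower iota p (phi z).
Proof. by move=> [n _ zn]; exists n => //; exact: layer_phi. Qed.

Lemma phi_neq0 z : tower iota p z -> z != 0 -> phi z != 0.
Proof.
move=> Kz z0; apply/eqP => fz0; have := phiM Kz (sfV tower_subfield Kz).
by rewrite divff // phi1 fz0 mul0r => /eqP; rewrite oner_eq0.
Qed.

Lemma phiV z : tower iota p z -> phi z^-1 = (phi z)^-1.
Proof.
move=> Kz; have [->|z0] := eqVneq z 0; first by rewrite invr0 phi0 invr0.
apply: (mulfI (phi_neq0 Kz z0)); rewrite -phiM ?divff ?phi1 ?phi_neq0 //.
exact: sfV tower_subfield Kz.
Qed.

Lemma phiX z i : tower iota p z -> phi (z ^+ i) = phi z ^+ i.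
Proof.
move=> Kz; have KR := subfield_subring tower_subfield.
elim: i => [|i IH]; first by rewrite !expr0 phi1.
by rewrite !exprS phiM ?IH //; exact: srX.
Qed.

Definition phin i z := iter i phi z.

Lemma phin_layer i n h : phin i h^i.[theta n] = h^i.[theta n ^+ (q0 ^ i)].
Proof.
elim: i => [|i IH]; first by rewrite expn0 expr1.
rewrite /phin iterS -/(phin i _) IH (@phiE n).
  by rewrite -exprM -expnSr.
elim: {IH} i => [|i IH]; first by rewrite expn0 expr1; exact: theta_Fr.
by rewrite expnSr exprM; exact: Fr_frob.
Qed.

Lemma phin_period n z : layer iota p n z -> phin (p ^ n) z = z.
Proof. by move=> /layerP [h ->]; rewrite phin_layer (theta_Fr n). Qed.

Lemma layer_phin i n z : layer iota p n z -> layer iota p n (phin i z).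
Proof. by move=> zn; elim: i => [//|i IH]; exact: layer_phi. Qed.

Lemma phin_Fr i n b : Fr n b -> phin i b = b ^+ (q0 ^ i).
Proof.
move=> bn; elim: i => [|i IH]; first by rewrite expn0 expr1.
rewrite /phin iterS -/(phin i _) IH expnSr exprM (@phi_Fr n) //.
elim: {IH} i => [|i IH]; first by rewrite expn0 expr1.
by rewrite expnSr exprM; exact: Fr_frob.
Qed.

End Tower.

(** * Galois theory of the layers: trace, norm and Hilbert 90 *)

Section TowerGalois.
Context (ell : nat) (hell : prime ell) (F : fieldExtType {fraction {poly 'F_ell}}).
Context (Omega : closedFieldType) (iota : {rmorphism F -> Omega}).
Context (p : nat) (hp : prime p).

Local Notation kap := (constants F).
Local Notation "h ^i" := (map_poly iota h) (at level 2, format "h ^i").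
Local Notation q0 := (q0 hell F).
Local Notation Fr := (@Fr ell hell F Omega p).
Local Notation theta := (@theta ell hell F Omega iota p hp).
Local Notation phi := (@phi ell hell F Omega iota p).
Local Notation phin := (@phin ell hell F Omega iota p).
Local Notation K := (tower iota p).
Local Notation layer := (layer iota p).

Let KF : is_subfield K. Proof. exact: (tower_subfield hell). Qed.
Let KR : is_subring K. Proof. exact: subfield_subring. Qed.

(** Independence of the powers of Frobenius: a nonzero combination of the X^(q0^i) with i < p^n has
    degree below the number of elements of [Fr n], so that not all of these are roots. *)
Lemma additive_poly_neq0 n (a : nat -> Omega) : a 0%N != 0 ->
  exists2 b, Fr n b & \sum_(i < p ^ n) a i * b ^+ (q0 ^ i) != 0.
Proof.
move=> a0; have [s [[us sFr] sz]] := Fr_enum hell iota hp n.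
have m0 : (0 < p ^ n)%N by rewrite expn_gt0 prime_gt0.
pose h := \sum_(i < p ^ n) a i *: 'X^(q0 ^ i) : {poly Omega}.
have q1 := q0_gt1 hell F.
have h0 : h != 0.
  apply: contra_neq a0 => /(congr1 (fun u : {poly Omega} => u`_1)).
  rewrite coef0 coef_sum (bigD1 (Ordinal m0)) //= coefZ coefXn expn0 eqxx mulr1.
  rewrite big1 ?addr0 // => i i0; rewrite coefZ coefXn.
  rewrite -{1}(expn0 q0) eqn_exp2l // eq_sym; move: i0; rewrite -val_eqE /= => /negPf ->.
  by rewrite mulr0.
have hs : (size h <= q0 ^ (p ^ n))%N.
  apply: leq_trans (size_sum _ _ _) _; apply/bigmax_leqP => i _.
  apply: leq_trans (size_scale_leq _ _) _; rewrite size_polyXn.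
  by rewrite ltn_exp2l.
apply: contrapT => H.
have : (size s < size h)%N.
  apply: (max_poly_roots h0) => //; apply/allP => b /sFr bn; apply: contrapT => nr.
  apply: H; exists b => //; apply: contra_notN nr => /eqP E.
  apply/rootP; rewrite horner_sum -[RHS]E; apply: eq_bigr => i _.
  by rewrite hornerZ hornerXn.
by rewrite sz ltnNge hs.
Qed.

Lemma trace_Fr0 n c : Fr n c -> Fr 0 (\sum_(i < p ^ n) c ^+ (q0 ^ i)).
Proof.
move=> cn; have [r [r0 qE]] := q0_ell hell F.
have FS := frob_sum hell (pcharO hell iota) r (index_enum _) xpredT (fun i : 'I_(p ^ n) => c ^+ (q0 ^ i)).
rewrite -qE in FS; rewrite /Fr /= expn0 expn1 FS {FS}.
have m0 : (0 < p ^ n)%N by rewrite expn_gt0 prime_gt0.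
move: (cn); rewrite /Fr /=; move: m0; case: (p ^ n)%N => // m _ cm.
rewrite big_ord_recr big_ord_recl /= addrC; congr (_ + _).
  by rewrite -exprM -expnSr cm expn0 expr1.
by apply: eq_bigr => i _; rewrite -exprM -expnSr.
Qed.

(** For b in [Fr n] with nonzero trace t, z t is the trace of z b. Expanding z b in powers of theta,
    whose traces are constants of F, puts z t in F; t lies in F as well. *)
Lemma phi_fixed n z : layer n z -> phi z = z -> exists y, z = iota y.
Proof.
move=> zn fz.
have [b bn] := @additive_poly_neq0 n (fun=> 1) (oner_neq0 _).
under eq_bigr do rewrite mul1r.
set t := \sum_(i < p ^ n) _ => t0.
have [c kc tE] := Fr0_constants iota (trace_Fr0 bn).
have [h zE] := (layerP hell iota hp n z).1 zn.
have [g bE] := (layerP hell iota hp n b).1 (layer_Fr hp bn).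
have fzi i : phin i z = z.
  by elim: i => [//|i IH]; rewrite /phin iterS -/(phin i z) IH.
have zt : z * t = \sum_(j < size (h * g)^i) ((h * g)^i)`_j * \sum_(i < p ^ n) (theta n ^+ j) ^+ (q0 ^ i).
  rewrite /t mulr_sumr; under [RHS]eq_bigr do rewrite mulr_sumr.
  rewrite exchange_big; apply: eq_bigr => i _ /=.
  have -> : z * b ^+ (q0 ^ i) = (h * g)^i.[theta n ^+ (q0 ^ i)].
    rewrite rmorphM hornerM -!(phin_layer hell iota hp) -zE -bE fzi.
    by rewrite (phin_Fr iota hp i bn).
  rewrite horner_coef; apply: eq_bigr => j _.
  by rewrite -!exprM mulnC.
have FrR := subfield_subring (Fr_subfield hell iota p n).
have [y yE] : exists y, z * t = iota y.
  rewrite zt; apply: (big_ind (fun x => exists y, x = iota y)) => [||j _].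
  - by exists 0; rewrite rmorph0.
  - by move=> _ _ [x ->] [y ->]; exists (x + y); rewrite rmorphD.
  - rewrite coef_map.
    have [d _ ->] := Fr0_constants iota (trace_Fr0 (srX FrR j (theta_Fr hell iota hp n))).
    by exists ((h * g)`_j * d); exact: esym (rmorphM iota _ _).
have {}tE : t = iota c := tE.
have ic0 : iota c != 0 by rewrite -tE.
exists (y / c); apply: (mulIf t0); rewrite yE fmorph_div.
by rewrite tE divfK.
Qed.

Lemma phin_iter i z : phin i (phi z) = phi (phin i z).
Proof. by rewrite /phin -iterSr. Qed.

Lemma tower_phin i z : K z -> K (phin i z).
Proof. by move=> Kz; elim: i => [//|i IH]; exact: (tower_phi hell hp). Qed.

Lemma phin_neq0 i z : K z -> z != 0 -> phin i z != 0.
Proof.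
move=> Kz z0; elim: i => [//|i IH]; apply: (phi_neq0 hell hp) => //; exact: tower_phin.
Qed.

Lemma phinM i x y : K x -> K y -> phin i (x * y) = phin i x * phin i y.
Proof.
move=> Kx Ky; elim: i => [//|i IH]; rewrite /phin !iterS -!/(phin i _) IH.
by rewrite (phiM hell hp) //; exact: tower_phin.
Qed.

Lemma phinX i x m : K x -> phin i (x ^+ m) = phin i x ^+ m.
Proof.
move=> Kx; elim: m => [|m IH]; last first.
  by rewrite !exprS phinM ?IH //; exact: srX.
by rewrite !expr0; elim: i => [//|i IH]; rewrite /phin iterS -/(phin i _) IH phi1.
Qed.

Lemma phin_iota i y : phin i (iota y) = iota y.
Proof.
by elim: i => [//|i IH]; rewrite /phin iterS -/(phin i _) IH (phi_iota hell iota hp).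
Qed.

Lemma phi_prod (m : nat) (f : nat -> Omega) : (forall i, K (f i)) ->
  phi (\prod_(i < m) f i) = \prod_(i < m) phi (f i).
Proof.
move=> Kf; elim: m => [|m IH]; first by rewrite !big_ord0 (phi1 hell iota hp).
by rewrite !big_ord_recr /= (phiM hell hp) ?IH //; exact: sr_prod.
Qed.

Lemma phi_sum (m : nat) (f : nat -> Omega) : (forall i, K (f i)) ->
  phi (\sum_(i < m) f i) = \sum_(i < m) phi (f i).
Proof.
move=> Kf; elim: m => [|m IH]; first by rewrite !big_ord0 (phi0 hell iota hp).
by rewrite !big_ord_recr /= (phiD hell hp) ?IH //; exact: sr_sum.
Qed.

Definition tower_norm n z := \prod_(i < p ^ n) phin i z.

Lemma norm_phi n z : layer n z -> phi (tower_norm n z) = tower_norm n z.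
Proof.
move=> zn; have Kz : K z by exists n.
rewrite /tower_norm phi_prod; last by move=> i; exact: tower_phin.
have m0 : (0 < p ^ n)%N by rewrite expn_gt0 prime_gt0.
have := phin_period hell hp zn; move: m0; case: (p ^ n)%N => // m _ zm.
rewrite big_ord_recr big_ord_recl /= mulrC; congr (_ * _).
by rewrite -[LHS]/(phin m.+1 z) zm.
Qed.

Lemma norm_layer n z : layer n z -> layer n (tower_norm n z).
Proof.
move=> zn; apply: sr_prod => [|i _]; first exact: subfield_subring (layer_subfield iota p n).
exact: (layer_phin hell hp).
Qed.

Lemma norm_iota n z : layer n z -> exists y, tower_norm n z = iota y.
Proof. by move=> zn; apply: (phi_fixed (norm_layer zn)); exact: norm_phi. Qed.

Lemma normM n x y : K x -> K y -> tower_norm n (x * y) = tower_norm n x * tower_norm n y.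
Proof. by move=> Kx Ky; rewrite -big_split; apply: eq_bigr => i _; exact: phinM. Qed.

Lemma norm_neq0 n z : K z -> z != 0 -> tower_norm n z != 0.
Proof.
by move=> Kz z0; apply/prodf_neq0 => i _; exact: phin_neq0.
Qed.

(** The resolvent w, the sum of the a_i phi^i(b) with a_i the partial norms of u, satisfies u phi(w)
    = w. The field S is left open in order to apply this to a layer and to its field of
    constants. *)
Lemma hilbert90 n (S : set Omega) u : is_subfield S -> Fr n `<=` S -> S `<=` layer n ->
  (forall z, S z -> S (phi z)) -> S u -> u != 0 -> tower_norm n u = 1 ->
  exists w, [/\ S w, w != 0 & u = phi w / w].
Proof.
move=> SF FrS Sl Sphi Su u0 Nu; have SR := subfield_subring SF.
have SK z : S z -> K z by move=> Sz; exists n => //; exact: Sl.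
have Sphin i z : S z -> S (phin i z) by move=> Sz; elim: i => [//|i IH]; exact: Sphi.
pose a i := \prod_(j < i) phin j u.
have a0 : a 0%N != 0 by rewrite /a big_ord0 oner_neq0.
have [b bn] := additive_poly_neq0 n a0.
under eq_bigr do rewrite -(phin_Fr iota hp _ bn).
set w := \sum_(i < p ^ n) _ => w0.
have Sb := FrS b bn.
have Sa i : S (a i) by apply: sr_prod => // j _; exact: Sphin.
have Sw : S w by apply: sr_sum => // i _; apply: srM => //; exact: Sphin.
have aS i : u * phi (a i) = a i.+1.
  rewrite /a phi_prod; last by move=> j; apply: SK; exact: Sphin.
  by rewrite big_ord_recl; congr (_ * _).
have uw : u * phi w = w.
  rewrite /w (@phi_sum _ (fun i => a i * phin i b)); last by move=> i; apply: srM => //; apply: SK => //; exact: Sphin.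
  have am : a (p ^ n)%N = 1 by [].
  have bm : phin (p ^ n) b = b by apply: (phin_period hell hp); exact: Sl.
  have m0 : (0 < p ^ n)%N by rewrite expn_gt0 prime_gt0.
  rewrite mulr_sumr; under eq_bigr => i _.
    rewrite (phiM hell hp); [|by apply: SK|by apply: SK; exact: Sphin].
    rewrite mulrA aS -[phi (phin i b)]/(phin i.+1 b).
    over.
  move: m0 am bm; case: (p ^ n)%N => // m _ am bm.
  transitivity (\sum_(i < m) a i.+1 * phin i.+1 b + a m.+1 * phin m.+1 b).
    by rewrite big_ord_recr.
  transitivity (a 0%N * b + \sum_(i < m) a i.+1 * phin i.+1 b); last by rewrite big_ord_recl.
  rewrite am bm addrC; congr (_ * _ + _).
  by rewrite /a big_ord0.
exists w^-1; split; first exact: sfV.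
  by rewrite invr_eq0.
have fw0 : phi w != 0 by apply: (phi_neq0 hell hp) => //; exact: SK.
rewrite invrK (phiV hell hp (SK w Sw)).
by apply: (mulIf fw0); rewrite uw mulrAC mulVf // mul1r.
Qed.

Lemma norm_surjective n c : kap c -> c != 0 ->
  exists b, [/\ Fr n b, b != 0 & tower_norm n b = iota c].
Proof.
move=> kc c0; have q1 := q0_gt1 hell F.
have tP := thetaP hell iota hp n.
(* On [Fr n] the norm is the S-th power; theta^S has order q0 - 1 and thus generates the nonzero
   constants of F. *)
pose S := (\sum_(i < p ^ n) q0 ^ i)%N.
have SE : (S * q0.-1)%N = (q0 ^ (p ^ n)).-1 by rewrite mulnC /S -predn_exp.
have gP : (q0.-1).-primitive_root (theta n ^+ S).
  have := dvdn_prim_root tP (_ : (q0.-1 %| (q0 ^ (p ^ n)).-1)%N).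
  by rewrite -SE dvdn_mull // mulnK; [apply|lia].
have : (iota c) ^+ q0.-1 = 1.
  have ic0 : iota c != 0 by rewrite fmorph_eq0.
  apply: (mulfI ic0); rewrite -exprS prednK ?(ltnW q1) // mulr1 -rmorphXn.
  by rewrite (constants_q0 hell kc).
move=> /(prim_rootP gP) [i cE].
have FrR := subfield_subring (Fr_subfield hell iota p n).
have tF := theta_Fr hell iota hp n.
exists (theta n ^+ i); split; first exact: srX.
  rewrite expf_neq0 // (prim_root_eq0 tP) -lt0n.
  by have := card_gt1 hell F hp n; lia.
rewrite /tower_norm cE -exprM mulnC exprM; under eq_bigr => j _.
  rewrite (phin_Fr iota hp _ (srX FrR i tF)).
  over.
by rewrite prodrXr.
Qed.

Lemma phi_surj z : K z -> exists2 w, K w & phi w = z.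
Proof.
move=> [n _ zn]; exists (phin (p ^ n).-1 z); first by apply: tower_phin; exists n.
rewrite -[LHS]/(phin (p ^ n).-1.+1 z) prednK ?expn_gt0 ?prime_gt0 //.
exact: (phin_period hell hp).
Qed.

Lemma prime_phi Q : Defs.primes K Q ->
  let Q' := [set z | K z /\ Q (phi z)] in
  Defs.primes K Q' /\ forall x, K x -> x != 0 -> ord K Q' x = ord K Q (phi x).
Proof.
move=> HQ; have [O [pi [OV QE [piN pi0 pidec] _ A]]] := ord_spec KF HQ.
have [OR OK Ot [z0 Kz0 nOz0]] := OV; have Opi : O pi by case: piN.
pose O' := [set z | K z /\ O (phi z)].
have O'V : is_valring K O'.
  split.
  - apply/is_subringP; split.
    + by split; [exact: sr1|rewrite (phi1 hell iota hp); exact: sr1].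
    + move=> x y [Kx Ox] [Ky Oy]; split; first exact: srB.
      by rewrite (phiB hell hp) //; exact: srB.
    + move=> x y [Kx Ox] [Ky Oy]; split; first exact: srM.
      by rewrite (phiM hell hp) //; exact: srM.
  - by move=> z [].
  - move=> z Kz; have [?|?] := Ot (phi z) (tower_phi hell hp Kz); first by left.
    by right; split; [exact: sfV|rewrite (phiV hell hp)].
  - by have [w Kw wE] := phi_surj Kz0; exists w => // -[_]; rewrite wE.
have nE : nonunits O' = [set z | K z /\ Q (phi z)].
  rewrite QE; apply/seteqP; split=> z.
    move=> [[Kz Oz] zN]; split=> //; split=> //.
    case: zN => [->|nO]; first by left; rewrite (phi0 hell iota hp).
    by right=> H; apply: nO; split; [exact: sfV|rewrite (phiV hell hp)].
  move=> [Kz [Oz zN]]; split; first by split.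
  case: zN => [fz|nO]; last by right=> -[_]; rewrite (phiV hell hp).
  by left; apply: contrapT => /eqP z0'; have := phi_neq0 hell hp Kz z0'; rewrite fz eqxx.
have [w Kw wE] := phi_surj (OK _ Opi).
have w0 : w != 0 by apply: contra_neq pi0 => w0; rewrite -wE w0 (phi0 hell iota hp).
have phiXz x (n : int) : K x -> phi (x ^ n) = phi x ^ n.
  move=> Kx; case: n => n; first by rewrite -!exprnP (phiX hell hp).
  by rewrite NegzE -!exprnN (phiV hell hp) ?(phiX hell hp) //; exact: srX.
have as' x n : K x -> x != 0 -> associated O (phi x) (pi ^ n) -> associated O' x (w ^ n).
  move=> Kx x0 [a b]; have Kwn : K (w ^ n) by exact: sfXz.
  split; (split; first exact: sf_div).
    by rewrite (phiM hell hp) ?(phiV hell hp) ?phiXz ?wE //; exact: sfV.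
  by rewrite (phiM hell hp) ?(phiV hell hp) ?phiXz ?wE //; exact: sfV.
have unif : is_uniformizer K O' w.
  split=> //.
    by rewrite nE; split=> //; rewrite wE QE.
  move=> x Kx x0; have [n an] := pidec (phi x) (tower_phi hell hp Kx) (phi_neq0 hell hp Kx x0).
  by exists n; exact: as'.
have [HP' E] := ord_of_uniformizer KF O'V unif.
move=> Q'; rewrite /Q' -nE; split=> // x Kx x0.
apply: E => //; apply: as' => //; apply: A; first exact: (tower_phi hell hp).
exact: (phi_neq0 hell hp).
Qed.

End TowerGalois.

(** * Valuations of F and their extensions to the tower *)

Lemma expr_div_le (L : fieldType) (x : L) i d : x != 0 -> (i <= d)%N ->
  x ^+ i / x ^+ d = x^-1 ^+ (d - i).
Proof.
move=> x0 id; rewrite -[in LHS](subnK id) exprD invfM mulrCA mulfV ?expf_neq0 //.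
by rewrite mulr1 exprVn.
Qed.

Section ValringExtra.
Context {L : fieldType} (K O : set L) (KF : is_subfield K) (OV : is_valring K O).

Let OR : is_subring O. Proof. by case: OV. Qed.

Lemma uniformizer_div pi z : is_uniformizer K O pi -> nonunits O z -> O (z / pi).
Proof.
move=> [[Opi _] pi0 pidec] [Oz zN]; have [->|z0] := eqVneq z 0.
  by rewrite mul0r; exact: sr0.
have [[[|n]|n] [a b]] := pidec z (valring_sub OV Oz) z0.
- case: zN => [/eqP|]; first by rewrite (negPf z0).
  by case; move: b; rewrite expr0z mul1r.
- move: a; rewrite -exprnP exprS invfM mulrA => a.
  by rewrite -[X in O X](divfK (expf_neq0 n pi0)); apply: srM => //; exact: srX.
- case: zN => [/eqP|]; first by rewrite (negPf z0).
  case; move: b; rewrite NegzE -exprnN => b.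
  have -> : z^-1 = pi ^- n.+1 / z * pi ^+ n.+1 by rewrite mulrAC mulVf ?mul1r ?expf_neq0.
  by apply: srM => //; exact: srX.
Qed.

Lemma nonunits_pow n y : K y -> (0 < n)%N -> nonunits O (y ^+ n) -> nonunits O y.
Proof.
move=> Ky n0 Py; have [Oy|Oy] := pselect (O y); first exact: (nonunits_exp OV Oy Py).
have Py' := nonunitsV OV Ky Oy; have y0 : y != 0.
  by apply/eqP => y0; apply: Oy; rewrite y0; exact: sr0.
exfalso; apply: (nonunits1 OV); rewrite -(mulVf (expf_neq0 n y0)) -exprVn.
by apply: (nonunitsM OV) => //; apply: srX => //; case: Py'.
Qed.

Lemma associated_pow1 n y : K y -> y != 0 -> (0 < n)%N -> associated O (y ^+ n) 1 -> associated O y 1.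
Proof.
move=> Ky y0 n0; rewrite /associated !divr1 !div1r => -[a b].
have key w : K w -> w != 0 -> O (w ^+ n)^-1 -> O w^-1.
  move=> Kw w0 ow; have [//|nO] := pselect (O w^-1).
  have Pw : nonunits O w.
    by rewrite -[w]invrK; exact: (nonunitsV OV (sfV KF Kw) nO).
  have Pwn : nonunits O (w ^+ n).
    by rewrite -(prednK n0) exprSr; apply: (nonunitsM OV) => //; apply: srX => //; case: Pw.
  by have := nonunitsN1 (expf_neq0 n w0) Pwn ow.
split; last exact: key.
by rewrite -[y]invrK; apply: key; rewrite ?invr_eq0 //; [exact: sfV|rewrite exprVn invrK].
Qed.

(* A rational dependence of the valuation on that of a fixed element s yields
   a uniformizer, namely an element of least positive valuation. *)
Lemma uniformizer_exists N s : (0 < N)%N -> K s -> s != 0 -> nonunits O s ->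
  (forall z, K z -> z != 0 -> exists w : int, associated O (z ^+ N) (s ^ w)) ->
  exists pi, is_uniformizer K O pi.
Proof.
move=> N0 Ks s0 sN dep.
(* Here n is the value of z in units of the N-th part of the value of s; the least positive n
   belongs to a uniformizer. *)
have ex : exists n, (0 < n)%N && `[< exists z, [/\ K z, z != 0 & associated O (z ^+ N) (s ^+ n)] >].
  by exists N; rewrite N0; apply/asboolP; exists s; split=> //; exact: (associated_refl OR (expf_neq0 N s0)).
case: (ex_minnP ex) => m /andP[m0 /asboolP [pi [Kpi pi0 [am bm]]]] mmin.
have Os : O s by case: sN.
have piN : nonunits O pi.
  apply: (nonunits_pow Kpi N0).
  have -> : pi ^+ N = (pi ^+ N / s ^+ m) * s ^+ m.-1 * s.
    by rewrite -mulrA -exprSr prednK // divfK // expf_neq0.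
  by apply: (nonunitsM OV) => //; apply: srM => //; exact: srX.
exists pi; split=> // z Kz z0; have [w wz] := dep z Kz z0.
pose qq := (w %/ m%:Z)%Z; pose r := (w %% m%:Z)%Z.
have Kpq : K (pi ^ qq) by exact: sfXz.
have pq0 : pi ^ qq != 0 by rewrite expfz_neq0.
pose y := z / pi ^ qq.
have Ky : K y by exact: sf_div.
have y0 : y != 0 by rewrite mulf_neq0 // invr_eq0.
have m0' : m%:Z != 0 by lia.
have r0 : 0 <= r by exact: modz_ge0.
have rm : r < m%:Z by rewrite ltz_pmod; lia.
have yr : associated O (y ^+ N) (s ^ r).
  have -> : s ^ r = s ^ w / (s ^+ m) ^ qq.
    have E : s ^ (qq * m%:Z) = (s ^+ m) ^ qq by rewrite mulrC -exprz_exp.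
    have -> : s ^ w = (s ^+ m) ^ qq * s ^ r.
      by rewrite -E -expfzDr //; congr (_ ^ _); exact: divz_eq.
    by rewrite mulrAC divff ?mul1r // expfz_neq0 // expf_neq0.
  rewrite /y expr_div_n; apply: (associatedM OR wz); apply: (associatedV).
  have -> : (pi ^ qq) ^+ N = (pi ^+ N) ^ qq by rewrite !exprnP exprzAC.
  exact: (associatedXz OR).
exists qq.
have [req|rpos] := eqVneq r 0; last first.
  have rE : (absz r)%:Z = r by rewrite gez0_abs.
  have : (m <= absz r)%N.
    apply: mmin; apply/andP; split; first by lia.
    by apply/asboolP; exists y; split=> //; move: yr; rewrite -rE -exprnP.
  by lia.
move: yr; rewrite req expr0z => /(associated_pow1 Ky y0 N0) y1.
have -> : z = y * pi ^ qq by rewrite divfK.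
rewrite -{2}[pi ^ qq]mul1r; apply: (associatedM OR y1).
exact: (associated_refl OR pq0).
Qed.

End ValringExtra.

(** * Every valuation ring of F is discrete *)

Section FunctionFieldValuations.
Context (ell : nat) (hell : prime ell) (F : fieldExtType {fraction {poly 'F_ell}}).

Local Notation F0 := {fraction {poly 'F_ell}}.
Local Notation pfe := (@prime_field_embedding ell F).
Local Notation "x %:F" := (@FracField.tofrac {poly 'F_ell} x).
Local Notation kap := (constants F).
Local Notation x := (gen_x F).

Context (O : set F) (OV : is_valring [set: F] O).

Let OR : is_subring O. Proof. by case: OV. Qed.
Let TF : is_subfield [set: F]. Proof. exact: is_subfieldT. Qed.

Lemma valring_pfe a : O (pfe a).
Proof. by rewrite -[a]natr_Zp rmorph_nat; exact: sr_nat. Qed.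

Lemma valring_constants z : kap z -> O z.
Proof.
move=> /(constantsP hell) [r [r0 zr]].
apply: (@valring_integral _ setT O TF OV ('X^(ell ^ r) - 'X)) => //.
- have A1 : (1 < ell ^ r)%N.
    by apply: leq_trans (prime_gt1 hell) _; rewrite -{1}[ell]expn1 leq_exp2l // prime_gt1.
  by rewrite monicE lead_coefDl ?lead_coefXn // size_polyXn size_polyN size_polyX.
- by apply: coefs_inB => //; [exact: coefs_inXn|exact: coefs_inX].
- by rewrite rootE !hornerE zr subrr.
Qed.

Lemma valring_constants_unit z : kap z -> z != 0 -> ~ nonunits O z.
Proof.
move=> kz z0 /(nonunitsN1 z0); apply; apply: valring_constants.
exact: sfV (constants_subfield F) kz.
Qed.

Lemma valring_base_proper : exists c : F0, ~ O c%:A.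
Proof.
apply: contrapT => H; have [_ _ _ [z _ nOz]] := OV; apply: nOz.
have [h [hm hz _]] := minPoly_base z.
apply: (@valring_integral _ setT O TF OV (map_poly (in_alg F) h)) => //.
  by rewrite map_monic.
by move=> i; rewrite coef_map /=; apply: contrapT => nO; apply: H; exists h`_i.
Qed.

Lemma base_associated (s : F) : s != 0 ->
  (forall h : {poly 'F_ell}, h != 0 -> exists j : int, associated O (h%:F)%:A (s ^ j)) ->
  forall c : F0, c != 0 -> exists j : int, associated O c%:A (s ^ j).
Proof.
move=> s0 H c c0; have [a [b [b0 cE]]] := frac_repr c.
have a0 : a != 0 by apply: contra_neq c0 => a0; rewrite cE a0 tofrac0 mul0r.
have [i ai] := H a a0; have [j bj] := H b b0; exists (i - j).
have -> : c%:A = (a%:F)%:A / (b%:F)%:A :> F.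
  by rewrite cE -[LHS]/(in_alg F _) fmorph_div.
by rewrite expfzDr // -invr_expz; apply: (associatedM OR ai); exact: associatedV.
Qed.

(** The valuation is first determined on F_ell(x): if x is integral, s is a polynomial of least
    degree among the nonunits; otherwise s is 1 / x. *)
Lemma base_uniformizer : exists s : F, [/\ s != 0, nonunits O s &
  forall c : F0, c != 0 -> exists j : int, associated O c%:A (s ^ j)].
Proof.
have polyO (h : {poly 'F_ell}) : O x -> O (h%:F)%:A.
  move=> Ox; rewrite poly_in_F; apply: sr_horner => // i; rewrite coef_map.
  exact: valring_pfe.
have A0 (h : {poly 'F_ell}) : h != 0 -> (h%:F)%:A != 0 :> F.
  by move=> h0; rewrite scaler_eq0 tofrac_eq0 (negPf h0) oner_eq0.
have [Ox|nOx] := pselect (O x).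
  have ex : exists n, `[< exists f : {poly 'F_ell}, [/\ f != 0, nonunits O (f%:F)%:A & size f = n] >].
    apply: contrapT => H; have [c nOc] := valring_base_proper; apply: nOc.
    have [a [b [b0 ->]]] := frac_repr c.
    rewrite -[_%:A]/(in_alg F _) fmorph_div; apply: srM => //; first exact: polyO.
    have [_ //] := unitP OR (polyO b Ox) (fun Pb => H (ex_intro _ (size b) (asboolT (ex_intro _ b (And3 b0 Pb erefl))))).
  case: (ex_minnP ex) => d /asboolP [f [f0 Pf fs]] fmin.
  exists (f%:F)%:A; split=> //; first exact: A0.
  apply: base_associated; first exact: A0.
  move=> h; have [n] := ubnP (size h); elim: n h => // n IH h hn h0.
  have [Ph|uh] := pselect (nonunits O (h%:F)%:A); last first.
    by exists 0; rewrite expr0z; apply: (associated1 OR) => //; [exact: A0|exact: polyO].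
  have hE := divp_eq h f.
  have r0 : h %% f = 0.
    apply: contrapT => /eqP r0.
    have : (d <= size (h %% f)%R)%N.
      apply: fmin; apply/asboolP; exists (h %% f); split=> //.
      have -> : h %% f = h - h %/ f * f by rewrite {2}hE addrC addKr.
      rewrite tofracB tofracM scalerBl.
      apply: (nonunitsD TF OV) => //; apply: (nonunitsN OV).
      rewrite -[_%:A]/(in_alg F _) rmorphM; apply: (nonunitsM OV) => //; exact: polyO.
    by rewrite -fs leqNgt ltn_modp f0.
  have hE' : h = h %/ f * f by rewrite {1}hE r0 addr0.
  have q0 : h %/ f != 0 by apply: contra_neq h0 => q0; rewrite hE' q0 mul0r.
  have f1 : (1 < size f)%N.
    rewrite ltnNge; apply/negP => f1; move: Pf f0; rewrite [f]size1_polyC // => Pf.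
    rewrite polyC_eq0 => c0; move: Pf; rewrite poly_in_F map_polyC hornerC /=.
    apply: valring_constants_unit; first exact: algebraic_id.
    by rewrite fmorph_eq0.
  have qn : (size (h %/ f)%R < n)%N.
    have sE := size_mul q0 f0; rewrite -hE' in sE.
    have q1 : (0 < size (h %/ f)%R)%N by rewrite size_poly_gt0.
    move: hn; rewrite sE ltnS; apply: leq_trans.
    by move: f1 q1; case: (size f) => [|[|m]] // _; rewrite addnS /= addnS ltnS leq_addr.
  have [j jq] := IH (h %/ f) qn q0.
  exists (j + 1); rewrite hE' tofracM -[_%:A]/(in_alg F _) rmorphM expfzDr ?A0 // expr1z.
  by apply: (associatedM OR jq); exact: (associated_refl OR (A0 f f0)).
have x0 : x != 0 by apply/eqP => x0; apply: nOx; rewrite x0; exact: sr0.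
have Px := nonunitsV OV (I : [set: F] x) nOx.
exists x^-1; split=> //; first by rewrite invr_eq0.
apply: base_associated; first by rewrite invr_eq0.
move=> h h0; exists (- (size h).-1%:Z); rewrite exprz_inv opprK -exprnP.
have hn : (0 < size h)%N by rewrite size_poly_gt0.
set d := (size h).-1.
(* This quotient differs from the leading coefficient of h by a nonunit, so it is a unit. *)
pose u := (h%:F)%:A / x ^+ d.
have xd0 : x ^+ d != 0 by rewrite expf_neq0.
have uE : u = pfe (lead_coef h) + \sum_(i < d) pfe h`_i * x^-1 ^+ (d - i).
  rewrite /u poly_in_F (@horner_coef_wide _ d.+1); last by rewrite size_map_poly /d prednK.
  rewrite big_ord_recr /= coef_map /= mulrDl mulfK // addrC; congr (_ + _).
  rewrite mulr_suml; apply: eq_bigr => i _; rewrite coef_map /= -mulrA; congr (_ * _).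
  by rewrite expr_div_le // ltnW.
have PS : nonunits O (\sum_(i < d) pfe h`_i * x^-1 ^+ (d - i)).
  apply: (nonunits_sum TF OV) => i _; apply: (nonunitsM OV); first exact: valring_pfe.
  have il : (i < d)%N := ltn_ord i.
  rewrite -(subnSK il) exprSr; apply: (nonunitsM OV) => //.
  by apply: srX => //; case: Px.
have Ou : O u by rewrite uE; apply: srD => //; [exact: valring_pfe|case: PS].
have nPu : ~ nonunits O u.
  move=> Pu; have := nonunitsD TF OV Pu (nonunitsN OV PS).
  rewrite uE addrK; apply: valring_constants_unit; first exact: algebraic_id.
  by rewrite fmorph_eq0 lead_coef_eq0.
by have [_ Oui] := unitP OR Ou nPu; split=> //; move: Oui; rewrite /u invf_div.
Qed.

(** Two terms c_i z^i and c_j z^j of the minimal equation of z are associated, so z^(j - i) has the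
    value of an element of F_ell(x), hence of a power of s. As j - i is at most the degree n of F,
    the exponent n! serves for every z. *)
Lemma F_uniformizer : exists pi, is_uniformizer [set: F] O pi.
Proof.
have [s [s0 sN sdec]] := base_uniformizer.
set n := \dim {:F}.
apply: (uniformizer_exists TF OV (fact_gt0 n) I s0 sN) => z _ z0.
have [h [hm hz hs]] := minPoly_base z.
pose u (i : 'I_(size h)) : F := (h`_i)%:A * z ^+ i.
have us : \sum_i u i = 0.
  have := rootP hz; rewrite horner_coef size_map_poly => {2}<-.
  by apply: eq_bigr => i _; rewrite /u coef_map.
have hn : (0 < size h)%N by rewrite size_poly_gt0 monic_neq0.
have un : exists i, u i != 0.
  have lt : ((size h).-1 < size h)%N by rewrite prednK.
  exists (Ordinal lt); rewrite /u /= -lead_coefE (monicP hm) scale1r mul1r.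
  by rewrite expf_neq0.
have key (i j : 'I_(size h)) : (i < j)%N -> u i != 0 -> u j != 0 ->
    associated O (u i) (u j) -> exists w : int, associated O (z ^+ n`!) (s ^ w).
  move=> ij; rewrite /u !mulf_eq0 !negb_or => /andP[hi0 zi0] /andP[hj0 zj0] aij.
  have ci : h`_i != 0 by apply: contra_neq hi0 => ->; rewrite scale0r.
  have cj : h`_j != 0 by apply: contra_neq hj0 => ->; rewrite scale0r.
  have [w1 a1] := sdec _ ci; have [w2 a2] := sdec _ cj.
  have zji : associated O (z ^+ (j - i)) (s ^ (w1 - w2)).
    have -> : z ^+ (j - i) = ((h`_i)%:A / (h`_j)%:A) * (((h`_j)%:A * z ^+ j) / ((h`_i)%:A * z ^+ i)).
      have E (a b v w : F) : a != 0 -> b != 0 -> w != 0 -> v = a / b * (b * (v * w) / (a * w)).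
        by move=> a0 b0 w0; field; rewrite a0 b0 w0.
      have -> : z ^+ j = z ^+ (j - i) * z ^+ i by rewrite -exprD subnK // ltnW.
      exact: E.
    rewrite -[s ^ _]mulr1; apply: (associatedM OR).
      by rewrite expfzDr // -invr_expz; apply: (associatedM OR a1); exact: associatedV.
    by have [a b] := aij; split; rewrite ?divr1 // div1r invf_div.
  have /dvdnP [m mE] : (j - i %| n`!)%N.
    apply: dvdn_fact; have := ltn_ord j; rewrite subn_gt0 ij /=.
    by move=> jh; have := leq_trans jh hs; rewrite ltnS; apply: leq_trans; exact: leq_subr.
  exists ((w1 - w2) * m%:Z); rewrite mE mulnC exprM -exprz_exp -exprnP.
  exact: (associatedX OR).
have [i [j [ij ui uj aij]]] := valring_two_terms TF OV (fun=> I) us un.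
move: ij; rewrite -val_eqE neq_ltn => /orP[ij|ji]; first exact: (key i j).
by apply: (key j i) => //; exact: associated_sym.
Qed.

End FunctionFieldValuations.

(** * Residue fields are algebraic over the prime field *)

Section Residues.
Context (ell : nat) (hell : prime ell) (F : fieldExtType {fraction {poly 'F_ell}}).

Local Notation F0 := {fraction {poly 'F_ell}}.
Local Notation pfe := (@prime_field_embedding ell F).
Local Notation "x %:F" := (@FracField.tofrac {poly 'F_ell} x).
Local Notation kap := (constants F).

Context (O : set F) (OV : is_valring [set: F] O).

Let OR : is_subring O. Proof. by case: OV. Qed.
Let TF : is_subfield [set: F]. Proof. exact: is_subfieldT. Qed.

(* z is algebraic over F_ell(pi); reducing a primitive relation modulo pi
   yields a nonzero polynomial over F_ell whose value at z is a nonunit. *)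
Lemma residue_root z : O z -> exists h : {poly 'F_ell}, h != 0 /\ nonunits O (map_poly pfe h).[z].
Proof.
move=> Oz; have [pi [piN pi0 _]] := F_uniformizer hell OV.
have Opi : O pi by case: piN.
have npi : ~ kap pi by move=> /(valring_constants_unit hell OV) /(_ pi0).
have [fm [fmE falg]] := transcendental_extension npi.
have [h h0 hz] := falg z.
have [P [c [P0 c0 PE]]] := frac_poly_clear h0.
have Uz : (map_poly (map_poly pfe) P).[z, pi] = 0.
  rewrite horner2_map -map_poly_comp (_ : map_poly _ P = map_poly fm (c *: h)).
    by rewrite map_polyZ hornerZ (rootP hz) mulr0.
  by rewrite -PE -map_poly_comp; apply: eq_map_poly => a /=; rewrite fmE.
have ex : exists n, `[< exists G : {poly {poly 'F_ell}},
    [/\ G != 0, (map_poly (map_poly pfe) G).[pi, z] = 0 & size G = n] >].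
  exists (size (swapXY P)); apply/asboolP; exists (swapXY P); split=> //.
    by rewrite swapXY_eq0.
  by rewrite -swapXY_map horner2_swapXY.
case: (ex_minnP ex) => d /asboolP [G [G0 Gz Gs]] dmin.
have [G' [g GE]] : exists G' g, G = G' * 'X + g%:P.
  elim/poly_ind: G {G0 Gz Gs dmin} => [|G' g _]; last by exists G', g.
  by exists 0, 0; rewrite mul0r add0r.
have mapG : map_poly (map_poly pfe) G = map_poly (map_poly pfe) G' * 'X + (map_poly pfe g)%:P.
  by rewrite GE rmorphD rmorphM /= map_polyX map_polyC.
have OG' : O (map_poly (map_poly pfe) G').[pi, z].
  rewrite horner2_map; apply: sr_horner => // i; rewrite !coef_map.
  apply: sr_horner => // j; rewrite coef_map; exact: valring_pfe.
exists g; split.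
  apply/eqP => g0; have G'0 : G' != 0.
    by apply: contra_neq G0 => G'0; rewrite GE G'0 g0 mul0r addr0.
  have : (d <= size G')%N.
    apply: dmin; apply/asboolP; exists G'; split=> //.
    move: Gz; rewrite mapG g0 map_poly0 addr0 hornerMX hornerM hornerC => /eqP.
    by rewrite mulf_eq0 (negPf pi0) orbF => /eqP.
  by rewrite -Gs GE g0 addr0 size_mulX // ltnn.
move: Gz; rewrite mapG hornerD hornerMX hornerC hornerD hornerM hornerC addrC => /eqP.
by rewrite addr_eq0 => /eqP ->; apply: (nonunitsN OV); exact: (nonunitsM OV).
Qed.

(** The argument of [algebraic_frob_fixed] carried out modulo nonunits; injectivity of Frobenius
    becomes the fact that a nonunit power has a nonunit base. *)
Lemma residue_frob z : O z -> exists r, (0 < r)%N /\ nonunits O (z ^+ (ell ^ r) - z).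
Proof.
move=> Oz; have [h [h0 Ph]] := residue_root Oz.
have [i [j [ij fij]]] :=
  nat_pigeonhole (fun i : nat => poly_rV ('X^(ell ^ i) %% h) : 'rV['F_ell]_(size h)).
have {}fij : ('X^(ell ^ i) %% h) = ('X^(ell ^ j) %% h).
  have sz n : (size ('X^n %% h)%R <= size h)%N by rewrite ltnW // ltn_modp.
  by rewrite -(poly_rV_K (sz _)) fij poly_rV_K.
have zE n : z ^+ n = (map_poly pfe ('X^n %/ h)).[z] * (map_poly pfe h).[z] + (map_poly pfe ('X^n %% h)).[z].
  have := congr1 (fun p => (map_poly pfe p).[z]) (divp_eq ('X^n) h).
  by rewrite /= rmorphD rmorphM /= map_polyXn hornerD hornerM hornerXn.
exists (j - i)%N; split; first by rewrite subn_gt0.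
have Ozz : O (z ^+ (ell ^ (j - i)) - z) by apply: srB => //; exact: srX.
apply: (nonunits_exp OV (n := (ell ^ i)%N)) => //.
rewrite (frobB hell (pcharF hell F)) -exprM -expnD subnK; last exact: ltnW.
rewrite !zE fij opprD addrACA subrr addr0 -mulrBl.
apply: (nonunitsM OV) => //; apply: srB => //; apply: sr_horner => // n;
  rewrite coef_map; exact: valring_pfe.
Qed.

Lemma residue_frob_mul z r m : O z -> nonunits O (z ^+ (ell ^ r) - z) ->
  nonunits O (z ^+ (ell ^ (r * m)) - z).
Proof.
move=> Oz Pr; elim: m => [|m IH].
  by rewrite muln0 expn0 expr1 subrr; exact: (nonunits0 OV).
have -> : z ^+ (ell ^ (r * m.+1)) - z =
    (z ^+ (ell ^ (r * m)) - z) ^+ (ell ^ r) + (z ^+ (ell ^ r) - z).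
  rewrite (frobB hell (pcharF hell F)) mulnS addnC expnD exprM.
  by rewrite addrA subrK.
apply: (nonunitsD TF OV) => //.
have e0 : (0 < ell ^ r)%N by rewrite expn_gt0 prime_gt0.
rewrite -(prednK e0) exprS mulrC; apply: (nonunitsM OV) => //.
by apply: srX => //; case: IH.
Qed.

Lemma residue_frob_coefs (h : {poly F}) : coefs_in O h -> forall m, exists r, (0 < r)%N /\
  forall i, (i < m)%N -> nonunits O (h`_i ^+ (ell ^ r) - h`_i).
Proof.
move=> hO; elim=> [|m [r [r0 rP]]]; first by exists 1%N.
have [r' [r'0 r'P]] := residue_frob (hO m).
exists (r * r')%N; split; first by rewrite muln_gt0 r0.
move=> i; rewrite ltnS leq_eqVlt => /orP[/eqP ->|im].
  by rewrite mulnC; exact: residue_frob_mul.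
by apply: residue_frob_mul => //; exact: rP.
Qed.

End Residues.

(** * Constant extensions are unramified *)

Section TowerPrimes.
Context (ell : nat) (hell : prime ell) (F : fieldExtType {fraction {poly 'F_ell}}).
Context (Omega : closedFieldType) (iota : {rmorphism F -> Omega}).
Context (p : nat) (hp : prime p).

Local Notation kap := (constants F).
Local Notation "h ^i" := (map_poly iota h) (at level 2, format "h ^i").
Local Notation q0 := (q0 hell F).
Local Notation Fr := (@Fr ell hell F Omega p).
Local Notation theta := (@theta ell hell F Omega iota p hp).
Local Notation phi := (@phi ell hell F Omega iota p).
Local Notation phin := (@phin ell hell F Omega iota p).
Local Notation K := (tower iota p).
Local Notation k := (const_tower iota p).
Local Notation layer := (layer iota p).
Local Notation tower_norm := (@tower_norm ell hell F Omega iota p).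

Let KF : is_subfield K. Proof. exact: (tower_subfield hell). Qed.
Let KR : is_subring K. Proof. exact: subfield_subring. Qed.
Let TF : is_subfield [set: F]. Proof. exact: is_subfieldT. Qed.
Let kF : is_subfield k. Proof. exact: (const_tower_subfield hell). Qed.
Let kR : is_subring k. Proof. exact: subfield_subring. Qed.

Lemma const_tower_sub : k `<=` K.
Proof. by move=> z /(const_towerP hell iota hp) [n zn]; exact: (tower_Fr iota hp zn). Qed.

Lemma layer_algebraic n z : layer n z -> algebraicOver iota z.
Proof.
move=> /(layerP hell iota hp) [h ->]; rewrite horner_coef.
apply: (big_ind (algebraicOver iota)) => [||i _]; [exact: algebraic0|exact: algebraic_add|].
apply: algebraic_mul; first by rewrite coef_map; exact: algebraic_id.
elim: (nat_of_ord i) => [|m IH]; first by rewrite expr0; exact: algebraic1.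
by rewrite exprS; apply: algebraic_mul => //; exact: (theta_algebraic hell iota hp).
Qed.

Section ValringOfTower.
Context (O : set Omega) (OV : is_valring K O).
Let OR : is_subring O. Proof. by case: OV. Qed.

Lemma tower_valring_Fr n z : Fr n z -> O z.
Proof.
move=> zn; apply: (@valring_integral _ K O KF OV ('X^(q0 ^ (p ^ n)) - 'X)).
- exact: (tower_Fr iota hp zn).
- have A1 := card_gt1 hell F hp n.
  by rewrite monicE lead_coefDl ?lead_coefXn // size_polyXn size_polyN size_polyX.
- by apply: coefs_inB => //; [exact: coefs_inXn|exact: coefs_inX].
- by move: zn; rewrite /Fr /= rootE !hornerE => ->; rewrite subrr.
Qed.

(** The restriction cannot be all of F, since the tower is integral over F and [O] is integrally
    closed. *)
Lemma restrict_valring : is_valring [set: F] (iota @^-1` O).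
Proof.
split=> //.
- apply/is_subringP; split; rewrite /preimage /=.
  + by rewrite rmorph1; exact: sr1.
  + by move=> x y Ox Oy; rewrite rmorphB; exact: srB.
  + by move=> x y Ox Oy; rewrite rmorphM; exact: srM.
- move=> z _; have := valring_total OV (tower_iota iota p z).
  by rewrite -fmorphV.
- apply: contrapT => H; have [_ _ _ [z [n _ zn] nOz]] := OV; apply: nOz.
  have /integral_algebraic [h hm hz] := layer_algebraic zn.
  apply: (@valring_integral _ K O KF OV h^i) => //; first by exists n.
    by rewrite map_monic.
  move=> i; rewrite coef_map; apply: contrapT => nO; apply: H.
  by exists h`_i.
Qed.

Local Notation OF := (iota @^-1` O).
Let OFR : is_subring OF. Proof. by case: restrict_valring. Qed.

Lemma iota_nonunits z : nonunits OF z <-> nonunits O (iota z).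
Proof.
rewrite /nonunits /preimage /= fmorphV; split=> -[Oz [z0|nO]]; split=> //; try by right.
  by left; rewrite z0 rmorph0.
by left; apply: (fmorph_inj iota); rewrite rmorph0.
Qed.

Lemma iota_associated x y : associated OF x y -> associated O (iota x) (iota y).
Proof. by rewrite /associated /preimage /= !fmorph_div. Qed.

Lemma horner_valring n (h : {poly F}) x : Fr n x -> coefs_in OF h -> O h^i.[x].
Proof.
move=> xn hO; apply: sr_horner => // [i|]; last exact: tower_valring_Fr xn.
by rewrite coef_map; exact: hO.
Qed.

Section Etale.
Context (pi : F) (piU : is_uniformizer [set: F] OF pi).

Lemma clear_denominators (h : {poly F}) : exists i, coefs_in OF (pi ^+ i *: h).
Proof.
have [[Opi _] pi0 pidec] := piU.
suff H m : exists i, forall j, (j < m)%N -> OF (pi ^+ i * h`_j).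
  have [i iP] := H (size h); exists i => j; rewrite coefZ.
  have [/iP //|hj] := ltnP j (size h).
  by rewrite nth_default // mulr0; exact: sr0.
elim: m => [|m [i iP]]; first by exists 0%N.
have [i' i'P] : exists i', OF (pi ^+ i' * h`_m).
  have [->|hm0] := eqVneq h`_m 0; first by exists 0%N; rewrite mulr0; exact: sr0.
  have [[n|n] [a b]] := pidec _ I hm0.
    exists 0%N; rewrite mul1r -[h`_m](divfK (expfz_neq0 n pi0)).
    by apply: srM => //; exact: srX.
  by exists n.+1; move: a; rewrite NegzE -exprnN invrK mulrC.
exists (i + i')%N => j; rewrite ltnS leq_eqVlt => /orP[/eqP ->|jm].
  by rewrite exprD -mulrA; apply: srM => //; exact: srX.
by rewrite addnC exprD -mulrA; apply: srM => //; [exact: srX|exact: iP].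
Qed.

(* The coefficients of h are fixed modulo pi by a common power of Frobenius,
   which also fixes theta; hence a nonunit a = h(theta) is pi times an element
   of the same kind, up to the unit a^(M-1) - 1. *)
Lemma etale_step n (h : {poly F}) : coefs_in OF h -> nonunits O h^i.[theta n] ->
  h^i.[theta n] != 0 ->
  exists g : {poly F}, [/\ coefs_in OF g, g^i.[theta n] != 0 &
    associated O h^i.[theta n] (iota pi * g^i.[theta n])].
Proof.
move=> hO Pa a0; set a := h^i.[theta n] in Pa a0 *.
have [[Opi _] pi0 pidec] := piU.
have FV := restrict_valring.
have [r [r0 rP]] := residue_frob_coefs hell FV hO (size h).
have [r1 [r10 q0E]] := q0_ell hell F.
pose m := (r * (r1 * p ^ n))%N.
have xm : theta n ^+ (ell ^ m) = theta n.
  rewrite /m mulnC; apply: (frob_fixed_mul); rewrite expnM -q0E.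
  exact: (theta_Fr hell iota hp n).
have hm i : nonunits OF (h`_i ^+ (ell ^ m) - h`_i).
  have [ih|hi] := ltnP i (size h); last first.
    rewrite nth_default // expr0n expn_eq0 (gtn_eqF (prime_gt0 hell)) /= subrr.
    exact: (nonunits0 FV).
  exact: (residue_frob_mul hell FV _ (hO i) (rP i ih)).
pose g := \poly_(i < size h) ((h`_i ^+ (ell ^ m) - h`_i) / pi).
have gO : coefs_in OF g.
  move=> i; rewrite coef_poly; case: ltnP => _; last exact: (sr0 OFR).
  exact: (uniformizer_div FV piU (hm i)).
have E : a ^+ (ell ^ m) - a = iota pi * g^i.[theta n].
  rewrite /a horner_coef (frob_sum hell (pcharO hell iota)).
  rewrite (@horner_coef_wide _ (size h)); last by rewrite size_map_poly size_poly.
  rewrite size_map_poly -sumrB mulr_sumr; apply: eq_bigr => i _.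
  rewrite exprMn -exprM mulnC exprM xm -mulrBl mulrA; congr (_ * _).
  by rewrite !coef_map coef_poly ltn_ord /= rmorphM rmorphB rmorphXn fmorphV mulrC divfK // fmorph_eq0.
have M1 : (1 < ell ^ m)%N.
  apply: leq_trans (prime_gt1 hell) _; rewrite -{1}[ell]expn1 leq_exp2l ?prime_gt1 //.
  by rewrite /m !muln_gt0 r0 r10 expn_gt0 prime_gt0.
pose u := a ^+ (ell ^ m).-1 - 1.
have Oa : O a by case: Pa.
have Ou : O u by apply: srB => //; [exact: srX|exact: sr1].
have Pa1 : nonunits O (a ^+ (ell ^ m).-1).
  rewrite -[(ell ^ m).-1]prednK; last by rewrite -ltnS prednK // ltnW.
  by rewrite exprS mulrC; apply: (nonunitsM OV) => //; exact: srX.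
have nPu : ~ nonunits O u.
  move=> Pu; have := nonunitsD KF OV Pa1 (nonunitsN OV Pu).
  by rewrite /u opprB addrC subrK; exact: (nonunits1 OV).
have [u0 Oui] := unitP OR Ou nPu.
have E' : a * u = iota pi * g^i.[theta n].
  by rewrite -E /u mulrBr mulr1 -exprS prednK // ltnW.
have g0 : g^i.[theta n] != 0.
  by apply/eqP => g0; move/eqP: E'; rewrite g0 mulr0 mulf_eq0 (negPf a0) (negPf u0).
exists g; split=> //; rewrite -E' /associated.
by split; [rewrite invfM mulrA divff ?mul1r|rewrite mulrAC divff ?mul1r].
Qed.

(* A nonzero a = h(theta) divides its tower_norm, which bounds its valuation. *)
Lemma etale_valuation n (h : {poly F}) : coefs_in OF h -> h^i.[theta n] != 0 ->
  exists j : nat, associated O h^i.[theta n] (iota pi ^+ j).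
Proof.
move=> hO a0; have [[Opi _] pi0 pidec] := piU.
have ln : layer n h^i.[theta n] by apply/(layerP hell iota hp); exists h.
have Ka : K h^i.[theta n] by exists n.
have [c cE] := norm_iota hell hp ln.
have c0 : c != 0.
  by rewrite -(fmorph_eq0 iota) -cE; exact: (norm_neq0 hell hp).
have FrR := subfield_subring (Fr_subfield hell iota p n).
have Oi i : O (phin i h^i.[theta n]).
  rewrite (phin_layer hell iota hp); apply: (@horner_valring n) => //.
  by apply: srX => //; exact: (theta_Fr hell iota hp n).
have Oca : O (iota c / h^i.[theta n]).
  rewrite -cE /tower_norm; have m0 : (0 < p ^ n)%N by rewrite expn_gt0 prime_gt0.
  rewrite (bigD1 (Ordinal m0)) //= mulrAC divff // mul1r.
  by apply: sr_prod => // i _; exact: Oi.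
have Oc : OF c by rewrite /preimage /= -cE; apply: sr_prod => // i _; exact: Oi.
have [J cJ] : exists J : nat, associated OF c (pi ^+ J).
  have [[J|J] [x y]] := pidec c I c0; first by exists J.
  exists 0%N; rewrite expr0; split; first by rewrite divr1.
  rewrite div1r; move: y; rewrite NegzE -exprnN => y.
  have -> : c^-1 = pi ^- J.+1 / c * pi ^+ J.+1 by rewrite mulrAC mulVf ?mul1r ?expf_neq0.
  by apply: srM => //; exact: srX.
have iE m : iota (pi ^+ m) = iota pi ^+ m by rewrite rmorphXn.
(* Induction on the order J of c, a multiple of h(theta): a nonunit h(theta) is associated to pi
   g(theta), and c / pi is then a multiple of g(theta). *)
elim: J c h hO a0 c0 Oca cJ {ln Ka cE Oi Oc} => [|J IH] c h hO a0 c0 Oca cJ;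
  set a := h^i.[theta n] in a0 Oca *; have Oa : O a by apply: (@horner_valring n) => //; exact: (theta_Fr hell iota hp n).
  have [c1 c2] := iota_associated cJ; rewrite rmorph1 div1r in c2.
  exists 0%N; rewrite expr0 /associated divr1 div1r; split=> //.
  by rewrite -[a^-1](mulKf (_ : iota c != 0)) ?fmorph_eq0 //; exact: srM.
have [Pa|nPa] := pselect (nonunits O a); last first.
  by exists 0%N; rewrite expr0; exact: (associated1 OR).
have [g [gO g0 ag]] := etale_step hO Pa a0.
have ip0 : iota pi != 0 by rewrite fmorph_eq0.
have [j aj] : exists j : nat, associated O g^i.[theta n] (iota pi ^+ j).
  apply: (IH (c / pi)) => //.
  - by rewrite mulf_neq0 // invr_eq0.
  - have [x y] := ag; rewrite fmorph_div.
    have -> : iota c / iota pi / g^i.[theta n] = (iota c / a) * (a / (iota pi * g^i.[theta n])).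
      by rewrite mulrA divfK // invfM mulrA.
    exact: srM.
  - have -> : pi ^+ J = pi ^+ J.+1 / pi by rewrite exprSr mulfK.
    have pv : pi^-1 != 0 by rewrite invr_eq0.
    exact: (associatedM OFR cJ (associated_refl OFR pv)).
exists j.+1; apply: (associated_trans OR _ ag); first by rewrite mulf_neq0.
by rewrite exprS; apply: (associatedM OR) => //; exact: (associated_refl OR).
Qed.

(** A power of pi makes any element of the tower a polynomial in theta with integral coefficients,
    to which [etale_valuation] applies. This is what keeps valuation rings discrete in the infinite
    tower. *)
Lemma tower_uniformizer : is_uniformizer K O (iota pi).
Proof.
have [piN pi0 pidec] := piU; have ip0 : iota pi != 0 by rewrite fmorph_eq0.
split=> //; first exact/iota_nonunits.
move=> z [n _ /(layerP hell iota hp) [h ->]] z0.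
have [i hO] := clear_denominators h.
have E : (pi ^+ i *: h)^i.[theta n] = iota pi ^+ i * h^i.[theta n].
  by rewrite map_polyZ hornerZ rmorphXn.
have [|j aj] := @etale_valuation n _ hO; first by rewrite E mulf_neq0 // expf_neq0.
exists (j%:Z - i%:Z); rewrite expfzDr // -exprnP -exprnN.
have -> : h^i.[theta n] = (pi ^+ i *: h)^i.[theta n] * (iota pi ^- i).
  by rewrite E mulrAC divff ?mul1r ?expf_neq0.
apply: (associatedM OR) => //; apply: (associated_refl OR).
by rewrite invr_eq0 expf_neq0.
Qed.
End Etale.

Lemma tower_valring_prime : [/\ Defs.primes K (nonunits O),
  Defs.primes [set: F] (iota @^-1` nonunits O) &
  forall x, x != 0 -> ord K (nonunits O) (iota x) = ord [set: F] (iota @^-1` nonunits O) x].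
Proof.
have [pi piU] := F_uniformizer hell restrict_valring.
have [HQ oQ] := ord_of_uniformizer KF OV (tower_uniformizer piU).
have [HP oP] := ord_of_uniformizer TF restrict_valring piU.
have nE : iota @^-1` nonunits O = nonunits OF.
  by apply/seteqP; split=> z /iota_nonunits.
rewrite nE; split=> // x x0; have [_ _ pidec] := piU.
have [n an] := pidec x I x0; rewrite (oP x n) //; apply: oQ.
- exact: tower_iota.
- by rewrite fmorph_eq0.
have := iota_associated an; suff -> : iota (pi ^ n) = iota pi ^ n by [].
by case: n {an} => n; rewrite ?NegzE -?exprnP -?exprnN ?fmorphV rmorphXn.
Qed.

End ValringOfTower.

End TowerPrimes.

Lemma prime_valring (L : fieldType) (K P : set L) : is_subfield K -> Defs.primes K P ->
  is_valring K (oge K P 0) /\ P = nonunits (oge K P 0).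
Proof.
move=> KF HP; have [O [_ OV PE OE _]] := oge_ring KF HP.
suff <- : O = oge K P 0 by [].
by apply/seteqP; split=> z /OE.
Qed.

Lemma oge_subring (L : fieldType) (K P : set L) : is_subfield K -> Defs.primes K P ->
  is_subring (oge K P 0).
Proof. by move=> KF HP; have [[]] := prime_valring KF HP. Qed.

(** Residue field k, that is, degree 1 over k, in the form in which it is used: subtracting a
    constant makes an integral element vanish at P. *)
Definition is_rational (L : fieldType) (k K P : set L) :=
  forall z, oge K P 0 z -> exists2 c, k c & oge K P 1 (z - c).

(** * Primes of the tower and their restrictions to F *)

Section TowerPlaces.
Context (ell : nat) (hell : prime ell) (F : fieldExtType {fraction {poly 'F_ell}}).
Context (Omega : closedFieldType) (iota : {rmorphism F -> Omega}).
Context (p : nat) (hp : prime p).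

Local Notation kap := (constants F).
Local Notation "h ^i" := (map_poly iota h) (at level 2, format "h ^i").
Local Notation q0 := (q0 hell F).
Local Notation Fr := (@Fr ell hell F Omega p).
Local Notation theta := (@theta ell hell F Omega iota p hp).
Local Notation K := (tower iota p).
Local Notation k := (const_tower iota p).
Local Notation layer := (layer iota p).
Local Notation ordQ := (ord K).
Local Notation ordP := (ord [set: F]).
Local Notation ogeQ := (oge K).
Local Notation ogeP := (oge [set: F]).

Let KF : is_subfield K. Proof. exact: (tower_subfield hell). Qed.
Let KR : is_subring K. Proof. exact: subfield_subring. Qed.
Let TF : is_subfield [set: F]. Proof. exact: is_subfieldT. Qed.
Let kF : is_subfield k. Proof. exact: (const_tower_subfield hell). Qed.
Let kR : is_subring k. Proof. exact: subfield_subring. Qed.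

Lemma prime_restrict Q : Defs.primes K Q ->
  Defs.primes [set: F] (iota @^-1` Q) /\
  forall x, x != 0 -> ordQ Q (iota x) = ordP (iota @^-1` Q) x.
Proof.
move=> HQ; have [OV QE] := prime_valring KF HQ.
by have [_ H1 H2] := tower_valring_prime hell hp OV; rewrite -QE in H1 H2.
Qed.

Lemma oge_restrict Q n x : Defs.primes K Q ->
  ogeQ Q n (iota x) <-> ogeP (iota @^-1` Q) n x.
Proof.
move=> HQ; have [HP oE] := prime_restrict HQ.
have [->|x0] := eqVneq x 0.
  by rewrite rmorph0; split=> _; exact: oge0.
have ix0 : iota x != 0 by rewrite fmorph_eq0.
have Kx := tower_iota iota p x.
by split=> [/(ogeE _ _ Kx ix0)|/(ogeE _ _ I x0)] h; apply/ogeE => //; rewrite ?oE // -oE.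
Qed.

(** Some valuation ring of the tower contains the ring of P but not the inverse of its uniformizer;
    its restriction to F contains the ring of P, hence equals it by [prime_eq]. *)
Lemma prime_extend P : Defs.primes [set: F] P ->
  exists Q, Defs.primes K Q /\ iota @^-1` Q = P.
Proof.
move=> HP; have [pi [_ pi0 pi1]] := ord_uniformizer TF HP.
have PR := oge_subring TF HP.
pose C : set Omega := iota @` (ogeP P 0).
have CR : is_subring C.
  apply/is_subringP; split.
  - by exists 1; rewrite ?rmorph1 //; exact: sr1.
  - by move=> _ _ [x Ox <-] [y Oy <-]; exists (x - y); [exact: srB|rewrite rmorphB].
  - by move=> _ _ [x Ox <-] [y Oy <-]; exists (x * y); [exact: srM|rewrite rmorphM].
have CK : C `<=` K by move=> _ [x _ <-]; exact: tower_iota.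
have Cpi : C (iota pi) by exists pi => //; apply/ogeE; rewrite ?pi1.
have ip0 : iota pi != 0 by rewrite fmorph_eq0.
have nC : ~ C (iota pi)^-1.
  rewrite -fmorphV => -[y Oy /fmorph_inj yE]; move: Oy; rewrite yE.
  by move=> /(ogeE _ _ I); rewrite invr_eq0 => /(_ pi0); rewrite ordV // pi1.
have [O [OV CO nO]] := valring_exists KF CR CK Cpi ip0 nC.
have [HQ HP' oE] := tower_valring_prime hell hp OV.
exists (nonunits O); split=> //; apply/esym; apply: (prime_eq TF HP HP').
move=> x Ox; apply/(oge_restrict _ _ HQ).
have [O' [_ O'V E OE' _]] := oge_ring KF HQ.
apply/OE'; have Oix : O (iota x) by apply: CO; exists x.
have [//|nO'] := pselect (O' (iota x)).
have Pi := nonunitsV O'V (tower_iota iota p x) nO'.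
rewrite -E in Pi; have ix0 : iota x != 0.
  by apply/eqP => x0; apply: nO'; rewrite x0; apply: sr0; case: O'V.
have := nonunitsN1 _ Pi; rewrite invr_eq0 ix0 invrK => /(_ isT).
by [].
Qed.

Section AtInfinity.
Context (P : set F) (HP : Defs.primes [set: F] P) (Prat : is_rational kap [set: F] P).

Let PR : is_subring (ogeP P 0). Proof. exact: oge_subring. Qed.

(** As P is rational, each coefficient of h is a constant modulo pi. Iterated, this expands h(theta)
    in powers of pi without reference to any prime above P. *)
Lemma rational_decomp n (h : {poly F}) pi : ordP P pi = 1 -> pi != 0 ->
  coefs_in (ogeP P 0) h -> exists (g : {poly F}) c,
  [/\ coefs_in (ogeP P 0) g, k c & h^i.[theta n] = c + iota pi * g^i.[theta n]].
Proof.
move=> pi1 pi0 hO.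
have H i : {c : F | kap c & ogeP P 1 (h`_i - c)} by apply: cid2; exact: Prat.
pose c i := s2val (H i).
have kc i : kap (c i) := s2valP (H i).
have Oc i : ogeP P 1 (h`_i - c i) := s2valP' (H i).
pose g := \poly_(i < size h) ((h`_i - c i) / pi).
exists g, (\sum_(i < size h) iota (c i) * theta n ^+ i); split.
- move=> i; rewrite coef_poly; case: ltnP => _; last exact: sr0.
  rewrite -[0](subrr 1); apply: (ogeM TF HP (Oc i)); apply/ogeE; rewrite ?invr_eq0 //.
  by rewrite ordV // pi1.
- apply: sr_sum => // i _; apply: srM => //.
    by apply/(const_towerP hell iota hp); exists 0%N; exact: Fr_constants.
  apply: srX => //; apply/(const_towerP hell iota hp); exists n.
  exact: (theta_Fr hell iota hp n).
rewrite (@horner_coef_wide _ (size h) g^i); last by rewrite size_map_poly size_poly.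
rewrite horner_coef size_map_poly mulr_sumr -big_split; apply: eq_bigr => i _ /=.
rewrite mulrA -mulrDl; congr (_ * _).
by rewrite !coef_map coef_poly ltn_ord /= -rmorphM -rmorphD mulrC divfK // addrCA subrr addr0.
Qed.

Section Above.
Context (Q : set Omega) (HQ : Defs.primes K Q) (QP : iota @^-1` Q = P).

Lemma oge_above n x : ogeQ Q n (iota x) <-> ogeP P n x.
Proof. by rewrite -QP; exact: oge_restrict. Qed.

Lemma ord_above x : x != 0 -> ordQ Q (iota x) = ordP P x.
Proof. by move=> x0; have [_ ->] := prime_restrict HQ; rewrite ?QP. Qed.

Lemma oge_const c : k c -> ogeQ Q 0 c.
Proof.
move=> /(const_towerP hell iota hp) [n cn]; have [OV _] := prime_valring KF HQ.
exact: (tower_valring_Fr hp OV cn).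
Qed.

Lemma const_ord c : k c -> c != 0 -> ordQ Q c = 0.
Proof.
move=> kc c0; apply: oge_ord0 => //; first exact: (const_tower_sub hell hp).
  exact: oge_const.
by apply: oge_const; exact: sfV.
Qed.

Lemma oge_horner n (h : {poly F}) : coefs_in (ogeP P 0) h -> ogeQ Q 0 h^i.[theta n].
Proof.
move=> hO; apply: sr_horner => [|i|].
- exact: oge_subring.
- by rewrite coef_map; apply/oge_above; exact: hO.
by apply: oge_const; apply/(const_towerP hell iota hp); exists n; exact: (theta_Fr hell iota hp n).
Qed.

Lemma above_clear (h : {poly F}) pi : ordP P pi = 1 -> pi != 0 ->
  exists i, coefs_in (ogeP P 0) (pi ^+ i *: h).
Proof.
move=> pi1 pi0; suff H m : exists i, forall j, (j < m)%N -> ogeP P 0 (pi ^+ i * h`_j).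
  have [i iP] := H (size h); exists i => j; rewrite coefZ.
  have [/iP //|hj] := ltnP j (size h).
  by rewrite nth_default // mulr0; exact: sr0.
elim: m => [|m [i iP]]; first by exists 0%N.
exists (i + absz (ordP P h`_m))%N => j; rewrite ltnS leq_eqVlt => /orP[/eqP ->|jm].
  have [->|hm] := eqVneq h`_m 0; first by rewrite mulr0; exact: oge0.
  apply/ogeE => //; first by rewrite mulf_neq0 // expf_neq0.
  by rewrite ordM ?expf_neq0 // ordX // pi1; lia.
rewrite addnC exprD -mulrA; apply: srM => //; last exact: iP.
by apply: srX => //; apply/ogeE; rewrite ?pi1.
Qed.
End Above.

(** A nonzero constant part means order 0 at every prime above P; otherwise a factor pi splits off,
    and pi has order 1 at all of them. *)
Lemma above_ord Q Q' (N : nat) n (h : {poly F}) :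
  Defs.primes K Q -> Defs.primes K Q' -> iota @^-1` Q = P -> iota @^-1` Q' = P ->
  coefs_in (ogeP P 0) h -> h^i.[theta n] != 0 ->
  ordQ Q h^i.[theta n] = N -> ordQ Q' h^i.[theta n] = N.
Proof.
move=> HQ HQ' QP QP'; have [pi [_ pi0 pi1]] := ord_uniformizer TF HP.
have ip0 : iota pi != 0 by rewrite fmorph_eq0.
have Kt g : K (g^i.[theta n]) by exists n => //; apply/(layerP hell iota hp); exists g.
have Kpi := tower_iota iota p pi.
elim: N h => [|N IH] h hO a0 aN.
  have [g [c [gO kc E]]] := rational_decomp n pi1 pi0 hO.
  have c0 : c != 0.
    apply/eqP => c0; have : ogeQ Q 1 h^i.[theta n].
      rewrite E c0 add0r -[1]addr0; apply: ogeM => //; last exact: (oge_horner HQ QP).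
      by apply/(oge_above HQ QP)/ogeE; rewrite ?pi1.
    by rewrite ogeE // aN.
  have : c + iota pi * g^i.[theta n] != 0 /\ ordQ Q' (c + iota pi * g^i.[theta n]) = ordQ Q' c.
    apply: (@ord_lt_add _ K Q' KF HQ' c _ 1) => //.
    - exact: (const_tower_sub hell hp).
    - rewrite -[1]addr0; apply: ogeM => //; last exact: (oge_horner HQ' QP').
      by apply/(oge_above HQ' QP')/ogeE; rewrite ?pi1.
    - by rewrite (const_ord HQ').
  by rewrite -E => -[_ ->]; rewrite (const_ord HQ').
have [g [c [gO kc E]]] := rational_decomp n pi1 pi0 hO.
have c0 : c = 0.
  apply/eqP; apply: contrapT => /negP c0.
  have : ogeQ Q 1 c.
    have -> : c = h^i.[theta n] - iota pi * g^i.[theta n] by rewrite E addrK.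
    apply: ogeB => //; first by rewrite ogeE // aN.
    rewrite -[1]addr0; apply: ogeM => //; last exact: (oge_horner HQ QP).
    by apply/(oge_above HQ QP)/ogeE; rewrite ?pi1.
  by rewrite ogeE ?(const_ord HQ) //; exact: (const_tower_sub hell hp).
rewrite {}c0 add0r in E.
have g0 : g^i.[theta n] != 0 by apply: contra_neq a0 => g0; rewrite E g0 mulr0.
have : ordQ Q g^i.[theta n] = N.
  by move: aN; rewrite E ordM // (ord_above HQ QP) // pi1; lia.
move=> /(IH g gO g0) gN; rewrite E ordM // (ord_above HQ' QP') // pi1 gN.
by lia.
Qed.

Lemma above_unique Q Q' : Defs.primes K Q -> Defs.primes K Q' ->
  iota @^-1` Q = P -> iota @^-1` Q' = P -> Q = Q'.
Proof.
move=> HQ HQ' QP QP'; apply: (prime_eq KF HQ HQ') => z Oz.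
have [->|z0] := eqVneq z 0; first exact: oge0.
have Kz : K z by case: Oz.
have [n _ /(layerP hell iota hp) [h zE]] := Kz.
have [pi [_ pi0 pi1]] := ord_uniformizer TF HP.
have ip0 : iota pi != 0 by rewrite fmorph_eq0.
have Kpi := tower_iota iota p pi.
have [i hO] := above_clear h pi1 pi0.
have E : (pi ^+ i *: h)^i.[theta n] = iota pi ^+ i * z.
  by rewrite map_polyZ hornerZ rmorphXn zE.
have a0 : (pi ^+ i *: h)^i.[theta n] != 0 by rewrite E mulf_neq0 // expf_neq0.
move: Oz; rewrite !ogeE // => oz.
have oE Q0 : Defs.primes K Q0 -> iota @^-1` Q0 = P ->
    ordQ Q0 (pi ^+ i *: h)^i.[theta n] = i%:Z + ordQ Q0 z.
  move=> HQ0 QP0; rewrite E ordM ?expf_neq0 //; last exact: srX.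
  by rewrite ordX // (ord_above HQ0 QP0) // pi1 mulr1.
have oN : (absz (i%:Z + ordQ Q z))%:Z = i%:Z + ordQ Q z by rewrite gez0_abs //; lia.
have := above_ord HQ HQ' QP QP' hO a0 (_ : _ = (absz (i%:Z + ordQ Q z))%:Z).
by rewrite oN !oE // => /(_ erefl); lia.
Qed.

Lemma above_rational Q : Defs.primes K Q -> iota @^-1` Q = P -> is_rational k K Q.
Proof.
move=> HQ QP z Oz; have Kz : K z by case: Oz.
have [n _ /(layerP hell iota hp) [h zE]] := Kz.
have [pi [_ pi0 pi1]] := ord_uniformizer TF HP.
have ip0 : iota pi != 0 by rewrite fmorph_eq0.
have [i hO] := above_clear h pi1 pi0.
have E : (pi ^+ i *: h)^i.[theta n] = iota pi ^+ i * z.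
  by rewrite map_polyZ hornerZ rmorphXn zE.
have ogpi m : ogeQ Q m%:Z (iota pi ^+ m).
  have o1 : ogeQ Q 1 (iota pi) by apply/(oge_above HQ QP)/ogeE; rewrite ?pi1.
  by have := ogeX KF HQ m o1; rewrite mulr1.
(* Induction on the power of pi in the denominator: as z is integral, the constant part vanishes as
   long as that power is positive. *)
elim: i (pi ^+ i *: h) hO E => [|i IH] g gO E;
  have [g' [c [g'O kc E']]] := rational_decomp n pi1 pi0 gO.
  have zg : z = g^i.[theta n] by rewrite E expr0 mul1r.
  exists c => //; rewrite zg E' addrC addKr.
  by rewrite -[1]addr0; apply: ogeM => //; [have := ogpi 1%N; rewrite expr1|exact: (oge_horner HQ QP)].
have c0 : c = 0.
  apply/eqP; apply: contrapT => /negP c0.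
  have : ogeQ Q 1 c.
    have -> : c = iota pi ^+ i.+1 * z - iota pi * g'^i.[theta n] by rewrite -E E' addrK.
    apply: ogeB => //; rewrite -[1]addr0; apply: ogeM => //.
    - by apply: (oge_le KF _ (ogpi i.+1)); lia.
    - by have := ogpi 1%N; rewrite expr1.
    - exact: (oge_horner HQ QP).
  by rewrite ogeE ?(const_ord HQ) //; exact: (const_tower_sub hell hp).
apply: (IH g' g'O); apply: (mulfI ip0); rewrite mulrA -exprS -E E' c0 add0r.
by [].
Qed.

(** At a prime above P, z is congruent to some c in k; z - c is algebraic over F_ell again, so it
    would be a unit if it were not 0. *)
Lemma algebraic_const z : K z -> is_frob_fixed ell z -> k z.
Proof.
move=> Kz [r [r0 zr]]; have [Q [HQ QP]] := prime_extend HP.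
have [OV _] := prime_valring KF HQ.
have Oz w m : K w -> (0 < m)%N -> w ^+ (ell ^ m) = w -> ogeQ Q 0 w.
  move=> Kw m0 wr.
  apply: (@valring_integral _ K _ KF OV ('X^(ell ^ m) - 'X)) => //.
  - have A1 : (1 < ell ^ m)%N.
      by apply: leq_trans (prime_gt1 hell) _; rewrite -{1}[ell]expn1 leq_exp2l // prime_gt1.
    by rewrite monicE lead_coefDl ?lead_coefXn // size_polyXn size_polyN size_polyX.
  - by have [OR _ _ _] := OV; apply: coefs_inB => //; [exact: coefs_inXn|exact: coefs_inX].
  - by rewrite rootE !hornerE wr subrr.
have [c kc zc] := above_rational HQ QP (Oz z r Kz r0 zr).
have [n cn] := (const_towerP hell iota hp c).1 kc.
have [s [s0 qE]] := q0_ell hell F.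
pose m := (r * (s * p ^ n))%N.
have m0 : (0 < m)%N by rewrite /m !muln_gt0 r0 s0 expn_gt0 prime_gt0.
have wm : (z - c) ^+ (ell ^ m) = z - c.
  rewrite (frobB hell (pcharO hell iota)); congr (_ - _); first exact: frob_fixed_mul.
  by rewrite /m mulnC; apply: frob_fixed_mul; rewrite expnM -qE.
have Kc := const_tower_sub hell hp kc.
have [/eqP|w0] := eqVneq (z - c) 0; first by rewrite subr_eq0 => /eqP ->.
have Kw : K (z - c) by exact: srB.
exfalso; have Ow : ogeQ Q 0 (z - c)^-1.
  by apply: (Oz _ m) => //; [exact: sfV|rewrite exprVn wm].
have := oge_ord0 KF HQ Kw w0 (oge_le KF ler01 zc) Ow.
by move: zc => /(ogeE _ _ Kw w0) z1 z0; move: z1; rewrite z0.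
Qed.

(** If y^-1 were in k[y], y would be algebraic over k and thus constant. So some valuation ring
    contains k[y] but not y^-1. *)
Lemma zero_exists y : K y -> ~ k y -> exists2 Q, Defs.primes K Q & ogeQ Q 1 y.
Proof.
move=> Ky nky.
have y0 : y != 0 by apply/eqP => y0; apply: nky; rewrite y0; exact: sr0.
have [O [OV CO nO]] : exists O, [/\ is_valring K O, adjoin k y `<=` O & ~ O y^-1].
  apply: valring_exists => //.
  - exact: adjoin_subring.
  - move=> _ [h hk <-]; apply: sr_horner => // i; apply: (const_tower_sub hell hp); exact: hk.
  - exact: adjoin_gen.
  move=> [h hk hy]; apply: nky.
  have : root (h * 'X - 1) y.
    by rewrite rootE !hornerE hy mulVf // subrr.
  have hn : h * 'X - 1 != 0.
    apply/eqP => /(congr1 (fun u : {poly Omega} => u`_0)).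
    by rewrite coefB coefMX coef1 /= sub0r coef0 => /eqP; rewrite oppr_eq0 oner_eq0.
  move=> hr; apply: algebraic_const => //.
  have e : {rmorphism 'F_ell -> Omega} := iota \o @prime_field_embedding ell F.
  apply/(algebraic_frob_fixed hell (pcharO hell iota) e)/integral_algebraic.
  apply: (integral_root hn hr) => c /(nthP 0) [i _ <-].
  apply/integral_algebraic/(algebraic_frob_fixed hell (pcharO hell iota) e).
  have : coefs_in k (h * 'X - 1).
    apply: coefs_inB => //; first by apply: coefs_inM => //; exact: coefs_inX.
    by rewrite -polyC1; apply: coefs_inC => //; exact: sr1.
  move=> /(_ i) /(const_towerP hell iota hp) [n cn].
  have [s [s0 qE]] := q0_ell hell F.
  exists (s * p ^ n)%N; split; first by rewrite muln_gt0 s0 expn_gt0 prime_gt0.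
  by rewrite expnM -qE.
have [HQ _ _] := tower_valring_prime hell hp OV; exists (nonunits O) => //.
apply/(prime_oge KF HQ); split; first by apply: CO; exact: adjoin_gen.
by right.
Qed.

Lemma no_pole_const y : K y -> (forall Q, Defs.primes K Q -> ogeQ Q 0 y) -> k y.
Proof.
move=> Ky H; apply: contrapT => nky.
have y0 : y != 0 by apply/eqP => y0; apply: nky; rewrite y0; exact: sr0.
have nkyi : ~ k y^-1 by move=> kyi; apply: nky; rewrite -[y]invrK; exact: sfV.
have [Q HQ] := zero_exists (sfV KF Ky) nkyi.
rewrite ogeE ?invr_eq0 //; last exact: sfV.
by rewrite ordV //; have := H Q HQ; rewrite ogeE //; lia.
Qed.

End AtInfinity.

End TowerPlaces.

(** * Functions of F regular outside a rational place *)

(** For z outside [O], divide h(z) = 0 by a power of z and solve for the leading coefficient times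
    z: only powers of z^-1 remain on the other side. *)
Lemma valring_lead_mul (L : fieldType) (K O : set L) (h : {poly L}) z :
  is_subfield K -> is_valring K O -> K z -> coefs_in O h -> root h z ->
  O (lead_coef h * z).
Proof.
move=> KF OV Kz hO hz; have [OR _ _ _] := OV.
have [h0|hn0] := eqVneq h 0; first by rewrite h0 lead_coef0 mul0r; exact: sr0.
have [Oz|nOz] := pselect (O z); first by apply: srM => //; exact: hO.
have z0 : z != 0 by apply/eqP => z0; apply: nOz; rewrite z0; exact: sr0.
have [Ozi _] := nonunitsV OV Kz nOz.
have h1 := root_size_gt1 hn0 hz.
set m := (size h).-2; have sh : size h = m.+2 by rewrite /m; case: (size h) h1 => [|[]].
have := rootP hz; rewrite horner_coef sh big_ord_recr /= => /eqP.
rewrite addrC addr_eq0 => /eqP E.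
have zm : z ^+ m != 0 by rewrite expf_neq0.
have -> : lead_coef h * z = - \sum_(i < m.+1) h`_i * z^-1 ^+ (m - i).
  apply: (mulIf zm); rewrite /lead_coef sh /= -mulrA -exprS E mulNr mulr_suml.
  congr (- _); apply: eq_bigr => i _; rewrite -mulrA; congr (_ * _).
  have im : (i <= m)%N by rewrite -ltnS.
  have -> : z ^+ m = z ^+ (m - i) * z ^+ i by rewrite -exprD subnK.
  by rewrite mulrA exprVn mulVf ?mul1r // expf_neq0.
apply: (srN OR); apply: (sr_sum OR) => i _; apply: (srM OR); first exact: hO.
exact: (srX OR).
Qed.

(* Over the finite field k, there are more combinations of d + 1 vectors than
   classes modulo W. *)
Lemma finite_dependence (L : fieldType) (k V W : set L) s d (v : 'I_d.+1 -> L) :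
  is_subfield k -> is_subspace k V -> is_subspace k W -> enumerates k s ->
  has_dim k V W d -> (forall i, V (v i)) ->
  exists c : 'I_d.+1 -> L, [/\ (forall i, k (c i)), (exists i, c i != 0) & W (\sum_i c i * v i)].
Proof.
move=> kF VS WS [us ks] [b [Vb bP]] Vv; have kR := subfield_subring kF.
pose x (c : {ffun 'I_d.+1 -> seq_sub s}) := \sum_i val (c i) * v i.
have Vx c : V (x c).
  rewrite /x; apply: (subspace_sum _ VS) => i _; have [_ _] := VS; apply=> //.
  by apply/ks; exact: valP.
have H c : {e : 'rV[L]_d | (forall i, k (e 0 i)) /\ W (x c - lincomb e b)}.
  by apply: cid; have [e [eP _]] := bP _ (Vx c); exists e.
have mem c i : (sval (H c)) 0 i \in s by apply/ks; have [] := svalP (H c).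
pose f c : {ffun 'I_d -> seq_sub s} := [ffun i => SeqSub (mem c i)].
have s1 : (1 < size s)%N.
  have : (size [:: 0%R; 1%R : L] <= size s)%N.
    apply: uniq_leq_size; first by rewrite /= inE eq_sym oner_neq0.
    move=> z; rewrite !inE => /orP[] /eqP ->; apply/ks; [exact: sr0|exact: sr1].
  by [].
have /injectivePn [c [c' cc' fcc']] : ~~ injectiveb f.
  apply/negP => /injectiveP /leq_card.
  by rewrite !card_ffun !card_ord !card_seq_sub // leq_exp2l // ltnn.
have eE : sval (H c) = sval (H c').
  apply/rowP => i; have := congr1 (fun g : {ffun 'I_d -> seq_sub s} => val (g i)) fcc'.
  by rewrite !ffunE.
exists (fun i => val (c i) - val (c' i)); split.
- by move=> i; apply: srB => //; apply/ks; exact: valP.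
- apply: contrapT => nex; move/eqP: cc'; apply; apply/ffunP => i; apply/val_inj/eqP.
  by rewrite -subr_eq0; apply: contrapT => /negP ci; apply: nex; exists i.
have -> : \sum_i (val (c i) - val (c' i)) * v i = x c - x c'.
  by rewrite /x -sumrB; apply: eq_bigr => i _; rewrite mulrBl.
have [_ Wc] := svalP (H c); have [_ Wc'] := svalP (H c').
have -> : x c - x c' = (x c - lincomb (sval (H c)) b) - (x c' - lincomb (sval (H c')) b).
  by rewrite eE; ring.
exact: (subspaceB kF WS).
Qed.

Section AffineRing.
Context (ell : nat) (hell : prime ell) (F : fieldExtType {fraction {poly 'F_ell}}).
Local Notation pfe := (@prime_field_embedding ell F).
Local Notation kap := (constants F).
Local Notation ordP := (ord [set: F]).
Local Notation ogeP := (oge [set: F]).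
Local Notation prm := (Defs.primes [set: F]).

Context (Poo : set F) (HPoo : prm Poo) (Prat : is_rational kap [set: F] Poo).
Context (no_pole : forall y, (forall P, prm P -> ogeP P 0 y) -> kap y).

Let TF : is_subfield [set: F]. Proof. exact: is_subfieldT. Qed.
Let kF : is_subfield kap. Proof. exact: constants_subfield. Qed.
Let kR : is_subring kap. Proof. exact: subfield_subring. Qed.

Definition RF : set F := [set z | forall P, prm P -> P <> Poo -> ogeP P 0 z].

Lemma RF_subring : is_subring RF.
Proof.
apply/is_subringP; split.
- by move=> P HP _; exact: oge1.
- by move=> x y Rx Ry P HP PP; apply: ogeB => //; [exact: Rx|exact: Ry].
- by move=> x y Rx Ry P HP PP; rewrite -[0]addr0; apply: ogeM => //; [exact: Rx|exact: Ry].
Qed.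
Let RR := RF_subring.

Lemma constants_oge P c : prm P -> kap c -> ogeP P 0 c.
Proof.
move=> HP kc; have [OV _] := prime_valring TF HP.
exact: (valring_constants hell OV kc).
Qed.

Lemma constants_RF : kap `<=` RF.
Proof. by move=> c kc P HP _; exact: constants_oge. Qed.

Lemma constants_ord P c : prm P -> kap c -> c != 0 -> ordP P c = 0.
Proof.
move=> HP kc c0; apply: oge_ord0 => //; apply: constants_oge => //.
exact: sfV.
Qed.

Lemma RF_constant z : RF z -> ogeP Poo 0 z -> kap z.
Proof.
move=> Rz Oz; apply: no_pole => P HP.
by have [->//|PP] := pselect (P = Poo); exact: Rz.
Qed.

Lemma RF_ord_lt0 z : RF z -> ~ kap z -> ordP Poo z < 0.
Proof.
move=> Rz nkz; rewrite ltNge; apply/negP => o0; apply: nkz.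
by apply: RF_constant => //; split=> //; right.
Qed.

Lemma RF_ord_le0 z : RF z -> z != 0 -> ordP Poo z <= 0.
Proof.
move=> Rz z0; have [kz|/(RF_ord_lt0 Rz)] := pselect (kap z); last lia.
by rewrite constants_ord.
Qed.

(** Meant for elements of [RF], whose order at infinity is never positive: there it is the order of
    the pole and behaves like a degree. *)
Definition pole z := absz (ordP Poo z).

Lemma poleE z : RF z -> z != 0 -> ordP Poo z = - (pole z)%:Z.
Proof. by move=> Rz z0; rewrite /pole; have := RF_ord_le0 Rz z0; lia. Qed.

Lemma poleM x y : RF x -> RF y -> x != 0 -> y != 0 -> pole (x * y) = (pole x + pole y)%N.
Proof.
move=> Rx Ry x0 y0; have := poleE (srM RR Rx Ry) (mulf_neq0 x0 y0).
by rewrite ordM // !poleE //; move: (pole (x * y)) (pole x) (pole y) => *; lia.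
Qed.

Lemma poleX x n : RF x -> x != 0 -> pole (x ^+ n) = (n * pole x)%N.
Proof.
move=> Rx x0; have := poleE (srX RR n Rx) (expf_neq0 n x0).
by rewrite ordX // poleE //; move: (pole (x ^+ n)) (pole x) => *; lia.
Qed.

Lemma pole_gt0 z : RF z -> ~ kap z -> (0 < pole z)%N.
Proof. by move=> Rz nkz; rewrite /pole; have := RF_ord_lt0 Rz nkz; lia. Qed.

Lemma pole_constant c : kap c -> c != 0 -> pole c = 0%N.
Proof. by move=> kc c0; rewrite /pole constants_ord. Qed.

(* Since the place at infinity is rational, leading terms can be cancelled. *)
Lemma pole_cancel z e : RF z -> RF e -> z != 0 -> e != 0 -> pole z = pole e ->
  exists c, [/\ kap c, c != 0 & z - c * e = 0 \/ (pole (z - c * e) < pole z)%N].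
Proof.
move=> Rz Re z0 e0 pe.
have o0 : ordP Poo (z / e) = 0 by rewrite ord_div // !poleE // pe subrr.
have ze0 : z / e != 0 by rewrite mulf_neq0 // invr_eq0.
have Oze : ogeP Poo 0 (z / e) by apply/ogeE; rewrite ?o0.
have [c kc cP] := Prat Oze; exists c.
have c0 : c != 0.
  by apply: contraTneq isT => c0; move: cP; rewrite c0 subr0 => /(ogeE _ _ I ze0); rewrite o0.
split=> //; have [E|zc0] := eqVneq (z - c * e) 0; [by left|right].
have Rc : RF (z - c * e) by apply: (srB RR) => //; apply: (srM RR) => //; exact: constants_RF.
have zE : z - c * e = e * (z / e - c) by field.
have oc : 1 <= ordP Poo (z / e - c).
  by apply/ogeE => //; apply: contra_neq zc0 => E; rewrite zE E mulr0.
have := poleE Rc zc0; rewrite {1}zE ordM //; last by apply: contra_neq zc0 => E; rewrite zE E mulr0.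
by rewrite poleE // -pe; move: oc; move: (ordP Poo (z / e - c)) (pole (z - c * e)) (pole z) => *; lia.
Qed.

Section Transcendental.
Context (y : F) (Ry : RF y) (nky : ~ kap y).

Let y0 : y != 0. Proof. by apply/eqP => y0; apply: nky; rewrite y0; exact: sr0. Qed.

Lemma RF_poly (g : {poly 'F_ell}) : RF (map_poly pfe g).[y].
Proof.
apply: (sr_horner RR) => // i; rewrite coef_map; apply: constants_RF.
exact: algebraic_id.
Qed.

Lemma poly_neq0 (g : {poly 'F_ell}) : g != 0 -> (map_poly pfe g).[y] != 0.
Proof. by move=> g0; apply/eqP => gy; apply: nky; exists g => //; apply/rootP. Qed.

Lemma pole_poly (g : {poly 'F_ell}) : g != 0 -> pole (map_poly pfe g).[y] = ((size g).-1 * pole y)%N.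
Proof.
move=> g0; have yd := pole_gt0 Ry nky.
have gs : (0 < size g)%N by rewrite size_poly_gt0.
rewrite (@horner_coef_wide _ (size g).-1.+1); last by rewrite size_map_poly prednK.
rewrite big_ord_recr /= addrC; set m := (size g).-1.
have lc : (map_poly pfe g)`_m != 0.
  by rewrite coef_map fmorph_eq0 -lead_coefE lead_coef_eq0.
have klc : kap (map_poly pfe g)`_m by rewrite coef_map; exact: algebraic_id.
have Rlc := constants_RF klc.
have ly0 : (map_poly pfe g)`_m * y ^+ m != 0 by rewrite mulf_neq0 // expf_neq0.
have pl : pole ((map_poly pfe g)`_m * y ^+ m) = (m * pole y)%N.
  by rewrite (poleM Rlc (srX RR m Ry) lc (expf_neq0 m y0)) (pole_constant klc lc) add0n poleX.
have Rl : RF ((map_poly pfe g)`_m * y ^+ m) by apply: (srM RR) => //; exact: (srX RR).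
set S := \sum_(i < m) _.
have oS : ogeP Poo (1 - (m * pole y)%:Z) S.
  apply: (oge_sum TF HPoo) => i _; rewrite -[1 - _]add0r; apply: (ogeM TF HPoo).
    by apply: constants_oge => //; rewrite coef_map; exact: algebraic_id.
  apply/ogeE => //; first by rewrite expf_neq0.
  have im : (i < m)%N := ltn_ord i.
  by rewrite ordX // poleE //; move: (pole y) yd => a a0; nia.
have ol : ordP Poo ((map_poly pfe g)`_m * y ^+ m) = - (m * pole y)%:Z by rewrite poleE // pl.
have [|_ E] := ord_lt_add TF HPoo I ly0 oS; first by rewrite ol; lia.
by rewrite /pole E ol abszN.
Qed.

(* F is algebraic over F_ell(y), and an element integral over F_ell[y] lies in
   RF. *)
Lemma clear_poles z : exists g : {poly 'F_ell}, g != 0 /\ RF ((map_poly pfe g).[y] * z).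
Proof.
have [fm [fmE falg]] := transcendental_extension nky.
have [h h0 hz] := falg z.
have [P [c [P0 c0 PE]]] := frac_poly_clear h0.
pose G := map_poly (horner_eval y \o map_poly pfe) P.
have Gz : root G z.
  apply/rootP; rewrite (_ : G = map_poly fm (c *: h)).
    by rewrite map_polyZ hornerZ (rootP hz) mulr0.
  by rewrite /G -PE -map_poly_comp; apply: eq_map_poly => a /=; rewrite fmE.
have lG : lead_coef G = (map_poly pfe (lead_coef P)).[y].
  by rewrite /G lead_coef_map_inj //; last exact: rmorph0; move=> a b /= /eqP; 
     rewrite -subr_eq0 -[horner_eval y _ - _]rmorphB -rmorphB /= => ab; apply/eqP;
     rewrite -subr_eq0; apply: contraT => /poly_neq0; rewrite ab.
exists (lead_coef P); split; first by rewrite lead_coef_eq0.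
move=> Q HQ QP; rewrite -lG; have [OV _] := prime_valring TF HQ.
apply: (valring_lead_mul TF OV I) => // i.
by rewrite coef_map; exact: (RF_poly _ HQ QP).
Qed.

Definition is_RF_ideal (J : set F) :=
  [/\ J `<=` RF, (exists2 i, J i & i != 0), (forall x z, J x -> J z -> J (x + z))
    & forall r x, RF r -> J x -> J (r * x)].

Context (J : set F) (JI : is_RF_ideal J).

Lemma RF_ideal0 : J 0.
Proof. by have [_ [i Ji _] _ JM] := JI; rewrite -(mul0r i); apply: JM => //; exact: (sr0 RR). Qed.

Lemma RF_ideal_subspace : is_subspace kap J.
Proof.
have [_ _ JD JM] := JI; split=> //; first exact: RF_ideal0.
by move=> a x ka; apply: JM; exact: constants_RF.
Qed.

(** Any order at infinity is available in F, and removing the other poles by a polynomial in y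
    changes it only by a multiple of [pole y]. *)
Lemma pole_class i : (i < pole y)%N -> exists e, [/\ J e, e != 0 & (pole e %% pole y)%N = i].
Proof.
move=> id; have [JR [j Jj j0] _ JM] := JI; have yd := pole_gt0 Ry nky.
have [pi [_ pi0 pi1]] := ord_uniformizer TF HPoo.
(* With this m, pi^m j has order pole y - i at infinity, which is the class of a pole of order i. *)
pose m := (pole j + (pole y - i))%N.
have [g [g0 Rz]] := clear_poles (pi ^+ m).
have gy := poly_neq0 g0; have pm0 : pi ^+ m != 0 by rewrite expf_neq0.
have Rj := JR _ Jj.
exists ((map_poly pfe g).[y] * pi ^+ m * j); split; first exact: JM.
  by rewrite !mulf_neq0.
have := poleE (srM RR Rz Rj) (mulf_neq0 (mulf_neq0 gy pm0) j0).
rewrite !ordM ?mulf_neq0 // poleE //; last exact: RF_poly.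
rewrite ordX // pi1 (poleE Rj j0) pole_poly // => E.
have {}E : (pole ((map_poly pfe g).[y] * pi ^+ m * j) + pole y = (size g).-1 * pole y + i)%N.
  have mE : m = (pole j + (pole y - i))%N by [].
  move: E id mE; move: (pole ((map_poly pfe g).[y] * pi ^+ m * j)) (pole j).
  move: ((size g).-1 * pole y)%N => S; move: (pole y); clear; lia.
have := congr1 (modn^~ (pole y)) E; rewrite modnDr modnMDl => ->.
by rewrite modn_small.
Qed.

(** The Apery set, with respect to [pole y], of the pole numbers of J. *)
Lemma ideal_basis : exists e : 'I_(pole y) -> F, forall i,
  [/\ J (e i), e i != 0, (pole (e i) %% pole y)%N = i &
    forall e', J e' -> e' != 0 -> (pole e' %% pole y)%N = i -> (pole (e i) <= pole e')%N].
Proof.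
suff H (i : 'I_(pole y)) : {e | [/\ J e, e != 0, (pole e %% pole y)%N = i &
    forall e', J e' -> e' != 0 -> (pole e' %% pole y)%N = i -> (pole e <= pole e')%N]}.
  by exists (fun i => sval (H i)) => i; exact: (svalP (H i)).
apply: cid.
have ex : exists n, `[< exists e, [/\ J e, e != 0, (pole e %% pole y)%N = i & pole e = n] >].
  have [e [Je e0 ei]] := pole_class (ltn_ord i).
  by exists (pole e); apply/asboolP; exists e.
case: (ex_minnP ex) => n /asboolP [e [Je e0 ei en]] nmin; exists e; split=> // e' Je' e'0 e'i.
by rewrite en; apply: nmin; apply/asboolP; exists e'.
Qed.

Definition ymul : set F := [set y * r | r in J].

Lemma ymul_subspace : is_subspace kap ymul.
Proof.
have [J0 JD JM] := RF_ideal_subspace; split.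
- by exists 0 => //; rewrite mulr0.
- by move=> _ _ [x Jx <-] [z Jz <-]; exists (x + z); [exact: JD|rewrite mulrDr].
- by move=> a _ ka [x Jx <-]; exists (a * x); [exact: JM|rewrite mulrCA].
Qed.

(** Every r in J has the leading term of some c y^m e_i, which lies in y J for m > 0; subtracting it
    lowers the pole, so the e_i span. They are independent: a combination equal to y r would give r
    a smaller pole than some e_i in the same class. The dimension is the same for all J, whence the
    product formula and [denominator]. *)
Lemma ideal_has_dim : has_dim kap J ymul (pole y).
Proof.
have [e eP] := ideal_basis; have [JR _ JD JM] := JI; have yd := pole_gt0 Ry nky.
have [J0 _ JZ] := RF_ideal_subspace; have YS := ymul_subspace; have [Y0 YD YZ] := YS.
apply: (has_dim_intro (b := \row_i e i) kF YS).
- by move=> i; rewrite mxE; have [] := eP i.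
- move=> r; have [n] := ubnP (pole r); elim: n r => // n IH r rn Jr.
  have [->|r0] := eqVneq r 0.
    exists 0; split=> [i|]; first by rewrite mxE; exact: sr0.
    by rewrite /lincomb big1 ?subr0 // => i _; rewrite !mxE mul0r.
  have id : (pole r %% pole y < pole y)%N by rewrite ltn_mod.
  pose i := Ordinal id; have [Je e0 ei emin] := eP i.
  have le := emin r Jr r0 erefl.
  pose m := ((pole r - pole (e i)) %/ pole y)%N.
  have rE : pole r = (m * pole y + pole (e i))%N.
    rewrite /m divnK ?subnK //.
    by rewrite -(eqn_mod_dvd _ le) ei.
  have Re := JR _ Je; have Rym := srX RR m Ry; have ym0 := expf_neq0 m y0.
  have [c [kc c0 cP]] : exists c, [/\ kap c, c != 0 & r - c * (y ^+ m * e i) = 0 \/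
      (pole (r - c * (y ^+ m * e i)) < pole r)%N].
    apply: pole_cancel => //; [exact: JR|exact: (srM RR)|exact: mulf_neq0|].
    by rewrite poleM // poleX // -rE.
  have Jym : J (y ^+ m * e i) by exact: JM.
  set r' := r - _ in cP.
  have Jr' : J r' by rewrite /r' -mulNr; apply: JD => //; apply: JZ => //; exact: srN.
  have [c' [kc' Yc']] : exists c' : 'rV[F]_(pole y), (forall i, kap (c' 0 i)) /\
      ymul (r' - lincomb c' (\row_i e i)).
    case: cP => [r'0|lt]; last by apply: IH => //; move: rn lt; rewrite ltnS; move=> a b; exact: leq_trans b a.
    exists 0; split=> [j|]; first by rewrite mxE; exact: sr0.
    by rewrite r'0 /lincomb big1 ?subr0 // => j _; rewrite !mxE mul0r.
  have [m0|m0] := posnP m.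
    exists (c' + c *: delta_mx 0 i); split=> [j|].
      rewrite !mxE; apply: srD => //; apply: srM => //; exact: sr_nat.
    have -> : lincomb (c' + c *: delta_mx 0 i) (\row_i e i) = lincomb c' (\row_i e i) + c * e i.
      rewrite lincombD; congr (_ + _); rewrite /lincomb (bigD1 i) //= !mxE !eqxx mulr1.
      by rewrite big1 ?addr0 // => j ji; rewrite !mxE (negPf ji) mulr0 mul0r.
    by move: Yc'; rewrite /r' m0 expr0 mul1r [in r - _ - _]addrAC -addrA -opprD.
  exists c'; split=> //.
  have -> : r - lincomb c' (\row_i e i) = r' - lincomb c' (\row_i e i) + c * (y ^+ m * e i).
    by rewrite /r' [r - _ - lincomb _ _]addrAC subrK.
  apply: YD => //; apply: YZ => //; exists (y ^+ m.-1 * e i); last by rewrite mulrA -exprS prednK.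
  by apply: JM => //; exact: (srX RR).
move=> c kc [r Jr rE]; apply: contrapT => /eqP c0.
have [i0 ci0] : exists i, c 0 i != 0.
  apply/existsP; rewrite -negb_forall; apply: contra c0 => /forallP H.
  by apply/eqP/rowP => i; rewrite mxE; exact/eqP.
pose i := [arg max_(i > i0 | c 0 i != 0) pole (e i)].
have [ci imax] : c 0 i != 0 /\ forall j, c 0 j != 0 -> (pole (e j) <= pole (e i))%N.
  by rewrite /i; case: arg_maxnP.
have [Je e0 ei emin] := eP i; have Re := JR _ Je.
have Rce : RF (c 0 i * e i) by apply: (srM RR) => //; exact: constants_RF.
have ce0 : c 0 i * e i != 0 by rewrite mulf_neq0.
have pce : ordP Poo (c 0 i * e i) = - (pole (e i))%:Z.
  by rewrite ordM // (constants_ord HPoo) // add0r poleE.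
have lE : lincomb c (\row_i e i) = c 0 i * e i + \sum_(j | j != i) c 0 j * e j.
  by rewrite /lincomb (bigD1 i) //= mxE; congr (_ + _); apply: eq_bigr => j _; rewrite mxE.
have [l0 lo] : lincomb c (\row_i e i) != 0 /\ ordP Poo (lincomb c (\row_i e i)) = - (pole (e i))%:Z.
  rewrite lE -pce; apply: (ord_lt_add TF HPoo (n := 1 - (pole (e i))%:Z)) => //; last by rewrite pce; move: (pole (e i)); clear; lia.
  apply: (oge_sum TF HPoo) => j ji.
  have [->|cj0] := eqVneq (c 0 j) 0; first by rewrite mul0r; exact: oge0.
  have [Jej ej0 ej _] := eP j; have Rej := JR _ Jej.
  have : pole (e j) != pole (e i).
    by apply: contra_neq ji => pe; apply/val_inj; rewrite /= -ej -ei pe.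
  have := imax j cj0 => le ne.
  apply/ogeE => //; first by rewrite mulf_neq0.
  rewrite ordM // (constants_ord HPoo) // add0r poleE //.
  by move: le ne; move: (pole (e j)) (pole (e i)); clear; lia.
have r0 : r != 0 by apply: contra_neq l0 => r0; rewrite -rE r0 mulr0.
have Rr := JR _ Jr.
have pr : (pole y + pole r = pole (e i))%N.
  move: lo; rewrite -rE ordM // !poleE //.
  by move: (pole (e i)) (pole y) (pole r); clear; lia.
have := emin r Jr r0 (_ : _ = _ :> nat).
by rewrite -ei -pr modnDl => /(_ erefl); move: yd; move: (pole r) (pole y); clear; lia.
Qed.

End Transcendental.

End AffineRing.

Lemma dvr_of_prime_oge (L : fieldType) (K O P : set L) : is_subfield K ->
  is_dvr_of_prime K O P -> O = oge K P 0.
Proof.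
move=> KF HO; have [|O' [HO' _ _ OE' _]] := @oge_ring _ K P KF; first by exists O.
by apply/seteqP; split=> x; [move/(valring_of_primeE KF x HO)/(valring_of_primeE KF x HO')/OE'
  |move/OE'/(valring_of_primeE KF x HO')/(valring_of_primeE KF x HO)].
Qed.

(* If the leading coefficient l of h lies in P, then l z lies in S and in P,
   and h may be replaced by a polynomial of smaller degree. *)
Lemma denominator_of_root (L : fieldType) (K P S : set L) (h : {poly L}) z : is_subfield K ->
  Defs.primes K P -> is_subring S -> S `<=` oge K P 0 ->
  (forall g, coefs_in S g -> root g z -> S (lead_coef g * z)) ->
  oge K P 0 z -> coefs_in S h -> root h z -> (exists i, ~ P h`_i) ->
  exists b, [/\ S b, ~ P b & S (b * z)].
Proof.
move=> KF HP SR SO int Oz; have PM x : oge K P 0 x -> forall y, P y -> P (x * y).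
  move=> Ox y /(prime_oge KF HP) Py; apply/(prime_oge KF HP); rewrite -[1]add0r.
  exact: (ogeM KF HP).
have [m] := ubnP (size h); elim: m h => // m IH h hm hR hz [i0 nPi].
have Slz := int h hR hz.
have [Pl|nPl] := pselect (P (lead_coef h)); last by exists (lead_coef h); split=> //; exact: hR.
have hn0 : h != 0.
  by apply/eqP => h0; apply: nPi; rewrite h0 coef0; apply/(prime_oge KF HP); exact: oge0.
have h1 := root_size_gt1 hn0 hz; set n := (size h).-2.
have sh : size h = n.+2 by rewrite /n; case: (size h) h1 => [|[]].
have lE : lead_coef h = h`_n.+1 by rewrite /lead_coef sh.
have Plz : P (lead_coef h * z) by rewrite mulrC; exact: PM.
pose h' := h - lead_coef h *: 'X^(n.+1) + (lead_coef h * z) *: 'X^n.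
have h'E j : h'`_j = h`_j - lead_coef h * (j == n.+1)%:R + lead_coef h * z * (j == n)%:R.
  by rewrite coefD coefB !coefZ !coefXn.
apply: (IH h').
- have : (size h' <= n.+1)%N.
    apply/leq_sizeP => j nj; rewrite h'E (gtn_eqF nj) mulr0 addr0.
    have [->|jn] := eqVneq j n.+1; first by rewrite mulr1 lE subrr.
    by rewrite mulr0 subr0 nth_default // sh ltn_neqAle eq_sym jn.
  by move: hm; rewrite sh; move: (size h'); clear; lia.
- move=> j; rewrite h'E; apply: (srD SR); first apply: (srB SR).
  + exact: hR.
  + by apply: (srM SR); [exact: hR|exact: (sr_nat SR)].
  + by apply: (srM SR) => //; exact: (sr_nat SR).
- apply/rootP; rewrite /h' hornerD hornerD hornerN !hornerZ !hornerXn (rootP hz).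
  by rewrite sub0r exprS mulrA addNr.
- exists i0 => Pi; apply: nPi.
  have -> : h`_i0 = h'`_i0 + lead_coef h * (i0 == n.+1)%:R - lead_coef h * z * (i0 == n)%:R.
    by rewrite h'E addrAC addrK subrK.
  have Onat (b : bool) : oge K P 0 b%:R by apply: SO; exact: (sr_nat SR).
  apply/(prime_oge KF HP)/(ogeB KF HP); first apply: (ogeD KF HP).
  + exact/(prime_oge KF HP).
  + by apply/(prime_oge KF HP); rewrite mulrC; exact: PM.
  + by apply/(prime_oge KF HP); rewrite mulrC; exact: PM.
Qed.

(** * Primes outside infinity, their degrees, and divisors of regular functions *)

Section PrimeIdeals.
Context (ell : nat) (hell : prime ell) (F : fieldExtType {fraction {poly 'F_ell}}).
Local Notation pfe := (@prime_field_embedding ell F).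
Local Notation kap := (constants F).
Local Notation ordP := (ord [set: F]).
Local Notation ogeP := (oge [set: F]).
Local Notation prm := (Defs.primes [set: F]).

Context (Poo : set F) (HPoo : prm Poo) (Prat : is_rational kap [set: F] Poo).
Context (no_pole : forall y, (forall P, prm P -> ogeP P 0 y) -> kap y).
Local Notation RF := (RF Poo).
Local Notation pole := (pole Poo).

Context (t0 : F) (Rt0 : RF t0) (nkt0 : ~ kap t0).

Let TF : is_subfield [set: F]. Proof. exact: is_subfieldT. Qed.
Let kF : is_subfield kap. Proof. exact: constants_subfield. Qed.
Let kR : is_subring kap. Proof. exact: subfield_subring. Qed.
Let RR : is_subring RF. Proof. exact: RF_subring. Qed.
Let kRF : kap `<=` RF. Proof. exact: constants_RF. Qed.

Lemma RF_is_ideal : is_RF_ideal Poo RF.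
Proof.
split=> //; first by exists 1; [exact: (sr1 RR)|exact: oner_neq0].
  by move=> x z; exact: (srD RR).
by move=> x z; exact: (srM RR).
Qed.

Lemma RF_subspace : is_subspace kap RF.
Proof. exact: subspace_subring. Qed.

Section OnePrime.
Context (P : set F) (HP : prm P) (PPoo : P <> Poo).

Lemma RF_oge z : RF z -> ogeP P 0 z.
Proof. by apply. Qed.

Lemma primeD x y : P x -> P y -> P (x + y).
Proof. by move=> /(prime_oge TF HP) Px /(prime_oge TF HP) Py; apply/(prime_oge TF HP)/ogeD. Qed.

Lemma primeB x y : P x -> P y -> P (x - y).
Proof. by move=> /(prime_oge TF HP) Px /(prime_oge TF HP) Py; apply/(prime_oge TF HP)/ogeB. Qed.

Lemma primeM x y : ogeP P 0 x -> P y -> P (x * y).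
Proof.
move=> Ox /(prime_oge TF HP) Py; apply/(prime_oge TF HP); rewrite -[1]add0r.
exact: (ogeM TF HP).
Qed.

Lemma prime_const c : kap c -> P c -> c = 0.
Proof.
move=> kc /(prime_oge TF HP) Pc; apply/eqP; apply: contraT => c0.
by have := (ogeE _ _ I c0).1 Pc; rewrite (constants_ord hell HP kc c0).
Qed.

Lemma nprime_neq0 x : ~ P x -> x != 0.
Proof. by move=> nPx; apply/eqP => x0; apply: nPx; apply/(prime_oge TF HP); rewrite x0; exact: oge0. Qed.

Lemma nprime_ord x : ogeP P 0 x -> ~ P x -> ordP P x = 0.
Proof.
move=> Ox nPx; have x0 := nprime_neq0 nPx; have := (ogeE _ _ I x0).1 Ox.
have : ~ (1 <= ordP P x) by move=> h; apply: nPx; apply/(prime_oge TF HP)/ogeE.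
by move: (ordP P x); clear; lia.
Qed.

Lemma prime_subspace : is_subspace kap P.
Proof.
split; first by apply/(prime_oge TF HP); exact: oge0.
  exact: primeD.
by move=> a x ka; apply: primeM; exact: constants_oge.
Qed.

Lemma oge_subspace n : is_subspace kap (ogeP P n).
Proof.
split; [exact: oge0|by move=> x y; exact: ogeD|move=> a x ka ox].
by rewrite -[n]add0r; apply: ogeM => //; exact: constants_oge.
Qed.

Lemma prime_frob z : ogeP P 0 z -> exists r, (0 < r)%N /\ P (z ^+ (ell ^ r) - z).
Proof.
move=> Oz; have [OV PE] := prime_valring TF HP.
by have [r [r0 Pr]] := residue_frob hell OV Oz; exists r; rewrite PE.
Qed.

(** The residue of t0 is fixed by a power of Frobenius, so t0^(ell^r) - t0 lies in P. Were it
    constant, it would be 0 and t0 algebraic. *)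
Lemma prime_element : exists y, [/\ RF y, ~ kap y & P y].
Proof.
have [r [r0 Pr]] := prime_frob (RF_oge Rt0); exists (t0 ^+ (ell ^ r) - t0); split=> //.
  by apply: (srB RR) => //; exact: (srX RR).
move=> /prime_const /(_ Pr) /eqP; rewrite subr_eq0 => /eqP E; apply: nkt0.
by apply/(constantsP hell); exists r.
Qed.

(* The powers of the ideal (r, f), where z = r / f, all have the same index
   pole y over their multiple by y, which yields a relation for z with a unit
   coefficient. *)
Lemma denominator z : ogeP P 0 z -> exists a b, [/\ RF a, RF b, ~ P b & z = a / b].
Proof.
move=> Oz.
suff [b [Rb nPb Rbz]] : exists b, [/\ RF b, ~ P b & RF (b * z)].
  exists (b * z), b; split=> //.
  by rewrite [b * z]mulrC mulfK //; exact: nprime_neq0.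
have [g [g0]] := clear_poles hell Rt0 nkt0 z.
have f0 := poly_neq0 nkt0 g0; have Rf : RF (map_poly pfe g).[t0] by exact: RF_poly.
set f := (map_poly pfe g).[t0] in f0 Rf * => Rr; set r := f * z in Rr.
have [y [Ry nky Py]] := prime_element; set n := pole y.
(* These n + 1 elements generate the n-th power J of the ideal (r, f). As J / y J has dimension n,
   they are dependent modulo y J. *)
pose v (i : 'I_n.+1) := r ^+ i * f ^+ (n - i).
have Rv i : RF (v i) by apply: (srM RR); exact: (srX RR).
pose J : set F := [set x | exists a : 'I_n.+1 -> F, (forall i, RF (a i)) /\ x = \sum_i a i * v i].
have Jv i : J (v i).
  exists (fun j => (j == i)%:R); split=> [j|]; first exact: (sr_nat RR).
  by rewrite (bigD1 i) //= eqxx mul1r big1 ?addr0 // => j /negPf ->; rewrite mul0r.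
have JI : is_RF_ideal Poo J.
  split.
  - by move=> _ [a [Ra ->]]; apply: (sr_sum RR) => i _; exact: (srM RR).
  - exists (v ord0) => //.
    by rewrite /v expr0 mul1r expf_neq0.
  - move=> _ _ [a [Ra ->]] [a' [Ra' ->]]; exists (fun i => a i + a' i).
    split=> [i|]; first exact: (srD RR).
    by rewrite -big_split; apply: eq_bigr => i _; rewrite mulrDl.
  - move=> c _ Rc [a [Ra ->]]; exists (fun i => c * a i).
    split=> [i|]; first exact: (srM RR).
    by rewrite mulr_sumr; apply: eq_bigr => i _; rewrite mulrA.
have [s ks] := constants_finite hell F.
have [c [kc [i0 ci0] [_ [a [Ra ->]] E]]] := finite_dependence kF (RF_ideal_subspace hell JI)
  (ymul_subspace hell y JI) ks (ideal_has_dim hell HPoo Prat no_pole Ry nky JI) Jv.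
pose h := \poly_(i < n.+1) (c (inord i) - y * a (inord i)).
have hR : coefs_in RF h.
  move=> i; rewrite coef_poly; case: ifP => _; last exact: (sr0 RR).
  by apply: (srB RR); [exact: kRF|exact: (srM RR)].
apply: (denominator_of_root TF HP RR _ _ Oz hR).
- by move=> x; exact: RF_oge.
- move=> h1 h1R h1z Q HQ QP; have [OV _] := prime_valring TF HQ.
  by apply: (valring_lead_mul TF OV I) => // i; exact: h1R.
- apply/rootP; apply: (mulIf (expf_neq0 n f0)); rewrite mul0r /h horner_poly mulr_suml.
  have -> : \sum_(i < n.+1) (c (inord i) - y * a (inord i)) * z ^+ i * f ^+ n =
            \sum_(i < n.+1) c i * v i - y * \sum_(i < n.+1) a i * v i.
    rewrite mulr_sumr -sumrB; apply: eq_bigr => i _; rewrite inord_val [y * (a i * _)]mulrA -mulrBl -mulrA.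
    congr (_ * _); have le : (i <= n)%N by rewrite -ltnS.
    by rewrite /v /r exprMn mulrAC -exprD subnKC // mulrC.
  by rewrite E subrr.
(* As y lies in P, the coefficient at i0 is a nonzero constant modulo P. *)
exists i0; rewrite coef_poly ltn_ord inord_val => Pc.
have : P (c i0 - y * a i0 + a i0 * y) by apply: primeD => //; apply: primeM => //; exact: RF_oge.
by rewrite [a i0 * y]mulrC subrK => /(prime_const (kc i0)) /eqP; exact/negP.
Qed.

Lemma RF_residue z : ogeP P 0 z -> exists2 w, RF w & P (z - w).
Proof.
move=> /denominator [a [b [Ra Rb nPb ->]]]; have b0 := nprime_neq0 nPb.
have [r [r0 Pr]] := prime_frob (RF_oge Rb).
have [m mE] : exists m, (ell ^ r = m.+2)%N.
  have : (1 < ell ^ r)%N by rewrite -{1}(expn0 ell) ltn_exp2l // prime_gt1.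
  by case: (ell ^ r)%N => [|[|m]] // _; exists m.
(* Since b^(m + 2) is congruent to b and b is a unit at P, b^m is an inverse of b modulo P. *)
exists (a * b ^+ m); first by apply: (srM RR) => //; exact: (srX RR).
have -> : a / b - a * b ^+ m = - (a * b^-1 ^+ 2) * (b ^+ (ell ^ r) - b).
  rewrite mE (_ : b ^+ m.+2 = b ^+ m * (b * b)); last by rewrite !exprS mulrA mulrC.
  by move: (b ^+ m) => B; field.
apply: primeM => //; apply/(ogeN TF HP); rewrite -[0]addr0; apply: (ogeM TF HP); first exact: RF_oge.
have <- : (2%:Z * 0)%R = 0 by [].
apply: (ogeX TF HP); apply/ogeE => //; first by rewrite invr_eq0.
by rewrite ordV // nprime_ord //; exact: RF_oge.
Qed.

Lemma RF_uniformizer : exists w, [/\ RF w, w != 0 & ordP P w = 1].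
Proof.
have [pi [_ pi0 pi1]] := ord_uniformizer TF HP.
have Opi : ogeP P 0 pi by apply/ogeE; rewrite ?pi1.
have [a [b [Ra Rb nPb E]]] := denominator Opi; have b0 := nprime_neq0 nPb.
have aE : a = pi * b by rewrite E divfK.
have a0 : a != 0 by rewrite aE mulf_neq0.
by exists a; split=> //; rewrite aE ordM // pi1 nprime_ord ?addr0 //; exact: RF_oge.
Qed.

(** For a nonconstant regular y in P, reduction modulo P factors through the quotient by y, of
    dimension [pole y]. *)
Lemma residue_degree : exists d, (0 < d)%N /\ has_dim kap RF P d.
Proof.
have [y [Ry nky Py]] := prime_element.
have := ideal_has_dim hell HPoo Prat no_pole Ry nky RF_is_ideal.
move/(has_dim_quotient kF RF_subspace prime_subspace) => [|d [_ Hd]].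
  by move=> _ [r Rr <-]; rewrite mulrC; apply: primeM => //; exact: RF_oge.
exists d; split=> //; rewrite lt0n; apply/eqP => d0; move: Hd; rewrite d0.
move=> [b [_ /(_ 1 (sr1 RR)) [c [[_]]]]]; rewrite big_ord0 subr0 => P1 _.
by have := prime_const (sr1 kR) P1; apply/eqP; exact: oner_neq0.
Qed.

(** By [RF_residue] the regular functions already fill the residue field. *)
Lemma residue_degreeE d : has_dim kap RF P d -> prime_degree kap [set: F] P = d.
Proof.
move=> [b [Rb bP]].
have Hd : has_dim kap (ogeP P 0) P d.
  apply: (has_dim_intro (b := b) kF prime_subspace) => [i|x Ox|c kc].
  - exact: RF_oge.
  - have [w Rw Pw] := RF_residue Ox; have [c [[kc Pc] _]] := bP w Rw.
    exists c; split=> //.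
    by rewrite -(subrK w x) -addrA; exact: primeD.
  - by apply: (has_dim_indep kF RF_subspace _ Rb bP) => //; have [] := prime_subspace.
have [O [HO _ _ _ _]] := oge_ring TF HP.
rewrite /prime_degree; case: xgetP => [d' _ [O' HO' Hd']|/(_ d)]; last first.
  by case; exists O => //; rewrite (dvr_of_prime_oge TF HO).
apply: (has_dim_uniq kF (oge_subspace 0) prime_subspace _ Hd).
by rewrite -(dvr_of_prime_oge TF HO').
Qed.

End OnePrime.

Lemma prime_separation P P' : prm P -> P <> Poo -> prm P' -> P' <> Poo -> P <> P' ->
  exists s, [/\ RF s, P' s & ~ P s].
Proof.
move=> HP PPoo HP' P'Poo PP'; apply: contrapT => nex; apply: PP'.
apply: (prime_eq TF HP HP') => z /(denominator HP PPoo) [a [b [Ra Rb nPb ->]]].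
have nP'b : ~ P' b by move=> P'b; apply: nex; exists b.
have b0 := nprime_neq0 HP nPb.
rewrite -[0]addr0; apply: (ogeM TF HP'); first exact: RF_oge.
by apply/ogeE; rewrite ?invr_eq0 // ordV // nprime_ord //; exact: RF_oge.
Qed.

Definition finite_primes (l : seq (set F)) := forall P, P \in l -> prm P /\ P <> Poo.

(** The list stands for an effective divisor away from infinity, repetitions being
    multiplicities. *)
Definition ideal_of (l : seq (set F)) : set F :=
  [set r | forall P, prm P -> P <> Poo -> ogeP P (count_mem P l)%:Z r].

Lemma ideal_of_RF l : ideal_of l `<=` RF.
Proof. by move=> r Ir P HP PPoo; apply: oge_le (Ir _ HP PPoo). Qed.

Lemma ideal_of_subspace l : is_subspace kap (ideal_of l).
Proof.
split.
- by move=> P HP _; exact: oge0.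
- by move=> x y Ix Iy P HP PPoo; apply: ogeD => //; [exact: Ix|exact: Iy].
- by move=> a x ka Ix P HP PPoo; have [_ _] := oge_subspace HP (count_mem P l)%:Z; apply=> //; exact: Ix.
Qed.

Lemma ideal_ofM l x y : RF x -> ideal_of l y -> ideal_of l (x * y).
Proof.
move=> Rx Iy P HP PPoo; rewrite -[(count_mem P l)%:Z]add0r.
by apply: (ogeM TF HP); [exact: Rx|exact: Iy].
Qed.

(** A product: a uniformizer for each occurrence of P and, for every other finite prime in the list,
    a function vanishing there but not at P. *)
Lemma ideal_of_exact P l : prm P -> P <> Poo ->
  exists w, [/\ ideal_of l w, w != 0 & ordP P w = (count_mem P l)%:Z].
Proof.
move=> HP PPoo; elim: l => [|P' l [w [Iw w0 ow]]].
  exists 1; split; [by move=> Q HQ _; exact: oge1|exact: oner_neq0|by rewrite (ord_one TF HP)].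
have [PP'|PP'] := eqVneq P' P.
  have [u [Ru u0 ou]] := RF_uniformizer HP PPoo.
  exists (u * w); split; [|exact: mulf_neq0|].
    move=> Q HQ QPoo; rewrite /= PP' [X in ogeP Q X](_ : _ = (P == Q)%:Z + (count_mem Q l)%:Z) //.
    apply: (ogeM TF HQ); last exact: Iw.
    have [<-|_] := eqVneq P Q; last exact: Ru.
    by apply/ogeE; rewrite ?ou.
  by rewrite ordM // ou ow /= PP' eqxx.
have [[HP' P'Poo]|nP'] := pselect (prm P' /\ P' <> Poo); last first.
  exists w; split=> //; last by rewrite ow /= (negPf PP').
  move=> Q HQ QPoo /=; have -> : (P' == Q) = false by apply/eqP => P'Q; apply: nP'; rewrite P'Q.
  exact: Iw.
have [s [Rs P's nPs]] := prime_separation HP PPoo HP' P'Poo (fun E => negP PP' (introT eqP (esym E))).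
exists (s * w); split.
- move=> Q HQ QPoo; rewrite /= [X in ogeP Q X](_ : _ = (P' == Q)%:Z + (count_mem Q l)%:Z) //.
  apply: (ogeM TF HQ); last exact: Iw.
  have [<-|_] := eqVneq P' Q; last exact: Rs.
  exact/(prime_oge TF HP').
- by apply: mulf_neq0 => //; exact: (nprime_neq0 HP nPs).
- rewrite ordM //; last exact: (nprime_neq0 HP nPs).
  by rewrite (nprime_ord HP (Rs _ HP PPoo) nPs) ow /= (negPf PP').
Qed.

Definition degree (P : set F) := prime_degree kap [set: F] P.

(** Multiplication by an element of the ideal with exact order at P identifies the residue field of
    P with this quotient. *)
Lemma has_dim_step P l : prm P -> P <> Poo -> has_dim kap (ideal_of l) (ideal_of (P :: l)) (degree P).
Proof.
move=> HP PPoo; have [w [Iw w0 ow]] := ideal_of_exact l HP PPoo.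
have [d [_ Hd]] := residue_degree HP PPoo.
rewrite /degree (residue_degreeE HP PPoo Hd); have [b [Rb bP]] := Hd.
have wE (c : 'rV[F]_d) : lincomb c (\row_i (w * b 0 i)) = w * lincomb c b.
  by rewrite /lincomb mulr_sumr; apply: eq_bigr => i _; rewrite mxE mulrCA.
have SI := ideal_of_subspace (P :: l).
apply: (has_dim_intro (b := \row_i (w * b 0 i)) kF SI) => [i|r Ir|c kc].
- by rewrite mxE mulrC; exact: ideal_ofM.
- have Orw : ogeP P 0 (r / w).
    rewrite -(subrr (count_mem P l)%:Z); apply: (ogeM TF HP); first exact: Ir.
    by apply/ogeE; rewrite ?invr_eq0 // ordV // ow.
  have [w' Rw' Pw'] := RF_residue HP PPoo Orw.
  have [c [[kc Pc] _]] := bP _ Rw'; exists c; split=> // Q HQ QPoo; rewrite wE.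
  have Rlc : RF (lincomb c b).
    by apply: (sr_sum RR) => i _; apply: (srM RR) => //; exact: kRF.
  rewrite /= [X in ogeP Q X](_ : _ = (P == Q)%:Z + (count_mem Q l)%:Z) //.
  have [<-|_] := eqVneq P Q; last first.
    rewrite add0r; apply: (ogeB TF HQ); first exact: Ir.
    by rewrite mulrC; exact: (ideal_ofM Rlc Iw).
  have -> : r - w * lincomb c b = ((r / w - w') + (w' - lincomb c b)) * w.
    by rewrite [X in _ = X * w]addrA subrK mulrBl divfK // [w * _]mulrC.
  apply: (ogeM TF HP); last exact: Iw.
  by apply/(prime_oge TF HP); exact: primeD.
- rewrite wE => /(_ P HP PPoo) Iwc; have [kP0 _ _] := prime_subspace HP.
  apply: (has_dim_indep kF RF_subspace kP0 Rb bP kc); apply/(prime_oge TF HP).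
  have [->|lc0] := eqVneq (lincomb c b) 0; first exact: oge0.
  apply/ogeE => //; move: Iwc => /(ogeE _ _ I (mulf_neq0 w0 lc0)).
  by rewrite /= eqxx ordM // ow; move: (ordP P _) (count_mem P l); clear; lia.
Qed.

Lemma has_dim_ideal_of l : finite_primes l ->
  has_dim kap RF (ideal_of l) (\sum_(P <- l) degree P)%N.
Proof.
elim: l => [|P l IH] Hl.
  rewrite big_nil; apply: (has_dim_intro (b := 0) kF (ideal_of_subspace _)) => [[]//|r Rr|c _ _].
    exists 0; split=> [[]//|]; rewrite /lincomb big_ord0 subr0 => Q HQ QPoo.
    exact: Rr.
  by apply/rowP => -[].
have [HP PPoo] := Hl P (mem_head _ _).
have Hl' : finite_primes l by move=> Q Ql; apply: Hl; rewrite in_cons Ql orbT.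
rewrite big_cons addnC; apply: (has_dim_add kF RF_subspace (ideal_of_subspace l)
  (ideal_of_subspace _) (@ideal_of_RF l) _ (IH Hl') (has_dim_step l HP PPoo)).
by move=> r Ir Q HQ QPoo; apply: oge_le (Ir Q HQ QPoo) => //=; rewrite lez_nat leq_addl.
Qed.

Lemma degree_gt0 P : prm P -> P <> Poo -> (0 < degree P)%N.
Proof.
move=> HP PPoo; have [d [d0 Hd]] := residue_degree HP PPoo.
by rewrite /degree (residue_degreeE HP PPoo Hd).
Qed.

(* A list l of zeros of y, with y in its ideal, has at most pole y elements;
   if l has maximal length, then it exhausts the zeros of y. *)
Lemma RF_divisor y : RF y -> ~ kap y -> exists l, [/\ finite_primes l,
  (forall P, prm P -> P <> Poo -> ordP P y = (count_mem P l)%:Z) &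
  pole y = (\sum_(P <- l) degree P)%N].
Proof.
move=> Ry nky.
have y0 : y != 0 by apply/eqP => y0; apply: nky; rewrite y0; exact: (sr0 kR).
have Hd := ideal_has_dim hell HPoo Prat no_pole Ry nky RF_is_ideal.
have bound l : finite_primes l -> ideal_of l y -> (size l <= pole y)%N.
  move=> Hl Iy.
  have [|d' [le Hd']] := has_dim_quotient kF RF_subspace (ideal_of_subspace l) _ Hd.
    by move=> _ [r Rr <-]; rewrite mulrC; exact: ideal_ofM.
  apply: leq_trans le; rewrite (has_dim_uniq kF RF_subspace (ideal_of_subspace l) Hd' (has_dim_ideal_of Hl)).
  rewrite -sum1_size big_seq [X in (_ <= X)%N]big_seq; apply: leq_sum => P /Hl [HP PPoo].
  exact: degree_gt0.
pose ok n := `[< exists l, [/\ finite_primes l, ideal_of l y & size l = n] >].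
have ex : exists n, ok n.
  by exists 0%N; apply/asboolP; exists [::]; split=> // P HP PPoo; exact: Ry.
have ub n : ok n -> (n <= pole y)%N by move=> /asboolP [l [Hl Iy <-]]; exact: bound.
case: (ex_maxnP ex ub) => n /asboolP [l [Hl Iy ln]] nmax.
have oy P : prm P -> P <> Poo -> ordP P y = (count_mem P l)%:Z.
  move=> HP PPoo; apply: contrapT => ne.
  have lt : (count_mem P l)%:Z + 1 <= ordP P y.
    have := (ogeE _ _ I y0).1 (Iy _ HP PPoo).
    by move: ne; move: (ordP P y) (count_mem P l); clear; lia.
  suff : ok n.+1 by move/nmax; rewrite ltnn.
  apply/asboolP; exists (P :: l); split; last by rewrite /= ln.
    by move=> Q; rewrite in_cons => /orP[/eqP ->//|]; exact: Hl.
  move=> Q HQ QPoo /=; have [<-|_] := eqVneq P Q; last exact: Iy.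
  by apply/ogeE => //; rewrite addnC PoszD.
exists l; split=> //.
apply: (has_dim_uniq kF RF_subspace (ideal_of_subspace l) _ (has_dim_ideal_of Hl)).
suff <- : ymul y RF = ideal_of l by [].
apply/seteqP; split=> [_ [r Rr <-]|r Ir]; first by rewrite mulrC; exact: ideal_ofM.
exists (r / y); last by rewrite mulrC divfK.
move=> P HP PPoo; rewrite -(subrr (count_mem P l)%:Z).
apply: (ogeM TF HP); first exact: Ir.
by apply/ogeE; rewrite ?invr_eq0 // ordV // oy.
Qed.

End PrimeIdeals.

(** * The class group *)

Section ClassGroup.
Context (ell : nat) (hell : prime ell) (F : fieldExtType {fraction {poly 'F_ell}}).
Local Notation kap := (constants F).
Local Notation ordP := (ord [set: F]).
Local Notation ogeP := (oge [set: F]).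
Local Notation prm := (Defs.primes [set: F]).

Let TF : is_subfield [set: F]. Proof. exact: is_subfieldT. Qed.

Lemma place_prime (P : place F) : prm (place_ideal P).
Proof. exact: (set_mem (valP P)). Qed.

Lemma principal_divisorP (D : divisor F) : is_principal_divisor D <->
  exists2 x : F, x != 0 & forall P, coeff P D = ordP (place_ideal P) x.
Proof.
split=> -[x x0 xD]; exists x => // P.
  by have /(has_orderP TF (place_prime P)) [_ _ ->] := xD P.
by apply/(has_orderP TF (place_prime P)).
Qed.

Lemma principal_divisor0 : is_principal_divisor (0 : divisor F).
Proof.
apply/principal_divisorP; exists 1; first exact: oner_neq0.
by move=> P; rewrite coeff0 (ord_one TF (place_prime P)).
Qed.

Lemma principal_divisorB (D E : divisor F) : is_principal_divisor D ->
  is_principal_divisor E -> is_principal_divisor (D - E).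
Proof.
move=> /principal_divisorP [x x0 xD] /principal_divisorP [y y0 yE]; apply/principal_divisorP.
exists (x / y) => [|P]; first by rewrite mulf_neq0 ?invr_eq0.
by rewrite coeffB xD yE (ord_div TF (place_prime P)).
Qed.

Lemma principal_divisorN (D : divisor F) : is_principal_divisor D -> is_principal_divisor (- D).
Proof. by move=> pD; rewrite -sub0r; apply: principal_divisorB => //; exact: principal_divisor0. Qed.

Lemma principal_divisorD (D E : divisor F) : is_principal_divisor D ->
  is_principal_divisor E -> is_principal_divisor (D + E).
Proof. by move=> pD pE; rewrite -[E]opprK; apply: principal_divisorB => //; exact: principal_divisorN. Qed.

Lemma principal_divisorMn (D : divisor F) n : is_principal_divisor D -> is_principal_divisor (D *+ n).
Proof.
move=> pD; elim: n => [|n IH]; first by rewrite mulr0n; exact: principal_divisor0.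
by rewrite mulrS; exact: principal_divisorD.
Qed.

HB.instance Definition _ := GRing.isZmodMorphism.Build (divisor F) int (@divisor_degree ell F)
  (lift_is_additive (fun P => (place_degree P)%:Z : int^o)).

Lemma degreeD (D E : divisor F) : divisor_degree (D + E) = divisor_degree D + divisor_degree E.
Proof. exact: raddfD. Qed.

Lemma degreeB (D E : divisor F) : divisor_degree (D - E) = divisor_degree D - divisor_degree E.
Proof. exact: raddfB. Qed.

Lemma degreeMn (D : divisor F) n : divisor_degree (D *+ n) = divisor_degree D *+ n.
Proof. exact: raddfMn. Qed.

Lemma degreeU (c : int) P : divisor_degree (<< c *g P >> : divisor F) = c * (place_degree P)%:Z.
Proof. by rewrite /divisor_degree liftU. Qed.

Lemma degree_sum (I : Type) (s : seq I) (f : I -> divisor F) :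
  divisor_degree (\sum_(i <- s) f i) = \sum_(i <- s) divisor_degree (f i).
Proof. exact: raddf_sum. Qed.

(* Adding E permutes the classes, so that summing representatives of all the
   classes shows that h E is principal. *)
Lemma class_number_mul (E : divisor F) : finite_set (@class_group ell F) -> divisor_degree E = 0 ->
  is_principal_divisor (E *+ class_number F).
Proof.
move=> fin dE; rewrite /class_number; set S := fset_set _.
have SE c : c \in S <-> @class_group ell F c.
  by rewrite in_fset_set //; split=> [/set_mem//|]; exact: mem_set.
pose rep (c : set (divisor F)) := xget (0 : divisor F) [set D | divisor_degree D = 0 /\ divisor_class D = c].
have repP c : c \in S -> divisor_degree (rep c) = 0 /\ divisor_class (rep c) = c.
  move=> /SE [D dD <-]; rewrite /rep; case: xgetP => [D' _ //|/(_ D) []].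
  by split.
have class_eq (D D' : divisor F) : divisor_degree D = 0 -> is_principal_divisor (D - D') ->
    divisor_degree D' = 0 -> divisor_class D = divisor_class D'.
  move=> dD pDD' dD'; apply/seteqP; split=> A [dA pA]; split=> //.
    have -> : A - D' = (A - D) + (D - D') by rewrite addrA subrK.
    exact: (principal_divisorD pA pDD').
  have -> : A - D = (A - D') - (D - D') by rewrite opprB addrA subrK.
  exact: principal_divisorB.
have class_principal (D D' : divisor F) : divisor_degree D = 0 -> divisor_class D = divisor_class D' ->
    is_principal_divisor (D - D').
  move=> dD DD'; have : divisor_class D D by split=> //; rewrite subrr; exact: principal_divisor0.
  by rewrite DD' => -[].
pose f c := divisor_class (rep c + E).
have df c : c \in S -> divisor_degree (rep c + E) = 0.
  by move=> /repP [d _]; rewrite degreeD d dE addr0.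
have fS c : c \in S -> f c \in S.
  by move=> cS; apply/SE; exists (rep c + E) => //; exact: df.
have finj : {in S &, injective f}.
  move=> c c' cS c'S fcc'; have [dc rc] := repP c cS; have [dc' rc'] := repP c' c'S.
  rewrite -rc -rc'; apply: class_eq => //.
  have := class_principal _ _ (df c cS) fcc'.
  by rewrite opprD addrACA subrr addr0.
have perm : perm_eq (map f S) S.
  have um : uniq (map f S) by rewrite map_inj_in_uniq ?fset_uniq.
  have sub : {subset map f S <= S} by move=> _ /mapP [c cS ->]; exact: fS.
  apply: uniq_perm => //; first exact: fset_uniq.
  by have [|_] := uniq_min_size um sub; first by rewrite size_map.
have : is_principal_divisor (\sum_(c <- S) (rep c + E - rep (f c))).
  rewrite big_seq; apply: big_ind => [||c cS].
  - exact: principal_divisor0.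
  - by move=> D D'; exact: principal_divisorD.
  - apply: class_principal; first exact: df.
    by have [_ ->] := repP _ (fS c cS).
rewrite sumrB big_split /= -(big_map f xpredT rep) (perm_big _ perm) /= addrAC subrr add0r.
by rewrite big_const_seq count_predT iter_addr_0.
Qed.

Lemma principal_divisor_root p (E : divisor F) : prime p -> ~~ (p %| class_number F)%N ->
  divisor_degree E = 0 -> is_principal_divisor (E *+ p) -> is_principal_divisor E.
Proof.
(* On an infinite set [fset_set] is empty, so [class_number] would be 0, which p divides. *)
move=> hp hF dE pE; have [fin|nfin] := pselect (finite_set (@class_group ell F)); last first.
  by case/negP: hF; rewrite /class_number /fset_set; case: pselect => // _; rewrite cardfs0.
have hE := class_number_mul fin dE.
have /coprimeP : coprime (class_number F) p by rewrite coprime_sym prime_coprime.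
case; first by rewrite lt0n; apply: contraNneq hF => ->.
move=> [u v] /= uv; have -> : E = E *+ class_number F *+ u - E *+ p *+ v.
  by rewrite -!mulrnA -mulrnBr ?[(_ * u)%N]mulnC ?[(_ * v)%N]mulnC ?uv //; lia.
by apply: principal_divisorB; exact: principal_divisorMn.
Qed.

End ClassGroup.

Section DivisorOfFunction.
Context (ell : nat) (hell : prime ell) (F : fieldExtType {fraction {poly 'F_ell}}).
Local Notation kap := (constants F).
Local Notation ordP := (ord [set: F]).
Local Notation ogeP := (oge [set: F]).
Local Notation prm := (Defs.primes [set: F]).

Let TF : is_subfield [set: F]. Proof. exact: is_subfieldT. Qed.
Let kF : is_subfield kap. Proof. exact: constants_subfield. Qed.
Let kR : is_subring kap. Proof. exact: subfield_subring. Qed.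

Context (Pinf : place F) (hPinf : place_degree Pinf = 1%N).
Local Notation Poo := (place_ideal Pinf).
Let HPoo : prm Poo. Proof. exact: place_prime. Qed.

Lemma rational_place : is_rational kap [set: F] Poo.
Proof.
move: hPinf; rewrite /place_degree /prime_degree.
case: xgetP => // _ -> [O HO [b [Ob bP]]] d1; move: b Ob bP; rewrite d1 => b Ob bP z Oz.
have OE := dvr_of_prime_oge TF HO.
rewrite OE in Ob bP.
have dec x : ogeP Poo 0 x -> exists2 c, kap c & Poo (x - c * b 0 0).
  move=> /bP [c [[kc]]]; rewrite big_ord1 => Pc _.
  by exists (c 0 0).
have [c0 kc0 P1] := dec 1 (oge1 TF HPoo); have [c kc Pc] := dec z Oz.
have c00 : c0 != 0.
  apply/eqP => c00; move: P1; rewrite c00 mul0r subr0 => P1.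
  by have := prime_const hell HPoo (sr1 kR) P1; apply/eqP; exact: oner_neq0.
exists (c / c0); first exact: sf_div.
apply/(prime_oge TF HPoo).
have -> : z - c / c0 = (z - c * b 0 0) - c / c0 * (1 - c0 * b 0 0) by field.
apply: (primeB HPoo) => //; apply: (primeM HPoo) => //.
by apply: constants_oge => //; exact: sf_div.
Qed.

Context (no_pole : forall y, (forall P, prm P -> ogeP P 0 y) -> kap y).
Context (t0 : F) (Rt0 : RF Poo t0) (nkt0 : ~ kap t0).
Let RR : is_subring (RF Poo). Proof. exact: RF_subring. Qed.

Lemma place_neq (P : place F) : P != Pinf -> place_ideal P <> Poo.
Proof. by move=> PP E; move/eqP: PP; apply; exact: val_inj. Qed.

Lemma divisor_of_RF y : RF Poo y -> y != 0 -> exists D : divisor F,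
  (forall P, coeff P D = ordP (place_ideal P) y) /\ divisor_degree D = 0.
Proof.
move=> Ry y0; have [ky|nky] := pselect (kap y).
  exists 0; split=> [P|]; last exact: raddf0.
  by rewrite coeff0 (constants_ord hell (place_prime P)).
have [l [Hl oy dy]] := RF_divisor hell HPoo rational_place no_pole Rt0 nkt0 Ry nky.
have pole_ord := poleE hell HPoo no_pole Ry y0.
pose pl (P : set F) : place F := insubd Pinf P.
have plE P : P \in l -> place_ideal (pl P) = P.
  by move=> /Hl [HP _]; exact: (insubdK Pinf (mem_set HP)).
(* The zeros of y against its single pole; both parts have degree [pole Poo y] by [RF_divisor]. *)
exists (\sum_(P <- l) << pl P >> - << (pole Poo y)%:Z *g Pinf >>); split=> [P|].
  rewrite coeffB coeffU raddf_sum /=.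
  under eq_bigr do rewrite coeffU mul1r.
  have [->|PP] := eqVneq P Pinf.
    rewrite mulr1 pole_ord big_seq big1 ?sub0r // => P' P'l.
    suff /negPf -> : pl P' != Pinf by [].
    by apply/eqP => E; have [_] := Hl _ P'l; apply; rewrite -(plE _ P'l) E.
  rewrite mulr0 subr0 (oy _ (place_prime P) (place_neq PP)).
  rewrite -sum1_count (big_morph Posz PoszD erefl) [RHS]big_mkcond [LHS]big_seq [RHS]big_seq; apply: eq_bigr => P' P'l /=.
  have -> : (pl P' == P) = (P' == place_ideal P).
    apply/eqP/eqP => [<-|E]; first by rewrite plE.
    by apply: val_inj; rewrite -[LHS](plE _ P'l) in E *.
  by case: eqP.
rewrite degreeB degree_sum degreeU hPinf mulr1 dy.
rewrite (big_morph Posz PoszD erefl) big_seq [X in _ - X]big_seq -sumrB big1 // => P Pl.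
by rewrite degreeU mul1r /place_degree plE // subrr.
Qed.

Lemma divisor_exists y : y != 0 -> exists D : divisor F,
  (forall P, coeff P D = ordP (place_ideal P) y) /\ divisor_degree D = 0.
Proof.
move=> y0; have [g [g0 Rgy]] := clear_poles hell Rt0 nkt0 y.
have f0 := poly_neq0 nkt0 g0; have Rf : RF Poo (map_poly (@prime_field_embedding ell F) g).[t0] by exact: RF_poly.
set f := (map_poly _ g).[t0] in f0 Rf Rgy.
have [D [DE dD]] := divisor_of_RF Rgy (mulf_neq0 f0 y0).
have [E [EE dE]] := divisor_of_RF Rf f0.
exists (D - E); split=> [P|]; last by rewrite degreeB dD dE subrr.
by rewrite coeffB DE EE (ordM TF (place_prime P)) // addrC addKr.
Qed.

Lemma divisor_at_infinity (D : divisor F) : divisor_degree D = 0 ->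
  (forall P, P != Pinf -> coeff P D = 0) -> D = 0.
Proof.
move=> dD DP; have E : D = << coeff Pinf D *g Pinf >>.
  apply/eqP/freeg_eqP => P; rewrite coeffU.
  have [<-|PP] := eqVneq Pinf P; first by rewrite mulr1.
  by rewrite mulr0 DP // eq_sym.
by move: dD; rewrite E degreeU hPinf mulr1 => ->; exact: freegU0.
Qed.

(** Outside infinity the coefficients are divided by p. As [Pinf] has degree 1, the coefficient
    there can be chosen to make the degree 0, and is determined by that condition. *)
Lemma divisor_root (p : nat) (D : divisor F) : divisor_degree D = 0 ->
  (forall P, P != Pinf -> (p %| coeff P D)%Z) ->
  exists E : divisor F, divisor_degree E = 0 /\ E *+ p = D.
Proof.
move=> dD py.
pose E0 : divisor F := \sum_(P <- dom D | P != Pinf) << (coeff P D %/ p)%Z *g P >>.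
pose E : divisor F := E0 - << divisor_degree E0 *g Pinf >>.
exists E; have dE : divisor_degree E = 0 by rewrite degreeB degreeU hPinf mulr1 subrr.
have E0E P : P != Pinf -> coeff P E0 = (coeff P D %/ p)%Z.
  move=> PP; rewrite raddf_sum /=; have [Pd|Pd] := boolP (P \in dom D).
    rewrite big_mkcond (bigD1_seq P) ?uniq_dom //= PP coeffU eqxx mulr1 big1 ?addr0 // => P' P'P.
    by case: ifP => //; rewrite coeffU (negPf P'P) mulr0.
  rewrite (coeff_outdom Pd) div0z big_seq_cond big1 // => P' /andP[P'd _].
  rewrite coeffU; have [E'|_] := eqVneq P' P; last by rewrite mulr0.
  by rewrite -E' P'd in Pd.
split=> //; apply/eqP; rewrite -subr_eq0; apply/eqP; apply: divisor_at_infinity => [|P PP].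
  by rewrite degreeB degreeMn dE dD mul0rn subrr.
rewrite coeffB coeffMn /= coeffB E0E // coeffU [Pinf == P]eq_sym (negPf PP) mulr0 subr0.
by rewrite -mulr_natr natz divzK ?subrr //; exact: py.
Qed.

Lemma pth_power_of_divisible p y : prime p -> ~~ (p %| class_number F)%N -> y != 0 ->
  (forall P, prm P -> P <> Poo -> (p %| ordP P y)%Z) ->
  exists c z, [/\ kap c, c != 0, z != 0 & y = c * z ^+ p].
Proof.
move=> hp hF y0 py; have [D [DE dD]] := divisor_exists y0.
have [|E [dE ED]] := divisor_root dD (p := p).
  by move=> P PP; rewrite DE; apply: py; [exact: place_prime|exact: place_neq].
have pE : is_principal_divisor (E *+ p) by rewrite ED; apply/principal_divisorP; exists y.
have /principal_divisorP [z z0 zE] := principal_divisor_root hell hp hF dE pE.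
have zp0 : z ^+ p != 0 by rewrite expf_neq0.
exists (y / z ^+ p), z; split=> //; last 1 first.
- by rewrite divfK.
- apply: no_pole => P HP; pose Q : place F := SigSub (mem_set HP : P \in prm).
  have QP : place_ideal Q = P by [].
  apply/ogeE => //; first by rewrite mulf_neq0 ?invr_eq0.
  by rewrite ord_div // ordX // -QP -zE -DE -ED coeffMn -natz mulr_natl subrr.
- by rewrite mulf_neq0 ?invr_eq0.
Qed.

End DivisorOfFunction.

(** * p-th powers in the tower *)

(** Used in the group ring Z[phi] with X = phi: on layer n, X^(p^n) - 1 acts trivially, so that (phi
    - 1)^(p^n) produces only p-th powers. *)
Lemma frobenius_X_sub_1 (p n : nat) : prime p ->
  exists g : {poly int}, ('X - 1) ^+ (p ^ n) = 'X^(p ^ n) - 1 + g *+ p.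
Proof.
move=> hp; set d : {poly int} := ('X - 1) ^+ (p ^ n) - ('X^(p ^ n) - 1).
have pc : p \in [pchar {poly 'F_p}] by rewrite pchar_poly pchar_Fp.
have frob m (x y : {poly 'F_p}) : (x - y) ^+ (p ^ m) = x ^+ (p ^ m) - y ^+ (p ^ m).
  elim: m => [|m IH] //.
  by rewrite expnSr !exprM IH -(pFrobenius_autE pc) rmorphB /= !pFrobenius_autE.
have d0 : map_poly (intr : int -> 'F_p) d = 0.
  rewrite /d !rmorphB /= rmorphXn /= rmorphB /= !map_polyXn map_polyX rmorph1.
  by rewrite frob expr1n subrr.
have pd i : (p %| d`_i)%Z.
  have := congr1 (fun h : {poly 'F_p} => h`_i) d0; rewrite coef_map coef0 /= => /eqP.
  by rewrite -(dvdz_pcharf (pchar_Fp hp)).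
exists (\poly_(i < size d) (d`_i %/ p)%Z).
rewrite -[LHS](subrK ('X^(p ^ n) - 1)) addrC -/d; congr (_ + _).
apply/polyP => i; rewrite coefMn coef_poly; case: ltnP => [_|le].
  by rewrite -mulr_natr natz divzK.
by rewrite mul0rn nth_default.
Qed.

(** * The ring at infinity and the action of Frobenius on it *)

Section FunctionsAtInfinity.
Context (ell : nat) (hell : prime ell) (F : fieldExtType {fraction {poly 'F_ell}}).
Context (Omega : closedFieldType) (iota : {rmorphism F -> Omega}).
Context (p : nat) (hp : prime p) (Pinf : place F) (hPinf : place_degree Pinf = 1%N).

Local Notation kap := (constants F).
Local Notation "h ^i" := (map_poly iota h) (at level 2, format "h ^i").
Local Notation q0 := (q0 hell F).
Local Notation Fr := (@Fr ell hell F Omega p).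
Local Notation K := (tower iota p).
Local Notation k := (const_tower iota p).
Local Notation layer := (layer iota p).
Local Notation phi := (@phi ell hell F Omega iota p).
Local Notation phin := (@phin ell hell F Omega iota p).
Local Notation ordQ := (ord K).
Local Notation ordP := (ord [set: F]).
Local Notation ogeQ := (oge K).
Local Notation ogeP := (oge [set: F]).
Local Notation Rinf := (ring_at_infinity iota p Pinf).
Local Notation Poo := (place_ideal Pinf).
Local Notation tower_norm := (@tower_norm ell hell F Omega iota p).

Let KF : is_subfield K. Proof. exact: (tower_subfield hell). Qed.
Let KR : is_subring K. Proof. exact: subfield_subring. Qed.
Let TF : is_subfield [set: F]. Proof. exact: is_subfieldT. Qed.
Let kF : is_subfield k. Proof. exact: (const_tower_subfield hell). Qed.
Let kR : is_subring k. Proof. exact: subfield_subring. Qed.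
Let HPoo : Defs.primes [set: F] Poo. Proof. exact: place_prime. Qed.
Let Prat : is_rational kap [set: F] Poo. Proof. exact: rational_place. Qed.
Let kK : k `<=` K. Proof. exact: (const_tower_sub hell). Qed.

Let kP z : k z <-> exists n, Fr n z. Proof. exact: (const_towerP hell iota hp). Qed.

Definition finite_prime Q := Defs.primes K Q /\ iota @^-1` Q <> Poo.

Lemma ring_at_infinityP x : Rinf x <-> K x /\ forall Q, finite_prime Q -> ogeQ Q 0 x.
Proof.
split=> -[Kx H]; split=> // Q.
  move=> [HQ QP]; have [->|x0] := eqVneq x 0; first exact: oge0.
  apply/ogeE => //; rewrite leNgt; apply/negP => lt; apply: (H Q HQ QP).
  by exists (ordQ Q x) => //; apply/(has_orderP KF HQ).
move=> HQ QP [n n0 /(has_orderP KF HQ) [_ x0 nE]].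
have := (ogeE _ _ Kx x0).1 (H Q (conj HQ QP)); rewrite -nE; move: n0.
by move: (n); clear; lia.
Qed.

Lemma Rinf_subring : is_subring Rinf.
Proof.
apply/is_subringP; split.
- apply/ring_at_infinityP; split; first exact: sr1.
  by move=> Q [HQ _]; exact: oge1.
- move=> x y /ring_at_infinityP [Kx Rx] /ring_at_infinityP [Ky Ry]; apply/ring_at_infinityP.
  split; first exact: srB.
  by move=> Q fQ; have [HQ _] := fQ; apply: ogeB => //; [exact: Rx|exact: Ry].
- move=> x y /ring_at_infinityP [Kx Rx] /ring_at_infinityP [Ky Ry]; apply/ring_at_infinityP.
  split; first exact: srM.
  move=> Q fQ; have [HQ _] := fQ; rewrite -[0]addr0.
  by apply: (ogeM KF HQ); [exact: Rx|exact: Ry].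
Qed.

Lemma const_oge c Q : Defs.primes K Q -> k c -> ogeQ Q 0 c.
Proof. by move=> HQ; exact: (oge_const hell hp HQ). Qed.

Lemma const_ord0 c Q : Defs.primes K Q -> k c -> c != 0 -> ordQ Q c = 0.
Proof. by move=> HQ; exact: (const_ord hell hp HQ). Qed.

Lemma const_Rinf c : k c -> Rinf c.
Proof.
move=> kc; apply/ring_at_infinityP; split; first exact: kK.
by move=> Q [HQ _]; exact: const_oge.
Qed.

Lemma iota_const c : kap c -> k (iota c).
Proof. by move=> kc; apply/kP; exists 0%N; exact: Fr_constants. Qed.

Lemma F_no_pole y : (forall P, Defs.primes [set: F] P -> ogeP P 0 y) -> kap y.
Proof.
move=> Hy; have : k (iota y).
  apply: (no_pole_const hell hp HPoo Prat) => [|Q HQ]; first exact: tower_iota.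
  apply/(oge_restrict hell hp _ _ HQ); apply: Hy.
  by have [] := prime_restrict hell hp HQ.
by move/kP => [n]; exact: (Fr_constantsE hp).
Qed.

Lemma pole_at_infinity Q x : Defs.primes K Q -> iota @^-1` Q = Poo -> Rinf x -> ~ k x ->
  ordQ Q x < 0.
Proof.
move=> HQ QP /ring_at_infinityP [Kx Rx] nkx; rewrite ltNge; apply/negP => o0; apply: nkx.
apply: (no_pole_const hell hp HPoo Prat) => // Q' HQ'.
have [Q'P|Q'P] := pselect (iota @^-1` Q' = Poo); last exact: Rx.
have -> : Q' = Q := above_unique hell hp HPoo Prat HQ' HQ Q'P QP.
by split=> //; right.
Qed.

Lemma Rinf_iota y : Rinf (iota y) <-> RF Poo y.
Proof.
split=> [/ring_at_infinityP [_ H] P HP PPoo|Ry].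
  have [Q [HQ QP]] := prime_extend hell iota hp HP.
  by rewrite -QP; apply/(oge_restrict hell hp _ _ HQ)/H; split=> //; rewrite QP.
apply/ring_at_infinityP; split=> [|Q [HQ QP]]; first exact: tower_iota.
apply/(oge_restrict hell hp _ _ HQ); apply: Ry => //.
by have [] := prime_restrict hell hp HQ.
Qed.

Lemma finite_prime_phi Q : finite_prime Q -> exists Q', finite_prime Q' /\
  forall x, K x -> x != 0 -> ordQ Q (phi x) = ordQ Q' x.
Proof.
move=> [HQ QP]; have [HQ' oE] := prime_phi hell hp HQ.
exists [set z | K z /\ Q (phi z)]; split; last by move=> x Kx x0; rewrite oE.
split=> //; rewrite (_ : iota @^-1` _ = iota @^-1` Q) //.
apply/seteqP; split=> y /=; rewrite (phi_iota hell iota hp); first by case.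
by move=> Qy; split=> //; exact: tower_iota.
Qed.

Lemma Rinf_phi x : Rinf x -> Rinf (phi x).
Proof.
move=> /ring_at_infinityP [Kx Rx]; apply/ring_at_infinityP.
have Kp : K (phi x) by exact: tower_phi.
split=> // Q fQ; have [HQ _] := fQ; have [->|x0] := eqVneq x 0.
  by rewrite -(rmorph0 iota) (phi_iota hell iota hp) rmorph0; exact: oge0.
have [Q' [fQ' E]] := finite_prime_phi fQ.
apply/ogeE => //; first exact: phi_neq0.
by rewrite E //; apply/ogeE => //; exact: Rx.
Qed.

Lemma Rinf_phin i x : Rinf x -> Rinf (phin i x).
Proof. by move=> Rx; elim: i => // i IH; exact: Rinf_phi. Qed.

Lemma phi_const x : k x -> k (phi x).
Proof.
move=> /kP [n kx]; apply/kP; exists n.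
by rewrite (phi_Fr iota hp kx); exact: Fr_frob.
Qed.

(* The norm of x to F is nonconstant, as its order at infinity is negative. *)
Lemma RF_nonconstant x : Rinf x -> ~ k x -> exists t, RF Poo t /\ ~ kap t.
Proof.
move=> Rx nkx; have Kx : K x by move/ring_at_infinityP: (Rx) => [].
have [n _ lx] := Kx; have [t tE] := norm_iota hell hp lx.
have RN : Rinf (tower_norm n x).
  rewrite /tower_norm; apply: (big_ind Rinf); first exact: (sr1 Rinf_subring).
    by move=> *; exact: (srM Rinf_subring).
  by move=> i _; exact: Rinf_phin.
exists t; split; first by apply/Rinf_iota; rewrite -tE.
move=> kt; have x0 : x != 0 by apply/eqP => x0; apply: nkx; rewrite x0; exact: sr0.
have [Q [HQ QP]] := prime_extend hell iota hp HPoo.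
have ox i : (i < p ^ n)%N -> ordQ Q (phin i x) < 0.
  move=> ipn; apply: pole_at_infinity => //; first exact: Rinf_phin.
  move=> kp; apply: nkx; rewrite -(phin_period hell hp lx) -(subnK (ltnW ipn)) /phin iterD.
  by elim: (_ - i)%N => // j IH; exact: phi_const.
have o0 : ordQ Q (iota t) = 0.
  by apply: const_ord0 => //; [exact: iota_const|rewrite -tE (norm_neq0 hell hp n Kx)].
suff : ordQ Q (iota t) < 0 by rewrite o0.
have Kph i : K (phin i x) by exact: tower_phin.
rewrite -tE /tower_norm (ord_prod KF HQ) => [||i]; [|by move=> i; exact: tower_phin|exact: (phin_neq0 hell hp)].
have pn0 : (0 < p ^ n)%N by rewrite expn_gt0 prime_gt0.
rewrite (bigD1 (Ordinal pn0)) //= -[0]addr0; apply: ltr_leD; first exact: (ox 0%N pn0).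
by apply: sumr_le0 => i _; exact/ltW/ox.
Qed.

(** Let N be the cardinality of a layer of constants containing e. If p does not divide N - 1, the
    p-th power is bijective on that layer; otherwise the next layer, of degree p over it, contains
    the root. *)
Lemma const_pth_root e : k e -> exists2 e', k e' & e' ^+ p = e.
Proof.
move=> /kP [n kn]; have [->|e0] := eqVneq e 0.
  by exists 0; [exact: sr0|rewrite expr0n -[p]prednK ?prime_gt0].
pose N := (q0 ^ (p ^ n))%N; have eNe : e ^+ N = e := kn; have N1 : (1 < N)%N := card_gt1 hell F hp n.
have eN : e ^+ N.-1 = 1.
  by apply: (mulfI e0); rewrite mulr1 -exprS prednK ?eNe ?(ltnW N1).
have [cop|ncop] := boolP (coprime p N.-1).
  have [[u v] /= uv] : exists u : nat * nat, (u.1 * p - u.2 * N.-1 = 1)%N.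
    by apply/coprimeP => //; exact: prime_gt0.
  exists (e ^+ u); first by apply: (srX kR); apply/kP; exists n.
  have -> : e ^+ u ^+ p = e ^+ (u * p - v * N.-1 + v * N.-1).
    by rewrite subnK ?exprM //; move: uv; move: (u * p)%N (v * N.-1)%N; clear; lia.
  by rewrite uv exprD mulnC exprM eN expr1n mulr1 expr1.
have pN : (p %| N.-1)%N by move: ncop; rewrite prime_coprime // negbK.
have [x xp] : exists x : Omega, x ^+ p = e.
  have := @solve_monicpoly Omega p (fun i => if i == 0%N then e else 0) (prime_gt0 hp).
  move=> [x xE]; exists x; apply: etrans xE _; rewrite -(prednK (prime_gt0 hp)) big_ord_recl /= mulr1.
  by rewrite big1 ?addr0 // => i _; rewrite mul0r.
exists x => //; apply/kP; exists n.+1.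
have x0 : x != 0 by apply: contra_neq e0 => x0; rewrite -xp x0 expr0n (gtn_eqF (prime_gt0 hp)).
(* The N-th power multiplies x by z, a p-th root of unity, and fixes z as p divides N - 1. So its
   p-th iterate fixes x. *)
set z := x ^+ N.-1; have zp : z ^+ p = 1 by rewrite /z exprAC xp.
have zN : z ^+ N = z.
  rewrite -[N]prednK ?(ltnW N1) // exprS; have /dvdnP [d ->] := pN.
  by rewrite mulnC exprM zp expr1n mulr1.
have xN i : x ^+ (N ^ i) = z ^+ i * x.
  elim: i => [|i IH]; first by rewrite expn0 expr1 expr0 mul1r.
  rewrite expnSr exprM IH exprMn -exprM mulnC exprM zN exprS [z * _]mulrC -mulrA; congr (_ * _).
  by rewrite /z -exprSr prednK ?(ltnW N1).
have := xN p; rewrite zp mul1r /N -expnM -expnSr => H.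
exact: H.
Qed.

Lemma phiXz x (m : int) : K x -> phi (x ^ m) = phi x ^ m.
Proof.
move=> Kx; case: m => n; first exact: (phiX hell hp).
rewrite -[LHS]/(phi (x ^+ n.+1)^-1) -[RHS]/(phi x ^+ n.+1)^-1 (phiV hell hp); last exact: (srX KR).
by rewrite (phiX hell hp).
Qed.

(* The action of the group ring Z[phi] on the multiplicative group of the
   tower. *)
Definition phi_act x (h : {poly int}) := \prod_(i < size h) phin i x ^ h`_i.

Section GroupRingAction.
Context (x : Omega) (Kx : K x) (x0 : x != 0).

Let Kp i : K (phin i x). Proof. exact: tower_phin. Qed.
Let p0 i : phin i x != 0. Proof. exact: (phin_neq0 hell hp). Qed.

Lemma phi_act_wide (h : {poly int}) N : (size h <= N)%N -> phi_act x h = \prod_(i < N) phin i x ^ h`_i.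
Proof.
move=> le; rewrite /phi_act (big_ord_widen _ (fun i => phin i x ^ h`_i) le) big_mkcond.
apply: eq_bigr => i _; case: ltnP => // si.
by rewrite nth_default // expr0z.
Qed.

Lemma phi_act_tower h : K (phi_act x h).
Proof. by apply: (sr_prod KR) => i _; exact: sfXz. Qed.

Lemma phi_act_neq0 h : phi_act x h != 0.
Proof. by apply/prodf_neq0 => i _; exact: expfz_neq0. Qed.

Lemma phi_actD h g : phi_act x (h + g) = phi_act x h * phi_act x g.
Proof.
rewrite (phi_act_wide (size_polyD h g)) (phi_act_wide (leq_maxl (size h) (size g))).
rewrite (phi_act_wide (leq_maxr (size h) (size g))) -big_split; apply: eq_bigr => i _.
by rewrite coefD expfzDr.
Qed.

Lemma phi_act0 : phi_act x 0 = 1.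
Proof. by rewrite /phi_act size_poly0 big_ord0. Qed.

Lemma phi_actN h : phi_act x (- h) = (phi_act x h)^-1.
Proof.
apply: (mulIf (phi_act_neq0 h)); rewrite mulVf ?phi_act_neq0 //.
by rewrite -phi_actD addNr phi_act0.
Qed.

Lemma phi_actMn h m : phi_act x (h *+ m) = phi_act x h ^+ m.
Proof.
elim: m => [|m IH]; first by rewrite mulr0n phi_act0 expr0.
by rewrite mulrS phi_actD IH exprS.
Qed.

Lemma phi_act_mulX h : phi_act x ('X * h) = phi (phi_act x h).
Proof.
rewrite (phi_act_wide (N := (size h).+1)); last first.
  by rewrite mulrC; have [->|h0] := eqVneq h 0; rewrite ?mul0r ?size_poly0 // size_mulX.
rewrite big_ord_recl coefXM /= expr0z mul1r /phi_act.
have -> := phi_prod hell hp (size h) (f := fun i => phin i x ^ h`_i).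
  by apply: eq_bigr => i _; rewrite coefXM /= phiXz.
by move=> i; exact: sfXz.
Qed.

Lemma phi_actXn n : phi_act x 'X^n = phin n x.
Proof.
elim: n => [|n IH]; first by rewrite expr0 /phi_act size_poly1 big_ord1 coef1 /= expr1z.
by rewrite exprS phi_act_mulX IH.
Qed.

Lemma iter_psi m : iter m (fun z => phi z / z) x = phi_act x (('X - 1) ^+ m).
Proof.
elim: m => [|m IH]; first by rewrite expr0 (phi_actXn 0).
by rewrite iterS IH exprS mulrBl mul1r phi_actD phi_actN phi_act_mulX.
Qed.

Lemma iter_psi_pth_power n : layer n x -> exists2 u, K u & iter (p ^ n) (fun z => phi z / z) x = u ^+ p.
Proof.
move=> lx; have [g gE] := frobenius_X_sub_1 n hp; exists (phi_act x g); first exact: phi_act_tower.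
rewrite iter_psi gE !phi_actD phi_actMn phi_actXn phi_actN (phi_actXn 0).
by rewrite (phin_period hell hp lx) divff // mul1r.
Qed.

End GroupRingAction.

Definition divisible x := [/\ K x, x != 0 & forall Q, finite_prime Q -> (p %| ordQ Q x)%Z].

Lemma divisible_psi x : divisible x -> divisible (phi x / x).
Proof.
move=> [Kx x0 dx]; have Kp : K (phi x) by exact: tower_phi.
have p0 : phi x != 0 by exact: phi_neq0.
split; [exact: sf_div|by rewrite mulf_neq0 ?invr_eq0|move=> Q fQ].
have [HQ _] := fQ; rewrite (ord_div KF HQ) //; apply: rpredB; last exact: dx.
have [Q' [fQ' oE]] := finite_prime_phi fQ.
by rewrite oE //; exact: dx.
Qed.

Section ClassNumber.
Context (hF : ~~ (p %| class_number F)%N).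
Context (t : F) (Rt : RF Poo t) (nkt : ~ kap t).

(* Hilbert 90, applied first to the layer and then to its constants, reduces
   the claim for x to the claim for an element of F. *)
Lemma pth_power_descent x u : divisible x -> K u -> phi x / x = u ^+ p ->
  exists2 w, K w & x = w ^+ p.
Proof.
move=> [Kx x0 dx] Ku xu.
have [n [lx lu]] : exists n, layer n x /\ layer n u.
  have [n _ lx] := Kx; have [m _ lu] := Ku; exists (maxn n m); split.
    exact: (layer_mono hell hp (leq_maxl n m)).
  exact: (layer_mono hell hp (leq_maxr n m)).
have LF := layer_subfield iota p n; have LR := subfield_subring LF.
have FF := Fr_subfield hell iota p n; have FR := subfield_subring FF.
have px0 : phi x != 0 by exact: phi_neq0.
have Kpx : K (phi x) by exact: tower_phi.
have u0 : u != 0.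
  apply/eqP => u0; move/eqP: xu; rewrite u0 expr0n (gtn_eqF (prime_gt0 hp)) mulf_eq0 invr_eq0.
  by rewrite (negPf px0) (negPf x0).
have [c cE] := norm_iota hell hp lu.
have normX z m : K z -> tower_norm n (z ^+ m) = tower_norm n z ^+ m.
  move=> Kz; elim: m => [|m IH].
    by rewrite !expr0 /tower_norm big1 // => i _; rewrite -(rmorph1 iota) (phin_iota hell iota hp).
  by rewrite !exprS (normM hell hp) // ?IH //; exact: (srX KR).
have Npsi z : layer n z -> z != 0 -> tower_norm n (phi z / z) = 1.
  move=> lz z0; have Kz : K z by exists n.
  have Kpz : K (phi z) by exact: tower_phi.
  have E : tower_norm n (phi z) = tower_norm n z.
    rewrite -[RHS](norm_phi hell hp lz) /tower_norm.
    rewrite (phi_prod hell hp (p ^ n) (f := fun i => phin i z)) => [|i]; last exact: tower_phin.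
    by apply: eq_bigr => i _; exact: phin_iter.
  apply: (mulIf (norm_neq0 hell hp n Kz z0)); rewrite mul1r -(normM hell hp) //; last first.
    exact: sf_div.
  by rewrite divfK.
(* The norm of phi x / x is 1, so c^p = 1 and c is constant; a constant b with norm c then corrects
   u to an element of norm 1. *)
have cp : c ^+ p = 1.
  apply: (fmorph_inj iota); rewrite rmorphXn /= -cE -normX // -xu rmorph1.
  exact: Npsi.
have kc : kap c.
  apply: (constants_root (h := 'X^p - 1)).
  - by rewrite -size_poly_gt0 size_XnsubC // prime_gt0.
  - have kapR := subfield_subring (constants_subfield F).
    apply: (coefs_inB kapR); first exact: (coefs_inXn kapR).
    by rewrite -polyC1; apply: (coefs_inC kapR); exact: sr1.
  - by apply/rootP; rewrite hornerD hornerN hornerXn hornerC cp subrr.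
have c0 : c != 0.
  by apply: contra_eq_neq cp => ->; rewrite expr0n (gtn_eqF (prime_gt0 hp)) eq_sym oner_neq0.
have [b [Fb b0 bc]] := norm_surjective hell iota hp n kc c0.
have lb : layer n b by exact: layer_Fr.
have Kb : K b by exists n.
have ub0 : u / b != 0 by rewrite mulf_neq0 ?invr_eq0.
have Kub : K (u / b) by exact: sf_div.
have [w [lw w0 wE]] : exists w, [/\ layer n w, w != 0 & u / b = phi w / w].
  apply: (hilbert90 hp (n := n) (S := layer n)) => //.
  - by move=> z; exact: layer_Fr.
  - by move=> z; exact: layer_phi.
  - exact: (sf_div LF).
  - apply: (mulIf (norm_neq0 hell hp n Kb b0)); rewrite mul1r -(normM hell hp) //.
    by rewrite divfK // cE bc.
have Kw : K w by exists n.
have pw0 : phi w != 0 by exact: phi_neq0.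
(* Dividing x by w^p replaces u by the constant b. *)
set z := x / w ^+ p; have wp0 : w ^+ p != 0 by rewrite expf_neq0.
have lz : layer n z by apply: (sf_div LF) => //; exact: (srX LR).
have z0 : z != 0 by rewrite mulf_neq0 ?invr_eq0.
have zE : phi z / z = b ^+ p.
  have Kwp : K (w ^+ p) by exact: (srX KR).
  rewrite /z (phiM hell hp) //; last exact: sfV.
  rewrite (phiV hell hp) // (phiX hell hp) //.
  have -> : b ^+ p = u ^+ p / (u / b) ^+ p.
    by rewrite -expr_div_n invf_div mulrC divfK.
  rewrite -xu wE expr_div_n.
  by field; rewrite x0 /= !expf_neq0.
(* The norm of b^p is c^p = 1, so that d can be found among the constants and has no influence on
   orders. *)
have [d [Fd d0 dE]] : exists d, [/\ Fr n d, d != 0 & b ^+ p = phi d / d].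
  apply: (hilbert90 hp (n := n) (S := Fr n)) => //.
  - by move=> y; exact: layer_Fr.
  - by move=> y Fy; rewrite (phi_Fr iota hp Fy); exact: Fr_frob.
  - exact: (srX FR).
  - by rewrite expf_neq0.
  - by rewrite normX // bc -rmorphXn cp rmorph1.
have ld : layer n d by exact: layer_Fr.
have Kd : K d by exists n.
have pd0 : phi d != 0 by exact: phi_neq0.
have Kz : K z by exists n.
have [f fE] : exists f, z / d = iota f.
  apply: (phi_fixed hp (n := n)); first exact: (sf_div LF).
  rewrite (phiM hell hp) //; last exact: sfV.
  rewrite (phiV hell hp) //.
  have -> : phi z = b ^+ p * z by rewrite -zE divfK.
  by rewrite dE; field; rewrite pd0 d0.
have f0 : f != 0.
  by rewrite -(fmorph_eq0 iota) -fE mulf_neq0 ?invr_eq0.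
have df P : Defs.primes [set: F] P -> P <> Poo -> (p %| ordP P f)%Z.
  move=> HP PPoo; have [Q [HQ QP]] := prime_extend hell iota hp HP.
  have [_ oE] := prime_restrict hell hp HQ.
  rewrite -QP -oE // -fE (ord_div KF HQ) // (const_ord0 HQ _ d0); last by apply/kP; exists n.
  rewrite subr0 /z (ord_div KF HQ) //; last exact: (srX KR).
  rewrite (ordX KF HQ) //; apply: rpredB; last exact: dvdz_mulr.
  by apply: dx; split=> //; rewrite QP.
(* Only here does the class number enter: f is a p-th power up to a constant, and constants have
   p-th roots in the tower. *)
have [c1 [g [kc1 c10 g0 fg]]] := pth_power_of_divisible hell hPinf F_no_pole Rt nkt hp hF f0 df.
have [e ke ep] : exists2 e, k e & e ^+ p = d * iota c1.
  by apply: const_pth_root; apply: srM => //; [apply/kP; exists n|exact: iota_const].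
exists (w * iota g * e).
  by apply: srM => //; [apply: srM => //; exact: tower_iota|exact: kK].
rewrite !exprMn ep -rmorphXn.
have -> : x = w ^+ p * (d * (z / d)) by rewrite [d * _]mulrC divfK // /z mulrC divfK.
rewrite fE fg rmorphM /= -!mulrA; congr (_ * _).
by rewrite [RHS]mulrCA; congr (_ * _); rewrite mulrC.
Qed.

(** Applied p^n times, phi - 1 turns x into a p-th power, n being the index of a layer containing x.
    Since phi - 1 preserves divisibility of the orders, [pth_power_descent] removes one application
    at a time. *)
Lemma divisible_pth_power x : divisible x -> exists2 w, K w & x = w ^+ p.
Proof.
move=> dx; have [[n _ lx] x0 _] := dx; have Kx : K x by exists n.
have [u Ku uE] := iter_psi_pth_power Kx x0 lx.
have {u Ku uE} : exists2 u, K u & iter (p ^ n) (fun z => phi z / z) x = u ^+ p by exists u.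
elim: (p ^ n)%N => // m IH [u Ku uE]; apply: IH.
have dm : divisible (iter m (fun z => phi z / z) x).
  by elim: m {uE} => // m; exact: divisible_psi.
exact: (pth_power_descent dm Ku uE).
Qed.

End ClassNumber.

End FunctionsAtInfinity.

(** * Solutions of the equation, and the case of exponent p *)

Section Equation.
Context (ell : nat) (hell : prime ell) (F : fieldExtType {fraction {poly 'F_ell}}).
Context (Omega : closedFieldType) (iota : {rmorphism F -> Omega}).
Context (p : nat) (hp : prime p) (Pinf : place F) (hPinf : place_degree Pinf = 1%N).

Local Notation kap := (constants F).
Local Notation K := (tower iota p).
Local Notation k := (const_tower iota p).
Local Notation ordQ := (ord K).
Local Notation ogeQ := (oge K).
Local Notation Rinf := (ring_at_infinity iota p Pinf).
Local Notation Poo := (place_ideal Pinf).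
Local Notation finite_prime := (finite_prime iota p Pinf).

Let KF : is_subfield K. Proof. exact: (tower_subfield hell). Qed.
Let KR : is_subring K. Proof. exact: subfield_subring. Qed.
Let kF : is_subfield k. Proof. exact: (const_tower_subfield hell). Qed.
Let kR : is_subring k. Proof. exact: subfield_subring. Qed.
Let HPoo : Defs.primes [set: F] Poo. Proof. exact: place_prime. Qed.
Let Prat : is_rational kap [set: F] Poo. Proof. exact: rational_place. Qed.
Let kK : k `<=` K. Proof. exact: (const_tower_sub hell). Qed.
Let RP x : Rinf x <-> K x /\ forall Q, finite_prime Q -> ogeQ Q 0 x. Proof. exact: (ring_at_infinityP hell iota hp). Qed.
Let RI : is_subring Rinf. Proof. exact: Rinf_subring. Qed.

Lemma natr_eq0_dvdn m : m%:R = 0 :> Omega -> (ell %| m)%N.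
Proof.
move=> m0; have ch : ell \in [pchar Omega] by exact: (pcharO hell iota).
by rewrite (dvdn_pcharf ch) m0.
Qed.

(** At the only prime above infinity either e or its inverse has no pole, and that one is then
    constant. *)
Lemma Rinf_unit_const e : K e -> e != 0 -> (forall Q, finite_prime Q -> ordQ Q e = 0) -> k e.
Proof.
move=> Ke e0 oe; have [Q [HQ QP]] := prime_extend hell iota hp HPoo.
have const x : K x -> x != 0 -> (forall Q, finite_prime Q -> ordQ Q x = 0) -> 0 <= ordQ Q x -> k x.
  move=> Kx x0 ox oQ; apply: (no_pole_const hell hp HPoo Prat) => // Q' HQ'.
  apply/ogeE => //; have [Q'P|Q'P] := pselect (iota @^-1` Q' = Poo); last by rewrite ox.
  by rewrite (above_unique hell hp HPoo Prat HQ' HQ Q'P QP).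
have [/(const e Ke e0 oe)//|lt] := leP 0 (ordQ Q e).
rewrite -[e]invrK; apply: (sfV kF); apply: const; [exact: sfV|by rewrite invr_eq0| |].
  by move=> Q' fQ'; have [HQ' _] := fQ'; rewrite (ordV KF HQ') // oe // oppr0.
by rewrite (ordV KF HQ) // oppr_ge0 ltW.
Qed.

(* u - v is a unit of the ring at infinity, hence a constant; the quotient
   of u^p - v^p by u - v has a pole of order p - 1 times that of v. *)
Lemma const_pth_power_difference u v c : p <> ell -> Rinf u -> Rinf v ->
  k c -> c != 0 -> u ^+ p - v ^+ p = c -> k v.
Proof.
move=> pell Ru Rv kc c0 uvc.
have Ku : K u by move/RP: Ru => [].
have Kv : K v by move/RP: Rv => [].
set S := \sum_(i < p) u ^+ (p.-1 - i) * v ^+ i.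
have cE : c = (u - v) * S by rewrite -uvc subrXX.
have RS : Rinf S by apply: (sr_sum RI) => i _; apply: (srM RI); exact: (srX RI).
have KS : K S by move/RP: RS => [].
have [e0 S0] : u - v != 0 /\ S != 0 by apply/andP; rewrite -negb_or -mulf_eq0 -cE.
have Re : Rinf (u - v) by exact: (srB RI).
have Ke : K (u - v) by exact: srB.
have ke : k (u - v).
  apply: Rinf_unit_const => // Q fQ; have [HQ _] := fQ.
  have := const_ord0 hell hp HQ kc c0; rewrite cE (ordM KF HQ) //.
  have /(ogeE _ _ Ke e0) := ((RP _).1 Re).2 Q fQ.
  have /(ogeE _ _ KS S0) := ((RP _).1 RS).2 Q fQ.
  by move: (ordQ Q S) (ordQ Q (u - v)); clear; lia.
apply: contrapT => nkv; have v0 : v != 0 by apply/eqP => v0; apply: nkv; rewrite v0; exact: sr0.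
have [Q [HQ QP]] := prime_extend hell iota hp HPoo.
have ov := pole_at_infinity hell hp hPinf HQ QP Rv nkv.
have Kvi : K v^-1 by exact: sfV.
set s := u / v; have Ks : K s by exact: sf_div.
have s1 : ogeQ Q 1 (s - 1).
  have -> : s - 1 = (u - v) * v^-1 by rewrite mulrBl divff.
  rewrite -[1]add0r; apply: (ogeM KF HQ); first exact: (const_oge hell hp).
  apply/ogeE => //; first by rewrite invr_eq0.
  by rewrite (ordV KF HQ) //; move: ov; move: (ordQ Q v); clear; lia.
have Os : ogeQ Q 0 s.
  rewrite -(subrK 1 s); apply: (ogeD KF HQ); last exact: oge1.
  by apply: oge_le s1.
have sX i : ogeQ Q 1 (s ^+ i - 1).
  rewrite subrX1 -[1 : int]addr0; apply: (ogeM KF HQ) => //; apply: (oge_sum KF HQ) => j _.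
  by have := ogeX KF HQ j Os; rewrite mulr0.
(* At infinity s = u / v is congruent to 1, so S / v^(p - 1) is congruent to p, a unit because p
   differs from ell. Hence S has a pole, although S = c / (u - v) is constant. *)
have pS : ogeQ Q 1 (S / v ^+ p.-1 - p%:R).
  have -> : S / v ^+ p.-1 - p%:R = \sum_(i < p) (s ^+ (p.-1 - i) - 1).
    rewrite sumrB sumr_const card_ord; congr (_ - _); rewrite /S mulr_suml.
    apply: eq_bigr => i _; have le : (i <= p.-1)%N by rewrite -ltnS prednK ?prime_gt0.
    rewrite /s expr_div_n -mulrA; congr (_ * _).
    apply: (mulIf (expf_neq0 p.-1 v0)); rewrite -mulrA mulVf ?expf_neq0 // mulr1.
    by rewrite -{2}(subnK le) exprD mulrA mulVf ?expf_neq0 // mul1r.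
  by apply: (oge_sum KF HQ) => i _.
have kp : k p%:R by exact: sr_nat.
have p0 : p%:R != 0 :> Omega.
  apply/eqP => /natr_eq0_dvdn; rewrite dvdn_prime2 // => /eqP E.
  exact: pell.
have op := const_ord0 hell hp HQ kp p0.
have op1 : ordQ Q p%:R < 1 by rewrite op.
have [_] := ord_lt_add KF HQ (kK kp) p0 pS op1.
rewrite op addrC subrK (ord_div KF HQ) ?(ordX KF HQ) ?expf_neq0 //; last exact: (srX KR).
have := const_ord0 hell hp HQ kc c0; rewrite cE (ordM KF HQ) // (const_ord0 hell hp HQ ke e0) add0r => ->.
have := prime_gt1 hp; move: ov; move: (ordQ Q v) (p); clear => o m; nia.
Qed.

Context (t : nat) (a0 : F) (ha0 : kap a0) (ha0nz : a0 != 0).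
Context (a : 'I_t -> F) (ha : forall i, kap (a i)) (hainj : injective a).
Context (n : 'I_t -> nat).
Local Notation f := (a0 *: \prod_(i < t) ('X - (a i)%:P) ^+ n i).

Lemma horner_factors X : (map_poly iota f).[X] = iota a0 * \prod_(i < t) (X - iota (a i)) ^+ n i.
Proof.
rewrite map_polyZ hornerZ rmorph_prod horner_prod; congr (_ * _); apply: eq_bigr => i _.
by rewrite rmorphXn /= horner_exp rmorphB /= map_polyX map_polyC /= hornerXsubC.
Qed.

Lemma const_solution N X Y : (0 < N)%N -> k X -> Rinf Y -> Y ^+ N = (map_poly iota f).[X] -> k Y.
Proof.
move=> N0 kX /RP [KY _] E.
have [->|Y0] := eqVneq Y 0; first exact: sr0.
have kE : k (Y ^+ N).
  rewrite E horner_factors; apply: (srM kR); first exact: (iota_const hell).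
  apply: (sr_prod kR) => i _; apply: (srX kR); apply: (srB kR) => //.
  exact: (iota_const hell).
apply: (no_pole_const hell hp HPoo Prat) => // Q HQ; apply/ogeE => //.
have := const_ord0 hell hp HQ kE (expf_neq0 N Y0).
by rewrite (ordX KF HQ) // => /eqP; rewrite mulf_eq0 eqz_nat (gtn_eqF N0) => /eqP ->.
Qed.

Lemma solution_orders q m X Y i : prime q -> Rinf X -> Rinf Y -> ~ k X ->
  Y ^+ (q ^ m) = (map_poly iota f).[X] -> ~~ (q %| n i)%N ->
  forall Q, finite_prime Q -> ((q ^ m)%N %| ordQ Q (X - iota (a i)))%Z.
Proof.
move=> hq RX RY nkX E qni Q fQ; have [HQ _] := fQ.
have KX : K X by move/RP: RX => [].
have KY : K Y by move/RP: RY => [].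
have ka j : k (iota (a j)) by exact: (iota_const hell).
have KXa j : K (X - iota (a j)) by apply: (srB KR) => //; exact: kK.
have Xa0 j : X - iota (a j) != 0.
  by rewrite subr_eq0; apply/eqP => Xa; apply: nkX; rewrite Xa.
have oX j : 0 <= ordQ Q (X - iota (a j)).
  have R : Rinf (X - iota (a j)) by apply: (srB RI) => //; exact: const_Rinf.
  by apply/(ogeE _ _ (KXa j) (Xa0 j)); have [_] := (RP _).1 R; apply.
have [-> |oi] := eqVneq (ordQ Q (X - iota (a i))) 0; first exact: dvdz0.
have oj j : j != i -> ordQ Q (X - iota (a j)) = 0.
  move=> ji; have d0 : iota (a i) - iota (a j) != 0.
    by rewrite -rmorphB fmorph_eq0 subr_eq0; apply: contra_neq ji => /hainj.
  have kd : k (iota (a i) - iota (a j)) by exact: (srB kR).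
  have O1 : ogeQ Q 1 (X - iota (a i)).
    by apply/ogeE => //; move: (oX i) oi; move: (ordQ Q _); clear; lia.
  have od := const_ord0 hell hp HQ kd d0.
  have od1 : ordQ Q (iota (a i) - iota (a j)) < 1 by rewrite od.
  have [_] := ord_lt_add KF HQ (kK kd) d0 O1 od1.
  by rewrite od [_ + (X - _)]addrC addrA subrK => ->.
have Y0 : Y != 0.
  apply: contra_eq_neq E => ->; rewrite expr0n expn_eq0 (gtn_eqF (prime_gt0 hq)) /= eq_sym.
  rewrite horner_factors mulf_neq0 ?fmorph_eq0 //.
  by apply/prodf_neq0 => j _; exact: expf_neq0.
have : ordQ Q (Y ^+ (q ^ m)) = (n i)%:Z * ordQ Q (X - iota (a i)).
  have Kn j : K ((X - iota (a j)) ^+ n j) by exact: (srX KR).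
  have n0 j : (X - iota (a j)) ^+ n j != 0 by exact: expf_neq0.
  rewrite E horner_factors (ordM KF HQ) ?fmorph_eq0 //; last first.
  - by apply/prodf_neq0 => j _.
  - by apply: (sr_prod KR).
  - exact/kK/(iota_const hell).
  rewrite (const_ord0 hell hp HQ) ?fmorph_eq0 //; last exact: (iota_const hell).
  rewrite add0r (ord_prod KF HQ) // (bigD1 i) //= big1 ?addr0; first by rewrite (ordX KF HQ).
  by move=> j ji; rewrite (ordX KF HQ) // oj // mulr0.
rewrite (ordX KF HQ) // => oE.
have : ((q ^ m)%N %| (n i)%:Z * ordQ Q (X - iota (a i)))%Z by rewrite -oE; exact: dvdz_mulr.
rewrite Gauss_dvdzr // /coprimez /gcdz /= eqz_nat.
by apply: coprimeXl; rewrite prime_coprime.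
Qed.

Lemma constant_solutions_of_prime_exponent X Y : p <> ell -> ~~ (p %| class_number F)%N ->
  (2 <= #|[pred i | ~~ (p %| n i)%N]|)%N -> Rinf X -> Rinf Y ->
  Y ^+ p = (map_poly iota f).[X] -> k X /\ k Y.
Proof.
move=> pell hF h2 RX RY E.
suff kX : k X by split=> //; exact: const_solution (prime_gt0 hp) kX RY E.
apply: contrapT => nkX; have [t0 [Rt0 nkt0]] := RF_nonconstant hell hp hPinf RX nkX.
have [i [j [pi pj ij]]] : exists i j, [/\ ~~ (p %| n i)%N, ~~ (p %| n j)%N & i != j].
  by have /card_gt1P [i [j [? ? ?]]] := h2; exists i, j.
have KX : K X by move/RP: RX => [].
have root l : ~~ (p %| n l)%N -> exists2 u, Rinf u & X - iota (a l) = u ^+ p.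
  move=> pl; have kl : k (iota (a l)) by exact: (iota_const hell).
  have KXa : K (X - iota (a l)) by apply: (srB KR) => //; exact: kK.
  have Xa0 : X - iota (a l) != 0.
    by rewrite subr_eq0; apply/eqP => Xa; apply: nkX; rewrite Xa.
  have E1 : Y ^+ (p ^ 1) = (map_poly iota f).[X] by rewrite expn1.
  have dv : divisible iota p Pinf (X - iota (a l)).
    split=> // Q fQ; have := solution_orders hp RX RY nkX E1 pl fQ.
    by rewrite expn1.
  have [u Ku uE] := divisible_pth_power hell hp hPinf hF Rt0 nkt0 dv.
  exists u => //; apply/RP; split=> // Q fQ; have [HQ _] := fQ.
  have u0 : u != 0.
    by apply: contra_neq Xa0 => u0; rewrite uE u0 expr0n (gtn_eqF (prime_gt0 hp)).
  have R : Rinf (X - iota (a l)) by apply: (srB RI) => //; exact: const_Rinf.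
  have [_ /(_ Q fQ) /(ogeE _ _ KXa Xa0)] := (RP _).1 R.
  rewrite uE (ordX KF HQ) // pmulr_rge0; last by rewrite ltz_nat prime_gt0.
  by move=> ou; apply/ogeE.
have [u Ru uE] := root i pi; have [v Rv vE] := root j pj.
have kij : k (iota (a j) - iota (a i)) by apply: (srB kR); exact: (iota_const hell).
have ij0 : iota (a j) - iota (a i) != 0.
  by rewrite -rmorphB fmorph_eq0 subr_eq0; apply: contra_neq ij => /hainj.
have kv : k v.
  apply: (const_pth_power_difference pell Ru Rv kij ij0).
  by rewrite -uE -vE opprB addrC addrA subrK.
apply: nkX; rewrite -(subrK (iota (a j)) X) vE; apply: (srD kR); first exact: (srX kR).
exact: (iota_const hell).
Qed.

End Equation.

(** * The Mason-Stothers argument *)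

Section PowerExpansion.
Context (ell : nat) (hell : prime ell) (F : fieldExtType {fraction {poly 'F_ell}}).
Local Notation pfe := (@prime_field_embedding ell F).
Local Notation kap := (constants F).
Local Notation ordP := (ord [set: F]).
Local Notation ogeP := (oge [set: F]).
Local Notation prm := (Defs.primes [set: F]).

Context (Poo : set F) (HPoo : prm Poo) (Prat : is_rational kap [set: F] Poo).
Context (no_pole : forall y, (forall P, prm P -> ogeP P 0 y) -> kap y).
Local Notation RF := (RF Poo).
Local Notation pole := (pole Poo).

Context (t0 : F) (Rt0 : RF t0) (nkt0 : ~ kap t0).

Let TF : is_subfield [set: F]. Proof. exact: is_subfieldT. Qed.
Let kF : is_subfield kap. Proof. exact: constants_subfield. Qed.
Let kR : is_subring kap. Proof. exact: subfield_subring. Qed.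
Let RR : is_subring RF. Proof. exact: RF_subring. Qed.
Let kRF : kap `<=` RF. Proof. exact: constants_RF. Qed.
Let chF : ell \in [pchar F]. Proof. exact: pcharF. Qed.

Let nk0 x : ~ kap x -> x != 0.
Proof. by move=> nkx; apply/eqP => x0; apply: nkx; rewrite x0; exact: sr0. Qed.

Lemma constants_ell_root c : kap c -> exists2 c', kap c' & c' ^+ ell = c.
Proof.
move=> kc; have /(constantsP hell) [r [r0 cr]] := kc.
exists (c ^+ (ell ^ r.-1)); first exact: (srX kR).
by rewrite -exprM -expnSr prednK.
Qed.

(** Each class modulo [pole t0] contains a pole number, and powers of t0 reach all larger members of
    the class; M0 dominates the chosen representatives. *)
Lemma pole_number : exists M0, forall M, (M0 <= M)%N -> exists e, [/\ RF e, e != 0 & pole e = M].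
Proof.
have d0 := pole_gt0 hell no_pole Rt0 nkt0; set d := pole t0 in d0.
have H (i : 'I_d) : {e | [/\ RF e, e != 0 & (pole e %% d)%N = i]}.
  apply: cid.
  exact: (pole_class hell HPoo no_pole Rt0 nkt0 (RF_is_ideal _) (ltn_ord i)).
exists (\sum_i pole (sval (H i)))%N => M leM.
have id : (M %% d < d)%N by rewrite ltn_mod.
have [Re e0 eM] := svalP (H (Ordinal id)); set e := sval _ in Re e0 eM.
have le : (pole e <= M)%N by apply: leq_trans leM; rewrite (bigD1 (Ordinal id)) //= leq_addr.
have t00 := nk0 nkt0.
have Rt := srX RR ((M - pole e) %/ d) Rt0.
have t0n : t0 ^+ ((M - pole e) %/ d) != 0 by rewrite expf_neq0.
exists (t0 ^+ ((M - pole e) %/ d) * e); split; [exact: (srM RR)|exact: mulf_neq0|].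
rewrite (poleM hell HPoo no_pole) // (poleX hell HPoo no_pole) // divnK ?subnK //.
by rewrite -(eqn_mod_dvd _ le) eM.
Qed.

Lemma coprime_pole : exists t, [/\ RF t, t != 0 & ~~ (ell %| pole t)%N].
Proof.
have [M0 HM] := pole_number.
have [|e [Re e0 pe]] := HM (ell * M0 + 1)%N.
  by apply: leq_trans (leq_addr _ _); rewrite leq_pmull // prime_gt0.
exists e; split=> //.
by rewrite pe dvdn_addr ?dvdn_mulr // dvdn1 gtn_eqF ?prime_gt1.
Qed.

(** Functions with the same pole number agree up to a constant factor and a smaller pole, and there
    are finitely many constants. *)
Lemma finite_pole_lt m : exists s : seq F, forall z, RF z -> (z = 0 \/ (pole z < m)%N) -> z \in s.
Proof.
elim: m => [|m [s sP]]; first by exists [:: 0] => z _ [->|//]; rewrite mem_head.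
have [[e [Re e0 em]]|nex] := pselect (exists e, [/\ RF e, e != 0 & pole e = m]); last first.
  exists s => z Rz zm; apply: sP => //.
  have [->|z0] := eqVneq z 0; [by left|right].
  case: zm => [/eqP|]; first by rewrite (negPf z0).
  rewrite ltnS leq_eqVlt => /orP[/eqP zm|//].
  by case: nex; exists z.
have [k [_ kk]] := constants_finite hell F.
exists (s ++ [seq z + c * e | z <- s, c <- k]) => z Rz zm; rewrite mem_cat.
have [zm'|zm'] := pselect (z = 0 \/ (pole z < m)%N); first by rewrite sP.
have z0 : z != 0 by apply/eqP => z0; apply: zm'; left.
have pz : pole z = m.
  apply/eqP; case: zm => [/eqP|]; first by rewrite (negPf z0).
  rewrite ltnS leq_eqVlt => /orP[//|lt].
  by case: zm'; right.
have [c [kc c0 cP]] := pole_cancel hell HPoo Prat no_pole Rz Re z0 e0 (etrans pz (esym em)).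
apply/orP; right; apply/allpairsP; exists (z - c * e, c); split=> /=; last by rewrite subrK.
  apply: sP; last by rewrite -pz.
  by apply: (srB RR) => //; apply: (srM RR) => //; exact: kRF.
exact/kk.
Qed.

Context (t : F) (Rt : RF t) (t_neq0 : t != 0) (tl : ~~ (ell %| pole t)%N).

(** The module over the ell-th powers of regular functions generated by 1, t, ..., t^(ell - 1).
    [power_span_conductor] measures how far it is from all regular functions. *)
Definition power_span : set F :=
  [set z | exists h : 'I_ell -> F, (forall b, RF (h b)) /\ z = \sum_b h b ^+ ell * t ^+ b].

Lemma power_spanD x y : power_span x -> power_span y -> power_span (x + y).
Proof.
move=> [h [Rh ->]] [g [Rg ->]]; exists (fun b => h b + g b); split=> [b|].
  exact: (srD RR).
rewrite -big_split; apply: eq_bigr => b _.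
by have := frobD hell chF 1 (h b) (g b); rewrite expn1 => ->; rewrite mulrDl.
Qed.

Lemma power_spanM r x : RF r -> power_span x -> power_span (r ^+ ell * x).
Proof.
move=> Rr [h [Rh ->]]; exists (fun b => r * h b); split=> [b|]; first exact: (srM RR).
by rewrite mulr_sumr; apply: eq_bigr => b _; rewrite exprMn mulrA.
Qed.

Lemma power_span_monomial r b : RF r -> (b < ell)%N -> power_span (r ^+ ell * t ^+ b).
Proof.
move=> Rr lt; exists (fun j => if j == b :> nat then r else 0); split=> [j|].
  by case: ifP => // _; exact: (sr0 RR).
rewrite (bigD1 (Ordinal lt)) //= eqxx big1 ?addr0 // => j jb.
have -> : (j == b :> nat) = false by apply/negbTE; apply: contra_neq jb => E; exact: val_inj.
by rewrite expr0n (gtn_eqF (prime_gt0 hell)) mul0r.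
Qed.

(* As ell does not divide the pole number of t, every large number is the
   pole number of some e^ell * t^b. *)
Lemma power_span_cofinite : exists M1, forall z, RF z ->
  exists z', [/\ RF z', z' = 0 \/ (pole z' < M1)%N & power_span (z - z')].
Proof.
have [M0 HM] := pole_number.
(* From this bound on, (M - b pole t) / ell is at least M0 for every b < ell, hence a pole number
   when it is an integer. *)
exists (ell * M0 + ell * pole t)%N => z Rz.
have span0 : power_span 0.
  exists (fun _ => 0); split=> [_|]; first exact: (sr0 RR).
  by rewrite big1 // => b _; rewrite expr0n (gtn_eqF (prime_gt0 hell)) mul0r.
have [n] := ubnP (pole z); elim: n z Rz => // n IH z Rz zn.
have [->|z0] := eqVneq z 0.
  by exists 0; split; [exact: (sr0 RR)|left|rewrite subrr].
have [lt|ge] := ltnP (pole z) (ell * M0 + ell * pole t)%N.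
  by exists z; split=> //; [right|rewrite subrr].
set M := pole z in ge zn.
have ell0 := prime_gt0 hell.
(* An inverse of [pole t] modulo ell, which selects the b with b pole t congruent to M. *)
have [u uE] : exists u, (u * pole t = 1 %[mod ell])%N.
  have : coprime (pole t) ell by rewrite coprime_sym prime_coprime.
  have pt0 : (0 < pole t)%N by rewrite lt0n; apply: contraNneq tl => ->; rewrite dvdn0.
  move/(coprimeP _ pt0) => [[u v] /= uv]; exists u.
  rewrite -(modnMDl v 1) -uv addnC subnK //.
  by move: uv; move: (u * pole t)%N (v * ell)%N; clear; lia.
pose b := ((M * u) %% ell)%N; have bl : (b < ell)%N by rewrite ltn_mod.
have bM : (b * pole t = M %[mod ell])%N.
  by rewrite /b modnMml -mulnA -modnMmr uE modnMmr muln1.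
have le : (b * pole t <= M)%N.
  apply: leq_trans ge; apply: leq_trans (leq_addl _ _).
  by rewrite leq_mul2r ltnW ?orbT.
have dv : (ell %| M - b * pole t)%N by rewrite -eqn_mod_dvd // bM.
have [|e [Re e0 pe]] := HM ((M - b * pole t) %/ ell)%N.
  rewrite leq_divRL // mulnC leq_subRL //; apply: leq_trans ge.
  by rewrite addnC leq_add2l leq_mul2r ltnW ?orbT.
have [Re' Rtb] := (srX RR ell Re, srX RR b Rt).
have [e'0 tb0] := (expf_neq0 ell e0, expf_neq0 b t_neq0).
have pl : pole (e ^+ ell * t ^+ b) = M.
  rewrite (poleM hell HPoo no_pole) // !(poleX hell HPoo no_pole) // pe mulnC divnK // subnK //.
have [c [kc c0 cP]] := pole_cancel hell HPoo Prat no_pole Rz (srM RR Re' Rtb) z0 (mulf_neq0 e'0 tb0) (esym pl).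
have [c' kc' c'E] := constants_ell_root kc.
set l := c * _ in cP; have Ll : power_span l.
  by rewrite /l mulrA -c'E -exprMn; apply: power_span_monomial => //; apply: (srM RR) => //; exact: kRF.
have Rl : RF l by apply: (srM RR); [exact: kRF|exact: (srM RR)].
case: cP => [zl|zl].
  exists 0; split; [exact: (sr0 RR)|by left|].
  by rewrite subr0 -(subrK l z) zl add0r.
have [|z' [Rz' z'P L]] := IH (z - l) (srB RR Rz Rl).
  by apply: leq_trans zl _; rewrite -ltnS.
exists z'; split=> //; have -> : z - z' = (z - l - z') + l by rewrite addrAC subrK.
exact: power_spanD.
Qed.

(* RF modulo the span is finite, so that two powers of t^ell act in the same
   way on it. *)
Lemma power_span_conductor : exists r, [/\ RF r, r != 0 &
  forall z, RF z -> power_span (r ^+ ell * z)].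
Proof.
have [M1 HM] := power_span_cofinite; have [s sP] := finite_pole_lt M1.
have H z : {z' | RF z -> [/\ RF z', z' \in s & power_span (z - z')]}.
  apply: cid; have [Rz|nRz] := pselect (RF z); last by exists 0.
  have [z' [Rz' z'P L]] := HM z Rz; exists z' => _.
  by split=> //; exact: sP.
pose rep z := sval (H z).
(* [f i] records how t^(i ell) acts on the finitely many representatives; the difference of two
   powers acting alike sends them into the span. *)
pose f (i : nat) : {ffun 'I_(size s) -> 'I_(size s).+1} :=
  [ffun j : 'I_(size s) => inord (index (rep ((t ^+ i) ^+ ell * nth 0 s j)) s)].
have [i [i' [lt fE]]] := nat_pigeonhole f.
have pt0 : (0 < pole t)%N by rewrite lt0n; apply: contraNneq tl => ->; rewrite dvdn0.
have Rti j : RF (t ^+ j) by exact: (srX RR).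
exists (t ^+ i - t ^+ i'); split; first exact: (srB RR).
  rewrite subr_eq0; apply: contraTneq lt => /(congr1 pole).
  rewrite !(poleX hell HPoo no_pole) // => /eqP; rewrite eqn_pmul2r // => /eqP ->.
  by rewrite ltnn.
have frob (x y : F) : (x - y) ^+ ell = x ^+ ell - y ^+ ell.
  by have := frobB hell chF 1 x y; rewrite expn1.
have Hs z : z \in s -> RF z -> power_span ((t ^+ i - t ^+ i') ^+ ell * z).
  move=> zs Rz; have zi : (index z s < size s)%N by rewrite index_mem.
  have R1 j : RF ((t ^+ j) ^+ ell * z) by apply: (srM RR) => //; exact: (srX RR).
  have [Ra as1 La] := svalP (H _) (R1 i); have [Ra' as' La'] := svalP (H _) (R1 i').
  have E : rep ((t ^+ i) ^+ ell * z) = rep ((t ^+ i') ^+ ell * z).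
    have := congr1 (fun g : {ffun _} => nat_of_ord (g (Ordinal zi))) fE.
    rewrite !ffunE /= nth_index // !inordK ?ltnS ?index_size // => E.
    by rewrite -[LHS](nth_index 0 as1) -[RHS](nth_index 0 as') E.
  have minus x : power_span x -> power_span (- x).
    move=> Lx; have := power_spanM (srN RR (sr1 RR)) Lx.
    have := frobN hell chF 1 1; rewrite expn1 expr1n => ->.
    by rewrite mulN1r.
  have -> : (t ^+ i - t ^+ i') ^+ ell * z = ((t ^+ i) ^+ ell * z - rep ((t ^+ i) ^+ ell * z))
      - ((t ^+ i') ^+ ell * z - rep ((t ^+ i') ^+ ell * z)).
    by rewrite -E frob mulrBl opprB addrA subrK.
  by apply: power_spanD => //; exact: minus.
move=> z Rz; have [Rz' z's L] := svalP (H z) Rz.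
rewrite -(subrK (sval (H z)) z) mulrDr; apply: power_spanD; last exact: Hs.
by apply: power_spanM => //; exact: (srB RR).
Qed.

End PowerExpansion.

(** No cancellation is possible: the nonzero term of least order determines the order of the sum. *)
Lemma oge_distinct (L : fieldType) (K P : set L) m (c : 'I_m -> L) (n : int) :
  is_subfield K -> Defs.primes K P -> (forall i, K (c i)) ->
  (forall i j, i != j -> c i != 0 -> c j != 0 -> ord K P (c i) != ord K P (c j)) ->
  oge K P n (\sum_i c i) -> forall i, oge K P n (c i).
Proof.
move=> KF HP Kc dist On i; apply: contrapT => nO; have KR := subfield_subring KF.
have ci0 : c i != 0 by apply/eqP => ci; apply: nO; rewrite ci; exact: oge0.
have lt : ord K P (c i) < n.
  by rewrite ltNge; apply/negP => le; apply: nO; apply/ogeE.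
pose i1 := [arg min_(j < i | c j != 0) ord K P (c j)]%O.
have [c0 cmin] : c i1 != 0 /\ forall j, c j != 0 -> ord K P (c i1) <= ord K P (c j).
  by rewrite /i1; case: arg_minP.
have rest : oge K P (ord K P (c i1) + 1) (\sum_(j | j != i1) c j).
  apply: (oge_sum KF HP) => j ji; have [->|cj0] := eqVneq (c j) 0; first exact: oge0.
  apply/ogeE => //; have := cmin j cj0; have := dist j i1 ji cj0 c0.
  by move: (ord K P (c i1)) (ord K P (c j)); clear; lia.
have [|s0 so] := ord_lt_add KF HP (Kc i1) c0 rest.
  by move: (ord K P (c i1)); clear; lia.
have KS : K (\sum_j c j) by apply: (sr_sum KR) => j _.
have E : \sum_j c j = c i1 + \sum_(j | j != i1) c j by rewrite (bigD1 i1).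
rewrite -E in s0 so.
have := (ogeE _ _ KS s0).1 On; rewrite so; have := cmin i ci0.
by move: lt; move: (ord K P (c i)) (ord K P (c i1)); clear; lia.
Qed.

(** * Functions with prescribed poles and primitive polynomials *)

Section SinglePole.
Context (ell : nat) (hell : prime ell) (F : fieldExtType {fraction {poly 'F_ell}}).
Local Notation kap := (constants F).
Local Notation ordP := (ord [set: F]).
Local Notation ogeP := (oge [set: F]).
Local Notation prm := (Defs.primes [set: F]).
Context (Poo : set F) (HPoo : prm Poo) (Prat : is_rational kap [set: F] Poo).
Context (no_pole : forall y, (forall P, prm P -> ogeP P 0 y) -> kap y).
Context (t0 : F) (Rt0 : RF Poo t0) (nkt0 : ~ kap t0).

Let TF : is_subfield [set: F]. Proof. exact: is_subfieldT. Qed.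
Let RR : is_subring (RF Poo). Proof. exact: RF_subring. Qed.

(** The inverse of the a-th power of a uniformizer at P, multiplied by a function that cancels its
    other finite poles and is a unit at P. *)
Lemma single_pole P (a : nat) : prm P -> P <> Poo -> exists e, [/\ e != 0, ordP P e = - a%:Z &
  forall P', prm P' -> P' <> Poo -> P' <> P -> ogeP P' 0 e].
Proof.
move=> HP PPoo; have [->|a0] := posnP a.
  exists 1; split; [exact: oner_neq0|by rewrite (ord_one TF HP)|].
  by move=> P' HP' _ _; exact: oge1.
have [u [Ru u0 ou]] := RF_uniformizer hell HPoo Prat no_pole Rt0 nkt0 HP PPoo.
have Rua : RF Poo (u ^+ a) by exact: (srX RR).
have ua0 : u ^+ a != 0 by rewrite expf_neq0.
have oua : ordP P (u ^+ a) = a by rewrite (ordX TF HP) // ou mulr1.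
have nkua : ~ kap (u ^+ a).
  by move=> /(constants_ord hell HP) /(_ ua0); rewrite oua; move: a0; clear; lia.
have [l [Hl ol _]] := RF_divisor hell HPoo Prat no_pole Rt0 nkt0 Rua nkua.
have [w [Iw w0 ow]] := ideal_of_exact hell HPoo Prat no_pole Rt0 nkt0 (filter (predC1 P) l) HP PPoo.
have cP : count_mem P (filter (predC1 P) l) = 0%N.
  by apply/count_memPn; rewrite mem_filter /= eqxx.
exists (w / u ^+ a); split.
- by rewrite mulf_neq0 ?invr_eq0.
- by rewrite (ord_div TF HP) // ow cP oua sub0r.
- move=> P' HP' P'Poo /eqP P'P; have := Iw P' HP' P'Poo.
  rewrite count_filter (eq_count (a2 := pred1 P')); last first.
    by move=> x /=; case: eqP => // ->; rewrite P'P.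
  move=> /(ogeE _ _ I w0) le; apply/ogeE => //; first by rewrite mulf_neq0 ?invr_eq0.
  by rewrite (ord_div TF HP') // (ol _ HP' P'Poo) subr_ge0.
Qed.

Lemma common_denominator m (c : nat -> F) : exists f, [/\ RF Poo f, f != 0 &
  forall j, (j < m)%N -> RF Poo (f * c j)].
Proof.
elim: m => [|m [f [Rf f0 fc]]]; first by exists 1; split; [exact: (sr1 RR)|exact: oner_neq0|].
have [g [g0 Rg]] := clear_poles hell Rt0 nkt0 (Poo := Poo) (c m).
have gt0 := poly_neq0 nkt0 g0.
have Rgt : RF Poo (map_poly (@prime_field_embedding ell F) g).[t0] by exact: RF_poly.
exists (f * (map_poly (@prime_field_embedding ell F) g).[t0]); split.
- exact: (srM RR).
- exact: mulf_neq0.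
- move=> j; rewrite ltnS leq_eqVlt => /orP[/eqP ->|jm]; first by rewrite -mulrA; exact: (srM RR).
  by rewrite mulrAC; apply: (srM RR) => //; exact: fc.
Qed.

(* Dividing by a coefficient of minimal order at P. *)
Lemma primitive_multiple P (h : {poly F}) : prm P -> P <> Poo -> h != 0 ->
  exists c, [/\ c != 0, coefs_in (RF Poo) (c *: h) & exists i, ~ P (c *: h)`_i].
Proof.
move=> HP PPoo h0; have [f [Rf f0 fh]] := common_denominator (size h) (fun j => h`_j).
have lh : ((size h).-1 < size h)%N by rewrite prednK ?size_poly_gt0.
have lc0 : h`_(Ordinal lh) != 0 by rewrite /= -lead_coefE lead_coef_eq0.
pose i := [arg min_(j < Ordinal lh | h`_j != 0) ordP P h`_j]%O.
have [hi0 imin] : h`_i != 0 /\ forall j : 'I_(size h), h`_j != 0 -> ordP P h`_i <= ordP P h`_j.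
  by rewrite /i; case: arg_minP.
have fhi0 : f * h`_i != 0 by exact: mulf_neq0.
have := (ogeE _ _ I fhi0).1 (fh i (ltn_ord i) P HP PPoo).
case aE : (ordP P (f * h`_i)) => [a|//] _.
have [e [e0 oe eP]] := single_pole a HP PPoo.
have oc j : (j < size h)%N -> ogeP P 0 (e * f * h`_j).
  move=> js; have [->|hj0] := eqVneq h`_j 0; first by rewrite mulr0; exact: oge0.
  apply/ogeE => //; first by rewrite !mulf_neq0.
  have := imin (Ordinal js) hj0; rewrite /=; move: aE oe.
  rewrite !(ordM TF HP) ?mulf_neq0 //.
  by move: (ordP P f) (ordP P h`_i) (ordP P h`_j) (ordP P e); clear; lia.
exists (e * f); split; first exact: mulf_neq0.
  move=> j; rewrite coefZ; have [js|js] := ltnP j (size h); last first.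
    by rewrite nth_default // mulr0; exact: (sr0 RR).
  move=> P' HP' P'Poo; have [->|P'P] := pselect (P' = P); first exact: oc.
  rewrite -mulrA -[0]addr0; apply: (ogeM TF HP'); first exact: eP.
  exact: fh.
exists i; rewrite coefZ => /(prime_oge TF HP) /(ogeE _ _ I (mulf_neq0 (mulf_neq0 e0 f0) hi0)).
by rewrite -mulrA (ordM TF HP) // oe aE addNr.
Qed.

End SinglePole.

(** * Coordinates over ell-th powers in the tower *)

Section Mason.
Context (ell : nat) (hell : prime ell) (F : fieldExtType {fraction {poly 'F_ell}}).
Context (Omega : closedFieldType) (iota : {rmorphism F -> Omega}).
Context (p : nat) (hp : prime p) (Pinf : place F) (hPinf : place_degree Pinf = 1%N).

Local Notation kap := (constants F).
Local Notation q0 := (q0 hell F).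
Local Notation Fr := (@Fr ell hell F Omega p).
Local Notation theta := (@theta ell hell F Omega iota p hp).
Local Notation K := (tower iota p).
Local Notation k := (const_tower iota p).
Local Notation layer := (layer iota p).
Local Notation phi := (@phi ell hell F Omega iota p).
Local Notation phin := (@phin ell hell F Omega iota p).
Local Notation ordQ := (ord K).
Local Notation ogeQ := (oge K).
Local Notation ordP := (ord [set: F]).
Local Notation Rinf := (ring_at_infinity iota p Pinf).
Local Notation Poo := (place_ideal Pinf).
Local Notation finite_prime := (finite_prime iota p Pinf).
Local Notation tower_norm := (@tower_norm ell hell F Omega iota p).

Let TF : is_subfield [set: F]. Proof. exact: is_subfieldT. Qed.
Let KF : is_subfield K. Proof. exact: (tower_subfield hell). Qed.
Let KR : is_subring K. Proof. exact: subfield_subring. Qed.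
Let kF : is_subfield k. Proof. exact: (const_tower_subfield hell). Qed.
Let kR : is_subring k. Proof. exact: subfield_subring. Qed.
Let HPoo : Defs.primes [set: F] Poo. Proof. exact: place_prime. Qed.
Let Prat : is_rational kap [set: F] Poo. Proof. exact: rational_place. Qed.
Let kK : k `<=` K. Proof. exact: (const_tower_sub hell). Qed.
Let RP x : Rinf x <-> K x /\ forall Q, finite_prime Q -> ogeQ Q 0 x. Proof. exact: (ring_at_infinityP hell iota hp). Qed.
Let RI : is_subring Rinf. Proof. exact: Rinf_subring. Qed.
Let kP z : k z <-> exists n, Fr n z. Proof. exact: (const_towerP hell iota hp). Qed.
Let chO : ell \in [pchar Omega]. Proof. exact: (pcharO hell iota). Qed.
Let np := F_no_pole hell iota hp hPinf.

Let frobB1 (x y : Omega) : (x - y) ^+ ell = x ^+ ell - y ^+ ell.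
Proof. by have := frobB hell chO 1 x y; rewrite expn1. Qed.

Let frob_sum1 (m : nat) (f : 'I_m -> Omega) : (\sum_i f i) ^+ ell = \sum_i f i ^+ ell.
Proof. by have := frob_sum hell chO 1 (index_enum _) xpredT f; rewrite expn1. Qed.

Lemma const_ell_root c : k c -> exists2 c', k c' & c' ^+ ell = c.
Proof.
move=> kc; have /kP [n kn] := kc; have [s [s0 qE]] := q0_ell hell F.
have E : (q0 ^ (p ^ n) = ell ^ (s * p ^ n).-1 * ell)%N.
  by rewrite qE -expnM -expnSr prednK // muln_gt0 s0 expn_gt0 prime_gt0.
exists (c ^+ (ell ^ (s * p ^ n).-1)); first exact: (srX kR).
by rewrite -exprM -E; exact: kn.
Qed.

Definition tower_trace n z := \sum_(i < p ^ n) phin i z.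

Lemma trace_Rinf n z : layer n z -> Rinf z -> exists f, RF Poo f /\ tower_trace n z = iota f.
Proof.
move=> lz Rz; have LR := subfield_subring (layer_subfield iota p n).
have RT : Rinf (tower_trace n z) by apply: (sr_sum RI) => i _; exact: Rinf_phin.
have [||f fE] := phi_fixed (hell := hell) (iota := iota) hp (n := n) (z := tower_trace n z).
- by apply: (sr_sum LR) => i _; exact: layer_phin.
- have Kp i : K (phin i z) by apply: tower_phin => //; exists n.
  rewrite /tower_trace (phi_sum hell hp (p ^ n) (f := fun i => phin i z)) //.
  have := phin_period hell hp lz; have : (0 < p ^ n)%N by rewrite expn_gt0 prime_gt0.
  case: (p ^ n)%N => // m _ per.
  by rewrite big_ord_recr big_ord_recl /= addrC -[phi (phin m z)]/(phin m.+1 z) per.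
- by exists f; split=> //; apply/(Rinf_iota hell iota hp); rewrite -fE.
Qed.

(* Orthogonality of the powers of a primitive root of unity recovers z from
   the traces of its multiples by constants. *)
Lemma trace_expansion n z : K z -> z =
  - \sum_(j < (q0 ^ (p ^ n)).-1) theta n ^- j * tower_trace n (theta n ^+ j * z).
Proof.
move=> Kz; set N := (q0 ^ (p ^ n)).-1; have N1 := card_gt1 hell F hp n.
have th := thetaP hell iota hp n; rewrite -/N in th.
have Ft := theta_Fr hell iota hp n; have Kt : K (theta n) by apply/kK/kP; exists n.
have th0 : theta n != 0.
  apply/eqP => t0; have := prim_expr_order th; rewrite t0 expr0n gtn_eqF; last by rewrite /N; move: N1; lia.
  by move=> /eqP; rewrite eq_sym oner_eq0.
have term j : theta n ^- j * tower_trace n (theta n ^+ j * z) =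
    \sum_(i < p ^ n) (theta n ^+ (q0 ^ i) / theta n) ^+ j * phin i z.
  rewrite /tower_trace mulr_sumr; apply: eq_bigr => i _.
  have Kth : K (theta n ^+ j) by exact: (srX KR).
  rewrite (phinM hell hp) // (phinX hell hp) //.
  by rewrite (phin_Fr iota hp i Ft) mulrA; congr (_ * _); rewrite expr_div_n mulrC.
under eq_bigr do rewrite term.
rewrite exchange_big /=.
have pn0 : (0 < p ^ n)%N by rewrite expn_gt0 prime_gt0.
rewrite (bigD1 (Ordinal pn0)) //= [X in _ + X]big1 => [|i i0].
  rewrite addr0 expn0 expr1 divff // -mulr_suml.
  under eq_bigr do rewrite expr1n.
  rewrite sumr_const card_ord.
  have Nr : N%:R = -1 :> Omega.
    apply/eqP; rewrite -subr_eq0 opprK -(natrD _ N 1) addn1 prednK; last by move: N1; lia.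
    have [s [s0 qE]] := q0_ell hell F.
    by rewrite qE -expnM natrX (pcharf0 chO) expr0n muln_eq0 expn_eq0 (gtn_eqF s0) (gtn_eqF (prime_gt0 hp)).
  by rewrite Nr mulN1r opprK.
rewrite -mulr_suml; set x := theta n ^+ _ / theta n.
have xN : x ^+ N = 1.
  by rewrite /x expr_div_n -exprM mulnC exprM (prim_expr_order th) expr1n divr1.
have x1 : x != 1.
  apply/eqP => x1.
  have : theta n ^+ (q0 ^ i) == theta n ^+ 1 by apply/eqP/(divIf th0); rewrite expr1 divff.
  have q1 := q0_gt1 hell F.
  have i1 : (0 < i)%N by rewrite lt0n; apply: contra_neq i0 => i0; exact: val_inj.
  have qi1 : (1 < q0 ^ i)%N by rewrite -{1}(expn0 q0) ltn_exp2l.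
  have le : (q0 ^ i.+1 <= q0 ^ (p ^ n))%N by rewrite leq_exp2l.
  rewrite (eq_prim_root_expr th) (eqn_mod_dvd _ (ltnW qi1)) => /dvdn_leq.
  rewrite subn_gt0 => /(_ qi1); rewrite /N.
  move: le qi1 q1; rewrite expnS; move: (q0 ^ i)%N (q0 ^ (p ^ n))%N q0; clear => A B q; nia.
have : (x - 1) * \sum_(j < N) x ^+ j = 0 by rewrite -subrX1 xN subrr.
by move/eqP; rewrite mulf_eq0 subr_eq0 (negPf x1) /= => /eqP ->; rewrite mul0r.
Qed.

(** The coefficients in [trace_expansion] are constants and the traces are regular functions of F,
    so no denominators arise. This is what carries the conductor r from F to the whole tower. *)
Lemma Rinf_span z : Rinf z -> exists m (c : 'I_m -> Omega) (f : 'I_m -> F),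
  [/\ forall j, k (c j), forall j, RF Poo (f j) & z = \sum_j c j * iota (f j)].
Proof.
move=> Rz; have Kz : K z by move/RP: Rz => [].
have [n _ lz] := Kz; have LR := subfield_subring (layer_subfield iota p n).
have kt : k (theta n) by apply/kP; exists n; exact: theta_Fr.
have H (j : 'I_(q0 ^ (p ^ n)).-1) : {f | RF Poo f /\ tower_trace n (theta n ^+ j * z) = iota f}.
  apply: cid; apply: trace_Rinf.
    by apply: (srM LR) => //; apply: (srX LR); apply: layer_Fr => //; exact: theta_Fr.
  by apply: (srM RI) => //; apply: const_Rinf => //; exact: (srX kR).
exists (q0 ^ (p ^ n)).-1, (fun j => - theta n ^- j), (fun j => sval (H j)); split=> [j|j|].
- by apply: (srN kR); apply: (sfV kF); exact: (srX kR).
- by have [] := svalP (H j).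
- rewrite {1}(trace_expansion n Kz) -sumrN; apply: eq_bigr => j _.
  by have [_ <-] := svalP (H j); rewrite mulNr.
Qed.

Context (r t : F) (Rr : RF Poo r) (r0 : r != 0) (Rt : RF Poo t) (t_neq0 : t != 0).
Context (tl : ~~ (ell %| pole Poo t)%N).
Context (conductor : forall z, RF Poo z -> power_span Poo t (r ^+ ell * z)).
Local Notation tau := (iota t).

(** Constants are ell-th powers of constants, so the expansions over F of the functions in
    [Rinf_span] can be combined, with the same denominator r. *)
Lemma Rinf_expansion z : Rinf z -> exists B : 'I_ell -> Omega,
  (forall b, Rinf (iota r * B b)) /\ z = \sum_b B b ^+ ell * tau ^+ b.
Proof.
move=> /Rinf_span [m [c [f [kc Rf ->]]]].
have [|c' c'P] := boolp.choice (P := fun j x => k x /\ x ^+ ell = c j).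
  by move=> j; have [x kx E] := const_ell_root (kc j); exists x.
have [h hP] := boolp.choice (fun j => conductor (Rf j)).
have ir0 : iota r != 0 by rewrite fmorph_eq0.
exists (fun b => \sum_j c' j * iota (h j b) / iota r); split=> [b|].
  rewrite mulr_sumr; apply: (sr_sum RI) => j _; rewrite mulrC divfK //.
  apply: (srM RI); first by apply: const_Rinf => //; have [] := c'P j.
  by apply/(Rinf_iota hell iota hp); have [] := hP j.
under [RHS]eq_bigr do rewrite frob_sum1 mulr_suml.
rewrite exchange_big; apply: eq_bigr => j _ /=.
have [_ <-] := c'P j; have [_ hE] := hP j.
have -> : iota (f j) = iota r ^- ell * \sum_b iota (h j b) ^+ ell * tau ^+ b.
  apply: (mulfI (expf_neq0 ell ir0)); rewrite mulrA divff ?expf_neq0 // mul1r.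
  rewrite -rmorphXn -rmorphM hE rmorph_sum; apply: eq_bigr => b _.
  by rewrite rmorphM !rmorphXn.
rewrite mulrA mulr_sumr; apply: eq_bigr => b _.
rewrite mulrA; congr (_ * _).
by rewrite expr_div_n exprMn mulrAC.
Qed.

Section Infinity.
Context (Q : set Omega) (HQ : Defs.primes K Q) (QP : iota @^-1` Q = Poo).

Let otau : ordQ Q tau = - (pole Poo t)%:Z.
Proof.
have [_ oE] := prime_restrict hell hp HQ; rewrite oE // QP.
exact: (poleE hell HPoo np Rt t_neq0).
Qed.

Let Kt b : K (tau ^+ b). Proof. by apply: (srX KR); exact: tower_iota. Qed.
Let tau0 : tau != 0. Proof. by rewrite fmorph_eq0. Qed.

(** Modulo ell the terms have orders -b pole t, which are distinct because ell does not divide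
    [pole t]. *)
Lemma expansion_oge (G : 'I_ell -> Omega) n : (forall b, K (G b)) ->
  ogeQ Q n (\sum_b G b ^+ ell * tau ^+ b) -> forall b, ogeQ Q n (G b ^+ ell * tau ^+ b).
Proof.
move=> KG; apply: oge_distinct => // [b|b b' bb'].
  by apply: (srM KR) => //; exact: (srX KR).
rewrite !mulf_eq0 !negb_or !expf_eq0 (prime_gt0 hell) /= => /andP[G0 _] /andP[G'0 _].
have KGe c : K (G c ^+ ell) by exact: (srX KR).
have Ktau : K tau := tower_iota iota p t.
rewrite !(ordM KF HQ) ?expf_neq0 // !(ordX KF HQ) // otau; apply: contra_neq bb' => E; apply: val_inj.
have dv : (ell %| ((b : nat)%:Z - (b' : nat)%:Z) * (pole Poo t)%:Z)%Z.
  apply/dvdzP; exists (ordQ Q (G b) - ordQ Q (G b')).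
  by move: E; move: (ordQ Q (G b)) (ordQ Q (G b')) (pole Poo t) (b : nat) (b' : nat); clear; nia.
move: dv; rewrite Gauss_dvdzl; last by rewrite coprimezE /= prime_coprime.
have := ltn_ord b; have := ltn_ord b'.
rewrite dvdzE /=; case: (ltngtP b b') => //= [lt|lt] bl b'l /dvdn_leq.
  by move: lt bl b'l; move: (b : nat) (b' : nat); clear; lia.
by move: lt bl b'l; move: (b : nat) (b' : nat); clear; lia.
Qed.

Lemma expansion_unique (G G' : 'I_ell -> Omega) : (forall b, K (G b)) -> (forall b, K (G' b)) ->
  \sum_b G b ^+ ell * tau ^+ b = \sum_b G' b ^+ ell * tau ^+ b -> forall b, G b = G' b.
Proof.
move=> KG KG' E b; have KD c : K (G c - G' c) by exact: (srB KR).
have S0 : \sum_b (G b - G' b) ^+ ell * tau ^+ b = 0.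
  transitivity (\sum_b G b ^+ ell * tau ^+ b - \sum_b G' b ^+ ell * tau ^+ b).
    by rewrite -sumrB; apply: eq_bigr => c _; rewrite frobB1 mulrBl.
  by rewrite E subrr.
apply/eqP; rewrite -subr_eq0; apply: contraT => D0.
set x := (G b - G' b) ^+ ell * tau ^+ b.
have x0 : x != 0 by rewrite mulf_neq0 ?expf_neq0.
have Kx : K x by apply: (srM KR) => //; exact: (srX KR).
have O0 : ogeQ Q (ordQ Q x + 1) (\sum_b (G b - G' b) ^+ ell * tau ^+ b) by rewrite S0; exact: oge0.
have := (ogeE _ _ Kx x0).1 (expansion_oge KD O0 b).
by move: (ordQ Q x); clear; lia.
Qed.

End Infinity.

Let nkt : ~ kap t.
Proof. by move=> kt; move: tl; rewrite (pole_constant hell HPoo kt t_neq0) dvdn0. Qed.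

(** The tower counterpart of [denominator]: a polynomial over F annihilating u is scaled to be
    primitive at the prime below Q, and [denominator_of_root] applies. *)
Lemma tower_denominator Q u : finite_prime Q -> K u -> ogeQ Q 0 u ->
  exists s, [/\ Rinf s, ~ Q s & Rinf (s * u)].
Proof.
move=> [HQ QP] Ku Ou; have [HP _] := prime_restrict hell hp HQ.
have [n _ lu] := Ku; have [h h0 hu] := layer_algebraic hell hp lu.
have [c [c0 cR [i nPi]]] := primitive_multiple hell HPoo Prat np Rt nkt HP QP h0.
apply: (denominator_of_root KF HQ RI (h := map_poly iota (c *: h))) => //.
- by move=> x /RP [_]; apply; split.
- move=> g gR gu; apply/RP; split.
    apply: (srM KR) => //; have /RP [] : Rinf (lead_coef g) by exact: gR.
    by [].
  move=> Q' fQ'; have [HQ' _] := fQ'; have [OV _] := prime_valring KF HQ'.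
  apply: (valring_lead_mul KF OV Ku) => // j.
  by have /RP [_] := gR j; apply.
- by move=> j; rewrite coef_map; apply/(Rinf_iota hell iota hp); exact: cR.
- by rewrite map_polyZ rootZ ?fmorph_eq0.
- by exists i; rewrite coef_map.
Qed.

(** Multiplying z by e^ell multiplies its coordinates by e, by uniqueness. With e of order -a at Q
    and e^ell z still regular outside infinity, r e B_b is regular too, which bounds the order of r
    B_b. *)
Lemma expansion_order z (B : 'I_ell -> Omega) Q (a : nat) : Rinf z -> z != 0 ->
  (forall b, Rinf (iota r * B b)) -> z = \sum_b B b ^+ ell * tau ^+ b ->
  finite_prime Q -> (ell * a)%N%:Z <= ordQ Q z -> forall b, ogeQ Q a (iota r * B b).
Proof.
move=> Rz z0 RB zE fQ oz b; have [HQ QP] := fQ; have Kz : K z by move/RP: Rz => [].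
have ir0 : iota r != 0 by rewrite fmorph_eq0.
have KB c : K (B c).
  have -> : B c = iota r * B c / iota r by rewrite mulrAC divff ?mul1r.
  by apply: (sf_div KF); [move/RP: (RB c) => []|exact: tower_iota].
have [HP oE] := prime_restrict hell hp HQ.
have [pi [_ pi0 opi]] := ord_uniformizer TF HP.
set w := iota pi; have w0 : w != 0 by rewrite fmorph_eq0.
have Kw : K w := tower_iota iota p pi.
have ow : ordQ Q w = 1 by rewrite oE.
have Kwa j : K (w ^+ j) by exact: (srX KR).
have wa0 j : w ^+ j != 0 by exact: expf_neq0.
have Ku : K (z / w ^+ (ell * a)) by exact: sf_div.
have u0 : z / w ^+ (ell * a) != 0 by rewrite mulf_neq0 ?invr_eq0.
have Ou : ogeQ Q 0 (z / w ^+ (ell * a)).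
  by apply/ogeE => //; rewrite (ord_div KF HQ) // (ordX KF HQ) // ow mulr1 subr_ge0.
have [s [Rs nQs Rsu]] := tower_denominator fQ Ku Ou.
have Ks : K s by move/RP: Rs => [].
have s0 : s != 0.
  by apply/eqP => s0; apply: nQs; apply/(prime_oge KF HQ); rewrite s0; exact: oge0.
have os : ordQ Q s = 0.
  have /RP [_ /(_ Q fQ) /(ogeE _ _ Ks s0)] := Rs.
  have : ~ (1 <= ordQ Q s) by move=> h; apply: nQs; apply/(prime_oge KF HQ)/ogeE.
  by move: (ordQ Q s); clear; lia.
set e := s / w ^+ a; have Ke : K e by exact: sf_div.
have e0 : e != 0 by rewrite mulf_neq0 ?invr_eq0.
have oe : ordQ Q e = - a%:Z by rewrite (ord_div KF HQ) // os (ordX KF HQ) // ow mulr1 sub0r.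
have Rez : Rinf (e ^+ ell * z).
  have -> : e ^+ ell * z = s ^+ ell.-1 * (s * (z / w ^+ (ell * a))).
    rewrite mulrA -exprSr prednK ?prime_gt0 // /e expr_div_n -exprM [(a * ell)%N]mulnC.
    by rewrite mulrA mulrAC.
  by apply: (srM RI) => //; exact: (srX RI).
have [C [RC CE]] := Rinf_expansion Rez.
have KC c : K (C c).
  have -> : C c = iota r * C c / iota r by rewrite mulrAC divff ?mul1r.
  by apply: (sf_div KF); [move/RP: (RC c) => []|exact: tower_iota].
have [Qi [HQi QiP]] := prime_extend hell iota hp HPoo.
have CB : C b = e * B b.
  apply: (expansion_unique HQi QiP (G := C) (G' := fun c => e * B c)) => // [c|].
    exact: (srM KR).
  by rewrite -CE zE mulr_sumr; apply: eq_bigr => c _; rewrite [(e * _) ^+ ell]exprMn mulrA.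
have -> : iota r * B b = e^-1 * (iota r * C b).
  by rewrite CB [RHS]mulrCA; congr (_ * _); rewrite mulKf.
rewrite -[a%:Z]addr0; apply: (ogeM KF HQ); last by have /RP [_] := RC b; apply.
apply/ogeE; [exact: sfV|by rewrite invr_eq0|].
by rewrite (ordV KF HQ) // oe opprK.
Qed.

End Mason.

(** * The bound on the exponent *)

Section PowerBound.
Context (ell : nat) (hell : prime ell) (F : fieldExtType {fraction {poly 'F_ell}}).
Context (Omega : closedFieldType) (iota : {rmorphism F -> Omega}).
Context (p : nat) (hp : prime p) (Pinf : place F) (hPinf : place_degree Pinf = 1%N).

Local Notation kap := (constants F).
Local Notation K := (tower iota p).
Local Notation k := (const_tower iota p).
Local Notation phi := (@phi ell hell F Omega iota p).
Local Notation phin := (@phin ell hell F Omega iota p).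
Local Notation ordQ := (ord K).
Local Notation ogeQ := (oge K).
Local Notation ordP := (ord [set: F]).
Local Notation Rinf := (ring_at_infinity iota p Pinf).
Local Notation Poo := (place_ideal Pinf).
Local Notation finite_prime := (finite_prime iota p Pinf).
Local Notation tower_norm := (@tower_norm ell hell F Omega iota p).

Let TF : is_subfield [set: F]. Proof. exact: is_subfieldT. Qed.
Let KF : is_subfield K. Proof. exact: (tower_subfield hell). Qed.
Let KR : is_subring K. Proof. exact: subfield_subring. Qed.
Let kF : is_subfield k. Proof. exact: (const_tower_subfield hell). Qed.
Let kR : is_subring k. Proof. exact: subfield_subring. Qed.
Let HPoo : Defs.primes [set: F] Poo. Proof. exact: place_prime. Qed.
Let Prat : is_rational kap [set: F] Poo. Proof. exact: rational_place. Qed.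
Let kK : k `<=` K. Proof. exact: (const_tower_sub hell). Qed.
Let RP x : Rinf x <-> K x /\ forall Q, finite_prime Q -> ogeQ Q 0 x. Proof. exact: (ring_at_infinityP hell iota hp). Qed.
Let RI : is_subring Rinf. Proof. exact: Rinf_subring. Qed.
Let np := F_no_pole hell iota hp hPinf.

Context (Qoo : set Omega) (HQoo : Defs.primes K Qoo) (QooP : iota @^-1` Qoo = Poo).

Lemma ord_phi_infinity x : K x -> x != 0 -> ordQ Qoo (phi x) = ordQ Qoo x.
Proof.
move=> Kx x0; have [HQ' oE] := prime_phi hell hp HQoo.
rewrite -oE //; congr ord; apply: (above_unique hell hp HPoo Prat HQ' HQoo) => //.
rewrite -QooP; apply/seteqP; split=> y /=; rewrite (phi_iota hell iota hp); first by case.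
by move=> Qy; split=> //; exact: tower_iota.
Qed.

(* The norm to F multiplies the order at infinity by a power of p, and there
   the product formula applies. *)
Lemma order_at_infinity_divisible N x : coprime N p -> Rinf x -> ~ k x ->
  (forall Q, finite_prime Q -> (N %| ordQ Q x)%Z) -> (N %| ordQ Qoo x)%Z.
Proof.
move=> Np Rx nkx dx; have [t [Rt nkt]] := RF_nonconstant hell hp hPinf Rx nkx.
have x0 : x != 0 by apply/eqP => x0; apply: nkx; rewrite x0; exact: sr0.
have Kx : K x by move/RP: Rx => [].
have [n _ lx] := Kx; have [f fE] := norm_iota hell hp lx.
have Kp i : K (phin i x) by exact: tower_phin.
have p0 i : phin i x != 0 by exact: (phin_neq0 hell hp).
have f0 : f != 0 by rewrite -(fmorph_eq0 iota) -fE (norm_neq0 hell hp n Kx x0).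
have onorm Q : Defs.primes K Q -> ordQ Q (iota f) = \sum_(i < p ^ n) ordQ Q (phin i x).
  by move=> HQ; rewrite -fE /tower_norm (ord_prod KF HQ).
have dphin i Q : finite_prime Q -> (N %| ordQ Q (phin i x))%Z.
  elim: i Q => [|i IH] Q fQ; first exact: dx.
  have [Q' [fQ' oE]] := finite_prime_phi hell hp fQ.
  by rewrite -[phin i.+1 x]/(phi (phin i x)) oE //; exact: IH.
have ophin i : ordQ Qoo (phin i x) = ordQ Qoo x.
  by elim: i => // i IH; rewrite -[phin i.+1 x]/(phi (phin i x)) ord_phi_infinity.
have [D [DE dD]] := divisor_exists hell hPinf np Rt nkt f0.
have [|E [_ ED]] := divisor_root hPinf dD (p := N).
  move=> P PP; rewrite DE; have PPoo := place_neq PP.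
  have [Q [HQ QP]] := prime_extend hell iota hp (place_prime P).
  have [_ oE] := prime_restrict hell hp HQ.
  rewrite -QP -oE // onorm //; apply: rpred_sum => i _; apply: dphin.
  by split=> //; rewrite QP.
have : (N %| ordP Poo f)%Z.
  by rewrite -DE -ED coeffMn -mulr_natr natz; exact: dvdz_mull.
have [_ oE] := prime_restrict hell hp HQoo.
rewrite -QooP -oE // onorm //; under eq_bigr do rewrite ophin.
rewrite sumr_const card_ord -mulr_natl natz Gauss_dvdzr // coprimezE /=.
exact: coprimeXr.
Qed.

Context (r t : F) (Rr : RF Poo r) (r0 : r != 0) (Rt : RF Poo t) (t_neq0 : t != 0).
Context (tl : ~~ (ell %| pole Poo t)%N).
Context (conductor : forall z, RF Poo z -> power_span Poo t (r ^+ ell * z)).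
Local Notation tau := (iota t).

(** The comparison at infinity, with d and rho the poles of x and r, and oz and ow the orders of z
    and w. It gives (N - 2l + 2) d <= N l rho, and N <= d then contradicts the lower bound on N. *)
Lemma power_bound_arith (N l rho d oz ow : int) : 0 < N -> 2 * l + l * rho < N -> 1 < l -> 0 <= rho ->
  N <= d -> - (l * rho) - d <= l * oz -> l * N * oz + 2 * (N - l + 1) * d = ow -> ow <= 0 -> False.
Proof.
move=> N0 H l1 rho0 Nd Hz Hw ow0.
have H1 : N * (- (l * rho) - d) <= N * (l * oz) by rewrite ler_pM2l.
have H2 : (N - 2 * l + 2) * N <= (N - 2 * l + 2) * d.
  by rewrite ler_pM2l //; nia.
have H3 : N * (l * rho) < N * (N - 2 * l + 2) by rewrite ltr_pM2l //; lia.
nia.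
Qed.

(** If o is the nonzero one of ox and oy, then o >= N and N (o - l + 1) - (N - l + 1) o = (l - 1) (o
    - N) is nonnegative. *)
Lemma finite_orders_bound (N l ox oy oz : int) : l <= N -> 1 < l -> 0 <= ox -> 0 <= oy ->
  (N %| ox)%Z -> (N %| oy)%Z -> ox = 0 \/ oy = 0 -> 0 <= oz ->
  ox - l + 1 <= l * oz -> oy - l + 1 <= l * oz -> (N - l + 1) * (ox + oy) <= l * N * oz.
Proof.
move=> lN l1 ox0 oy0 /dvdzP [A oxE] /dvdzP [A' oyE] xy oz0 Hx Hy.
have main o B : 0 <= o -> o = B * N -> o - l + 1 <= l * oz -> (N - l + 1) * o <= l * N * oz.
  move=> o0 oE Ho; have [B0|B0] := eqVneq B 0.
    rewrite oE B0 mul0r mulr0; apply: mulr_ge0 => //; apply: mulr_ge0; lia.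
  have oN : N <= o by rewrite oE; nia.
  have H1 : N * (o - l + 1) <= N * (l * oz) by rewrite ler_pM2l //; lia.
  have H2 : 0 <= (l - 1) * (o - N) by apply: mulr_ge0; lia.
  nia.
case: xy => E; rewrite E.
  by rewrite add0r; apply: main oyE Hy.
by rewrite addr0; apply: main oxE Hx.
Qed.

Lemma power_bound N : (2 * ell + ell * pole Poo r < N)%N -> coprime N p -> coprime N ell ->
  forall x c, Rinf x -> ~ k x -> k c -> c != 0 ->
  (forall Q, finite_prime Q -> (N %| ordQ Q x)%Z) ->
  (forall Q, finite_prime Q -> (N %| ordQ Q (x - c))%Z) -> False.
Proof.
move=> HN Np Nl x c.
(* The induction on the pole of x serves the case in which x is an ell-th power and is replaced by
   its root. *)
have [m] := ubnP (absz (ordQ Qoo x)); elim: m x c => // m IH x c xm Rx nkx kc c0 dx dy.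
have x0 : x != 0 by apply/eqP => x0; apply: nkx; rewrite x0; exact: sr0.
have Kx : K x by move/RP: Rx => [].
have [c' kc' c'E] := const_ell_root hell hp kc.
have Rc : Rinf c by exact: const_Rinf.
have Kc : K c by exact: kK.
set y := x - c; have Ry : Rinf y by exact: (srB RI).
have Ky : K y by exact: srB.
have nky : ~ k y by move=> ky; apply: nkx; rewrite -(subrK c x); exact: srD.
have y0 : y != 0 by apply/eqP => y0; apply: nky; rewrite y0; exact: sr0.
have ox := pole_at_infinity hell hp hPinf HQoo QooP Rx nkx.
have oy : ordQ Qoo y = ordQ Qoo x.
  have Oc : ogeQ Qoo 0 (- c) by apply: (ogeN KF HQoo); exact: (const_oge hell hp).
  by have [_ ->] := ord_lt_add KF HQoo Kx x0 Oc ox.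
have [B [RB BE]] := Rinf_expansion hell hp hPinf r0 conductor Rx.
have ir0 : iota r != 0 by rewrite fmorph_eq0.
have KB b : K (B b).
  have -> : B b = iota r * B b / iota r by rewrite mulrAC divff ?mul1r.
  by apply: (sf_div KF); [move/RP: (RB b) => []|exact: tower_iota].
have frob (u v : Omega) : (u - v) ^+ ell = u ^+ ell - v ^+ ell.
  by have := frobB hell (pcharO hell iota) 1 u v; rewrite expn1.
have ell0 := prime_gt0 hell; have ell1 := prime_gt1 hell.
have [[b [b0 Bb0]]|allz] := pselect (exists b : 'I_ell, b != 0 :> nat /\ B b != 0); last first.
  (* Here x = B_0^ell and x - c = (B_0 - c')^ell; as N is prime to ell, the divisibility of the
     orders passes to the roots. *)
  pose z := Ordinal ell0.
  have xE : x = B z ^+ ell.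
    rewrite BE (bigD1 z) //= expr0 mulr1 big1 ?addr0 // => b bz.
    have [->|Bb0] := eqVneq (B b) 0; first by rewrite expr0n (gtn_eqF ell0) mul0r.
    case: allz; exists b; split=> //; apply: contra_neq bz => b0; exact: val_inj.
  have Bz0 : B z != 0 by apply: contra_neq x0 => Bz0; rewrite xE Bz0 expr0n (gtn_eqF ell0).
  have oE Q : Defs.primes K Q -> ordQ Q x = ell%:Z * ordQ Q (B z) by move=> HQ; rewrite xE (ordX KF HQ).
  have dvd_root o : (N %| ell%:Z * o)%Z -> (N %| o)%Z by rewrite Gauss_dvdzr.
  apply: (IH (B z) c') => //.
  - move: xm ox; rewrite oE //; move: (ordQ Qoo (B z)) (ell1) => o; clear.
    move=> l1 H1 H2; have o0 : o < 0 by nia.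
    by move: H1; rewrite abszM /=; nia.
  - apply/RP; split=> // Q fQ; have [HQ _] := fQ; apply/ogeE => //.
    have /RP [_ /(_ Q fQ) /(ogeE _ _ Kx x0)] := Rx; rewrite oE //.
    by move: (ordQ Q (B z)) (ell1); clear; nia.
  - by move=> kB; apply: nkx; rewrite xE; exact: (srX kR).
  - by apply: contra_neq c0 => c'0; rewrite -c'E c'0 expr0n (gtn_eqF ell0).
  - by move=> Q fQ; apply: dvd_root; have [HQ _] := fQ; rewrite -oE //; exact: dx.
  - move=> Q fQ; apply: dvd_root; have [HQ _] := fQ.
    have KBc : K (B z - c') by apply: srB => //; exact: kK.
    have Bc0 : B z - c' != 0.
      by apply: contra_neq y0 => E; rewrite /y xE -c'E -frob E expr0n (gtn_eqF ell0).
    by rewrite -(ordX KF HQ) // frob -xE c'E; exact: dy.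
(* The coordinate with b > 0 plays the part of a derivative: it is common to x and y and vanishes
   wherever either vanishes to high order. *)
set z := iota r * B b; have z0 : z != 0 by rewrite mulf_neq0.
have Kz : K z by move/RP: (RB b) => [].
have [B' [RB' B'E B'b]] : exists B' : 'I_ell -> Omega, [/\ forall j, Rinf (iota r * B' j),
    y = \sum_j B' j ^+ ell * tau ^+ j & B' b = B b].
  (* Subtracting c = c'^ell changes only the coordinate at 0. *)
  exists (fun j => B j - (j == 0 :> nat)%:R * c'); split=> [j||].
  - rewrite mulrBr; apply: (srB RI) => //; apply: (srM RI).
      exact/(Rinf_iota hell iota hp).
    by apply: const_Rinf => //; apply: srM => //; exact: sr_nat.
  - under eq_bigr do rewrite frob mulrBl.
    rewrite sumrB -BE /y -c'E; congr (_ - _).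
    rewrite (bigD1 (Ordinal ell0)) //= mul1r expr0 mulr1 big1 ?addr0 // => j j0.
    have /negPf -> : j != 0 :> nat by apply: contra_neq j0 => j0; exact: val_inj.
    by rewrite mul0r expr0n (gtn_eqF ell0) mul0r.
  - by rewrite (negPf b0) mul0r subr0.
have order_z v (C : 'I_ell -> Omega) Q : Rinf v -> v != 0 -> (forall j, Rinf (iota r * C j)) ->
    v = \sum_j C j ^+ ell * tau ^+ j -> C b = B b -> finite_prime Q ->
    ordQ Q v - ell%:Z + 1 <= ell%:Z * ordQ Q z.
  move=> Rv v0 RC vE Cb fQ; have Kv : K v by move/RP: Rv => [].
  have /RP [_ /(_ Q fQ) /(ogeE _ _ Kv v0) ov] := Rv.
  case oE : (ordQ Q v) ov => [o|//] _.
  (* Rounding the order of v down to a multiple of ell costs at most ell - 1. *)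
  have le : (ell * (o %/ ell))%N%:Z <= ordQ Q v by rewrite oE lez_nat mulnC leq_trunc_div.
  have := expansion_order hell hp hPinf r0 Rt t_neq0 tl conductor Rv v0 RC vE fQ le b.
  rewrite Cb -/z => /(ogeE _ _ Kz z0); have := ltn_ceil o ell0.
  by move: (o %/ ell)%N (ordQ Q z) (ell1); clear; nia.
pose M := (N - ell + 1)%N.
have ellN : (ell <= N)%N by move: HN; clear; lia.
have ME : M%:Z = N%:Z - ell%:Z + 1 by rewrite /M; move: ellN; clear; lia.
have xy0 : x * y != 0 by exact: mulf_neq0.
have Kxy : K (x * y) by exact: srM.
(* The exponent M = N - ell + 1 is what a zero of order exactly N of x or y permits, by
   [finite_orders_bound]. *)
set w := z ^+ (ell * N) / (x * y) ^+ M.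
have w0 : w != 0 by rewrite mulf_neq0 ?invr_eq0 ?expf_neq0.
have Kw : K w by apply: (sf_div KF); exact: (srX KR).
have ow Q : Defs.primes K Q ->
    ordQ Q w = ell%:Z * N%:Z * ordQ Q z - (N%:Z - ell%:Z + 1) * (ordQ Q x + ordQ Q y).
  move=> HQ; have KXz : K (z ^+ (ell * N)) by exact: (srX KR).
  have KXxy : K ((x * y) ^+ M) by exact: (srX KR).
  by rewrite (ord_div KF HQ) ?expf_neq0 // !(ordX KF HQ) // (ordM KF HQ Kx Ky x0 y0) -ME PoszM.
have Rw : Rinf w.
  apply/RP; split=> // Q fQ; have [HQ _] := fQ; apply/ogeE => //; rewrite ow // subr_ge0.
  have /RP [_ /(_ Q fQ) /(ogeE _ _ Kx x0) ox0] := Rx.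
  have /RP [_ /(_ Q fQ) /(ogeE _ _ Ky y0) oy0] := Ry.
  have /RP [_ /(_ Q fQ) /(ogeE _ _ Kz z0) oz0] := RB b.
  apply: (finite_orders_bound _ _ ox0 oy0 (dx Q fQ) (dy Q fQ) _ oz0) => //.
  - have [ox1|ox1] := eqVneq (ordQ Q x) 0; first by left.
    have [oy1|oy1] := eqVneq (ordQ Q y) 0; first by right.
    have O1 : ogeQ Q 1 (x - y).
      by apply: (ogeB KF HQ); apply/ogeE => //; rewrite -gtz0_ge1 lt0r ?ox1 ?oy1.
    have := O1; rewrite /y subKr => /(ogeE _ _ Kc c0).
    by rewrite (const_ord0 hell hp HQ kc c0).
  - exact: (order_z x B).
  - exact: (order_z y B').
have owoo : ordQ Qoo w <= 0.
  have [kw|nkw] := pselect (k w); first by rewrite (const_ord0 hell hp HQoo kw w0).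
  exact/ltW/(pole_at_infinity hell hp hPinf HQoo QooP Rw nkw).
have dvd := order_at_infinity_divisible Np Rx nkx dx.
have [_ oE] := prime_restrict hell hp HQoo.
have or : ordQ Qoo (iota r) = - (pole Poo r)%:Z.
  by rewrite oE // QooP (poleE hell HPoo np Rr r0).
have ot : ordQ Qoo tau = - (pole Poo t)%:Z.
  by rewrite oE // QooP (poleE hell HPoo np Rt t_neq0).
(* By [expansion_oge] no term of the expansion has a larger pole than x, and the factor tau^b only
   adds to the pole of its term. *)
have ozoo : - (ell%:Z * (pole Poo r)%:Z) - - ordQ Qoo x <= ell%:Z * ordQ Qoo z.
  have Ox : ogeQ Qoo (ordQ Qoo x) (\sum_j B j ^+ ell * tau ^+ j) by rewrite -BE; exact: oge_ord.
  have := expansion_oge hell hp hPinf Rt t_neq0 tl HQoo QooP KB Ox b.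
  have Kt j : K (tau ^+ j) by apply: (srX KR); exact: tower_iota.
  have tau0 : tau != 0 by rewrite fmorph_eq0.
  have KBe : K (B b ^+ ell) by exact: (srX KR).
  have Bt0 : B b ^+ ell * tau ^+ b != 0 by rewrite mulf_neq0 ?expf_neq0.
  move/(ogeE _ _ (srM KR KBe (Kt b)) Bt0).
  have Ktau : K tau := tower_iota iota p t.
  rewrite (ordM KF HQoo) ?expf_neq0 // !(ordX KF HQoo) // ot.
  rewrite /z (ordM KF HQoo) //; last exact: tower_iota.
  rewrite or; move: (ordQ Qoo (B b)) (ordQ Qoo x) (pole Poo r) (pole Poo t) (b : nat); clear; nia.
apply: (@power_bound_arith N%:Z ell%:Z (pole Poo r)%:Z (- ordQ Qoo x) (ordQ Qoo z) (ordQ Qoo w)) => //.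
- by move: HN; move: (pole Poo r); clear; lia.
- have N0 : 0 < N%:Z by rewrite ltz_nat; exact: leq_ltn_trans HN.
  case/dvdzP: dvd => A AE; move: ox; rewrite AE pmulr_llt0 // => A0.
  by move: A0 N0; clear; nia.
- by rewrite ow // oy; ring.
Qed.

End PowerBound.

(** * Distinct primes p and q *)

Section DistinctPrimes.
Context (ell : nat) (hell : prime ell) (F : fieldExtType {fraction {poly 'F_ell}}).
Context (Omega : closedFieldType) (iota : {rmorphism F -> Omega}).
Context (p : nat) (hp : prime p) (Pinf : place F) (hPinf : place_degree Pinf = 1%N).
Context (q : nat) (hq : prime q) (hqell : q <> ell) (hpq : p <> q).
Context (t : nat) (a0 : F) (ha0 : constants F a0) (ha0nz : a0 != 0).
Context (a : 'I_t -> F) (ha : forall i, constants F (a i)) (hainj : injective a).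
Context (n : 'I_t -> nat) (hexp : (2 <= #|[pred i : 'I_t | ~~ (q %| n i)%N]|)%N).

Local Notation f := (a0 *: \prod_(i < t) ('X - (a i)%:P) ^+ n i).
Local Notation Rinf := (ring_at_infinity iota p Pinf).
Local Notation k := (const_tower iota p).
Local Notation Poo := (place_ideal Pinf).

Lemma constant_solutions_of_large_exponent : exists k0 : nat, forall m, (k0 <= m)%N ->
  forall X Y, Rinf X -> Rinf Y -> Y ^+ (q ^ m) = (map_poly iota f).[X] -> k X /\ k Y.
Proof.
have HPoo : Defs.primes [set: F] Poo := place_prime Pinf.
have Prat : is_rational (constants F) [set: F] Poo by exact: rational_place.
have np := F_no_pole hell iota hp hPinf.
have finish m X Y : k X -> Rinf Y -> Y ^+ (q ^ m) = (map_poly iota f).[X] -> k X /\ k Y.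
  move=> kX RY E; split=> //.
  by apply: (const_solution hell hp hPinf ha0 ha _ kX RY E); rewrite expn_gt0 prime_gt0.
(* If F had only constant functions regular outside infinity, so would the tower, by the norm. *)
have [[t0 [Rt0 nkt0]]|nt] := pselect (exists t0, RF Poo t0 /\ ~ constants F t0); last first.
  exists 0%N => m _ X Y RX RY E; apply: (finish m X Y) => //.
  by apply: contrapT => nkX; exact: nt (RF_nonconstant hell hp hPinf RX nkX).
have [s [Rs s0 sl]] := coprime_pole hell HPoo np Rt0 nkt0.
have [r [Rr r0 rP]] := power_span_conductor hell HPoo Prat np Rt0 nkt0 Rs s0 sl.
(* From m < q^m this threshold on m gives the bound on N = q^m required by [power_bound]; r was
   chosen before the solution. *)
exists (2 * ell + ell * pole Poo r)%N => m mle X Y RX RY E; apply: (finish m X Y) => //.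
apply: contrapT => nkX.
have [i [j [qi qj ij]]] : exists i j, [/\ ~~ (q %| n i)%N, ~~ (q %| n j)%N & i != j].
  by have /card_gt1P [i [j [? ? ?]]] := hexp; exists i, j.
have [Q [HQ QP]] := prime_extend hell iota hp HPoo.
have kF := const_tower_subfield hell iota hp; have kR := subfield_subring kF.
have ka l : k (iota (a l)) by exact: iota_const.
have RI : is_subring Rinf by exact: Rinf_subring.
have ord_a := solution_orders hell hp ha0 ha0nz ha hainj hq RX RY nkX E.
apply: (power_bound hell hp hPinf HQ QP Rr r0 Rs s0 sl rP (N := (q ^ m)%N) _ _ _
  (x := X - iota (a i)) (c := iota (a j) - iota (a i))).
- by apply: leq_ltn_trans mle _; apply: ltn_expl; exact: prime_gt1.
- by rewrite coprimeXl // prime_coprime // dvdn_prime2 //; apply/eqP => /esym.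
- by rewrite coprimeXl // prime_coprime // dvdn_prime2 //; exact/eqP.
- by apply: (srB RI) => //; exact: const_Rinf.
- by move=> kXa; apply: nkX; rewrite -(subrK (iota (a i)) X); exact: (srD kR).
- exact: (srB kR).
- by rewrite -rmorphB fmorph_eq0 subr_eq0; apply: contra_neq ij => /hainj.
- exact: ord_a.
- move=> Q' fQ'; rewrite opprB addrA subrK.
  exact: ord_a.
Qed.

End DistinctPrimes.

Theorem theorem3p2
  (ell : nat) (hell : prime ell)
  (F : fieldExtType {fraction {poly 'F_ell}})
  (Omega : closedFieldType) (iota : {rmorphism F -> Omega})
  (hOmega : forall z : Omega, algebraicOver iota z)
  (Pinf : place F) (hPinf : place_degree Pinf = 1%N)
  (p q : nat) (hp : prime p) (hq : prime q) (hqell : q <> ell)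
  (f : {poly F}) (hf : forall i : nat, constants F f`_i)
  (t : nat) (ht : (2 <= t)%N)
  (a0 : F) (ha0 : constants F a0) (ha0nz : a0 != 0)
  (a : 'I_t -> F) (ha : forall i, constants F (a i)) (hainj : injective a)
  (n : 'I_t -> nat) (hn : forall i, (0 < n i)%N)
  (hfact : f = a0 *: \prod_(i < t) ('X - (a i)%:P) ^+ n i)
  (hexp : (2 <= #|[pred i : 'I_t | ~~ (q %| n i)%N]|)%N) :
  (p <> q ->
   exists k0 : nat, forall k : nat, (k0 <= k)%N -> (0 < k)%N ->
   forall X Y : Omega,
     ring_at_infinity iota p Pinf X -> ring_at_infinity iota p Pinf Y ->
     Y ^+ (q ^ k) = (map_poly iota f).[X] ->
     const_tower iota p X /\ const_tower iota p Y) /\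
  (p = q -> ~~ (p %| class_number F)%N ->
   forall X Y : Omega,
     ring_at_infinity iota p Pinf X -> ring_at_infinity iota p Pinf Y ->
     Y ^+ p = (map_poly iota f).[X] ->
     const_tower iota p X /\ const_tower iota p Y).
Proof.
split=> [hpq|hpq hF].
  have [k0 H] := constant_solutions_of_large_exponent hell iota hp hPinf hq hqell hpq ha0 ha0nz ha hainj hexp.
  exists k0 => k le _ X Y RX RY E; apply: (H k le X Y RX RY).
  by rewrite -hfact.
subst q; move=> X Y RX RY E.
apply: (constant_solutions_of_prime_exponent hell hp hPinf ha0 ha0nz ha hainj hqell hF hexp RX RY).
by rewrite -hfact.
Qed.
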